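(* Let $0<H<1$. Let $p\ge 1$ and $0\le q<p$ be integers, let $\alpha_0,\alpha_1,\dots,\alpha_p,\beta_1,\dots,\beta_q$ be real numbers with $\alpha_1\neq 0$ (and $\beta_q\ne0$ if $q\geq 1$), let $\sigma>0$, and let $A,\beta,\delta_p$, $\{B_t^H\}$, $\{X_t\}$, $\{Y_t\}$ be as defined in the context. The equation $$X_t=e^{At}X_0+\alpha_0\int_0^t e^{A(t-u)}\delta_p\,du+\sigma\int_0^t e^{A(t-u)}\delta_p\,dB_u^H,\qquad t\ge 0,$$ with a deterministic initial condition $X_0$ admits an asymptotically stationary solution if and only if all the eigenvalues of $A$ have negative real parts. Moreover, if all the eigenvalues of $A$ have negative real parts and the solution is stationary, then for $Y_t=\beta'X_t$: (i) $Y_0$ and $\{B_t^H,\ t\ge 0\}$ are jointly Gaussian, with covariances given, for all $t\ge0$, by $$\operatorname{cov}(Y_0,B_t^H)=H\sigma\,\beta'\int_0^\infty e^{Au}\delta_p\,\{(u+t)^{2H-1}-u^{2H-1}\}\,du;$$ (ii) the stationary mean of $\{Y_t\}$ equals $\mu_Y=-\alpha_0/\alpha_1$.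
   Context: Prime denotes transpose. $\{B_t^H\}$ is a standard fractional Brownian motion with Hurst parameter $H\in(0,1)$: a zero-mean Gaussian process with $B_0^H=0$ and $E(B_t^HB_s^H)=\frac12\{|t|^{2H}+|s|^{2H}-|t-s|^{2H}\}$; it is defined for $t\ge0$ and extends to all real $t$ with the same covariance. $A$ is the $p\times p$ companion matrix whose $(i,i+1)$ entries are $1$ for $1\le i\le p-1$, whose last row is $(\alpha_1,\alpha_2,\dots,\alpha_p)$, and all of whose other entries are $0$ (for $p=1$, $A=(\alpha_1)$). $\delta_p=(0,\dots,0,1)'\in\mathbb{R}^p$. $\beta=(1,\beta_1,\dots,\beta_{p-1})'\in\mathbb{R}^p$ with $\beta_j=0$ for $j>q$. The state process $X_t\in\mathbb{R}^p$, $t\ge0$, is the solution (the displayed formula in the claim) of $dX_t=(AX_t+\alpha_0\delta_p)\,dt+\sigma\delta_p\,dB_t^H$ with initial condition $X_0$, and the CARFIMA$(p,H,q)$ process is $Y_t=\beta'X_t$. Stochastic integrals of the deterministic smooth integrands with respect to $B^H$ are limits of Riemann sums. ''Asymptotically stationary'' means that for all $k$ and $h_1,\dots,h_k\ge0$ the joint law of $(X_{t+h_1},\dots,X_{t+h_k})$ converges weakly as $t\to\infty$. ''The solution is stationary'' means that the initial condition $X_0$ is a random vector (possibly dependent on $B^H$) such that $\{X_t,t\ge0\}$ is strictly stationary. When the eigenvalues of $A$ all have negative real parts, and with $\alpha_0=0$, such a stationary solution is $X_t=\sigma\int_{-\infty}^t e^{A(t-u)}\delta_p\,dB_u^H$;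 for general $\alpha_0$ the constant vector $-(\alpha_0/\alpha_1)(1,0,\dots,0)'$ is added. *)

(* Defs.v *)
From HB Require Import structures.
From mathcomp Require Import all_boot all_order all_algebra.
From mathcomp Require Import complex.
From mathcomp Require Import all_classical all_reals all_analysis.

Set Implicit Arguments.
Unset Strict Implicit.
Unset Printing Implicit Defensive.

Import Order.TTheory GRing.Theory Num.Theory.
Import numFieldNormedType.Exports.

Local Open Scope classical_set_scope.
Local Open Scope ring_scope.

Section linear_system.
Context {R : realType}.

(* [alpha i] is the coefficient alpha_i, [0 <= i <= p]; only the values
   [alpha 1, ..., alpha p] occur in [A]. Indices of ['I_p] start at 0. *)
Definition companion (p : nat) (alpha : nat -> R) : 'M[R]_p :=
  \matrix_(i < p, j < p)
    if i.+1 == p then alpha j.+1 else (j == i.+1 :> nat)%:R.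

Definition delta_vec (p : nat) : 'cV[R]_p := \col_(i < p) (i.+1 == p)%:R.

Definition beta_vec (p q : nat) (beta : nat -> R) : 'cV[R]_p :=
  \col_(i < p) if i == 0%N :> nat then 1 else if (i <= q)%N then beta i else 0.

Definition expmx (p : nat) (A : 'M[R]_p) : 'M[R]_p :=
  \matrix_(i, j) limn (fun n => (\sum_(k < n) (k`!%:R)^-1 *: A ^+ k) i j).

(* All complex eigenvalues count, hence the extension of scalars to [R[i]]. *)
Definition eigenvalues_Re_lt0 (p : nat) (A : 'M[R]_p) : Prop :=
  forall z : R[i], eigenvalue (map_mx (real_complex R) A) z -> complex.Re z < 0.

Definition integral_cV (p : nat) (D : set R) (F : R -> 'cV[R]_p) : 'cV[R]_p :=
  \col_i (\int[lebesgue_measure]_(u in D) F u i 0).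

End linear_system.

Definition borel_mx (R : realType) (m n : nat) :=
  g_sigma_algebraType (@open 'M[R]_(m, n)).

Section processes.
Context {R : realType} {d : measure_display} {Omega : measurableType d}.
Variable P : probability Omega R.

(* Possibly degenerate normal law: [normal_prob m 0] is not the point mass
   at [m], so zero variance is treated separately. *)
Definition gaussian_rv (X : Omega -> R) : Prop :=
  measurable_fun setT X /\
  exists m s : R, 0 <= s /\
    forall E : set R, measurable E ->
      P (X @^-1` E) = if s == 0 then \d_m E else normal_prob m s E.

Definition jointly_gaussian (I : Type) (D : set I) (Z : I -> Omega -> R) :
    Prop :=
  forall (n : nat) (i : 'I_n -> I) (c : 'I_n -> R),
    (forall k, D (i k)) ->
    gaussian_rv (fun w => \sum_(k < n) c k * Z (i k) w).

(* Standard fractional Brownian motion on the half-line: only the values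
   [B t] with [0 <= t] are constrained, so the restriction of a two-sided
   fractional Brownian motion is covered. *)
Definition fBM (H : R) (B : R -> Omega -> R) : Prop :=
  [/\ jointly_gaussian [set t | 0 <= t] B,
      {ae P, forall w, B 0 w = 0},
      forall t, 0 <= t -> ('E_P[B t] = 0)%E
    & forall t s, 0 <= t -> 0 <= s ->
        ('E_P[(B t \* B s)%R] =
          (2^-1 * (`|t| `^ (2 * H) + `|s| `^ (2 * H)
                     - `|t - s| `^ (2 * H)))%:E)%E].

Definition riemann_sum (B : R -> Omega -> R) (f : R -> R)
    (n : nat) (s tau : nat -> R) (w : Omega) : R :=
  \sum_(k < n) f (tau k) * (B (s k.+1) w - B (s k) w).

(* Mean-square limit, as the mesh tends to 0, of the Riemann sums over all
   tagged partitions 0 = s_0 <= ... <= s_n = t. *)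
Definition stoch_integral (B : R -> Omega -> R) (t : R) (f : R -> R)
    (I : Omega -> R) : Prop :=
  measurable_fun setT I /\
  forall e : R, 0 < e -> exists2 r : R, 0 < r &
    forall (n : nat) (s tau : nat -> R),
      s 0%N = 0 -> s n = t ->
      (forall k, (k < n)%N ->
        [/\ s k <= tau k, tau k <= s k.+1 & s k.+1 - s k < r]) ->
      ('E_P[(fun w => (riemann_sum B f n s tau w - I w) ^+ 2)%R] <= e%:E)%E.

(* The equation holds almost surely at each time [t >= 0] (no path regularity
   is asked for); [X0] may be random and may depend on [B]. *)
Definition sde_solution (p : nat) (A : 'M[R]_p) (alpha0 sigma : R)
    (B : R -> Omega -> R) (X0 : Omega -> 'cV[R]_p)
    (X : R -> Omega -> 'cV[R]_p) : Prop :=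
  forall t : R, 0 <= t ->
    (forall i, measurable_fun setT (fun w => X t w i 0)) /\
    exists I : Omega -> 'cV[R]_p,
      (forall i, stoch_integral B t
        (fun u => (expmx ((t - u) *: A) *m delta_vec p) i 0)
        (fun w => I w i 0)) /\
      {ae P, forall w, X t w =
        expmx (t *: A) *m X0 w
        + alpha0 *: integral_cV `[0, t]
            (fun u => expmx ((t - u) *: A) *m delta_vec p)
        + sigma *: I w}.

Definition shifted (p : nat) (X : R -> Omega -> 'cV[R]_p) (k : nat)
    (h : 'I_k -> R) (t : R) (w : Omega) : 'M[R]_(p, k) :=
  \matrix_(i, j) X (t + h j) w i 0.

(* [mu] is the weak limit of the joint law of X_{t + h_1}, ..., X_{t + h_k}. *)
Definition asymptotically_stationary (p : nat) (X : R -> Omega -> 'cV[R]_p) :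
    Prop :=
  forall (k : nat) (h : 'I_k -> R), (forall j, 0 <= h j) ->
    exists mu : probability (borel_mx R p k) R,
      forall g : 'M[R]_(p, k) -> R,
        continuous g -> (exists M : R, forall x, `|g x| <= M) ->
        ('E_P[(fun w => g (shifted X h t w))%R] @[t --> +oo%R]
          --> \int[mu]_x (g x)%:E)%E.

Definition strictly_stationary (p : nat) (X : R -> Omega -> 'cV[R]_p) : Prop :=
  forall (k : nat) (h : 'I_k -> R) (t : R), (forall j, 0 <= h j) -> 0 <= t ->
    forall E : set (borel_mx R p k), measurable E ->
      P (shifted X h t @^-1` E) = P (shifted X h 0 @^-1` E).

Definition carfima (p q : nat) (beta : nat -> R) (X : R -> Omega -> 'cV[R]_p)
    (t : R) (w : Omega) : R :=
  ((beta_vec p q beta)^T *m X t w) 0 0.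

End processes.

(* Main.v *)
Require Import Defs.
From HB Require Import structures.
From mathcomp Require Import all_boot all_order all_algebra.
From mathcomp Require Import complex.
From mathcomp Require Import all_classical all_reals all_analysis.
From mathcomp Require Import measurable_realfun.
From mathcomp Require Import ring lra zify.

(* All estimates are in mean square. Abel summation and the increment norm
   ||B_b - B_a|| = (b - a)^H show that the integral J of a locally Lipschitz f
   satisfies ||J_b - J_a - f(a) (B_b - B_a)|| <= 2 L (b - a)^(1 + H), which makes
   the Riemann sums converge and all integrals Gaussian.

   Necessity: an eigenvalue a + iw with a >= 0 and a left eigenvector give a
   linear functional of the state whose noise is the integral of
   e^{a(t-u)} e^{iw(t-u)}; the spectral representation of the covariance bounds
   its variance from below by a positive power of t. A Gaussian variable of
   large variance puts little mass on any fixed interval, against tightness.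

   Sufficiency: under the reflection u |-> T - u, which preserves the covariance
   of the increments of B, the noise of (X_{t+h_j})_j has the same law as
   integrals of e^{Au} over [0, t], which converge in mean square when A is
   stable; the laws are compared through characteristic functions.

   Stationary solution: the increments of B are limits of linear functionals of
   the state process, hence the law of (Y_T, B_{T+t} - B_T) does not depend on T.
   As T grows, the initial condition is forgotten and this vector becomes the
   mean plus a Gaussian vector, so it was so at T = 0, with covariance the limit
   of that of sigma int_0^T beta' e^{A(T-u)} delta dB_u and B_{T+t} - B_T. The
   latter is an integral against the derivative H {(u+t)^{2H-1} - u^{2H-1}} of
   the covariance of B_T - B_{T-u} and B_{T+t} - B_T. *)

Set Implicit Arguments.
Unset Strict Implicit.
Unset Printing Implicit Defensive.

Import Order.TTheory GRing.Theory Num.Theory.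
Import numFieldNormedType.Exports.

Local Open Scope classical_set_scope.
Local Open Scope ring_scope.

(** * Square-integrable random variables as a semi-inner-product space *)

Section square_integrable.
Context {R : realType} {d : measure_display} {Omega : measurableType d}.
Variable P : probability Omega R.
Implicit Types (X Y Z : Omega -> R) (a c : R).

(** The range of [H] shapes the proof. For [H < 1/2] the formal covariance kernel [|u - v|^(2H - 2)]
    of the noise is not locally integrable. The estimates therefore rest on the norm [(b - a)^H] of
    an increment and on smooth integrands, and hold for every [H] because [1 + H > 1]. The motion is
    given on a half-line, and the noise [int_0^t e^{A(t-u)} delta dB_u] converges in law but not in
    mean square. Reflection produces a copy with the same law, a fixed integrand and a moving upper
    end, and this copy does converge. A stationary [X 0] comes with no moments and no joint law with
    [B], and stationarity concerns [X] alone. Hence the detour through functionals of [X] that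
    approximate increments of [B], and the bounded Lipschitz test functions: under these a remote
    initial condition disappears without integrability, and finite variance becomes a conclusion.
    For necessity the hard case is an eigenvalue on the imaginary axis: there is no exponential
    growth, and the power of [t] comes from resonance at frequencies near [w]. *)

Definition L2 X :=
  measurable_fun setT X /\ P.-integrable setT (EFin \o (fun w => X w ^+ 2)).

Definition ip X Y : R := \int[P]_w (X w * Y w).

Definition nm X : R := Num.sqrt (ip X X).

Lemma L2_measurable X : L2 X -> measurable_fun setT X.
Proof. by case. Qed.

Lemma L2_mul X Y : L2 X -> L2 Y ->
  P.-integrable setT (EFin \o (fun w => X w * Y w)).
Proof.
move=> [mX iX] [mY iY].
apply: (le_integrable measurableT _ _ (integrableD measurableT iX iY)).
  by apply/measurable_EFinP; exact: measurable_funM.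
move=> w _; rewrite -EFinD lee_fin normrM.
rewrite [leRHS]ger0_norm ?addr_ge0 ?sqr_ge0//.
rewrite -[X w ^+ 2]real_normK ?num_real// -[Y w ^+ 2]real_normK ?num_real//.
have := sqr_ge0 (`|X w| - `|Y w|); have := normr_ge0 (X w).
have := normr_ge0 (Y w); set x := `|X w|; set y := `|Y w|; nra.
Qed.

Lemma L2_cst c : L2 (cst c).
Proof.
split; first exact: measurable_cst.
exact: (finite_measure_integrable_cst P (c ^+ 2)).
Qed.

Lemma L2_int X : L2 X -> P.-integrable setT (EFin \o X).
Proof.
move=> hX; have := L2_mul hX (L2_cst 1); apply: eq_integrable => //.
by move=> w _ /=; rewrite mulr1.
Qed.

Lemma L2_0 : L2 0.
Proof. exact: L2_cst. Qed.

Lemma L2Z a X : L2 X -> L2 (a *: X).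
Proof.
move=> [mX iX]; split; first by apply: measurable_funM => //; exact: measurable_cst.
have := integrableZl measurableT (a ^+ 2) iX; apply: eq_integrable => //.
by move=> w _ /=; rewrite -EFinM -exprMn.
Qed.

Lemma L2D X Y : L2 X -> L2 Y -> L2 (X + Y).
Proof.
move=> hX hY; split; first by apply: measurable_funD; [case: hX|case: hY].
have h := integrableD measurableT (integrableD measurableT hX.2 hY.2)
  (integrableZl measurableT 2 (L2_mul hX hY)).
apply: eq_integrable h => // w _ /=.
by rewrite -EFinM -!EFinD; congr EFin; rewrite fctE; ring.
Qed.

Lemma L2N X : L2 X -> L2 (- X).
Proof. by rewrite -scaleN1r; exact: L2Z. Qed.

Lemma L2B X Y : L2 X -> L2 Y -> L2 (X - Y).
Proof. by move=> hX hY; exact/L2D/L2N. Qed.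

Lemma L2_sum (I : Type) (r : seq I) (Q : pred I) (X : I -> Omega -> R) :
  (forall i, Q i -> L2 (X i)) -> L2 (\sum_(i <- r | Q i) X i).
Proof.
by move=> h; apply: (big_ind L2) => //; [exact: L2_0 | exact: L2D].
Qed.

Lemma ipC X Y : ip X Y = ip Y X.
Proof. by apply: eq_Rintegral => w _; rewrite mulrC. Qed.

Lemma ipDl X Y Z : L2 X -> L2 Y -> L2 Z -> ip (X + Y) Z = ip X Z + ip Y Z.
Proof.
move=> hX hY hZ; rewrite /ip -RintegralD//; last 2 first.
- exact: L2_mul.
- exact: L2_mul.
by apply: eq_Rintegral => w _; rewrite fctE mulrDl.
Qed.

Lemma ipDr X Y Z : L2 X -> L2 Y -> L2 Z -> ip Z (X + Y) = ip Z X + ip Z Y.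
Proof. by move=> hX hY hZ; rewrite ipC ipDl// !(ipC Z). Qed.

Lemma ipZl a X Y : L2 X -> L2 Y -> ip (a *: X) Y = a * ip X Y.
Proof.
move=> hX hY; rewrite /ip -RintegralZl//; last exact: L2_mul.
by apply: eq_Rintegral => w _; rewrite mulrA.
Qed.

Lemma ipZr a X Y : L2 X -> L2 Y -> ip X (a *: Y) = a * ip X Y.
Proof. by move=> hX hY; rewrite ipC ipZl// ipC. Qed.

Lemma ipNl X Y : L2 X -> L2 Y -> ip (- X) Y = - ip X Y.
Proof. by move=> hX hY; rewrite -scaleN1r ipZl// mulN1r. Qed.

Lemma ipBl X Y Z : L2 X -> L2 Y -> L2 Z -> ip (X - Y) Z = ip X Z - ip Y Z.
Proof. by move=> hX hY hZ; rewrite ipDl// ?ipNl//; exact: L2N. Qed.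

Lemma ipBr X Y Z : L2 X -> L2 Y -> L2 Z -> ip Z (X - Y) = ip Z X - ip Z Y.
Proof. by move=> hX hY hZ; rewrite ipC ipBl// !(ipC Z). Qed.

Lemma ip0l X : ip 0 X = 0.
Proof.
rewrite /ip (@eq_Rintegral _ _ _ _ _ (cst 0)); last by move=> w _; rewrite mul0r.
by rewrite Rintegral_cst// mul0r.
Qed.

Lemma ip_suml (I : Type) (r : seq I) (X : I -> Omega -> R) Y :
  (forall i, L2 (X i)) -> L2 Y ->
  ip (\sum_(i <- r) X i) Y = \sum_(i <- r) ip (X i) Y.
Proof.
move=> hX hY; elim: r => [|i r IH]; first by rewrite !big_nil ip0l.
by rewrite !big_cons ipDl// ?IH//; exact: L2_sum.
Qed.

Lemma ip_sumr (I : Type) (r : seq I) (X : I -> Omega -> R) Y :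
  (forall i, L2 (X i)) -> L2 Y ->
  ip Y (\sum_(i <- r) X i) = \sum_(i <- r) ip Y (X i).
Proof.
by move=> hX hY; rewrite ipC ip_suml//; apply: eq_bigr => i _; rewrite ipC.
Qed.

Lemma ip_ge0 X : 0 <= ip X X.
Proof. by apply: Rintegral_ge0 => w _; rewrite -expr2 sqr_ge0. Qed.

Lemma nm_ge0 X : 0 <= nm X.
Proof. exact: sqrtr_ge0. Qed.

Lemma sqr_nm X : nm X ^+ 2 = ip X X.
Proof. by rewrite sqr_sqrtr// ip_ge0. Qed.

Lemma nm_le X c : 0 <= c -> ip X X <= c ^+ 2 -> nm X <= c.
Proof. by move=> c0 h; rewrite -(ger0_norm c0) -sqrtr_sqr ler_wsqrtr. Qed.

Lemma nm0 : nm 0 = 0.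
Proof. by rewrite /nm ip0l sqrtr0. Qed.

Lemma nmZ a X : L2 X -> nm (a *: X) = `|a| * nm X.
Proof.
move=> hX; rewrite /nm ipZl ?ipZr//; last exact: L2Z.
by rewrite mulrA -expr2 sqrtrM ?sqr_ge0// sqrtr_sqr.
Qed.

Lemma nmN X : L2 X -> nm (- X) = nm X.
Proof. by move=> hX; rewrite -scaleN1r nmZ// normrN1 mul1r. Qed.

Lemma nmBC X Y : L2 X -> L2 Y -> nm (X - Y) = nm (Y - X).
Proof. by move=> hX hY; rewrite -opprB nmN//; exact: L2B. Qed.

(** The quadratic form of [key] is nonnegative at every pair of coefficients. The pair
    [(- ip X Y, ip X X)] gives [ip X X] times the claim; the other pairs serve when one or both
    norms vanish, which may happen for nonzero functions. *)
Lemma cauchy_schwarz X Y : L2 X -> L2 Y -> `|ip X Y| <= nm X * nm Y.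
Proof.
move=> hX hY.
have key (a b : R) : 0 <= a ^+ 2 * ip X X + 2 * a * b * ip X Y + b ^+ 2 * ip Y Y.
  have := ip_ge0 (a *: X + b *: Y).
  have hZ := L2D (L2Z a hX) (L2Z b hY).
  rewrite ipDl ?ipDr ?ipZl ?ipZr ?ipZl//; try exact: L2Z; rewrite (ipC Y X).
  by move=> h; apply: le_trans h _; rewrite le_eqVlt; apply/orP; left; apply/eqP; ring.
rewrite -ler_sqr ?nnegrE ?mulr_ge0 ?nm_ge0// real_normK ?num_real// exprMn !sqr_nm.
have [X0|X0] := ltP 0 (ip X X).
  have := key (- ip X Y) (ip X X); rewrite sqrrN => h.
  rewrite -subr_ge0 -(pmulr_rge0 _ X0).
  apply: le_trans h _; rewrite le_eqVlt; apply/orP; left; apply/eqP; ring.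
have {X0} X0 : ip X X = 0 by apply/eqP; rewrite eq_le X0 ip_ge0.
have [Y0|Y0] := ltP 0 (ip Y Y).
  have := key (ip Y Y) (- ip X Y); rewrite sqrrN X0 => h; rewrite -subr_ge0 -(pmulr_rge0 _ Y0).
  apply: le_trans h _; rewrite le_eqVlt; apply/orP; left; apply/eqP; ring.
have {Y0} Y0 : ip Y Y = 0 by apply/eqP; rewrite eq_le Y0 ip_ge0.
have := key 1 (- ip X Y); rewrite X0 Y0 mul0r => h.
nra.
Qed.

Lemma nmD X Y : L2 X -> L2 Y -> nm (X + Y) <= nm X + nm Y.
Proof.
move=> hX hY; apply: nm_le; first by rewrite addr_ge0 ?nm_ge0.
rewrite ipDl ?ipDr//; try exact: L2D.
rewrite sqrrD !sqr_nm (ipC Y X).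
have := cauchy_schwarz hX hY; have := ler_norm (ip X Y); lra.
Qed.

Lemma nmB X Y : L2 X -> L2 Y -> nm (X - Y) <= nm X + nm Y.
Proof. by move=> hX hY; rewrite -(nmN hY) nmD//; exact: L2N. Qed.

Lemma nm_dist X Y Z : L2 X -> L2 Y -> L2 Z ->
  nm (X - Z) <= nm (X - Y) + nm (Y - Z).
Proof.
by move=> hX hY hZ; rewrite -[X - Z](subrKA Y) nmD//; exact: L2B.
Qed.

Lemma nm_sub X Y : L2 X -> L2 Y -> `|nm X - nm Y| <= nm (X - Y).
Proof.
move=> hX hY; rewrite ler_norml; apply/andP; split.
  rewrite lerNl opprB lerBlDr nmBC// -{1}(subrK X Y) nmD//; exact: L2B.
by rewrite lerBlDr -{1}(subrK Y X) nmD//; exact: L2B.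
Qed.

Lemma nm_sum (I : Type) (r : seq I) (X : I -> Omega -> R) :
  (forall i, L2 (X i)) -> nm (\sum_(i <- r) X i) <= \sum_(i <- r) nm (X i).
Proof.
move=> hX; elim: r => [|i r IH]; first by rewrite !big_nil nm0.
rewrite !big_cons; apply: le_trans (nmD _ _) _ => //; first exact: L2_sum.
by rewrite lerD2l.
Qed.

Lemma ip_fct X Y : L2 X -> L2 Y ->
  (\int[P]_w (X w * Y w)%:E)%E = (ip X Y)%:E.
Proof.
move=> hX hY; rewrite /ip /Rintegral fineK//.
exact: (integrable_fin_num measurableT (L2_mul hX hY)).
Qed.

(** Stochastic integrals are defined through extended-real expectations of squares of measurable
    functions. This is the passage to [L2]: the finite bound supplies integrability. *)
Lemma L2_of_sqr X e : measurable_fun setT X ->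
  ('E_P[(fun w => X w ^+ 2)%R] <= e%:E)%E -> L2 X /\ ip X X <= e.
Proof.
move=> mX; rewrite unlock => h.
have m2 : measurable_fun setT (EFin \o (fun w => X w ^+ 2)).
  by apply/measurable_EFinP; exact: measurable_funX.
have hX : L2 X.
  split => //; apply/integrableP; split => //.
  apply: le_lt_trans (ltry e); apply: le_trans h.
  under eq_integral do rewrite /= ger0_norm ?sqr_ge0//.
  by [].
split=> //; by rewrite -lee_fin -ip_fct//.
Qed.

Lemma sqr_of_L2 X e : L2 X -> ip X X <= e ->
  ('E_P[(fun w => X w ^+ 2)%R] <= e%:E)%E.
Proof.
move=> hX h; rewrite unlock; under eq_integral do rewrite expr2.
by rewrite ip_fct// lee_fin.
Qed.

Lemma L2_ae X Y : measurable_fun setT Y -> {ae P, forall w, X w = Y w} ->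
  L2 X -> L2 Y.
Proof.
move=> mY [N [mN N0 hN]] [mX iX]; split => //.
have m2 (Z : Omega -> R) : measurable_fun setT Z -> measurable_fun setT (EFin \o (fun w => Z w ^+ 2)).
  by move=> mZ; apply/measurable_EFinP; exact: measurable_funX.
have mD : measurable (~` N) by exact: measurableC.
apply/(negligible_integrable mN measurableT (m2 _ mY) N0).
have := integrableS measurableT mD (@subsetT _ _) iX; rewrite setTD.
apply: eq_integrable => // w; rewrite inE => Nw /=; congr (EFin (_ ^+ 2)).
by apply: contrapT => h; apply: Nw; exact: hN.
Qed.

Lemma ip_ae X Y Z : L2 X -> L2 Y -> L2 Z -> {ae P, forall w, X w = Y w} ->
  ip X Z = ip Y Z.
Proof.
move=> hX hY hZ XY; rewrite /ip /Rintegral; congr fine.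
apply: ae_eq_integral => //.
- by have /integrableP[] := L2_mul hX hZ.
- by have /integrableP[] := L2_mul hY hZ.
- by apply: filterS XY => w /= -> _.
Qed.

Lemma nm_ae X Y : L2 X -> L2 Y -> {ae P, forall w, X w = Y w} -> nm X = nm Y.
Proof.
by move=> hX hY XY; rewrite /nm (ip_ae hX hY hX XY) ipC (ip_ae hX hY hY XY).
Qed.

Lemma nm_eq0 X : L2 X -> nm X = 0 -> {ae P, forall w, X w = 0}.
Proof.
move=> hX X0; have := ip_fct hX hX; rewrite -sqr_nm X0 expr0n/= => h.
have : ae_eq P setT (fun w => (X w * X w)%:E) (cst 0%E).
  apply/ae_eq_integral_abs => //.
    by have /integrableP[] := L2_mul hX hX.
  rewrite -[RHS]h; apply: eq_integral => w _ /=.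
  by rewrite ger0_norm// -expr2 sqr_ge0.
apply: filterS => w /= /(_ I) []; move/eqP; rewrite mulf_eq0 orbb.
by move/eqP.
Qed.

(** Cauchy-Schwarz against the constant 1, which has norm 1 because [P] is a probability. *)
Lemma abs_int_le_nm X : L2 X ->
  P.-integrable setT (EFin \o (fun w => `|X w|)) /\ \int[P]_w `|X w| <= nm X.
Proof.
move=> hX; have hA : L2 (fun w => `|X w|).
  split; first by apply: measurableT_comp => //; case: hX.
  by have := hX.2; apply: eq_integrable => // w _ /=; rewrite real_normK ?num_real.
split; first exact: L2_int.
have := cauchy_schwarz hA (L2_cst 1); rewrite /nm {2 3}/ip.
under [X in _ <= _ * Num.sqrt X]eq_Rintegral do rewrite mulr1.
rewrite (@eq_Rintegral _ _ _ _ _ (fun=> 1) (cst 1)); last by [].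
rewrite [X in _ <= _ * Num.sqrt X]Rintegral_cst// mul1r.
have -> : fine (P setT) = 1 by rewrite probability_setT.
rewrite sqrtr1 mulr1.
move=> h; apply: le_trans (le_trans h _).
  have -> : \int[P]_w `|X w| = ip (fun w => `|X w|) (cst 1).
    by apply: eq_Rintegral => w _; rewrite mulr1.
  exact: ler_norm.
rewrite ler_wsqrtr// /ip le_eqVlt; apply/orP; left; apply/eqP.
by apply: eq_Rintegral => w _; rewrite -expr2 real_normK ?num_real.
Qed.

End square_integrable.

Lemma cvg_EFin_seq {R : realType} (u : nat -> R) (l : R) :
  u n @[n --> \oo] --> l -> (u n)%:E @[n --> \oo] --> l%:E.
Proof. by move=> h; apply/fine_cvgP; split; [exact: nearW|exact: h]. Qed.

(** * Limits in mean square, almost surely and in law *)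

Section convergence.
Context {R : realType} {d : measure_display} {Omega : measurableType d}.
Variable P : probability Omega R.
Implicit Types (X Y Z : Omega -> R) (M K C a b c e rho t : R).

Lemma bounded_int (g : Omega -> R) M : measurable_fun setT g ->
  (forall w, `|g w| <= M) -> P.-integrable setT (EFin \o g).
Proof.
move=> mg gM; have h : P.-integrable setT (EFin \o cst M) by exact: finite_measure_integrable_cst.
apply: (le_integrable measurableT _ _ h); first exact/measurable_EFinP.
by move=> w _; rewrite lee_fin (le_trans (gM w))// ler_norm.
Qed.

Lemma bounded_cvg (g_ : nat -> Omega -> R) (g : Omega -> R) M :
  (forall n, measurable_fun setT (g_ n)) -> measurable_fun setT g ->
  (forall n w, `|g_ n w| <= M) ->
  {ae P, forall w, g_ n w @[n --> \oo] --> g w} ->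
  \int[P]_w g_ n w @[n --> \oo] --> \int[P]_w g w.
Proof.
move=> mg_ mg gM cg.
have [ig _ h] := @dominated_convergence _ _ _ P setT measurableT
  (fun n => EFin \o g_ n) (EFin \o g) (cst M%:E)
  (fun n => (measurable_EFinP _ _).2 (mg_ n)) ((measurable_EFinP _ _).2 mg)
  ltac:(by apply: filterS cg => w h _; exact: cvg_EFin_seq)
  (finite_measure_integrable_cst P M measurableT)
  ltac:(by apply: aeW => w n _; rewrite lee_fin gM).
apply: fine_cvg; rewrite fineK; first exact: h.
exact: integrable_fin_num.
Qed.

(** The expectation of the sum of the [|Y n|] is at most the sum of the norms, so the sum is finite
    outside a null set. *)
Lemma ae_summable (Y : nat -> Omega -> R) K : (forall n, L2 P (Y n)) ->
  (forall n, \sum_(0 <= k < n) nm P (Y k) <= K) ->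
  {ae P, forall w, cvgn (series (fun n => `|Y n w|))}.
Proof.
move=> hY hK; pose f n w := (`|Y n w|)%:E.
have f0 n w : setT w -> (0 <= f n w)%E by move=> _; rewrite lee_fin.
have mf n : measurable_fun setT (f n).
  by apply/measurable_EFinP; apply: measurableT_comp => //; case: (hY n).
have fint : P.-integrable setT (fun w => \sum_(n <oo) f n w)%E.
  apply/integrableP; split; first by apply: ge0_emeasurable_sum => n *; [exact: f0 | exact: mf].
  under eq_integral.
    move=> w _; rewrite gee0_abs; last by apply: nneseries_ge0 => n _ _; exact: f0.
    over.
  rewrite integral_nneseries//; apply: (@le_lt_trans _ _ K%:E); last exact: ltry.
  apply: lime_le; first by apply: is_cvg_nneseries => n _ _; apply: integral_ge0 => w _; exact: f0.
  apply: nearW => n; apply: le_trans (_ : (\sum_(0 <= k < n) nm P (Y k))%:E <= _)%E.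
    rewrite -sumEFin; apply: lee_sum => k _.
    have [iY lY] := abs_int_le_nm (hY k).
    by rewrite -[leLHS]fineK ?lee_fin//; exact: (integrable_fin_num measurableT iY).
  by rewrite lee_fin.
apply: filterS (integrable_ae measurableT fint) => w /= /(_ I) fw.
apply: nondecreasing_is_cvgn.
  by apply/nondecreasing_seqP => n; rewrite seriesSr lerDl.
exists (fine (\sum_(n <oo) f n w)%E) => _ [n _ <-].
rewrite -lee_fin fineK// -sumEFin.
exact: nneseries_lim_ge.
Qed.

(** Completeness for a geometric rate: the increments are summable in norm, so by [ae_summable] the
    whole sequence converges almost surely. *)
Lemma L2_complete (X : nat -> Omega -> R) C rho : (forall n, L2 P (X n)) ->
  0 <= rho -> rho < 1 ->
  (forall n, nm P (X n.+1 - X n) <= C * rho ^+ n) ->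
  exists2 Y, L2 P Y & forall n, nm P (X n - Y) <= C * rho ^+ n / (1 - rho).
Proof.
move=> hX rho0 rho1 hC.
have C0 : 0 <= C by have := hC 0%N; rewrite expr0 mulr1; apply: le_trans; exact: nm_ge0.
have r1 : 0 < 1 - rho by rewrite subr_gt0.
have cauchy n m : nm P (X n - X (n + m)%N) <= C * rho ^+ n * ((1 - rho ^+ m) / (1 - rho)).
  elim: m => [|m IH]; first by rewrite addn0 !subrr nm0 mul0r mulr0.
  apply: le_trans (nm_dist (hX n) (hX (n + m)%N) (hX _)) _.
  rewrite addnS (nmBC (hX (n + m)%N)) //; apply: le_trans (lerD IH (hC _)) _.
  rewrite le_eqVlt; apply/orP; left; apply/eqP; rewrite exprD exprS.
  by field; rewrite gt_eqF.
have bnd n m : nm P (X n - X (n + m)%N) <= C * rho ^+ n / (1 - rho).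
  apply: le_trans (cauchy n m) _; rewrite ler_wpM2l ?mulr_ge0 ?exprn_ge0//.
  apply: ler_piMl; first by rewrite invr_ge0 ltW.
  by rewrite lerBlDr lerDl exprn_ge0.
have hD n : L2 P (X n.+1 - X n) by exact: L2B.
have sumD n : \sum_(0 <= k < n) nm P (X k.+1 - X k) <= C / (1 - rho).
  apply: le_trans (_ : \sum_(0 <= k < n) C * rho ^+ k <= _).
    by apply: ler_sum => k _; exact: hC.
  rewrite (_ : \sum_(0 <= k < n) C * rho ^+ k = C * ((1 - rho ^+ n) / (1 - rho))).
    rewrite ler_wpM2l//; apply: ler_piMl; first by rewrite invr_ge0 ltW.
    by rewrite lerBlDr lerDl exprn_ge0.
  elim: n => [|n IH]; first by rewrite big_geq// expr0 subrr mul0r mulr0.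
  by rewrite big_nat_recr//= IH exprS; field; rewrite gt_eqF.
have cvgX : {ae P, forall w, cvgn (X^~ w)}.
  apply: filterS (ae_summable hD sumD) => w /normed_cvg cw.
  have -> : X^~ w = series (fun n => (X n.+1 - X n) w) + cst (X 0%N w).
    by apply/funext => n; rewrite /series/= fctE telescope_sumr// subrK.
  by apply: is_cvgD => //; exact: is_cvg_cst.
(* An upper limit is measurable and defined everywhere, also where the sequence diverges; [fine]
   sends infinite values to 0. *)
pose Y w := fine (limn_esup (fun n => (X n w)%:E)).
have mY : measurable_fun setT Y.
  apply: measurableT_comp; first exact: fine_measurable.
  by apply: measurable_fun_limn_esup => n; apply/measurable_EFinP; case: (hX n).
have XY : {ae P, forall w, X n w @[n --> \oo] --> Y w}.
  apply: filterS cvgX => w /cvg_ex[l Xl].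
  suff -> : Y w = l by [].
  have h : (X n w)%:E @[n --> \oo] --> l%:E by exact: cvg_EFin_seq.
  by rewrite /Y (cvg_limn_einf_sup h).2.
have dXY n : L2 P (X n - Y) /\ ip P (X n - Y) (X n - Y) <= (C * rho ^+ n / (1 - rho)) ^+ 2.
  have mXY : measurable_fun setT (X n - Y) by apply: measurable_funB => //; case: (hX n).
  apply: L2_of_sqr => //; rewrite unlock.
  pose f m w := (((X n - X (n + m)%N) w) ^+ 2)%:E.
  have mf m : measurable_fun setT (f m).
    by apply/measurable_EFinP/measurable_funX; case: (L2B (hX n) (hX (n + m)%N)).
  have f0 m w : setT w -> (0 <= f m w)%E by move=> _; rewrite lee_fin sqr_ge0.
  (* Fatou carries the bound on [X n - X (n + m)] to the limit in [m]. *)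
  have := fatou P measurableT mf f0.
  rewrite (_ : integral _ _ _ = \int[P]_w (((X n - Y) w) ^+ 2)%:E)%E; last first.
    apply: ae_eq_integral => //.
    - rewrite (_ : (fun x => _) = (fun x => - limn_esup (fun m => - f m x))%E).
        apply: measurableT_comp => //; apply: measurable_fun_limn_esup => m.
        exact: measurableT_comp.
      by apply/funext => x; rewrite /limn_einf /limn_esup /limf_einf.
    - exact/measurable_EFinP/measurable_funX.
    apply: filterS XY => w /= h _.
    have h' : (f m w) @[m --> \oo] --> (((X n - Y) w) ^+ 2)%:E.
      apply: cvg_EFin_seq; apply: cvgM; apply: cvgB; [exact: cvg_cst|exact: (cvg_comp _ _ (cvg_addnl n) h)|
                                 exact: cvg_cst|exact: (cvg_comp _ _ (cvg_addnl n) h)].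
    by rewrite (cvg_limn_einf_sup h').1.
  move=> h; apply: le_trans h _.
  rewrite limn_einf_lim; apply: lime_le; first exact: is_cvg_einfs.
  apply: nearW => m; apply: le_trans (_ : \int[P]_w f m w <= _)%E.
    by apply: ereal_inf_lbound; exists m => /=.
  rewrite /f; under eq_integral do rewrite expr2.
  rewrite ip_fct ?lee_fin -?sqr_nm; [|exact: L2B|exact: L2B].
  by rewrite ler_sqr ?nnegrE ?nm_ge0// (le_trans (nm_ge0 _ _) (bnd n m)).
exists Y; last first.
  move=> n; apply: nm_le (dXY n).2.
  by rewrite mulr_ge0 ?mulr_ge0 ?exprn_ge0// invr_ge0 ltW.
rewrite -[Y]opprK -[- Y](addKr (X 0%N)) opprD opprK.
exact: L2B (hX 0%N) (dXY 0%N).1.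
Qed.

(** A geometric rate is summable, so [ae_summable] applies to the differences, and the terms of a
    convergent series tend to 0. *)
Lemma nm_cvg_ae (X : nat -> Omega -> R) Y C rho : (forall n, L2 P (X n)) -> L2 P Y ->
  0 <= rho -> rho < 1 -> (forall n, nm P (X n - Y) <= C * rho ^+ n) ->
  {ae P, forall w, X n w @[n --> \oo] --> Y w}.
Proof.
move=> hX hY rho0 rho1 hC.
have C0 : 0 <= C by have := hC 0%N; rewrite expr0 mulr1; apply: le_trans; exact: nm_ge0.
have r1 : 0 < 1 - rho by rewrite subr_gt0.
have hD n : L2 P (X n - Y) by exact: L2B.
have sumD n : \sum_(0 <= k < n) nm P (X k - Y) <= C / (1 - rho).
  apply: le_trans (_ : \sum_(0 <= k < n) C * rho ^+ k <= _).
    by apply: ler_sum => k _; exact: hC.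
  rewrite (_ : \sum_(0 <= k < n) C * rho ^+ k = C * ((1 - rho ^+ n) / (1 - rho))).
    rewrite ler_wpM2l//; apply: ler_piMl; first by rewrite invr_ge0 ltW.
    by rewrite lerBlDr lerDl exprn_ge0.
  elim: n => [|n IH]; first by rewrite big_geq// expr0 subrr mul0r mulr0.
  by rewrite big_nat_recr//= IH exprS; field; rewrite gt_eqF.
apply: filterS (ae_summable hD sumD) => w /normed_cvg /cvg_series_cvg_0 h.
apply: (cvg_sub0 h); exact: cvg_cst.
Qed.

Lemma ae_eq_of_nm X Y : L2 P X -> L2 P Y ->
  (forall e, 0 < e -> nm P (X - Y) <= e) -> {ae P, forall w, X w = Y w}.
Proof.
move=> hX hY h; have h0 : nm P (X - Y) = 0.
  apply/eqP; rewrite eq_le nm_ge0 andbT; apply/ler_addgt0Pr => e e0.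
  by rewrite add0r h.
by apply: filterS (nm_eq0 (L2B hX hY) h0) => w /eqP; rewrite subr_eq0 => /eqP.
Qed.

(** Bounded Lipschitz test functions: stable under mean-square perturbation, integrable whatever the
    moments of the argument, and numerous enough to determine a law. *)
Definition blip (g : R -> R) :=
  (exists M, forall x, `|g x| <= M) /\ (exists K, forall x y, `|g x - g y| <= K * `|x - y|).

Lemma blip_continuous (g : R -> R) : blip g -> continuous g.
Proof.
move=> [_ [K gK]] x; apply/cvgrPdist_le => e e0.
have K0 : 0 <= K by have := gK 1 0; rewrite subr0 normr1 mulr1; apply: le_trans.
near=> y; apply: le_trans (gK x y) _.
apply: le_trans (_ : (K + 1) * `|x - y| <= _); first by rewrite ler_wpM2r// lerDl.
rewrite mulrC -ler_pdivlMr ?ltr_wpDl//.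
near: y; apply: cvgr_dist_le; [exact: cvg_id|rewrite divr_gt0// ltr_wpDl].
Unshelve. all: by end_near. Qed.

Lemma blip_measurable (g : R -> R) X : blip g -> measurable_fun setT X ->
  measurable_fun setT (g \o X).
Proof.
move=> /blip_continuous cg mX; apply: measurableT_comp => //.
exact: continuous_measurable_fun.
Qed.

Lemma blip_int (g : R -> R) X : blip g -> measurable_fun setT X ->
  P.-integrable setT (EFin \o (g \o X)).
Proof.
move=> hg mX; have [[M gM] _] := hg.
by apply: (@bounded_int _ M) => [|w]; [exact: blip_measurable | exact: gM].
Qed.

(** [K] is a Lipschitz constant of [g], common to all pairs. Square integrability is asked of the
    difference alone, since the variables compared later have no known moments. *)
Lemma blip_dist (g : R -> R) : blip g -> exists2 K, 0 <= K & forall X Y, L2 P (X - Y) ->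
  measurable_fun setT X -> measurable_fun setT Y ->
  `|\int[P]_w g (X w) - \int[P]_w g (Y w)| <= K * nm P (X - Y).
Proof.
move=> hg; have [_ [K gK]] := hg; exists K.
  by have := gK 1 0; rewrite subr0 normr1 mulr1; apply: le_trans.
move=> X Y hXY mX mY.
have iX := blip_int hg mX; have iY := blip_int hg mY.
rewrite -RintegralB//.
apply: le_trans (le_normr_Rintegral _ _) _ => //; first exact: (integrableB measurableT iX iY).
have [iA lA] := abs_int_le_nm hXY.
have K0 : 0 <= K by have := gK 1 0; rewrite subr0 normr1 mulr1; apply: le_trans.
apply: le_trans (ler_wpM2l K0 lA); rewrite -RintegralZl//.
apply: le_Rintegral => //.
- apply: integrable_norm; exact: (integrableB measurableT iX iY).
- exact: (integrableZl measurableT K iA).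
Qed.

Definition clamp (x : R) : R := if x <= 0 then 0 else if 1 <= x then 1 else x.

Lemma clamp01 (x : R) : 0 <= clamp x <= 1.
Proof. by rewrite /clamp; case: (leP x 0) => ?; [|case: (leP 1 x) => ?]; apply/andP; split; lra. Qed.

Lemma clamp_ge1 (x : R) : 1 <= x -> clamp x = 1.
Proof. by rewrite /clamp; case: (leP x 0) => ? h; [lra|rewrite h]. Qed.

Lemma clamp_le0 (x : R) : x <= 0 -> clamp x = 0.
Proof. by rewrite /clamp => ->. Qed.

Lemma clamp_lip (x y : R) : `|clamp x - clamp y| <= `|x - y|.
Proof.
have H (a b : R) : a <= b -> 0 <= clamp b - clamp a <= b - a.
  move=> ab; rewrite /clamp.
  by case: (leP a 0) => ?; case: (leP b 0) => ?; case: (leP 1 a) => ?;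
    case: (leP 1 b) => ?; apply/andP; split; lra.
have [xy|/ltW yx] := leP x y.
  rewrite distrC (distrC x); have /andP[h1 h2] := H _ _ xy.
  by rewrite (ger0_norm h1) (ger0_norm (le_trans h1 h2)).
by have /andP[h1 h2] := H _ _ yx; rewrite (ger0_norm h1) (ger0_norm (le_trans h1 h2)).
Qed.

(** For [n > 0] the ramp is 1 up to [a] and 0 from [a + 1/n] on; it decreases to the indicator of
    the ray ending at [a]. *)
Lemma blip_ramp (n : nat) a : blip (fun x => clamp (1 - n%:R * (x - a))).
Proof.
split; first by exists 1 => x; have /andP[h1 h2] := clamp01 (1 - n%:R * (x - a)); rewrite ger0_norm.
exists n%:R => x y; apply: le_trans (clamp_lip _ _) _.
rewrite (_ : _ - _ = - (n%:R * (x - y))); last by ring.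
by rewrite normrN normrM ger0_norm.
Qed.

Lemma cvg_ramp (a x : R) :
  clamp (1 - n%:R * (x - a)) @[n --> \oo] --> ((x <= a)%R%:R : R).
Proof.
have [xa|xa] := leP x a.
  rewrite (_ : (fun n => _) = cst 1); first exact: cvg_cst.
  apply/funext => n; apply: clamp_ge1; rewrite lerBrDr gerDl.
  by rewrite mulr_ge0_le0// subr_le0.
apply: cvg_near_cst.
near=> n; apply/clamp_le0; rewrite subr_le0 -ler_pdivrMr ?subr_gt0//.
near: n; exact: nbhs_infty_ger.
Unshelve. all: by end_near. Qed.

Lemma law_le X a : measurable_fun setT X ->
  \int[P]_w clamp (1 - n%:R * (X w - a)) @[n --> \oo] --> fine (P (X @^-1` `]-oo, a])).
Proof.
move=> mX; have mA : measurable (X @^-1` `]-oo, a]) by rewrite -[X in measurable X]setTI; exact: mX.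
have -> : fine (P (X @^-1` `]-oo, a])) = \int[P]_w (\1_(X @^-1` `]-oo, a]) w : R).
  by rewrite /Rintegral; congr fine; rewrite integral_indic ?setIT.
apply: (@bounded_cvg _ _ 1).
- by move=> n; exact: (blip_measurable (blip_ramp n a)).
- exact: measurable_indic.
- by move=> n w; have /andP[h1 h2] := clamp01 (1 - n%:R * (X w - a)); rewrite ger0_norm.
- apply: aeW => w; rewrite indicE.
  have := @cvg_ramp a (X w); rewrite (_ : (X w <= a) = (w \in X @^-1` `]-oo, a]))//.
  by apply/idP/idP; rewrite ?inE /= ?in_itv.
Qed.

(** Ramps recover the measure of rays, differences of rays that of half-open intervals, and these
    form a generating family stable under intersection. *)
Lemma law_eq X Y : measurable_fun setT X -> measurable_fun setT Y ->
  (forall g, blip g -> \int[P]_w g (X w) = \int[P]_w g (Y w)) ->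
  forall E : set R, measurable E -> P (X @^-1` E) = P (Y @^-1` E).
Proof.
move=> mX mY h E mE.
have mpre Z (A : set R) : measurable_fun setT Z -> measurable A -> measurable (Z @^-1` A).
  by move=> mZ mA; rewrite -[X in measurable X]setTI; exact: mZ.
have ray a : P (X @^-1` `]-oo, a]) = P (Y @^-1` `]-oo, a]).
  rewrite -[LHS]fineK ?fin_num_measure//; last exact: mpre.
  rewrite -[RHS]fineK ?fin_num_measure//; last exact: mpre.
  congr EFin; have hX := @law_le X a mX; have hY := @law_le Y a mY.
  apply: (cvg_unique _ hX) => //; apply: cvg_trans hY.
  by apply: near_eq_cvg; apply: nearW => n; rewrite (h _ (blip_ramp n a)).
have oc a b : P (X @^-1` `]a, b]) = P (Y @^-1` `]a, b]).
  have [ba|ab] := leP b a.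
    by rewrite set_itv_ge ?bnd_simp -?leNgt// !preimage_set0 !measure0.
  have eD Z : measurable_fun setT Z ->
      P (Z @^-1` `]a, b]) = (P (Z @^-1` `]-oo, b]) - P (Z @^-1` `]-oo, a]))%E.
    move=> mZ; have -> : `]a, b]%classic = `]-oo, b] `\` `]-oo, a] :> set R.
      by rewrite -[RHS]setCK setCD setCitvl setUC -[LHS]setCK setCitv.
    rewrite (_ : Z @^-1` (_ `\` _) = Z @^-1` `]-oo, b] `\` Z @^-1` `]-oo, a])// measureD ?setIidr//; try exact: mpre.
    - by apply: preimage_subset; apply: subset_itvl; rewrite bnd_simp ltW.
    - by rewrite -ge0_fin_numE// fin_num_measure//; exact: mpre.
  by rewrite !eD// !ray.
pose X' : {mfun Omega >-> R} := HB.pack X (isMeasurableFun.Build _ _ _ _ X mX).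
pose Y' : {mfun Omega >-> R} := HB.pack Y (isMeasurableFun.Build _ _ _ _ Y mY).
apply: (@measure_unique _ R _ (@ocitv R) (fun n => `]- n%:R, n%:R]%classic) _ _ _ _
  (distribution P X') (distribution P Y')) => //.
- exact: ocitvI.
- by move=> i; exact: is_ocitv.
- rewrite -subTset => x _; near \oo => n; exists n => //=.
  rewrite in_itv/=; apply/andP; split.
    rewrite ltrNl (le_lt_trans (ler_norm _))// normrN.
    by near: n; exact: nbhs_infty_gtr.
  by apply: le_trans (ler_norm _) _; near: n; exact: nbhs_infty_ger.
- by move=> _ [[a b] _ <-]; exact: oc.
- by move=> k; rewrite (le_lt_trans (probability_le1 (distribution P X') _)) ?ltry.
Unshelve. all: by end_near. Qed.

End convergence.

(** * Integration by antiderivatives; moments of the normal density *)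

Section real_integrals.
Context {R : realType}.
Local Notation mu := (@lebesgue_measure R).

Lemma is_derive_cong (f g : R -> R) (x df dg : R) : is_derive x (1 : R) f df ->
  f =1 g -> df = dg -> is_derive x (1 : R) g dg.
Proof. by move=> h /funext <- <-. Qed.

Lemma is_derive_expR_comp (f : R -> R) (x df : R) : is_derive x (1 : R) f df ->
  is_derive x (1 : R) (fun y => expR (f y)) (expR (f x) * df).
Proof.
move=> hf; have h := is_derive_expR (f x).
exact: (is_derive_cong (is_derive1_comp h hf)).
Qed.

Lemma cont_of_derive (f g : R -> R) : (forall x : R, is_derive x (1 : R) f (g x)) -> continuous f.
Proof.
move=> h x; apply: differentiable_continuous; apply/derivable1_diffP.
by have [] := h x.
Qed.

Lemma FTC (F f : R -> R) (a b : R) : a <= b ->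
  (forall x : R, is_derive x (1 : R) F (f x)) -> continuous f ->
  \int[mu]_(x in `[a, b]) f x = F b - F a.
Proof.
move=> ab dF cf; have [->|nab] := eqVneq a b.
  by rewrite set_itv1 Rintegral_set1 subrr.
have {nab} ltab : a < b by rewrite lt_neqAle nab.
rewrite /Rintegral (@continuous_FTC2 _ f F) //.
- exact: continuous_subspaceT.
- split.
  + by move=> x _; have [] := dF x.
  + by apply: cvg_at_right_filter; exact: (cont_of_derive dF).
  + by apply: cvg_at_left_filter; exact: (cont_of_derive dF).
- by move=> x _; rewrite derive1E; have [_ ->] := dF x.
Qed.

(** Dominated convergence reduces the whole line to the intervals [[-n, n]], where the fundamental
    theorem leaves two boundary terms. *)
Lemma int_derive0 (F f : R -> R) : (forall x : R, is_derive x (1 : R) F (f x)) ->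
  continuous f -> mu.-integrable setT (EFin \o f) ->
  F n%:R @[n --> \oo] --> (0 : R) -> F (- n%:R) @[n --> \oo] --> (0 : R) ->
  \int[mu]_x f x = 0.
Proof.
move=> dF cf jf F1 F2.
pose g (n : nat) := f \_ `[- n%:R, n%:R].
have mf : measurable_fun setT f by exact: continuous_measurable_fun.
have gnear x : \forall n \near \oo, (EFin \o g n) x = (EFin \o f) x.
  near=> n; rewrite /g /= patchE mem_set// /= in_itv/= -ler_norml.
  by near: n; exact: nbhs_infty_ger.
have mg n : measurable_fun setT (EFin \o g n).
  apply/measurable_EFinP; apply/(measurable_restrictT f (measurable_itv _)).
  exact: measurable_funTS.
have cg : {ae mu, forall x, setT x -> (EFin \o g n) x @[n --> \oo] --> (EFin \o f) x}.
  by apply: aeW => x _; apply: cvg_near_cst; exact: gnear.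
have bg : {ae mu, forall x n, setT x -> (`|(EFin \o g n) x| <= (EFin \o (fun x => `|f x|)%R) x)%E}.
  by apply: aeW => x n _; rewrite lee_fin /g patchE; case: ifP => // _; rewrite normr0.
have [_ _ h] := @dominated_convergence _ _ _ mu setT measurableT (fun n => EFin \o g n)
  (EFin \o f) (EFin \o (fun x => `|f x|)) mg ((measurable_EFinP _ _).2 mf) cg
  (integrable_norm jf) bg.
have hn n : (\int[mu]_(x in setT) ((EFin \o g n) x) = (F n%:R - F (- n%:R))%:E)%E.
  transitivity (\int[mu]_(x in `[(- n%:R)%R, n%:R]) (f x)%:E)%E.
    rewrite [RHS]integral_mkcond; apply: eq_integral => x _.
    by rewrite /g /= !patchE; case: ifP.
  have le_n : - n%:R <= n%:R :> R by rewrite (le_trans _ (ler0n _ n))// oppr_le0.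
  rewrite -(FTC le_n dF cf).
  rewrite /Rintegral fineK//; apply: integrable_fin_num => //.
  exact: integrableS jf.
have h2 : (fun n => \int[mu]_(x in setT) ((EFin \o g n) x))%E @ \oo --> (0 : R)%:E.
  rewrite (_ : (fun n => _) = fun n => (F n%:R - F (- n%:R))%:E); last first.
    by apply/funext => n; rewrite hn.
  by apply: cvg_EFin_seq; rewrite -[X in _ --> X](subrr (0 : R)); exact: cvgB.
by rewrite /Rintegral -(cvg_unique _ h2 h).
Unshelve. all: by end_near. Qed.

(** From [z / 2 <= expR (z / 2)]: half of the exponent absorbs the factor [z]. *)
Lemma poly_gauss_le (z : R) : 0 <= z -> z * expR (- z) <= 2 * expR (- (z / 2)).
Proof.
move=> z0; have -> : - z = - (z / 2) + - (z / 2) by field.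
rewrite expRD mulrA ler_wpM2r ?expR_ge0//.
have := expR_ge1Dx (z / 2); have := expR_gt0 (z / 2); rewrite expRN => h1 h2.
rewrite ler_pdivrMr//; lra.
Qed.

Variables (m s : R).
Hypothesis s0 : s != 0.
Local Notation p := (normal_pdf m s).

Let s20 : 0 < s ^+ 2. Proof. by rewrite exprn_even_gt0. Qed.

Lemma is_derive_normal_pdf (x : R) : is_derive x (1 : R) p (- (x - m) / s ^+ 2 * p x).
Proof.
rewrite normal_pdfE//.
have h : is_derive x (1 : R) (fun y => - (y - m) ^+ 2 / (s ^+ 2 *+ 2)) (- (x - m) / s ^+ 2).
  have -> : (fun y => - (y - m) ^+ 2 / (s ^+ 2 *+ 2)) = (- (s ^+ 2 *+ 2)^-1) \*: ((id - cst m) ^+ 2 : R -> R).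
    by apply/funext => y; rewrite /= !fctE /= /GRing.scale/=; ring.
  apply: is_derive_eq; rewrite /GRing.scale/= /= !fctE.
  by rewrite subr0 mulr1 expr1 -mulr_natl; field.
apply: (is_derive_cong (is_deriveZ (normal_peak s) (is_derive_expR_comp h))) => //.
by rewrite /GRing.scale/= /normal_fun; ring.
Qed.

Lemma is_derive_normal_pdf1 (x : R) :
  is_derive x (1 : R) (fun y => (y - m) * p y) (p x - (x - m) ^+ 2 / s ^+ 2 * p x).
Proof.
have h : is_derive x (1 : R) (id - cst m : R -> R) 1 by apply: is_derive_eq; rewrite subr0.
apply: (is_derive_cong (is_deriveM h (is_derive_normal_pdf x))) => //.
by rewrite /GRing.scale/= !fctE; ring.
Qed.

(** Halving the exponent doubles the variance, so the dominating function is a multiple of the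
    normal density with parameter [sqrt 2 * s], whose integrability and boundedness are known. *)
Lemma sqr_normal_pdf_le (x : R) : (x - m) ^+ 2 * p x <=
  4 * s ^+ 2 * (normal_peak s / normal_peak (Num.sqrt 2 * s)) * normal_pdf m (Num.sqrt 2 * s) x.
Proof.
have s2 : Num.sqrt 2 * s != 0 by rewrite mulf_neq0// gt_eqF// sqrtr_gt0.
rewrite !normal_pdfE// /normal_fun exprMn sqr_sqrtr//.
have e3 (y : R) : - y / (2 * s ^+ 2 *+ 2) = - (y / (s ^+ 2 *+ 2) / 2).
  by rewrite (_ : 2 * s ^+ 2 *+ 2 = (s ^+ 2 *+ 2) * 2); [rewrite invfM; ring | ring].
have e4 (y : R) : y = 2 * s ^+ 2 * (y / (s ^+ 2 *+ 2)).
  rewrite (_ : s ^+ 2 *+ 2 = 2 * s ^+ 2); last by ring.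
  by rewrite mulrC divfK// mulf_neq0// gt_eqF.
rewrite e3 mulNr {1}(e4 ((x - m) ^+ 2)).
have : 0 <= (x - m) ^+ 2 / (s ^+ 2 *+ 2) by rewrite divr_ge0 ?sqr_ge0// mulrn_wge0// sqr_ge0.
move: ((x - m) ^+ 2 / (s ^+ 2 *+ 2)) => z z0.
have pk : normal_peak (Num.sqrt 2 * s) != 0 by rewrite gt_eqF// normal_peak_gt0.
have := poly_gauss_le z0; have := normal_peak_gt0 s0.
set P1 := normal_peak s; set P2 := normal_peak _ in pk *; set e1 := expR _; set e2 := expR _.
move=> P10 h; rewrite [leRHS](_ : _ = 2 * s ^+ 2 * P1 * (2 * e2)); last by field.
rewrite [leLHS](_ : _ = 2 * s ^+ 2 * P1 * (z * e1)); last by ring.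
by rewrite ler_wpM2l//; apply: mulr_ge0; [apply: mulr_ge0 => //|]; exact: ltW.
Qed.

Lemma int_sqr_normal_pdf : mu.-integrable setT (EFin \o (fun x => (x - m) ^+ 2 * p x)).
Proof.
have h := integrableZl measurableT (4 * s ^+ 2 * (normal_peak s / normal_peak (Num.sqrt 2 * s)))
   (integrable_normal_pdf m (Num.sqrt 2 * s)).
apply: (le_integrable measurableT _ _ h).
  apply/measurable_EFinP/measurable_funM; last exact: measurable_normal_pdf.
  by apply: measurable_funX; apply: measurable_funB.
move=> x _; rewrite -EFinM lee_fin ger0_norm; last by apply: mulr_ge0; rewrite ?sqr_ge0 ?normal_pdf_ge0.
exact: le_trans (sqr_normal_pdf_le x) (ler_norm _).
Qed.

Lemma int_lin_normal_pdf : mu.-integrable setT (EFin \o (fun x => (x - m) * p x)).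
Proof.
have h := integrableD measurableT int_sqr_normal_pdf (integrable_normal_pdf m s).
apply: (le_integrable measurableT _ _ h).
  apply/measurable_EFinP/measurable_funM; last exact: measurable_normal_pdf.
  exact: measurable_funB.
move=> x _; rewrite -EFinD lee_fin normrM (ger0_norm (normal_pdf_ge0 _ _ _)).
apply: le_trans (ler_norm _); rewrite -[X in _ <= _ + X]mul1r -mulrDl.
rewrite ler_wpM2r ?normal_pdf_ge0//.
rewrite -[(x - m) ^+ 2]real_normK ?num_real//; have := sqr_ge0 (`|x - m| - 1).
have := normr_ge0 (x - m); set t := `|_|; nra.
Qed.

(** [e] is 1 or -1 in the applications, which covers both ends of the line. The boundedness of
    [(x - m)^2 p x] makes [(x - m) p x] decay like [1 / |x - m|]. *)
Lemma normal_pdf_cvg0 (e : R) : `|e| = 1 ->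
  ((e * n%:R - m) * p (e * n%:R) @[n --> \oo] --> (0 : R)) /\
  (p (e * n%:R) @[n --> \oo] --> (0 : R)).
Proof.
move=> e1.
have s2 : Num.sqrt 2 * s != 0 by rewrite mulf_neq0// gt_eqF// sqrtr_gt0.
pose K := 4 * s ^+ 2 * (normal_peak s / normal_peak (Num.sqrt 2 * s)) * normal_peak (Num.sqrt 2 * s).
have Kx x : (x - m) ^+ 2 * p x <= K.
  apply: le_trans (sqr_normal_pdf_le x) _; rewrite ler_wpM2l ?normal_pdf_ub//.
  apply: mulr_ge0; first by rewrite mulr_ge0// ltW.
  by rewrite divr_ge0// normal_peak_ge0.
have main (a : R) (x : R) : 0 < a -> Num.max 1 (K / a) <= `|x - m| ->
    `|x - m| * p x <= a /\ p x <= a.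
  move=> a0; rewrite ge_max ler_pdivrMr// => /andP[h1 h2].
  have := Kx x; rewrite -[(x - m) ^+ 2]real_normK ?num_real//.
  have := normal_pdf_ge0 m s x; move: h1 h2; set t := `|_|; set u := p x => h1 h2 u0 h3.
  have t0 : 0 < t by lra.
  have h4 : t * u <= a.
    by rewrite -(ler_pM2l t0) mulrA -expr2 (le_trans h3).
  by split => //; apply: le_trans h4; nra.
have near_ (a : R) : 0 < a -> \forall n \near \oo, Num.max 1 (K / a) <= `|e * n%:R - m|.
  move=> a0; near=> n; apply: le_trans (lerB_dist _ _).
  rewrite normrM e1 mul1r lerBrDr (ger0_norm (ler0n _ _)).
  by near: n; exact: nbhs_infty_ger.
split; apply/cvgr0Pnorm_le => a a0; near=> n.
- have [h _] : `|e * n%:R - m| * p (e * n%:R) <= a /\ p (e * n%:R) <= a.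
    by apply: main => //; near: n; exact: near_.
  by rewrite normrM (ger0_norm (normal_pdf_ge0 _ _ _)).
- have [_ h] : `|e * n%:R - m| * p (e * n%:R) <= a /\ p (e * n%:R) <= a.
    by apply: main => //; near: n; exact: near_.
  by rewrite (ger0_norm (normal_pdf_ge0 _ _ _)).
Unshelve. all: by end_near. Qed.

(** [- s^2 p] is an antiderivative that vanishes at both ends. *)
Lemma mean_normal_pdf : \int[mu]_x ((x - m) * p x) = 0.
Proof.
have cp := (@continuous_normal_pdf R m s s0).
have cl : continuous (fun x : R => (x - m) * p x).
  exact: cont_of_derive is_derive_normal_pdf1.
apply: (@int_derive0 (fun x => - s ^+ 2 * p x) (fun x => (x - m) * p x)).
- move=> x; apply: (is_derive_cong (is_deriveZ (- s ^+ 2) (is_derive_normal_pdf x))) => //.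
  by rewrite /GRing.scale/=; field.
- exact: cl.
- exact: int_lin_normal_pdf.
- have [_ h] := @normal_pdf_cvg0 1 (normr1 _).
  rewrite -[X in _ --> X](mulr0 (- s ^+ 2)); apply: cvgMl_tmp.
  by under eq_fun do rewrite -[_%:R]mul1r.
- have [_ h] := @normal_pdf_cvg0 (-1) (normrN1 _).
  rewrite -[X in _ --> X](mulr0 (- s ^+ 2)); apply: cvgMl_tmp.
  by under eq_fun do rewrite -mulN1r.
Qed.

(** The derivative of [(x - m) p x] is [p] minus [(x - m)^2 / s^2] times [p], and its integral is
    0. *)
Lemma var_normal_pdf : \int[mu]_x ((x - m) ^+ 2 * p x) = s ^+ 2.
Proof.
have cp := (@continuous_normal_pdf R m s s0).
pose f (x : R) := p x - (x - m) ^+ 2 / s ^+ 2 * p x.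
have i2 := int_sqr_normal_pdf; have i0 := integrable_normal_pdf m s.
have i2' : mu.-integrable setT (EFin \o (fun x => (s ^+ 2)^-1 * ((x - m) ^+ 2 * p x))).
  exact: (integrableZl measurableT (s ^+ 2)^-1 i2).
have fE : f = fun x => p x - (s ^+ 2)^-1 * ((x - m) ^+ 2 * p x).
  by apply/funext => x; rewrite /f; ring.
have : \int[mu]_x f x = 0.
  apply: (@int_derive0 (fun x => (x - m) * p x)).
  - exact: is_derive_normal_pdf1.
  - have h (x : R) : is_derive x (1 : R) (id - cst m : R -> R) 1 by apply: is_derive_eq; rewrite subr0.
    apply: cont_of_derive => x.
    apply: (is_derive_cong (is_deriveB (is_derive_normal_pdf x) (is_deriveZ (s ^- 2)
      (is_deriveM (h x) (is_derive_normal_pdf1 x))))) => // y.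
    by change (p y - s ^- 2 * ((y - m) * ((y - m) * p y)) = f y); rewrite /f; ring.
  - by rewrite fE; exact: (integrableB measurableT i0 i2').
  - have [h _] := @normal_pdf_cvg0 1 (normr1 _).
    by under eq_fun do rewrite -[_%:R]mul1r.
  - have [h _] := @normal_pdf_cvg0 (-1) (normrN1 _).
    by under eq_fun do rewrite -mulN1r.
rewrite fE RintegralB// RintegralZl//.
rewrite (_ : \int[mu]_x p x = 1); last by rewrite /Rintegral integral_normal_pdf.
by move/eqP; rewrite subr_eq0 => /eqP h; apply: (mulfI (invr_neq0 (lt0r_neq0 s20))); rewrite -h mulVf// gt_eqF.
Qed.

End real_integrals.

(** * Moments and concentration of Gaussian variables *)

Section gaussian_laws.
Context {R : realType} {d : measure_display} {Omega : measurableType d}.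
Variable P : probability Omega R.
Local Notation mu := (@lebesgue_measure R).

Lemma transfer_int (X Y : Omega -> R) (h : R -> R) :
  measurable_fun setT X -> measurable_fun setT Y ->
  (forall E : set R, measurable E -> P (X @^-1` E) = P (Y @^-1` E)) ->
  measurable_fun setT h ->
  P.-integrable setT (EFin \o (h \o X)) -> P.-integrable setT (EFin \o (h \o Y)) ->
  \int[P]_w h (X w) = \int[P]_w h (Y w).
Proof.
move=> mX mY XY mh iX iY.
pose X' : {mfun Omega >-> R} := HB.pack X (isMeasurableFun.Build _ _ _ _ X mX).
pose Y' : {mfun Omega >-> R} := HB.pack Y (isMeasurableFun.Build _ _ _ _ Y mY).
have mh' : measurable_fun setT (EFin \o h) by exact/measurable_EFinP.
rewrite /Rintegral; congr fine.
transitivity (\int[distribution P X']_y (h y)%:E)%E.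
  by rewrite integral_distribution.
transitivity (\int[distribution P Y']_y (h y)%:E)%E.
  by apply: eq_measure_integral => A mA _; exact: XY.
by rewrite integral_distribution.
Qed.

(** The normal density and the Radon-Nikodym derivative of the law of [X] have the same integral
    over every measurable set, so they agree almost everywhere and the change of variables
    applies. *)
Lemma law_density_int (X : Omega -> R) (m s : R) (h : R -> R) :
  measurable_fun setT X ->
  (forall E : set R, measurable E -> P (X @^-1` E) = normal_prob m s E) ->
  measurable_fun setT h -> P.-integrable setT (EFin \o (h \o X)) ->
  \int[P]_w h (X w) = \int[mu]_x (h x * normal_pdf m s x).
Proof.
move=> mX XE mh iX.
have mX1 : measurable_fun setT (X : Omega -> measurableTypeR R) by exact: mX.
pose X' : {mfun Omega >-> measurableTypeR R} :=
  HB.pack (X : Omega -> measurableTypeR R) (isMeasurableFun.Build _ _ _ _ _ mX1).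
pose nu := distribution P X'.
have mh' : measurable_fun setT (EFin \o h) by exact/measurable_EFinP.
have dom : nu `<< mu.
  apply/null_content_dominatesP => A mA A0; apply: etrans (XE A mA) _.
  by have /null_content_dominatesP := normal_prob_dominates m s; apply.
have pE : ae_eq mu setT (Radon_Nikodym (charge_of_finite_measure nu) mu)
    (fun x => (normal_pdf m s x)%:E).
  apply: integral_ae_eq => //.
  - apply: Radon_Nikodym_integrable; exact: dom.
  - by apply/measurable_EFinP; exact: measurable_normal_pdf.
  - by move=> E _ mE; rewrite -Radon_Nikodym_integral//; exact: XE.
rewrite /Rintegral; congr fine.
transitivity (\int[nu]_y (h y)%:E)%E.
  by rewrite integral_distribution.
rewrite -(Radon_Nikodym_change_of_variables dom measurableT) //; last first.
  exact: integrable_pushforward.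
apply: ae_eq_integral => //.
- exact: emeasurable_funM.
- apply/measurable_EFinP; apply: measurable_funM => //; exact: measurable_normal_pdf.
- by apply: filterS pE => x /= /(_ I) -> _.
Qed.

(** [gaussian_rv] only provides some parameters [m] and [s]. The first two moments of the density
    identify them; the point mass has no density and is treated apart. *)
Lemma gaussian_center (X : Omega -> R) : L2 P X -> gaussian_rv P X ->
  \int[P]_w X w = 0 -> forall E : set R, measurable E ->
  P (X @^-1` E) = if nm P X == 0 then \d_(0 : R) E else normal_prob 0 (nm P X) E.
Proof.
move=> hX [mX [m [s [s0 XE]]]] EX.
have [s00|sn0] := eqVneq s 0.
  rewrite {}s00 eqxx in XE.
  have Xm : {ae P, forall w, X w = m}.
    exists (~` (X @^-1` [set m])); split => //.
    - apply: measurableC; rewrite -[X in measurable X]setTI; exact: mX.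
    - rewrite probability_setC; last by rewrite -[X in measurable X]setTI; exact: mX.
      by rewrite XE// diracE mem_set//= subee.
  have m0 : m = 0.
    have h : \int[P]_w X w = \int[P]_w (cst m w).
      rewrite /Rintegral; congr fine; apply: ae_eq_integral => //.
      - exact/measurable_EFinP.
      - exact/measurable_EFinP.
      - by apply: filterS Xm => w /= ->.
    by rewrite -EX h Rintegral_cst// (_ : fine (P setT) = 1) ?mulr1// probability_setT.
  have -> : nm P X = 0.
    rewrite m0 in Xm; by rewrite (nm_ae hX (@L2_0 _ _ _ P)) ?nm0.
  by rewrite eqxx -m0; exact: XE.
rewrite (negbTE sn0) in XE.
have ml : measurable_fun setT (fun x : R => x - m) by exact: measurable_funB.
have hXm : L2 P (X - cst m) by apply: L2B => //; exact: L2_cst.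
have m0 : m = 0.
  have := law_density_int mX XE ml (L2_int hXm); rewrite mean_normal_pdf//.
  rewrite (_ : \int[P]_w (X w - m) = - m); first by move/eqP; rewrite oppr_eq0 => /eqP.
  rewrite RintegralB//; [|exact: L2_int|exact: (L2_int (L2_cst P m))].
  rewrite EX add0r Rintegral_cst//.
  by rewrite (_ : fine (P setT) = 1) ?mulr1// probability_setT.
have vX : nm P X = s.
  have := law_density_int mX XE (measurable_funX 2 ml) hXm.2; rewrite var_normal_pdf// m0 => h.
  rewrite /nm (_ : ip P X X = s ^+ 2) ?sqrtr_sqr ?ger0_norm//.
  by rewrite -h; apply: eq_Rintegral => w _; rewrite subr0 expr2.
by rewrite vX (negbTE sn0) -m0; exact: XE.
Qed.

(** The density is at most its peak, which is at most [1 / s] because [2 pi >= 1]. *)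
Lemma gaussian_small_ball (X : Omega -> R) (a b : R) : L2 P X -> gaussian_rv P X ->
  \int[P]_w X w = 0 -> 0 < nm P X -> a <= b ->
  fine (P (X @^-1` `[a, b])) <= (b - a) / nm P X.
Proof.
move=> hX gX EX X0 ab; rewrite gaussian_center// gt_eqF//.
move: (nm P X) X0 => s X0.
have n0 : s != 0 by rewrite gt_eqF.
have pk : normal_peak (s) <= (s)^-1.
  rewrite /normal_peak lef_pV2 ?posrE//; last first.
    by rewrite sqrtr_gt0 pmulrn_lgt0// mulr_gt0 ?pi_gt0// exprn_gt0.
  apply: le_trans (_ : Num.sqrt (s ^+ 2) <= _); first by rewrite sqrtr_sqr ler_norm.
  rewrite ler_wsqrtr// -mulrnAr ler_peMr ?sqr_ge0//.
  by have := pi_ge2 R; rewrite mulr2n; lra.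
have le1 : (normal_prob 0 (s) `[a, b] <= ((b - a) / s)%:E)%E.
  apply: (@le_trans _ _ (\int[mu]_(x in `[a, b]) ((s)^-1)%:E)%E).
    apply: ge0_le_integral => //.
    - by move=> x _; rewrite lee_fin normal_pdf_ge0.
    - by apply/measurable_EFinP; apply: measurable_funTS; exact: measurable_normal_pdf.
    - by move=> x _; rewrite lee_fin (le_trans (normal_pdf_ub _ _ _)).
  rewrite integral_cst//= lebesgue_measure_itv/= lte_fin; case: ltP => h.
    by rewrite -EFinD -EFinM lee_fin mulrC.
  by rewrite mule0 lee_fin divr_ge0 ?subr_ge0// ltW.
rewrite -lee_fin fineK//.
by apply: fin_num_measure.
Qed.

End gaussian_laws.

(** * Entrywise derivatives of matrix functions and mean value bounds *)

Section matrix_derivative.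
Context {R : realType}.

Definition is_dmx (m n : nat) (F : R -> 'M[R]_(m, n)) (s : R) (D : 'M[R]_(m, n)) :=
  forall i j, is_derive s (1 : R) (fun t => F t i j) (D i j).

Lemma is_dmx_cst m n (M : 'M[R]_(m, n)) s : is_dmx (fun=> M) s 0.
Proof. by move=> i j; rewrite mxE; exact: is_derive_cst. Qed.

Lemma is_derive_sumf (I : Type) (r : seq I) (f : I -> R -> R) (s : R) (g : I -> R) :
  (forall i, is_derive s (1 : R) (f i) (g i)) ->
  is_derive s (1 : R) (fun t => \sum_(i <- r) f i t) (\sum_(i <- r) g i).
Proof.
move=> h; elim: r => [|i r IH].
  rewrite big_nil; apply: (is_derive_cong (is_derive_cst (0 : R) s 1)) => // t.
  by rewrite big_nil.
rewrite big_cons; apply: (is_derive_cong (is_deriveD (h i) IH)) => // t.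
by rewrite big_cons.
Qed.

Lemma is_dmx_mul m n k (F : R -> 'M[R]_(m, n)) (G : R -> 'M[R]_(n, k)) s DF DG :
  is_dmx F s DF -> is_dmx G s DG ->
  is_dmx (fun t => F t *m G t) s (DF *m G s + F s *m DG).
Proof.
move=> hF hG i j.
have h (l : 'I_n) : is_derive s (1 : R) (fun t => F t i l * G t l j)
    (DF i l * G s l j + F s i l * DG l j).
  apply: (is_derive_cong (is_deriveM (hF i l) (hG l j))) => //.
  by rewrite /GRing.scale/=; ring.
apply: (is_derive_cong (is_derive_sumf (index_enum _) h)).
  by move=> t; rewrite mxE.
by rewrite !mxE big_split.
Qed.

Lemma is_dmx_comp m n (F : R -> 'M[R]_(m, n)) (g : R -> R) s D (b : R) :
  is_dmx F (g s) D -> is_derive s (1 : R) g b ->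
  is_dmx (fun t => F (g t)) s (b *: D).
Proof.
move=> hF hg i j; apply: (is_derive_cong (is_derive1_comp (hF i j) hg)) => //.
by rewrite mxE mulrC.
Qed.

Lemma derive0_cst (f : R -> R) : (forall x : R, is_derive x (1 : R) f 0) ->
  forall x y, f x = f y.
Proof. by move=> h x y; exact: is_derive_0_is_cst. Qed.

Lemma dmx0_cst m n (F : R -> 'M[R]_(m, n)) : (forall s, is_dmx F s 0) ->
  forall s t, F s = F t.
Proof.
move=> h s t; apply/matrixP => i j.
by apply: (@derive0_cst (fun s => F s i j)) => x; have := h x i j; rewrite mxE.
Qed.

Lemma mvt_le (f g : R -> R) (a b L : R) : a <= b ->
  (forall x : R, is_derive x (1 : R) f (g x)) ->
  (forall x, a <= x -> x <= b -> `|g x| <= L) -> `|f b - f a| <= L * (b - a).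
Proof.
move=> ab df gL.
have [c /andP[c1 c2] ->] := @MVT_segment R f g a b ab (fun x _ => df x)
  (continuous_subspaceT (cont_of_derive df)).
by rewrite normrM (ger0_norm (_ : 0 <= b - a)) ?subr_ge0// ler_wpM2r ?subr_ge0// gL.
Qed.

Lemma nincr_of_derive (f g : R -> R) (a b : R) : a <= b ->
  (forall x : R, is_derive x (1 : R) f (g x)) ->
  (forall x, a <= x -> x <= b -> g x <= 0) -> f b <= f a.
Proof.
move=> ab df g0.
have [c /andP[c1 c2] h] := @MVT_segment R f g a b ab (fun x _ => df x)
  (continuous_subspaceT (cont_of_derive df)).
by rewrite -subr_le0 h mulr_le0_ge0 ?subr_ge0// g0.
Qed.

End matrix_derivative.

(** * The exponential of a matrix as a one-parameter group *)

Section matrix_exponential.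
Context {R : realType} (p : nat) (A : 'M[R]_p).

Definition mxabs : R := \sum_i \sum_j `|A i j|.

Lemma mxabs_ge0 : 0 <= mxabs.
Proof. by rewrite sumr_ge0// => i _; rewrite sumr_ge0. Qed.

Lemma row_le_mxabs i : \sum_j `|A i j| <= mxabs.
Proof.
rewrite /mxabs [leRHS](bigD1 i)//= lerDl sumr_ge0// => k _.
by rewrite sumr_ge0.
Qed.

Lemma normr_mxexp k i j : `|(A ^+ k) i j| <= mxabs ^+ k.
Proof.
elim: k i j => [|k IH] i j.
  by rewrite !expr0 mxE; case: (i == j); rewrite ?normr1 ?normr0 ?ler01.
rewrite !exprS mxE; apply: le_trans (ler_norm_sum _ _ _) _.
apply: le_trans (ler_wpM2r _ (row_le_mxabs i)); last by rewrite exprn_ge0 ?mxabs_ge0.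
by rewrite mulr_suml; apply: ler_sum => l _; rewrite normrM ler_wpM2l.
Qed.

(** Coefficients of the power series in [s] of the [(i, j)] entry of [A^n e^(sA)]; term-by-term
    differentiation shifts [n] by 1. *)
Definition expcoef (n : nat) (i j : 'I_p) (k : nat) : R := (A ^+ (n + k)%N) i j / k`!%:R.

Lemma expcoef_diffs n i j : pseries_diffs (expcoef n i j) = expcoef n.+1 i j.
Proof.
apply/funext => k; rewrite /pseries_diffs /expcoef factS natrM addnS addSn.
by rewrite invfM mulrCA mulVKf// pnatr_eq0.
Qed.

Lemma is_cvg_expcoef n i j x : cvgn (pseries (expcoef n i j) x).
Proof.
apply: normed_cvg; apply: (@series_le_cvg R _ (fun k => mxabs ^+ n * exp_coeff (mxabs * `|x|) k)).
- by move=> k /=.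
- by move=> k; rewrite mulr_ge0 ?exprn_ge0 ?mxabs_ge0// /exp_coeff/= divr_ge0// exprn_ge0// mulr_ge0 ?mxabs_ge0.
- move=> k /=; rewrite /expcoef /exp_coeff/= !normrM normrX normfV (ger0_norm (ler0n _ k`!)).
  rewrite exprMn mulrAC !mulrA -exprD ler_wpM2r ?invr_ge0// ler_wpM2r ?exprn_ge0//.
  exact: normr_mxexp.
- have -> : series (fun k => mxabs ^+ n * exp_coeff (mxabs * `|x|) k) =
      mxabs ^+ n \*: series (exp_coeff (mxabs * `|x|)).
    by apply/funext => m; rewrite /series/= /GRing.scale/= mulr_sumr.
  by apply: is_cvgZl_tmp; exact: is_cvg_series_exp_coeff.
Qed.

Lemma expr_mxZ (s : R) k : (s *: A) ^+ k = s ^+ k *: A ^+ k.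
Proof.
elim: k => [|k IH]; first by rewrite !expr0 scale1r.
by rewrite !exprS IH -[LHS]/((s *: A) *m (s ^+ k *: A ^+ k)) -scalemxAl -scalemxAr scalerA.
Qed.

Definition E (s : R) := expmx (s *: A).

Lemma E_pseries s n i j : (A ^+ n *m E s) i j = limn (pseries (expcoef n i j) s).
Proof.
have cE l : (pseries (expcoef 0 l j) s) @ \oo --> E s l j.
  have -> : E s l j = limn (pseries (expcoef 0 l j) s).
    rewrite mxE; congr (limn _); apply/funext => m.
    rewrite /pseries /series/= summxE big_mkord; apply: eq_bigr => k _.
    by rewrite mxE expr_mxZ mxE /expcoef add0n; ring.
  exact: is_cvg_expcoef.
rewrite mxE; apply/esym/cvg_lim => //.
have -> : pseries (expcoef n i j) s = fun m => \sum_l (A ^+ n) i l * pseries (expcoef 0 l j) s m.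
  apply/funext => m; under eq_bigr do rewrite /pseries /series/= mulr_sumr.
  rewrite exchange_big /=; apply: eq_bigr => k _.
  rewrite /= /expcoef exprD -[A ^+ n * _]/(A ^+ n *m A ^+ k) mxE !mulr_suml; apply: eq_bigr => l _.
  by rewrite add0n; ring.
apply: cvg_big => [|l _]; last by apply: cvgMl_tmp; exact: cE.
by move=> x; exact: add_continuous.
Qed.

Lemma E_comm s : A *m E s = E s *m A.
Proof.
apply/matrixP => i j; have := E_pseries s 1 i j; rewrite expr1 => ->.
rewrite mxE; apply: cvg_lim => //.
have -> : pseries (expcoef 1 i j) s = fun m => \sum_l pseries (expcoef 0 i l) s m * A l j.
  apply/funext => m; under eq_bigr do rewrite /pseries /series/= mulr_suml.
  rewrite exchange_big /=; apply: eq_bigr => k _.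
  rewrite /= /expcoef add1n exprSr -[A ^+ k * A]/(A ^+ k *m A) mxE !mulr_suml.
  by apply: eq_bigr => l _; rewrite add0n; ring.
apply: cvg_big => [|l _]; first by move=> x; exact: add_continuous.
apply: cvgMr_tmp; have := @is_cvg_expcoef 0 i l s.
by rewrite -[E s]mul1mx -[1%:M *m _]/((A ^+ 0) *m E s) E_pseries.
Qed.

Lemma is_dmx_E s : is_dmx E s (A *m E s).
Proof.
move=> i j; have h1 := E_pseries s 1 i j; rewrite expr1 in h1; rewrite h1.
have hs : `|s| < `| `|s| + 1 | by rewrite (ger0_norm (_ : 0 <= `|s| + 1)) ?ltrDl// addr_ge0.
have := @pseries_snd_diffs R (expcoef 0 i j) (`|s| + 1) s.
rewrite !expcoef_diffs => /(_ (@is_cvg_expcoef _ _ _ _) (@is_cvg_expcoef _ _ _ _) (@is_cvg_expcoef _ _ _ _) hs) h.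
apply: (is_derive_cong h) => // t.
by rewrite -E_pseries expr0 mul1mx.
Qed.

Lemma E0 : E 0 = 1%:M.
Proof.
apply/matrixP => i j; rewrite -[E 0]mul1mx -[1%:M *m _]/((A ^+ 0) *m E 0) E_pseries.
apply: cvg_lim => //; apply: cvg_near_cst; near=> n.
have n0 : (0 < n)%N by near: n; exists 1%N.
rewrite /pseries /series/= -(prednK n0) big_nat_recl// expr0 mulr1 /expcoef/= fact0 divr1.
rewrite big1_seq ?addr0; first by rewrite addn0.
by move=> k _; rewrite expr0n mulr0.
Unshelve. all: by end_near. Qed.

(** Constancy of this product in [s] is the group law: its value at [s = 0] is [E t]. *)
Let prodE t (s : R) : is_dmx (fun s => E (- s) *m E (s + t)) s 0.
Proof.
have h1 := is_dmx_comp (is_dmx_E (- s)) (is_deriveNid s (1 : R)).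
have hg : is_derive s (1 : R) (fun s => s + t) 1.
  by apply: (is_derive_cong (is_deriveD (is_derive_id s (1 : R)) (is_derive_cst t s 1))); rewrite ?addr0.
have h2 := @is_dmx_comp _ _ _ E (fun s => s + t) s _ _ (is_dmx_E (s + t)) hg.
have := is_dmx_mul h1 h2; rewrite scaleN1r scale1r (E_comm (- s)) mulNmx -mulmxA.
by rewrite addNr.
Qed.

Lemma END s t : E (- s) *m E (s + t) = E t.
Proof. by rewrite (dmx0_cst (prodE t) s 0) oppr0 add0r E0 mul1mx. Qed.

Lemma EN s : E (- s) *m E s = 1%:M.
Proof. by have := END s 0; rewrite addr0 E0. Qed.

Lemma ED s t : E (s + t) = E s *m E t.
Proof.
have h := EN (- s); rewrite opprK in h.
transitivity (E s *m (E (- s) *m E (s + t))); first by rewrite mulmxA h mul1mx.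
by congr (_ *m _); exact: END.
Qed.

End matrix_exponential.

(** * Exponential decay and planar linear systems with rotation *)

Section exponential_decay.
Context {R : realType}.

Definition decays (f : R -> R) :=
  exists C c, [/\ 0 <= C, 0 < c & forall s, 0 <= s -> `|f s| <= C * expR (- c * s)].

Lemma decays_common (f g : R -> R) : decays f -> decays g ->
  exists C c, [/\ 0 <= C, 0 < c & forall s, 0 <= s ->
    `|f s| <= C * expR (- c * s) /\ `|g s| <= C * expR (- c * s)].
Proof.
move=> [C [c [C0 c0 h]]] [C' [c' [C'0 c'0 h']]].
exists (C + C'), (Num.min c c'); split; [by rewrite addr_ge0|by rewrite lt_min c0|].
move=> s s0; split.
- apply: le_trans (h s s0) _; apply: ler_pM; rewrite ?expR_ge0 ?lerDl//.
  by rewrite ler_expR !mulNr lerN2 ler_wpM2r// ge_min lexx.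
- apply: le_trans (h' s s0) _; apply: ler_pM; rewrite ?expR_ge0 ?lerDr//.
  by rewrite ler_expR !mulNr lerN2 ler_wpM2r// ge_min lexx orbT.
Qed.

Lemma decaysD (f g : R -> R) : decays f -> decays g -> decays (fun s => f s + g s).
Proof.
move=> hf hg; have [C [c [C0 c0 h]]] := decays_common hf hg.
exists (C + C), c; split; rewrite ?addr_ge0// => s s0.
by have [h1 h2] := h s s0; rewrite mulrDl (le_trans (ler_normD _ _))// lerD.
Qed.

Lemma decaysZ (a : R) (f : R -> R) : decays f -> decays (fun s => a * f s).
Proof.
move=> [C [c [C0 c0 h]]]; exists (`|a| * C), c; split; rewrite ?mulr_ge0// => s s0.
by rewrite normrM -mulrA ler_wpM2l// h.
Qed.

Lemma decays0 : decays (fun=> 0).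
Proof. by exists 0, 1; split => // s _; rewrite normr0 mul0r. Qed.

Lemma decays_sum (I : Type) (r : seq I) (f : I -> R -> R) :
  (forall i, decays (f i)) -> decays (fun s => \sum_(i <- r) f i s).
Proof.
move=> h; elim: r => [|i r IH].
  by under eq_fun do rewrite big_nil; exact: decays0.
by under eq_fun do rewrite big_cons; exact: decaysD.
Qed.

(** Energy estimate. In the derivative of [u^2 + v^2] the rotation terms in [w] cancel, and half of
    the damping [2 a] pays for the forcing through [2 x y <= - a x^2 + y^2 / (- a)]. *)
Lemma decay_ode (u v g1 g2 : R -> R) (a w : R) : a < 0 ->
  (forall s : R, is_derive s (1 : R) u (a * u s - w * v s + g1 s)) ->
  (forall s : R, is_derive s (1 : R) v (w * u s + a * v s + g2 s)) ->
  decays g1 -> decays g2 -> decays u /\ decays v.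
Proof.
move=> a0 du dv d1 d2; have [C [c [C0 c0 hg]]] := decays_common d1 d2.
(* [K expR (- 2 c s)] bounds the forcing left over by that inequality. The rate [k] is at most
   [- a], so that the damping outweighs it, and at most [c], so that [e = 2 c - k] is positive. *)
pose K := 2 * C ^+ 2 / - a; pose k := Num.min (- a) c.
have k0 : 0 < k by rewrite lt_min c0 oppr_gt0 a0.
have ka : k <= - a by rewrite /k ge_min lexx.
have kc : k <= c by rewrite /k ge_min lexx orbT.
have K0 : 0 <= K by rewrite divr_ge0 ?mulr_ge0 ?sqr_ge0// oppr_ge0 ltW.
pose e := 2 * c - k; have e0 : 0 < e by rewrite /e; lra.
pose N s := u s ^+ 2 + v s ^+ 2.
(* The second term has derivative [- K expR (- e s)], which compensates the forcing: [D] does not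
   increase. *)
pose D s := N s * expR (k * s) + K / e * expR (- e * s).
pose N' s := 2 * u s * (a * u s - w * v s + g1 s) + 2 * v s * (w * u s + a * v s + g2 s).
pose D' s := (N' s + k * N s) * expR (k * s) - K * expR (- e * s).
have dN (s : R) : is_derive s (1 : R) N (N' s).
  apply: (is_derive_cong (is_deriveD (is_deriveM (du s) (du s)) (is_deriveM (dv s) (dv s)))).
    by move=> t; rewrite /N !expr2.
  by rewrite /N' /GRing.scale/=; ring.
have dexp (b s : R) : is_derive s (1 : R) (fun s => expR (b * s)) (b * expR (b * s)).
  have hb : is_derive s (1 : R) (fun s => b * s) b.
    by apply: (is_derive_cong (is_deriveZ b (is_derive_id s (1 : R)))) => //; rewrite /GRing.scale/= mulr1.
  by apply: (is_derive_cong (is_derive_expR_comp hb)) => //; rewrite mulrC.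
have dD (s : R) : is_derive s (1 : R) D (D' s).
  apply: (is_derive_cong (is_deriveD (is_deriveM (dN s) (dexp k s)) (is_deriveZ (K / e) (dexp (- e) s)))) => //.
  rewrite /D' /GRing.scale/=; field; exact: lt0r_neq0.
have D'0 s : 0 <= s -> D' s <= 0.
  move=> s0; have [h1 h2] := hg s s0.
  have E1 : expR (- e * s) = expR (- c * s) ^+ 2 * expR (k * s).
    by rewrite expr2 -!expRD /e; congr expR; ring.
  rewrite /D' E1 mulrA -mulrBl mulr_le0_ge0 ?expR_ge0//.
  have na : 0 < - a by rewrite oppr_gt0.
  have sq (x : R) : `|x| <= C * expR (- c * s) -> x ^+ 2 <= C ^+ 2 * expR (- c * s) ^+ 2.
    by move=> hx; rewrite -exprMn -real_normK ?num_real// ler_sqr ?nnegrE// mulr_ge0 ?expR_ge0.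
  have s1 := sq _ h1; have s2 := sq _ h2.
  have am (x y : R) : 2 * x * y <= - a * x ^+ 2 + y ^+ 2 / - a.
    rewrite -subr_ge0 (_ : _ - _ = (- a * x - y) ^+ 2 / - a); last by field; rewrite lt_eqF.
    by rewrite divr_ge0 ?sqr_ge0// ltW.
  have a1 := am (u s) (g1 s); have a2 := am (v s) (g2 s).
  have hK : (g1 s ^+ 2 + g2 s ^+ 2) / - a <= K * expR (- c * s) ^+ 2.
    rewrite /K mulrAC ler_wpM2r ?invr_ge0 ?(ltW na)//; lra.
  have NN : (k + a) * N s <= 0 by rewrite mulr_le0_ge0 ?addr_ge0 ?sqr_ge0//; lra.
  rewrite mulrDl in hK; rewrite /N' /N in NN *; lra.
have D0 s : 0 <= s -> N s * expR (k * s) <= D 0.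
  move=> s0; apply: le_trans (_ : D s <= _); last first.
    by apply: (nincr_of_derive s0 dD) => x x0 _; exact: D'0.
  by rewrite /D lerDl mulr_ge0 ?expR_ge0// divr_ge0// ltW.
have D00 : 0 <= D 0 by apply: le_trans (D0 0 (lexx _)); rewrite mulr_ge0 ?expR_ge0 ?addr_ge0 ?sqr_ge0.
have fin (f : R -> R) : (forall s, f s ^+ 2 <= N s) -> decays f.
  move=> fN; exists (Num.sqrt (D 0)), (k / 2); split; [exact: sqrtr_ge0|by rewrite divr_gt0|].
  move=> s s0; rewrite -ler_sqr ?nnegrE ?mulr_ge0 ?expR_ge0 ?sqrtr_ge0//.
  rewrite real_normK ?num_real// exprMn sqr_sqrtr//.
  have -> : expR (- (k / 2) * s) ^+ 2 = (expR (k * s))^-1.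
    by rewrite expr2 -expRD -expRN; congr expR; field.
  by rewrite ler_pdivlMr ?expR_gt0// (le_trans _ (D0 s s0))// ler_wpM2r ?expR_ge0.
by split; apply: fin => s; rewrite /N ?lerDl ?lerDr sqr_ge0.
Qed.

(** Undoing the growth and the rotation turns [(x, y)] into [(f, g)], which has derivative 0 and so
    keeps its initial value [(1, 0)]. *)
Lemma rotation_ode (x y : R -> R) (a w : R) :
  (forall s : R, is_derive s (1 : R) x (a * x s - w * y s)) ->
  (forall s : R, is_derive s (1 : R) y (w * x s + a * y s)) ->
  x 0 = 1 -> y 0 = 0 ->
  forall s, x s = expR (a * s) * cos (w * s) /\ y s = expR (a * s) * sin (w * s).
Proof.
move=> dx dy x0 y0 s.
have dlin (b t : R) : is_derive t (1 : R) (fun s => b * s) b.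
  by apply: (is_derive_cong (is_deriveZ b (is_derive_id t (1 : R)))) => //; rewrite /GRing.scale/= mulr1.
have de (t : R) : is_derive t (1 : R) (fun s => expR (- a * s)) (expR (- a * t) * - a).
  exact: is_derive_expR_comp (dlin _ _).
have dc (t : R) : is_derive t (1 : R) (fun s => cos (w * s)) (- sin (w * t) * w).
  exact: (is_derive_cong (is_derive1_comp (is_derive_cos (w * t)) (dlin w t))).
have ds (t : R) : is_derive t (1 : R) (fun s => sin (w * s)) (cos (w * t) * w).
  exact: (is_derive_cong (is_derive1_comp (is_derive_sin (w * t)) (dlin w t))).
pose f s := expR (- a * s) * (cos (w * s) * x s + sin (w * s) * y s).
pose g s := expR (- a * s) * (cos (w * s) * y s - sin (w * s) * x s).
have df (t : R) : is_derive t (1 : R) f 0.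
  apply: (is_derive_cong (is_deriveM (de t) (is_deriveD (is_deriveM (dc t) (dx t)) (is_deriveM (ds t) (dy t))))) => //.
  by rewrite /GRing.scale/= !fctE; ring.
have dg (t : R) : is_derive t (1 : R) g 0.
  apply: (is_derive_cong (is_deriveM (de t) (is_deriveB (is_deriveM (dc t) (dy t)) (is_deriveM (ds t) (dx t))))) => //.
  by rewrite /GRing.scale/= !fctE; ring.
have f1 : f s = 1 by rewrite (derive0_cst df s 0) /f !mulr0 x0 y0 expR0 cos0 sin0; ring.
have g0 : g s = 0 by rewrite (derive0_cst dg s 0) /g !mulr0 x0 y0 expR0 cos0 sin0; ring.
have ee : expR (a * s) * expR (- a * s) = 1 by rewrite -expRD mulNr subrr expR0.
have cs := cos2Dsin2 (w * s).
split.
- have -> : x s = expR (a * s) * expR (- a * s) * ((cos (w * s) ^+ 2 + sin (w * s) ^+ 2) * x s).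
    by rewrite ee cs !mul1r.
  rewrite (_ : _ * _ = expR (a * s) * (cos (w * s) * f s - sin (w * s) * g s)); last by rewrite /f /g; ring.
  by rewrite f1 g0; ring.
- have -> : y s = expR (a * s) * expR (- a * s) * ((cos (w * s) ^+ 2 + sin (w * s) ^+ 2) * y s).
    by rewrite ee cs !mul1r.
  rewrite (_ : _ * _ = expR (a * s) * (sin (w * s) * f s + cos (w * s) * g s)); last by rewrite /f /g; ring.
  by rewrite f1 g0; ring.
Qed.

End exponential_decay.

(** * Eigenvalues with negative real parts make the exponential decay *)

Section stability.
Context {R : realType}.
Local Open Scope complex_scope.
Local Notation C := (R[i]).
Local Notation toC := (real_complex R).

Lemma Re_mul_real (z : C) (x : R) : complex.Re (z * toC x) = complex.Re z * x.
Proof. by case: z => a b /=; rewrite mulr0 subr0. Qed.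

Lemma Im_mul_real (z : C) (x : R) : complex.Im (z * toC x) = complex.Im z * x.
Proof. by case: z => a b /=; rewrite mulr0 add0r. Qed.

Lemma Re_sum (I : Type) (r : seq I) (f : I -> C) :
  complex.Re (\sum_(i <- r) f i) = \sum_(i <- r) complex.Re (f i).
Proof. by elim: r => [|i r IH]; rewrite ?big_nil// !big_cons -IH; case: (f i); case: (\sum_(i <- r) f i). Qed.

Lemma Im_sum (I : Type) (r : seq I) (f : I -> C) :
  complex.Im (\sum_(i <- r) f i) = \sum_(i <- r) complex.Im (f i).
Proof. by elim: r => [|i r IH]; rewrite ?big_nil// !big_cons -IH; case: (f i); case: (\sum_(i <- r) f i). Qed.

Definition reM m n (M : 'M[C]_(m, n)) : 'M[R]_(m, n) := map_mx (@complex.Re R) M.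
Definition imM m n (M : 'M[C]_(m, n)) : 'M[R]_(m, n) := map_mx (@complex.Im R) M.

Lemma reM_mul m n k (M : 'M[C]_(m, n)) (A : 'M[R]_(n, k)) :
  reM (M *m map_mx toC A) = reM M *m A.
Proof.
apply/matrixP => i j; rewrite !mxE Re_sum; apply: eq_bigr => l _.
by rewrite !mxE Re_mul_real.
Qed.

Lemma imM_mul m n k (M : 'M[C]_(m, n)) (A : 'M[R]_(n, k)) :
  imM (M *m map_mx toC A) = imM M *m A.
Proof.
apply/matrixP => i j; rewrite !mxE Im_sum; apply: eq_bigr => l _.
by rewrite !mxE Im_mul_real.
Qed.

Lemma reM_lin m n (z : C) (M N : 'M[C]_(m, n)) :
  reM (z *: M + N) = complex.Re z *: reM M - complex.Im z *: imM M + reM N.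
Proof. by apply/matrixP => i j; rewrite !mxE; case: z => a b; case: (M i j) => c e; case: (N i j). Qed.

Lemma imM_lin m n (z : C) (M N : 'M[C]_(m, n)) :
  imM (z *: M + N) = complex.Im z *: reM M + complex.Re z *: imM M + imM N.
Proof.
apply/matrixP => i j; rewrite !mxE; case: z => a b; case: (M i j) => c e; case: (N i j) => f g /=.
by rewrite [a * e + _]addrC [b * c]mulrC.
Qed.

Lemma is_dmx_lE p (A : 'M[R]_p) m (M : 'M[R]_(m, p)) s : is_dmx (fun s => M *m E A s) s (M *m A *m E A s).
Proof.
by have := is_dmx_mul (is_dmx_cst M s) (is_dmx_E A s); rewrite mul0mx add0r mulmxA.
Qed.

(** One root is peeled off at a time. With [N = M (A - z)], the entries of [M e^(As)] solve a scalar
    equation with coefficient [z] and forcing [N e^(As)], which decays by induction; [decay_ode]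
    treats real and imaginary parts together. *)
Lemma decay_factor p (A : 'M[R]_p.+1) (l : seq C) : (forall z, z \in l -> complex.Re z < 0) ->
  forall M : 'M[C]_p.+1, M * \prod_(z <- l) (map_mx toC A - z%:M) = 0 ->
  forall i j, decays (fun s => (reM M *m E A s) i j) /\ decays (fun s => (imM M *m E A s) i j).
Proof.
elim: l => [|z l IH] hl M.
  rewrite big_nil mulr1 => -> i j.
  have -> : reM (0 : 'M[C]_p.+1) = 0 by apply/matrixP => ? ?; rewrite !mxE.
  have -> : imM (0 : 'M[C]_p.+1) = 0 by apply/matrixP => ? ?; rewrite !mxE.
  by split; under eq_fun do rewrite mul0mx mxE; exact: decays0.
rewrite big_cons mulrA => h i j.
have hl' y : y \in l -> complex.Re y < 0 by move=> yl; apply: hl; rewrite inE yl orbT.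
have [d1 d2] := IH hl' _ h i j.
set N := M * _ in h d1 d2.
have MA : M *m map_mx toC A = z *: M + N.
  by rewrite /N mulrBr -[M * z%:M]/(M *m z%:M) mul_mx_scalar addrC subrK.
have reE : reM M *m A = complex.Re z *: reM M - complex.Im z *: imM M + reM N.
  by rewrite -reM_mul MA reM_lin.
have imE : imM M *m A = complex.Im z *: reM M + complex.Re z *: imM M + imM N.
  by rewrite -imM_mul MA imM_lin.
clearbody N; have z0 : complex.Re z < 0 by apply: hl; rewrite inE eqxx.
apply: (@decay_ode R (fun s => (reM M *m E A s) i j) (fun s => (imM M *m E A s) i j)
  (fun s => (reM N *m E A s) i j) (fun s => (imM N *m E A s) i j)
  (complex.Re z) (complex.Im z) z0 _ _ d1 d2).
- move=> s; apply: (is_derive_cong (is_dmx_lE A (reM M) s i j)) => //.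
  by rewrite reE !mulmxDl mulNmx -!scalemxAl !mxE.
- move=> s; apply: (is_derive_cong (is_dmx_lE A (imM M) s i j)) => //.
  by rewrite imE !mulmxDl -!scalemxAl !mxE.
Qed.

(** Cayley-Hamilton is the hypothesis of [decay_factor] for [M = 1] and the list of roots of the
    characteristic polynomial. *)
Lemma E_decays p (A : 'M[R]_p) : eigenvalues_Re_lt0 A ->
  forall i j, decays (fun s => E A s i j).
Proof.
case: p A => [|p] A hA i j; first by case: i.
have [r rE] := closed_field_poly_normal (char_poly (map_mx toC A)).
have /monicP lc := char_poly_monic (map_mx toC A).
rewrite lc scale1r in rE.
have hr z : z \in r -> complex.Re z < 0.
  by move=> zr; apply: hA; rewrite eigenvalue_root_char rE root_prod_XsubC.
have CH := Cayley_Hamilton (map_mx toC A).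
rewrite rE rmorph_prod /= in CH.
have CH' : 1 * \prod_(z <- r) (map_mx toC A - z%:M) = 0.
  rewrite mul1r -[RHS]CH; apply: eq_bigr => z _.
  by rewrite rmorphB/= horner_mx_X horner_mx_C.
have [d1 _] := decay_factor hr CH' i j.
have re1 : reM (1 : 'M[C]_p.+1) = 1%:M.
  by apply/matrixP => k l; rewrite !mxE; case: (k == l).
by rewrite re1 in d1; under eq_fun do rewrite -[E A _]mul1mx.
Qed.

End stability.

(** * Left eigenvectors of the companion matrix *)

Section companion_matrix.
Context {R : realType} (p : nat) (alpha : nat -> R).
Local Notation A := (companion p.+1 alpha).
Local Notation delta := (@delta_vec R p.+1).
Local Notation toC := (real_complex R).

Definition first_vec : 'cV[R]_p.+1 := \col_(i < p.+1) (i == 0 :> nat)%:R.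

(** This makes [- (alpha_0 / alpha_1) e_1] the equilibrium of the drift, which is the source of the
    stationary mean. *)
Lemma companion_first : A *m first_vec = alpha 1%N *: delta.
Proof.
apply/matrixP => i j; rewrite !mxE (bigD1 ord0)//= !mxE eqxx mulr1 big1 ?addr0.
  by case: eqP => _; rewrite ?mulr1// mulr0.
by move=> k k0; rewrite !mxE -[k == 0 :> nat]/(k == ord0) (negbTE k0) mulr0.
Qed.

Lemma mul_delta (v : 'rV[R]_p.+1) : (v *m delta) 0 0 = v 0 ord_max.
Proof.
rewrite mxE (bigD1 ord_max)//= !mxE eqxx mulr1 big1 ?addr0// => k km.
rewrite !mxE eqSS; case: eqP => [kp|_]; last by rewrite mulr0.
by case/eqP: km; exact: val_inj.
Qed.

(** Controllability: the noise enters through the last coordinate, and every left eigenvector has a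
    nonzero last entry, here scaled to 1. Its real and imaginary parts are kept as two real rows. *)
Lemma left_eigenvector (z : R[i]) : eigenvalue (map_mx toC A) z ->
  exists vr vi : 'rV[R]_p.+1,
  [/\ vr *m A = complex.Re z *: vr - complex.Im z *: vi,
      vi *m A = complex.Im z *: vr + complex.Re z *: vi,
      (vr *m delta) 0 0 = 1 & (vi *m delta) 0 0 = 0].
Proof.
move=> /eigenvalueP[v vA v0].
have vm : v 0 ord_max != 0.
  apply: contra v0 => /eqP vm; apply/eqP.
  (* When the last entry is 0, column [j] of [v A = z v] reads [v_(j-1) = z v_j], so vanishing
     descends from the last entry to the first. *)
  have hn n : (n <= p)%N -> v 0 (inord (p - n)) = 0.
    elim: n => [|n IH] np.
      by rewrite -[RHS]vm; congr (v 0 _); apply: val_inj; rewrite /= inordK ?subn0.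
    have h := IH (ltnW np).
    have : (v *m map_mx toC A) 0 (inord (p - n)) = 0 by rewrite vA mxE h mulr0.
    rewrite mxE (bigD1 (inord (p - n.+1)))//= big1 ?addr0.
      rewrite !mxE !inordK ?ltnS ?leq_subr//.
      rewrite (_ : ((p - n.+1).+1 == p.+1) = false); last by apply/eqP; lia.
      by rewrite (_ : (p - n == (p - n.+1).+1)%N) ?mulr1//; apply/eqP; lia.
    move=> k kn; rewrite !mxE inordK ?ltnS ?leq_subr//; case: eqP => [kp|kp].
      have -> : k = ord_max by apply: val_inj => /=; lia.
      by rewrite vm mul0r.
    case: eqP => [e|_]; last by rewrite mulr0.
    case/eqP: kn; apply: val_inj; rewrite /= inordK; lia.
  apply/matrixP => i j; rewrite mxE (ord1 i).
  have -> : j = inord (p - (p - j)).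
    by apply: val_inj; rewrite /= inordK; have := ltn_ord j; lia.
  by apply: hn; exact: leq_subr.
pose u := (v 0 ord_max)^-1 *: v.
have uA : u *m map_mx toC A = z *: u + 0 by rewrite -scalemxAl vA addr0 !scalerA mulrC.
have um : u 0 ord_max = 1 by rewrite mxE mulVf.
exists (reM u), (imM u); split.
- by rewrite -reM_mul uA reM_lin (_ : reM 0 = 0) ?addr0//; apply/matrixP => i j; rewrite !mxE.
- by rewrite -imM_mul uA imM_lin (_ : imM 0 = 0) ?addr0//; apply/matrixP => i j; rewrite !mxE.
- by rewrite mul_delta mxE um.
- by rewrite mul_delta mxE um.
Qed.

End companion_matrix.

(** * Integrals of powers near 0 and at infinity; bounds for the cosine *)

Section power_integrals.
Context {R : realType}.
Local Notation mu := (@lebesgue_measure R).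
Implicit Types (a c x y T : R).

(** The integrands of interest are singular at 0, while antiderivatives and substitutions are used
    on intervals away from 0; monotone convergence fills the gap. *)
Lemma cvg_itv0 (f : R -> R) (b : itv_bound R) c : 0 < c ->
  (BRight c <= b)%O -> measurable_fun setT f -> (forall y, 0 < y -> 0 <= f y) ->
  (\int[mu]_(y in [set` Interval (BLeft (c / n.+1%:R)%R) b]) (f y)%:E @[n --> \oo] -->
   \int[mu]_(y in [set` Interval (BRight (0%R : R)) b]) (f y)%:E)%E.
Proof.
move=> c0 cb mf f0.
have cn0 n : 0 < c / n.+1%:R by rewrite divr_gt0.
have -> : [set` Interval (BRight (0%R : R)) b] = \bigcup_n [set` Interval (BLeft (c / n.+1%:R)%R) b].
  apply/seteqP; split => y /=.
    rewrite in_itv/= => /andP[y0 yb].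
    near \oo => n; exists n => //=; rewrite in_itv/= yb andbT.
    rewrite ler_pdivrMr// -ler_pdivrMl// mulrC; apply: (@le_trans _ _ n%:R); last by rewrite ler_nat.
    by near: n; exact: nbhs_infty_ger.
  by move=> [n _] /=; rewrite !in_itv/= => /andP[h ->]; rewrite (lt_le_trans (cn0 n)).
apply: ge0_nondecreasing_set_cvg_integral.
- apply/nondecreasing_seqP => n; apply/subsetPset => y /=; rewrite !in_itv/= => /andP[h ->].
  by rewrite andbT; apply: le_trans h; rewrite ler_pM2l// lef_pV2 ?posrE// ler_nat.
- by move=> n; exact: measurable_itv.
- by move=> n; apply/measurable_EFinP; exact: measurable_funTS.
- by move=> n y /=; rewrite in_itv/= => /andP[h _]; rewrite lee_fin f0// (lt_le_trans (cn0 n)).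
Unshelve. all: by end_near. Qed.

Lemma cont_int (f : R -> R) (a b : R) : continuous f -> mu.-integrable `[a, b] (EFin \o f).
Proof.
move=> cf; apply: continuous_compact_integrable; first exact: segment_compact.
exact: continuous_subspaceT.
Qed.

Lemma is_derive_lin (b s : R) : is_derive s (1 : R) (fun s => b * s) b.
Proof.
apply: (is_derive_cong (is_deriveZ b (is_derive_id s (1 : R)))) => //.
by rewrite /GRing.scale/= mulr1.
Qed.

Lemma int_cst_itv (c u v : R) : u <= v -> \int[mu]_(z in `[u, v]) cst c z = (v - u) * c.
Proof.
move=> uv; rewrite (@FTC _ (fun z => c * z) (cst c) u v uv (is_derive_lin c)).
  by ring.
by move=> x; exact: cvg_cst.
Qed.

Lemma scale_integral (G : R -> R) x : 0 < x -> measurable_fun setT G ->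
  (forall y, 0 < y -> 0 <= G y) -> (forall y, 0 < y -> {for y, continuous G}) ->
  (\int[mu]_(y in `]0%R, +oo[) (G y)%:E = \int[mu]_(y in `]0%R, +oo[) (G (x * y) * x)%:E)%E.
Proof.
move=> x0 mG G0 cG.
have h1 := @cvg_itv0 G (BInfty _ false) x x0 isT mG G0.
have mG' : measurable_fun setT (fun y => G (x * y) * x).
  by apply: measurable_funM => //; apply: measurableT_comp => //; exact: measurable_funM.
have G'0 y : 0 < y -> 0 <= G (x * y) * x by move=> y0; rewrite mulr_ge0 ?G0 ?mulr_gt0// ltW.
have h2 := @cvg_itv0 _ (BInfty _ false) 1 ltr01 isT mG' G'0.
apply: (cvg_unique _ h1) => //; apply: cvg_trans h2; apply: near_eq_cvg; apply: nearW => n.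
have n0 : (0 : R) < 1 / n.+1%:R by rewrite divr_gt0.
have dF : ((fun y => x * y) : R -> R)^`()%classic = cst x.
  by apply/funext => y; rewrite derive1E; have [_ ->] := is_derive_lin x y.
have FE : x / n.+1%:R = (fun y => x * y) (1 / n.+1%:R) by rewrite mul1r.
rewrite FE (@increasing_ge0_integration_by_substitutiony _ (fun y => x * y) G (1 / n.+1%:R)).
- by apply: eq_integral => y _; rewrite dF.
- by move=> y z _ _ yz; rewrite ltr_pM2l.
- by rewrite dF => y _; exact: cvg_cst.
- by rewrite dF; exact: is_cvg_cst.
- by rewrite dF; exact: is_cvg_cst.
- split; first by move=> y _; have [] := is_derive_lin x y.
  by apply: cvg_at_right_filter; apply: (cont_of_derive (is_derive_lin x)).
- by apply: gt0_cvgMry => //.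
- apply: continuous_in_subspaceT => y; rewrite inE/= in_itv/= andbT => h.
  by apply: cG; apply: lt_le_trans h; rewrite mulr_gt0.
- move=> y; rewrite in_itv/= andbT => h; apply: G0; apply: lt_trans h; exact: mulr_gt0.
Qed.

Lemma measurable_powRl a : measurable_fun setT (fun y : R => y `^ a).
Proof. exact: measurable_powR. Qed.

Lemma powR_continuous a y : 0 < y -> {for y, continuous (fun y : R => y `^ a)}.
Proof.
move=> y0; apply: differentiable_continuous; apply/derivable1_diffP.
by have [] := is_derive1_powR a y0.
Qed.

Lemma FTC_pos (F f : R -> R) a b : 0 < a -> a <= b ->
  (forall x : R, 0 < x -> is_derive x (1 : R) F (f x)) ->
  (forall x, 0 < x -> {for x, continuous f}) ->
  (\int[mu]_(x in `[a, b]) (f x)%:E = (F b - F a)%:E)%E.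
Proof.
move=> a0 ab dF cf; have [<-|nab] := eqVneq a b.
  by rewrite set_itv1 integral_set1 subrr.
have {nab} ltab : a < b by rewrite lt_neqAle nab.
have cF x : 0 < x -> {for x, continuous F}.
  by move=> x0; apply: differentiable_continuous; apply/derivable1_diffP; have [] := dF x x0.
rewrite (@continuous_FTC2 _ f F) ?EFinB//.
- apply: continuous_in_subspaceT => x; rewrite inE/= in_itv/= => /andP[h _].
  by apply: cf; exact: lt_le_trans h.
- split.
  + by move=> x; rewrite in_itv/= => /andP[h _]; have [] := dF x (lt_trans a0 h).
  + by apply: cvg_at_right_filter; apply: cF.
  + by apply: cvg_at_left_filter; apply: cF; exact: lt_trans ltab.
- move=> x; rewrite in_itv/= => /andP[h _]; rewrite derive1E.
  by have [_ ->] := dF x (lt_trans a0 h).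
Qed.

Lemma cvg_powR_seq a T : 0 < a -> 0 < T ->
  (T / n.+1%:R) `^ a @[n --> \oo] --> (0 : R).
Proof.
move=> a0 T0; have h := powR_cvg0 a0.
have u0 : T / n.+1%:R @[n --> \oo] --> (0 : R).
  by rewrite -[X in _ --> X](mulr0 T); apply: cvgMl_tmp; exact: cvg_harmonic.
move/cvg_at_rightP : h => /(_ (fun n => T / n.+1%:R)); apply; split => // n.
by rewrite divr_gt0.
Qed.

Lemma is_derive_powR a x : 0 < a -> 0 < x ->
  is_derive x (1 : R) (fun y => y `^ a / a) (x `^ (a - 1)).
Proof.
move=> a0 x0; apply: (is_derive_cong (is_deriveZ a^-1 (is_derive1_powR a x0))).
  by move=> y; rewrite /GRing.scale/= mulrC.
by rewrite /GRing.scale/= mulrA mulVf ?mul1r// gt_eqF.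
Qed.

Lemma int_powR0 a T : 0 < a -> 0 < T ->
  (\int[mu]_(y in `]0%R, T]) (y `^ (a - 1))%:E = (T `^ a / a)%:E)%E.
Proof.
move=> a0 T0.
have h1 := @cvg_itv0 (fun y => y `^ (a - 1)) (BRight T) T T0 (lexx _) (measurable_powRl _) (fun y _ => powR_ge0 _ _).
have h2 : ((T `^ a / a - (T / n.+1%:R) `^ a / a)%R%:E @[n --> \oo] --> (T `^ a / a)%:E)%E.
  apply: cvg_EFin_seq; rewrite -[X in _ --> X]subr0; apply: cvgB; first exact: cvg_cst.
  by rewrite -[X in _ --> X](mul0r a^-1); apply: cvgMr_tmp; exact: cvg_powR_seq.
apply: (cvg_unique _ h1) => //; apply: cvg_trans h2; apply: near_eq_cvg; apply: nearW => n.
apply/esym; apply: (@FTC_pos (fun y => y `^ a / a) (fun y => y `^ (a - 1))).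
- by rewrite divr_gt0.
- by rewrite ler_pdivrMr//; apply: ler_peMr; [exact: ltW|rewrite ler1n].
- by move=> x x0; exact: is_derive_powR.
- by move=> x x0; exact: powR_continuous.
Qed.

Lemma int_powR_inf a : 0 < a ->
  (\int[mu]_(y in `[1%R, +oo[) (y `^ (- 1 - a))%:E = (a^-1)%:E)%E.
Proof.
move=> a0; pose F (y : R) := - a^-1 * y `^ (- a).
have dF (x : R) : 0 < x -> is_derive x (1 : R) F (x `^ (- 1 - a)).
  move=> x0; apply: (is_derive_cong (is_deriveZ (- a^-1) (is_derive1_powR (- a) x0))) => //.
  rewrite -[LHS]/(- a^-1 * (- a * x `^ (- a - 1))) mulrA mulrNN mulVf ?gt_eqF// mul1r.
  by congr (_ `^ _); ring.
rewrite (@ge0_continuous_FTC2y _ _ F _ 0).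
- by rewrite /F powR1 mulr1 -EFinB sub0r opprK.
- by move=> x _; exact: powR_ge0.
- apply: continuous_in_subspaceT => x; rewrite inE/= in_itv/= andbT => h.
  by apply: powR_continuous; exact: lt_le_trans h.
- rewrite -[X in _ --> X](mulr0 (- a^-1)); apply: cvgMl_tmp.
  apply/cvgr0Pnorm_le => e e0; near=> y.
  have y0 : 0 < y by near: y; exact: nbhs_pinfty_gt.
  rewrite ger0_norm ?powR_ge0// powRN -[leRHS]invrK lef_pV2 ?posrE ?invr_gt0 ?powR_gt0//.
  have -> : e^-1 = (e^-1 `^ a^-1) `^ a.
    by rewrite -powRrM mulVf ?powRr1 ?invr_ge0 ?gt_eqF// ltW.
  have ye : e^-1 `^ a^-1 <= y by near: y; exact: nbhs_pinfty_ge.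
  by apply: ge0_ler_powR; rewrite ?nnegrE ?(ltW a0) ?powR_ge0 ?(ltW y0).
- by move=> x x1; have [] := dF x (lt_trans ltr01 x1).
- apply: cvg_at_right_filter; apply: differentiable_continuous; apply/derivable1_diffP.
  by have [] := dF 1 ltr01.
- move=> x; rewrite in_itv/= andbT => x1; rewrite derive1E.
  by have [_ ->] := dF x (lt_trans ltr01 x1).
Unshelve. all: by end_near. Qed.

Lemma sin_le_id (z : R) : 0 <= z -> `|sin z| <= z.
Proof.
move=> z0; have := @mvt_le R sin cos 0 z 1 z0 (@is_derive_sin R) (fun x _ _ => cos_max x).
by rewrite sin0 !subr0 mul1r.
Qed.

Lemma one_sub_cos (z : R) : 1 - cos z = 2 * sin (z / 2) ^+ 2.
Proof.
have -> : cos z = cos (z / 2 + z / 2) by congr cos; field.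
by have := cos2Dsin2 (z / 2); rewrite cosD; lra.
Qed.

Lemma one_sub_cos_le (z : R) : 1 - cos z <= z ^+ 2 / 2.
Proof.
have H (x : R) : 0 <= x -> 1 - cos x <= x ^+ 2 / 2.
  move=> x0; rewrite one_sub_cos.
  have h : `|sin (x / 2)| <= x / 2 by apply: sin_le_id; rewrite divr_ge0.
  have : sin (x / 2) ^+ 2 <= (x / 2) ^+ 2.
    by rewrite -real_normK ?num_real// ler_sqr ?nnegrE ?divr_ge0.
  rewrite exprMn exprVn; lra.
have [z0|z0] := leP 0 z; first exact: H.
by rewrite -cosN -sqrrN; apply: H; rewrite oppr_ge0 ltW.
Qed.

Lemma one_sub_cos_ge0 (z : R) : 0 <= 1 - cos z.
Proof. by rewrite subr_ge0 cos_le1. Qed.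

End power_integrals.

(** * The spectral weight of fractional Brownian motion *)

Section spectral.
Context {R : realType}.
Local Notation mu := (@lebesgue_measure R).
Variable H : R.
Hypotheses (H0 : 0 < H) (H1 : H < 1).

(** Up to a constant, the spectral density of [B], whose increments correspond to differences of
    complex exponentials. *)
Definition wgt (y : R) : R := y `^ (- 1 - 2 * H).

Local Notation D := (`]0%R, +oo[%classic : set R).

Lemma measurable_one_sub_cos (x : R) : measurable_fun setT (fun y : R => (1 - cos (x * y)) * wgt y).
Proof.
apply: measurable_funM; last exact: measurable_powRl.
apply: measurable_funB => //; apply: measurableT_comp; last exact: measurable_funM.
apply: continuous_measurable_fun; exact: continuous_cos.
Qed.

(* Spectral representation of the variogram: [psi x = psi 1 * `|x| `^ (2 * H)].
   It bounds variances from below by integrating over a window of frequencies. *)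
Definition psi (x : R) : R := \int[mu]_(y in D) ((1 - cos (x * y)) * wgt y).

(** Near 0 the bound [1 - cos y <= y^2] leaves the exponent [1 - 2 H], above -1 because [H < 1];
    beyond 1 the bound 2 leaves [- 1 - 2 H], below -1 because [0 < H]. *)
Lemma psi1_lty : (\int[mu]_(y in D) ((1 - cos (1 * y)) * wgt y)%:E < +oo)%E.
Proof.
have -> : D = `]0%R, 1%R] `|` `]1%R, +oo[.
  apply/seteqP; split => y /=; rewrite !in_itv/= !andbT.
    by move=> y0; case: (leP y 1) => h; [left; rewrite y0|right].
  by case => [/andP[]//|]; exact: lt_trans.
rewrite ge0_integral_setU//=; last 3 first.
- by apply/measurable_EFinP; apply: measurable_funTS; exact: measurable_one_sub_cos.
- by move=> y _; rewrite lee_fin mulr_ge0 ?one_sub_cos_ge0 ?powR_ge0.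
- by apply/disj_setPLR => y /=; rewrite !in_itv/= andbT => /andP[_ h] /lt_geF; rewrite h.
apply: lte_add_pinfty.
- apply: le_lt_trans (_ : \int[mu]_(y in `]0%R, 1%R]) (y `^ ((2 - 2 * H) - 1))%:E < _)%E; last first.
    by rewrite int_powR0 ?ltry// subr_gt0 -[ltRHS]mulr1 ltr_pM2l.
  apply: ge0_le_integral => //.
  + by move=> y _; rewrite lee_fin mulr_ge0 ?one_sub_cos_ge0 ?powR_ge0.
  + by apply/measurable_EFinP; apply: measurable_funTS; exact: measurable_one_sub_cos.
  + by apply/measurable_EFinP; apply: measurable_funTS; exact: measurable_powRl.
  + move=> y /=; rewrite in_itv/= => /andP[y0 y1]; rewrite lee_fin mul1r.
    apply: (@le_trans _ _ (y ^+ 2 * wgt y)).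
      rewrite ler_wpM2r ?powR_ge0// (le_trans (one_sub_cos_le _))//.
      by have := sqr_ge0 y; lra.
    rewrite /wgt -powR_mulrn ?(ltW y0)// -powRD; last by rewrite (gt_eqF y0) implybT.
    by rewrite le_eqVlt; apply/orP; left; apply/eqP; congr (_ `^ _); ring.
- apply: le_lt_trans (_ : \int[mu]_(y in `[1%R, +oo[) (2 * y `^ (- 1 - 2 * H))%:E < _)%E; last first.
    under eq_integral do rewrite EFinM.
    rewrite ge0_integralZl_EFin//; last 2 first.
    + by move=> y _; rewrite lee_fin powR_ge0.
    + by apply/measurable_EFinP; apply: measurable_funTS; exact: measurable_powRl.
    by rewrite int_powR_inf ?mulr_gt0// -EFinM ltry.
  rewrite -integral_itv_obnd_cbnd; last by apply/measurable_EFinP; apply: measurable_funTS; apply: measurable_funM => //; exact: measurable_powRl.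
  apply: ge0_le_integral => //.
  + by move=> y _; rewrite lee_fin mulr_ge0 ?one_sub_cos_ge0 ?powR_ge0.
  + by apply/measurable_EFinP; apply: measurable_funTS; exact: measurable_one_sub_cos.
  + by apply/measurable_EFinP; apply: measurable_funTS; apply: measurable_funM => //; exact: measurable_powRl.
  + by move=> y _; rewrite lee_fin ler_wpM2r ?powR_ge0//; have := cos_geN1 (1 * y); lra.
Qed.

(** Substitution and homogeneity of the weight. The identity is in extended reals because the
    finiteness of the left side is deduced from it. *)
Lemma psi_scale_ereal (x : R) : 0 < x ->
  (\int[mu]_(y in D) ((1 - cos (x * y)) * wgt y)%:E =
   (x `^ (2 * H))%:E * \int[mu]_(y in D) ((1 - cos (1 * y)) * wgt y)%:E)%E.
Proof.
move=> x0.
rewrite (@scale_integral _ (fun y => (1 - cos (1 * y)) * wgt y) x) //; first last.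
- move=> y y0; apply: cvgM; last exact: powR_continuous.
  apply: cvgB; first exact: cvg_cst.
  by apply: continuous_comp; [apply: cvgM; [exact: cvg_cst|exact: cvg_id]|exact: continuous_cos].
- by move=> y _; rewrite mulr_ge0 ?one_sub_cos_ge0 ?powR_ge0.
- exact: measurable_one_sub_cos.
rewrite -ge0_integralZl_EFin ?powR_ge0//; last 2 first.
- by move=> y _; rewrite lee_fin !mulr_ge0 ?one_sub_cos_ge0 ?powR_ge0 ?ltW.
- apply/measurable_EFinP; apply: measurable_funTS; apply: measurable_funM => //.
  by apply: (measurableT_comp (measurable_one_sub_cos 1)); exact: measurable_funM.
apply: eq_integral => y; rewrite inE/= in_itv/= andbT => y0.
rewrite -EFinM; congr EFin; rewrite mul1r /wgt powRM ?ltW//.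
have e : x `^ (2 * H) * x `^ (- 1 - 2 * H) * x = 1.
  have xn : x != 0 by rewrite gt_eqF.
  rewrite -[X in _ * X]powRr1 ?ltW// -!powRD ?xn ?implybT//.
  by rewrite (_ : 2 * H + (- 1 - 2 * H) + 1 = 0) ?powRr0//; ring.
transitivity (x `^ (2 * H) * x `^ (- 1 - 2 * H) * x * ((1 - cos (x * y)) * y `^ (- 1 - 2 * H))); [by rewrite e mul1r | ring].
Qed.

Lemma int_one_sub_cos (x : R) :
  mu.-integrable D (EFin \o (fun y => (1 - cos (x * y)) * wgt y)) /\
  psi x = `|x| `^ (2 * H) * psi 1.
Proof.
have mf z : measurable_fun D (EFin \o (fun y => (1 - cos (z * y)) * wgt y)).
  by apply/measurable_EFinP; apply: measurable_funTS; exact: measurable_one_sub_cos.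
have main z : 0 < z -> mu.-integrable D (EFin \o (fun y => (1 - cos (z * y)) * wgt y)) /\
    psi z = `|z| `^ (2 * H) * psi 1.
  move=> z0; split.
    apply/integrableP; split; first exact: mf.
    under eq_integral.
      move=> y _; rewrite gee0_abs ?lee_fin ?mulr_ge0 ?one_sub_cos_ge0 ?powR_ge0//; over.
    rewrite [ltLHS]psi_scale_ereal// lte_mul_pinfty ?lee_fin ?powR_ge0//.
    exact: psi1_lty.
  rewrite /psi /Rintegral psi_scale_ereal// fineM// ?gtr0_norm//.
  rewrite ge0_fin_numE ?psi1_lty//.
  by apply: integral_ge0 => y _; rewrite lee_fin mulr_ge0 ?one_sub_cos_ge0 ?powR_ge0.
have [x0|x0|->] := ltgtP x 0; last 2 first.
- exact: main.
- have z (y : R) : (1 - cos (0 * y)) * wgt y = 0 by rewrite mul0r cos0 subrr mul0r.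
  split.
    by rewrite (_ : EFin \o _ = cst 0%E); [exact: integrable0 | apply/funext => y /=; rewrite z].
  rewrite /psi; under eq_Rintegral do rewrite z.
  by rewrite /Rintegral integral0 normr0 powR0 ?mul0r// mulf_neq0// gt_eqF.
have nx : 0 < - x by rewrite oppr_gt0.
have z (y : R) : (1 - cos (- x * y)) * wgt y = (1 - cos (x * y)) * wgt y by rewrite mulNr cosN.
have [h1 h2] := main _ nx; split.
  by apply: eq_integrable h1 => // y _ /=; rewrite z.
rewrite -normrN -h2 /psi; apply: eq_Rintegral => y _; by rewrite z.
Qed.

End spectral.

(** * Covariance of the increments of [B] and its spectral form *)

Section fbm.
Context {R : realType} {d : measure_display} {Omega : measurableType d}.
Variables (P : probability Omega R) (H : R) (B : R -> Omega -> R).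
Hypotheses (H0 : 0 < H) (H1 : H < 1) (B_fBM : fBM P H B).
Local Notation mu := (@lebesgue_measure R).

Lemma fBM_measurable t : 0 <= t -> measurable_fun setT (B t).
Proof.
move=> t0; case: B_fBM => jg _ _ _.
have [m _] := jg 1%N (fun=> t) (fun=> 1) (fun=> t0).
by apply: eq_measurable_fun m => w _; rewrite big_ord1 mul1r.
Qed.

Lemma fBM_L2 t : 0 <= t -> L2 P (B t).
Proof.
move=> t0; case: (B_fBM) => _ _ _ /(_ t t t0 t0) h.
apply: (proj1 (@L2_of_sqr _ _ _ P (B t) _ (fBM_measurable t0) _)).
rewrite (_ : (fun w => B t w ^+ 2) = (B t \* B t)%R) ?h; first exact: lexx.
by apply/funext => w; rewrite expr2.
Qed.

Lemma fBM_mean t : 0 <= t -> \int[P]_w B t w = 0.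
Proof.
by move=> t0; case: B_fBM => _ _ /(_ t t0) h _; move: h; rewrite unlock /Rintegral => ->.
Qed.

Definition rho (x : R) := `|x| `^ (2 * H).

Lemma rhoN x : rho (- x) = rho x. Proof. by rewrite /rho normrN. Qed.

Lemma rho0 : rho 0 = 0.
Proof. by rewrite /rho normr0 powR0// mulf_neq0// gt_eqF. Qed.

Lemma rho_sqr x : rho x = (`|x| `^ H) ^+ 2.
Proof. by rewrite /rho mulrC powRrM powR_mulrn ?powR_ge0. Qed.

Lemma fBM_ip t s : 0 <= t -> 0 <= s ->
  ip P (B t) (B s) = (rho t + rho s - rho (t - s)) / 2.
Proof.
move=> t0 s0; case: B_fBM => _ _ _ /(_ t s t0 s0) h.
by move: h; rewrite unlock /ip /Rintegral /= => ->; rewrite /= mulrC.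
Qed.

Lemma incr_L2 a b : 0 <= a -> 0 <= b -> L2 P (B a - B b).
Proof. by move=> a0 b0; apply: L2B; exact: fBM_L2. Qed.

Lemma incr_ip a b c e : 0 <= a -> 0 <= b -> 0 <= c -> 0 <= e ->
  ip P (B a - B b) (B c - B e) = (rho (a - e) + rho (b - c) - rho (a - c) - rho (b - e)) / 2.
Proof.
move=> a0 b0 c0 e0; have [La Lb Lc Le] := And4 (fBM_L2 a0) (fBM_L2 b0) (fBM_L2 c0) (fBM_L2 e0).
rewrite ipBl ?ipBr//; try exact: L2B.
by rewrite !fBM_ip//; field.
Qed.

Lemma incr_nm a b : 0 <= a -> 0 <= b -> nm P (B a - B b) = `|a - b| `^ H.
Proof.
move=> a0 b0; rewrite /nm incr_ip// !subrr rho0 !subr0 -(rhoN (b - a)) opprB.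
rewrite (_ : (_ + _) / 2 = rho (a - b)); last by field.
by rewrite rho_sqr sqrtr_sqr ger0_norm// powR_ge0.
Qed.

(* Reflection [t |-> T - t] preserves the covariance of the increments. *)
Lemma reversal (I : Type) (r : seq I) (a x y : I -> R) T :
  (forall i, 0 <= x i <= T) -> (forall i, 0 <= y i <= T) ->
  nm P (\sum_(i <- r) a i *: (B (x i) - B (y i))) =
  nm P (\sum_(i <- r) a i *: (B (T - y i) - B (T - x i))).
Proof.
move=> hx hy.
have Lx i : L2 P (B (x i) - B (y i)).
  by case/andP: (hx i) => ? _; case/andP: (hy i) => ? _; exact: incr_L2.
have Ly i : L2 P (B (T - y i) - B (T - x i)).
  by case/andP: (hx i) => _ ?; case/andP: (hy i) => _ ?; apply: incr_L2; rewrite subr_ge0.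
rewrite /nm !ip_suml; try by [move=> i; exact: L2Z | apply: L2_sum => i _; exact: L2Z].
congr Num.sqrt; apply: eq_bigr => i _.
rewrite !ip_sumr; try by [move=> j; exact: L2Z | exact: L2Z].
apply: eq_bigr => j _; rewrite !ipZl ?ipZr//; try exact: L2Z.
case/andP: (hx i) => xi0 xiT; case/andP: (hy i) => yi0 yiT.
case/andP: (hx j) => xj0 xjT; case/andP: (hy j) => yj0 yjT.
rewrite !incr_ip ?subr_ge0//; congr (_ * (_ * (_ / 2))).
have e u v : T - u - (T - v) = - (u - v) by ring.
by rewrite !e !rhoN; ring.
Qed.

Local Notation D := (`]0%R, +oo[%classic : set R).
Local Notation psi1 := (psi H 1).

(** For [f = cos] and [f = sin]: the real and imaginary parts of [e^(i x z) - e^(i y z)], the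
    spectral image of [B x - B y]. *)
Definition trig_incr (x y : R) (f : R -> R) (z : R) := f (x * z) - f (y * z).

Lemma rho_psi (x : R) : rho x * psi1 = psi H x.
Proof. by have [_ ->] := int_one_sub_cos H0 H1 x. Qed.

(** Subtraction formulas turn the product of spectral images into four terms [1 - cos], which match
    the four terms of [incr_ip]. The factor [psi H 1] stays on the left, so that it is never divided
    by. *)
Lemma spectral_incr (a b c e : R) : 0 <= a -> 0 <= b -> 0 <= c -> 0 <= e ->
  mu.-integrable D (EFin \o (fun z =>
    (trig_incr a b cos z * trig_incr c e cos z + trig_incr a b sin z * trig_incr c e sin z) * wgt H z)) /\
  2 * psi1 * ip P (B a - B b) (B c - B e) = \int[mu]_(z in D)
    ((trig_incr a b cos z * trig_incr c e cos z + trig_incr a b sin z * trig_incr c e sin z) * wgt H z).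
Proof.
move=> a0 b0 c0 e0; have mD : measurable (D : set (measurableTypeR R)) by exact: measurable_itv.
pose g x z := (1 - cos (x * z)) * wgt H z.
have gi x : mu.-integrable D (EFin \o g x) := (int_one_sub_cos H0 H1 x).1.
have ge x : \int[mu]_(z in D) g x z = rho x * psi1 := esym (rho_psi x).
have E1 z : (trig_incr a b cos z * trig_incr c e cos z + trig_incr a b sin z * trig_incr c e sin z) * wgt H z
   = g (a - e) z + g (b - c) z - g (a - c) z - g (b - e) z.
  by rewrite /g /trig_incr !mulrBl !cosB; ring.
have i1 : mu.-integrable D (EFin \o (fun z => g (a - e) z + g (b - c) z)).
  exact: (integrableD mD (gi _) (gi _)).
have i2 : mu.-integrable D (EFin \o (fun z => g (a - e) z + g (b - c) z - g (a - c) z)).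
  exact: (integrableB mD i1 (gi _)).
have i3 : mu.-integrable D (EFin \o (fun z => g (a - e) z + g (b - c) z - g (a - c) z - g (b - e) z)).
  exact: (integrableB mD i2 (gi _)).
split; first by apply: eq_integrable i3 => // z _ /=; rewrite E1.
under eq_Rintegral do rewrite E1.
rewrite (RintegralB mD i2 (gi _)) (RintegralB mD i1 (gi _)) (RintegralD mD (gi _) (gi _)).
rewrite !ge incr_ip//; set q := psi1; by field.
Qed.

Lemma Rint_sum (I : Type) (r : seq I) (f : I -> R -> R) (A : set (measurableTypeR R)) : measurable A ->
  (forall i, mu.-integrable A (EFin \o f i)) ->
  mu.-integrable A (EFin \o (fun z => \sum_(i <- r) f i z)) /\
  \int[mu]_(z in A) \sum_(i <- r) f i z = \sum_(i <- r) \int[mu]_(z in A) f i z.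
Proof.
move=> mA hf; elim: r => [|i r [IH1 IH2]].
  split; first by rewrite (_ : EFin \o _ = cst 0%E); [exact: integrable0|apply/funext => z /=; rewrite big_nil].
  by under eq_Rintegral do rewrite big_nil; rewrite big_nil /Rintegral integral0.
have e : (fun z => \sum_(j <- i :: r) f j z) = fun z => f i z + \sum_(j <- r) f j z.
  by apply/funext => z; rewrite big_cons.
rewrite e; split; first exact: (integrableD mA (hf i) IH1).
by rewrite RintegralD// IH2 big_cons.
Qed.

Lemma spectral_sum (n : nat) (a x y : 'I_n -> R) :
  (forall i, 0 <= x i) -> (forall i, 0 <= y i) ->
  let g f z := \sum_(i < n) a i * trig_incr (x i) (y i) f z in
  let S := \sum_(i < n) a i *: (B (x i) - B (y i)) in
  mu.-integrable D (EFin \o (fun z => (g cos z ^+ 2 + g sin z ^+ 2) * wgt H z)) /\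
  2 * psi1 * ip P S S = \int[mu]_(z in D) ((g cos z ^+ 2 + g sin z ^+ 2) * wgt H z).
Proof.
move=> x0 y0 g S; have mD : measurable (D : set (measurableTypeR R)) by exact: measurable_itv.
pose h i j z := a i * (a j * ((trig_incr (x i) (y i) cos z * trig_incr (x j) (y j) cos z +
   trig_incr (x i) (y i) sin z * trig_incr (x j) (y j) sin z) * wgt H z)).
have sp i j := spectral_incr (x0 i) (y0 i) (x0 j) (y0 j).
have E1 z : (g cos z ^+ 2 + g sin z ^+ 2) * wgt H z = \sum_(i < n) \sum_(j < n) h i j z.
  rewrite !expr2 /g 2!mulr_suml -big_split/= mulr_suml; apply: eq_bigr => i _.
  rewrite !mulr_sumr -big_split/= mulr_suml; apply: eq_bigr => j _.
  by rewrite /h; ring.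
have ih i j : mu.-integrable D (EFin \o h i j) /\
    \int[mu]_(z in D) h i j z = 2 * psi1 * (a i * (a j * ip P (B (x i) - B (y i)) (B (x j) - B (y j)))).
  have i1 := integrableZl mD (a j) (sp i j).1; have i2 := integrableZl mD (a i) i1.
  split; first exact: i2.
  rewrite /h RintegralZl//; rewrite RintegralZl//; last exact: (sp i j).1.
  by rewrite -(sp i j).2; ring.
have [k1 k2] := @Rint_sum _ (index_enum 'I_n) (fun i z => \sum_(j < n) h i j z) D mD
  (fun i => (@Rint_sum _ (index_enum 'I_n) (h i) D mD (fun j => (ih i j).1)).1).
have L i : L2 P (B (x i) - B (y i)) by exact: incr_L2.
split; first by apply: eq_integrable k1 => // z _ /=; rewrite E1.
under eq_Rintegral do rewrite E1.
rewrite k2 /S ip_suml; [|by move=> i; exact: L2Z|by apply: L2_sum => i _; exact: L2Z].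
rewrite mulr_sumr; apply: eq_bigr => i _.
rewrite (@Rint_sum _ (index_enum 'I_n) (h i) D mD (fun j => (ih i j).1)).2.
rewrite ip_sumr; [|by move=> j; exact: L2Z|exact: L2Z].
rewrite mulr_sumr; apply: eq_bigr => j _.
by rewrite (ih i j).2 ipZl ?ipZr//; exact: L2Z.
Qed.

(** [a] and [b] are real and imaginary parts of complex weights. Of the four squares in the two
    spectral integrals two are kept, with [p1^2 + p2^2 >= (p1 - p2)^2 / 2]; on the window [[u, v]]
    the decreasing weight is at least [wgt H v]. *)
Lemma spectral_lower (n : nat) (a b x y : 'I_n -> R) (u v m : R) :
  (forall i, 0 <= x i) -> (forall i, 0 <= y i) -> 0 < u -> u <= v -> 0 <= m ->
  (forall z, u <= z <= v -> m <= \sum_(i < n) (a i * trig_incr (x i) (y i) sin z -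
     b i * trig_incr (x i) (y i) cos z)) ->
  (v - u) * (m ^+ 2 * wgt H v) <= 4 * psi1 * (ip P (\sum_(i < n) a i *: (B (x i) - B (y i))) (\sum_(i < n) a i *: (B (x i) - B (y i)))
    + ip P (\sum_(i < n) b i *: (B (x i) - B (y i))) (\sum_(i < n) b i *: (B (x i) - B (y i)))).
Proof.
move=> x0 y0 u0 uv m0 hm; pose S a := \sum_(i < n) a i *: (B (x i) - B (y i)).
rewrite -!/(S _); have mD : measurable (D : set (measurableTypeR R)) by exact: measurable_itv.
pose g a f z : R := \sum_(i < n) a i * trig_incr (x i) (y i) f z.
pose ga := g a; pose gb := g b.
have [ia ea] : mu.-integrable D (EFin \o (fun z => (ga cos z ^+ 2 + ga sin z ^+ 2) * wgt H z)) /\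
  2 * psi1 * ip P (S a) (S a) = \int[mu]_(z in D) ((ga cos z ^+ 2 + ga sin z ^+ 2) * wgt H z).
  exact (spectral_sum a x0 y0).
have [ib eb] : mu.-integrable D (EFin \o (fun z => (gb cos z ^+ 2 + gb sin z ^+ 2) * wgt H z)) /\
  2 * psi1 * ip P (S b) (S b) = \int[mu]_(z in D) ((gb cos z ^+ 2 + gb sin z ^+ 2) * wgt H z).
  exact (spectral_sum b x0 y0).
have -> : 4 * psi1 * (ip P (S a) (S a) + ip P (S b) (S b)) =
    2 * (2 * psi1 * ip P (S a) (S a) + 2 * psi1 * ip P (S b) (S b)) by ring.
rewrite {}ea {}eb -RintegralD//.
set F := fun z : R => _ + _.
have iF : mu.-integrable D (EFin \o F) by exact: (integrableD mD ia ib).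
have F0 z : 0 <= F z.
  by rewrite addr_ge0// mulr_ge0 ?powR_ge0// addr_ge0 ?sqr_ge0.
have sub : `[u, v] `<=` D.
  by move=> z /=; rewrite !in_itv/= andbT => /andP[h _]; exact: lt_le_trans h.
have mI : measurable (`[u, v]%classic : set (measurableTypeR R)) by exact: measurable_itv.
have iFI := integrableS mD mI sub iF.
have step1 : \int[mu]_(z in `[u, v]) F z <= \int[mu]_(z in D) F z.
  rewrite /Rintegral fine_le//; [exact: integrable_fin_num|exact: integrable_fin_num|].
  apply: ge0_subset_integral => //; first by have /integrableP[] := iF.
  by move=> z _; rewrite lee_fin.
have Fl z : u <= z <= v -> m ^+ 2 * wgt H v / 2 <= F z.
  move=> uz; have hz := hm z uz; case/andP: uz => uz zv.
  have wz : wgt H v <= wgt H z.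
    have wE t : wgt H t = (t `^ (1 + 2 * H))^-1 by rewrite -powRN opprD.
    have z0 : 0 < z by exact: lt_le_trans uz.
    rewrite !wE lef_pV2 ?posrE ?powR_gt0 ?(lt_le_trans z0)//.
    apply: ge0_ler_powR => //; rewrite ?nnegrE ?(ltW z0) ?(ltW (lt_le_trans z0 zv))//.
    by rewrite addr_ge0// mulr_ge0// ltW.
  have w0 : 0 <= wgt H v by exact: powR_ge0.
  have s1 : m <= ga sin z - gb cos z by rewrite (le_trans hz)// sumrB.
  have s2 : m ^+ 2 / 2 <= ga sin z ^+ 2 + gb cos z ^+ 2.
    have := sqr_ge0 (ga sin z + gb cos z); set p1 := ga sin z in s1 *; set p2 := gb cos z in s1 *; nra.
  apply: le_trans (_ : (ga sin z ^+ 2 + gb cos z ^+ 2) * wgt H z <= _).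
    by rewrite mulrAC; apply: ler_pM => //; rewrite divr_ge0// sqr_ge0.
  rewrite /F -mulrDl ler_wpM2r ?powR_ge0//.
  by have := sqr_ge0 (ga cos z); have := sqr_ge0 (gb sin z); lra.
have step2 : (v - u) * (m ^+ 2 * wgt H v / 2) <= \int[mu]_(z in `[u, v]) F z.
  have -> : (v - u) * (m ^+ 2 * wgt H v / 2) = \int[mu]_(z in `[u, v]) cst (m ^+ 2 * wgt H v / 2) z.
    by rewrite int_cst_itv.
  apply: le_Rintegral => //; first by apply: cont_int => z; exact: cvg_cst.
rewrite (_ : (v - u) * (m ^+ 2 * wgt H v) = 2 * ((v - u) * (m ^+ 2 * wgt H v / 2))); last by field.
by rewrite ler_pM2l// (le_trans step2).
Qed.

End fbm.

(** * The mean-square closure of the linear combinations of [B] *)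

Section gaussian_space.
Context {R : realType} {d : measure_display} {Omega : measurableType d}.
Variables (P : probability Omega R) (H : R) (B : R -> Omega -> R).
Hypotheses (H0 : 0 < H) (H1 : H < 1) (B_fBM : fBM P H B).
Implicit Types (l : seq (R * R)) (X Y : Omega -> R).

Definition lincomb l : Omega -> R := \sum_(x <- l) x.1 *: B x.2.

Definition tpos l := all (fun x : R * R => 0 <= x.2) l.

Lemma lincomb_cat l l' : lincomb (l ++ l') = lincomb l + lincomb l'.
Proof. by rewrite /lincomb big_cat. Qed.

Lemma lincomb_scale c l : lincomb [seq (c * x.1, x.2) | x <- l] = c *: lincomb l.
Proof.
rewrite /lincomb big_map scaler_sumr; apply: eq_bigr => x _.
by rewrite scalerA.
Qed.

Lemma tpos_scale c l : tpos [seq (c * x.1, x.2) | x <- l] = tpos l.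
Proof. by rewrite /tpos all_map. Qed.

Lemma lincomb_L2 l : tpos l -> L2 P (lincomb l).
Proof.
move=> /allP lpos; rewrite /lincomb big_seq; apply: L2_sum => x xl.
by apply: L2Z; apply: (fBM_L2 B_fBM); exact: lpos.
Qed.

Lemma lincomb_mean l : tpos l -> \int[P]_w lincomb l w = 0.
Proof.
elim: l => [|x l IH] /=.
  by move=> _; rewrite /lincomb big_nil /Rintegral integral0.
move=> /andP[x0 lpos]; rewrite /lincomb big_cons.
have Lx := fBM_L2 B_fBM x0.
transitivity (\int[P]_w (x.1 * B x.2 w + lincomb l w)); first by [].
rewrite RintegralD//; [|exact: (L2_int (L2Z x.1 Lx))|exact: (L2_int (lincomb_L2 lpos))].
rewrite IH// addr0 RintegralZl//; last exact: L2_int.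
by rewrite (fBM_mean B_fBM)// mulr0.
Qed.

Lemma lincomb_gauss l : tpos l -> gaussian_rv P (lincomb l).
Proof.
move=> /allP lpos; case: (B_fBM) => jg _ _ _.
have := jg (size l) (fun k => (nth (0, 0) l k).2) (fun k => (nth (0, 0) l k).1).
have tp (k : 'I_(size l)) : [set t : R | 0 <= t] (nth (0, 0) l k).2.
  by apply: lpos; exact: mem_nth.
move=> /(_ tp); congr gaussian_rv; apply/funext => w.
rewrite /lincomb (big_nth (0, 0)) big_mkord fct_sumE.
by apply: eq_bigr => k _.
Qed.

(* The Gaussian space of [B]. *)
Definition inB X := L2 P X /\
  forall e, 0 < e -> exists2 l, tpos l & nm P (X - lincomb l) <= e.

Lemma inB_L2 X : inB X -> L2 P X. Proof. by case. Qed.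

Lemma inB_lincomb l : tpos l -> inB (lincomb l).
Proof.
move=> lp; split; first exact: lincomb_L2.
by move=> e e0; exists l => //; rewrite subrr nm0 ltW.
Qed.

Lemma inB_B t : 0 <= t -> inB (B t).
Proof.
move=> t0; have := @inB_lincomb [:: (1, t)]; rewrite /tpos /= t0 => /(_ isT).
by rewrite /lincomb big_seq1 scale1r.
Qed.

Lemma inB_lim X : L2 P X -> (forall e, 0 < e -> exists2 Y, inB Y & nm P (X - Y) <= e) ->
  inB X.
Proof.
move=> hX h; split => // e e0; have e20 : 0 < e / 2 by rewrite divr_gt0.
have [Y [hY /(_ _ e20)[l lp hl]] hXY] := h _ e20.
exists l => //; apply: le_trans (nm_dist hX hY (lincomb_L2 lp)) _; lra.
Qed.

Lemma inBD X Y : inB X -> inB Y -> inB (X + Y).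
Proof.
move=> [hX aX] [hY aY]; split; first exact: L2D.
move=> e e0; have e20 : 0 < e / 2 by rewrite divr_gt0.
have [l lp hl] := aX _ e20; have [l' lp' hl'] := aY _ e20.
exists (l ++ l'); first by rewrite /tpos all_cat; apply/andP.
rewrite lincomb_cat opprD addrACA; apply: le_trans (nmD _ _) _.
- by apply: L2B => //; exact: lincomb_L2.
- by apply: L2B => //; exact: lincomb_L2.
- lra.
Qed.

Lemma inBZ (c : R) X : inB X -> inB (c *: X).
Proof.
move=> [hX aX]; split; first exact: L2Z.
move=> e e0; have c1 : 0 < `|c| + 1 by rewrite ltr_wpDl.
have [l lp hl] := aX (e / (`|c| + 1)) (divr_gt0 e0 c1).
exists [seq (c * x.1, x.2) | x <- l]; first by rewrite tpos_scale.
rewrite lincomb_scale -scalerBr nmZ; last by apply: L2B => //; exact: lincomb_L2.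
apply: le_trans (ler_wpM2l (normr_ge0 c) hl) _.
by rewrite mulrCA ler_piMr ?(ltW e0)// ler_pdivrMr// mul1r lerDl.
Qed.

Lemma inBN X : inB X -> inB (- X).
Proof. by rewrite -scaleN1r; exact: inBZ. Qed.

Lemma inBB X Y : inB X -> inB Y -> inB (X - Y).
Proof. by move=> hX hY; apply: inBD => //; exact: inBN. Qed.

Lemma inB0 : inB 0.
Proof. by have := @inB_lincomb [::] isT; rewrite /lincomb big_nil. Qed.

Lemma inB_sum (I : Type) (r : seq I) (X : I -> Omega -> R) :
  (forall i, inB (X i)) -> inB (\sum_(i <- r) X i).
Proof. by move=> h; apply: (big_ind inB) => //; [exact: inB0|exact: inBD]. Qed.

Lemma inB_mean X : inB X -> \int[P]_w X w = 0.
Proof.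
move=> [hX aX]; apply/eqP; rewrite -normr_le0; apply/ler_addgt0Pr => e e0; rewrite add0r.
have [l lp hl] := aX _ e0; have hl2 := lincomb_L2 lp.
have -> : \int[P]_w X w = \int[P]_w (X - lincomb l) w.
  transitivity (\int[P]_w (X w - lincomb l w)); last by [].
  by rewrite RintegralB//; [rewrite lincomb_mean// subr0|exact: L2_int|exact: L2_int].
have hD := L2B hX hl2.
apply: le_trans (le_normr_Rintegral measurableT (L2_int hD)) _.
exact: le_trans (abs_int_le_nm hD).2 hl.
Qed.

(** Rescaling an approximant to the exact norm of [X] gives all approximants one common normal law,
    which is then inherited by [X]. *)
Lemma inB_approx X e : inB X -> 0 < nm P X -> 0 < e ->
  exists l, [/\ tpos l, nm P (lincomb l) = nm P X & nm P (X - lincomb l) <= e].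
Proof.
move=> [hX aX] s0 e0; set s := nm P X in s0 *.
(* Half of [e] goes to the approximation and half to the rescaling; the bound [s / 2] keeps the norm
   of [Z] positive. *)
have m0 : 0 < Num.min (e / 2) (s / 2) by rewrite lt_min !divr_gt0.
have [l lp] := aX _ m0; rewrite le_min => /andP[l1 l2].
have hl := lincomb_L2 lp; set Z := lincomb l in l1 l2 hl.
have h := nm_sub hX hl; rewrite -/s in h.
have Z0 : 0 < nm P Z.
  by have := ler_norm (s - nm P Z); lra.
exists [seq (s / nm P Z * x.1, x.2) | x <- l]; split.
- by rewrite tpos_scale.
- rewrite lincomb_scale nmZ// ger0_norm; last by rewrite divr_ge0// ltW.
  by rewrite divfK// gt_eqF.
- rewrite lincomb_scale -/Z; apply: le_trans (nm_dist hX hl _) _; first exact: L2Z.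
  have -> : Z - (s / nm P Z) *: Z = (1 - s / nm P Z) *: Z by rewrite scalerBl scale1r.
  rewrite nmZ// -[X in _ * X](ger0_norm (ltW Z0)) -normrM mulrBl mul1r divfK ?gt_eqF//.
  rewrite distrC; lra.
Qed.

Lemma law_close X Y : L2 P X -> measurable_fun setT Y ->
  (forall e, 0 < e -> exists X', [/\ L2 P X', nm P (X - X') <= e &
     forall E : set R, measurable E -> P (X' @^-1` E) = P (Y @^-1` E)]) ->
  forall E : set R, measurable E -> P (X @^-1` E) = P (Y @^-1` E).
Proof.
move=> hX mY h; apply: law_eq => //; first exact: L2_measurable hX.
move=> g hg; apply/eqP; rewrite -subr_eq0 -normr_le0; apply/ler_addgt0Pr => e e0; rewrite add0r.
have [K K0 hK] := blip_dist P hg.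
have K1 : 0 < K + 1 by rewrite ltr_wpDl.
have [X' [hX' XX' sl]] := h (e / (K + 1)) (divr_gt0 e0 K1).
have mX' := L2_measurable hX'.
have <- : \int[P]_w g (X' w) = \int[P]_w g (Y w).
  apply: transfer_int => //; last 2 first.
  - exact: blip_int hg mX'.
  - exact: blip_int hg mY.
  exact: continuous_measurable_fun (blip_continuous hg).
apply: le_trans (hK X X' (L2B hX hX') (L2_measurable hX) mX') _.
apply: le_trans (ler_wpM2l K0 XX') _.
by rewrite mulrCA ler_piMr ?(ltW e0)// ler_pdivrMr// mul1r lerDl.
Qed.

(** The combinations from [inB_approx] share the normal law with parameter [nm P X]; [law_close]
    passes a law shared by arbitrarily close variables to [X]. Norm 0 forces the point mass. *)
Lemma inB_law X : inB X -> forall E : set R, measurable E ->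
  P (X @^-1` E) = if nm P X == 0 then \d_(0 : R) E else normal_prob 0 (nm P X) E.
Proof.
move=> hX E mE; have LX := inB_L2 hX.
have [s0|s0] := eqVneq (nm P X) 0.
  rewrite (@law_close X (cst 0) LX) //.
  - by rewrite preimage_cst diracE; case: ifPn => _; rewrite ?probability_setT ?measure0.
  - move=> e e0; exists 0; split => //; first exact: L2_0.
    by rewrite subr0 s0 ltW.
have sp : 0 < nm P X by rewrite lt_neqAle eq_sym s0 nm_ge0.
have lawl l : tpos l -> nm P (lincomb l) = nm P X -> forall E : set R, measurable E ->
    P (lincomb l @^-1` E) = normal_prob 0 (nm P X) E.
  move=> lp le F mF; rewrite (gaussian_center (lincomb_L2 lp) (lincomb_gauss lp) (lincomb_mean lp))//.
  by rewrite le (negbTE s0).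
have [l0 [l0p l0e _]] := inB_approx hX sp ltr01.
rewrite -(lawl _ l0p l0e)//; apply: law_close => //.
  exact: L2_measurable (lincomb_L2 l0p).
move=> e e0; have [l [lp le hl]] := inB_approx hX sp e0.
exists (lincomb l); split => //; first exact: lincomb_L2.
by move=> F mF; rewrite (lawl _ lp le)// (lawl _ l0p l0e).
Qed.

Lemma inB_same_law X Y : inB X -> inB Y -> nm P X = nm P Y ->
  forall E : set R, measurable E -> P (X @^-1` E) = P (Y @^-1` E).
Proof. by move=> hX hY e E mE; rewrite (inB_law hX mE) (inB_law hY mE) e. Qed.

Lemma inB_gaussian X : inB X -> gaussian_rv P X.
Proof.
move=> hX; split; first exact: L2_measurable (inB_L2 hX).
by exists 0, (nm P X); split => [|E mE]; [exact: nm_ge0|exact: inB_law].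
Qed.

Lemma inB_same_int (g : R -> R) (M : R) X Y : inB X -> inB Y -> nm P X = nm P Y ->
  measurable_fun setT g -> (forall x, `|g x| <= M) ->
  \int[P]_w g (X w) = \int[P]_w g (Y w).
Proof.
move=> hX hY e mg gM.
have mX := L2_measurable (inB_L2 hX); have mY := L2_measurable (inB_L2 hY).
apply: transfer_int => //; first exact: inB_same_law.
- apply: (@bounded_int _ _ _ P (g \o X) M) => [|w]; [exact: (measurableT_comp mg mX)|exact: gM].
- apply: (@bounded_int _ _ _ P (g \o Y) M) => [|w]; [exact: (measurableT_comp mg mY)|exact: gM].
Qed.

End gaussian_space.

(** * Dyadic Riemann sums and their local expansion *)

Section sewing.
Context {R : realType} {d : measure_display} {Omega : measurableType d}.
Variables (P : probability Omega R) (H : R) (B : R -> Omega -> R).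
Hypotheses (H0 : 0 < H) (H1 : H < 1) (B_fBM : fBM P H B).

Lemma abel_sum (V : lmodType R) (G : nat -> R) (b : nat -> V) K : b 0%N = 0 ->
  \sum_(k < K.+1) G k *: (b k.+1 - b k) =
  G K *: b K.+1 - \sum_(k < K) (G k.+1 - G k) *: b k.+1.
Proof.
move=> b0; elim: K => [|K IH].
  by rewrite big_ord1 big_ord0 b0 !subr0.
rewrite big_ord_recr/= IH [in RHS]big_ord_recr/=.
rewrite scalerBr scalerBl opprD opprB.
set S := \sum_(i < K) _.
by rewrite -!addrA (addrCA (- S)) (addrCA (G K *: _)) (addrCA (G K *: _) (- S)).
Qed.

(** Summation by parts charges the variation of [G] and the size of the partial sums. Adding the
    norms of the increments would cost about [n^(1 - H)] for [n] cells, which diverges under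
    refinement. *)
Lemma abel_bound (G : nat -> R) (b : nat -> Omega -> R) K (beta g0 V : R) : b 0%N = 0 ->
  (forall k, L2 P (b k)) -> (forall k, nm P (b k) <= beta) ->
  `|G K| <= g0 -> \sum_(k < K) `|G k.+1 - G k| <= V -> 
  nm P (\sum_(k < K.+1) G k *: (b k.+1 - b k)) <= (g0 + V) * beta.
Proof.
move=> b0 hb nb hG hV; have be0 : 0 <= beta := le_trans (nm_ge0 _ _) (nb 0%N).
rewrite abel_sum//; apply: le_trans (nmB _ _) _.
- exact: L2Z.
- by apply: L2_sum => k _; exact: L2Z.
rewrite mulrDl; apply: lerD.
  by rewrite nmZ//; apply: ler_pM => //; exact: nm_ge0.
apply: le_trans (nm_sum _ _) _; first by move=> k; exact: L2Z.
apply: le_trans (_ : \sum_(k < K) `|G k.+1 - G k| * beta <= _).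
  by apply: ler_sum => k _; rewrite nmZ// ler_wpM2l.
by rewrite -mulr_suml ler_wpM2r.
Qed.

Definition lip (f : R -> R) (L a b : R) :=
  0 <= L /\ forall x y, a <= x <= b -> a <= y <= b -> `|f x - f y| <= L * `|x - y|.

Lemma lipS f L a b a' b' : a <= a' -> b' <= b -> lip f L a b -> lip f L a' b'.
Proof.
move=> aa bb [L0 h]; split => // x y /andP[x1 x2] /andP[y1 y2]; apply: h.
- by rewrite (le_trans aa)// (le_trans x2).
- by rewrite (le_trans aa)// (le_trans y2).
Qed.

Definition grid n k : R := k%:R / 2 ^+ n.

Lemma grid_ge0 n k : 0 <= grid n k. Proof. by rewrite divr_ge0// exprn_ge0. Qed.

Lemma grid_le n k l : (k <= l)%N -> grid n k <= grid n l.
Proof. by move=> kl; rewrite ler_wpM2r ?invr_ge0 ?exprn_ge0// ler_nat. Qed.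

Lemma gridS n k : grid n k.+1 - grid n k = (2 ^+ n)^-1.
Proof. by rewrite /grid -mulrBl -natrB// subSnn mul1r. Qed.

Lemma grid_top n N : grid n (N * 2 ^ n) = N%:R.
Proof. by rewrite /grid natrM natrX mulfK// expf_neq0. Qed.

Lemma grid_double n k : grid n.+1 k.*2 = grid n k.
Proof. by rewrite /grid -muln2 natrM exprS invfM mulrA mulfK. Qed.

(** Left-point sums on the dyadic grid of [[0, N]]; [min] freezes [B] at [x], so that one grid
    serves every upper end [x <= N]. *)
Definition Jn (f : R -> R) n N x : Omega -> R :=
  \sum_(k < N * 2 ^ n) f (grid n k) *:
    (B (Num.min x (grid n k.+1)) - B (Num.min x (grid n k))).

Lemma min_ge0 (x y : R) : 0 <= x -> 0 <= y -> 0 <= Num.min x y.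
Proof. by move=> x0 y0; rewrite le_min x0. Qed.

Lemma Jn_inB f n N x : 0 <= x -> inB P B (Jn f n N x).
Proof.
move=> x0; apply: (inB_sum B_fBM) => k; apply: (inBZ B_fBM); apply: (inBB B_fBM);
  by apply: (inB_B B_fBM); rewrite min_ge0 ?grid_ge0.
Qed.

Lemma Jn_indep f n N N' x : x <= N%:R -> (N <= N')%N -> Jn f n N' x = Jn f n N x.
Proof.
move=> xN NN'; rewrite /Jn -!(big_mkord xpredT (fun k => f (grid n k) *:
    (B (Num.min x (grid n k.+1)) - B (Num.min x (grid n k))))).
rewrite (big_cat_nat (n := (N * 2 ^ n)%N)) ?leq_mul2r ?NN' ?orbT//=.
rewrite [X in _ + X]big1_seq ?addr0// => k; rewrite mem_index_iota => /andP[_ /andP[h _]].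
have xk : x <= grid n k by apply: le_trans xN _; rewrite -(grid_top n) grid_le.
by rewrite !min_l ?subrr ?scaler0// (le_trans xk)// grid_le.
Qed.

(** The norm of an increment shrinks by this factor when its length is halved. *)
Definition rate : R := 2^-1 `^ H.

Lemma rate_ge0 : 0 <= rate. Proof. exact: powR_ge0. Qed.

Lemma rate_lt1 : rate < 1.
Proof.
have <- : (1 : R) `^ H = 1 by rewrite powR1.
by rewrite /rate gt0_ltr_powR ?nnegrE ?ler01 ?invr_ge0 ?ler0n//; lra.
Qed.

Lemma rateX n : (2 ^+ n)^-1 `^ H = rate ^+ n.
Proof.
elim: n => [|n IH]; first by rewrite expr0 invr1 powR1.
by rewrite exprS invfM powRM ?invr_ge0 ?exprn_ge0// IH -exprS.
Qed.

Lemma min_dist (x y z : R) : `|Num.min x y - Num.min x z| <= `|y - z|.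
Proof.
have h1 := ler_norm (y - z); have h2 := ler_norm (z - y); rewrite distrC in h2.
rewrite ler_norml; case: (leP x y); case: (leP x z) => *; apply/andP; split; lra.
Qed.

Lemma sum_pairs (V : zmodType) (F : nat -> V) n :
  \sum_(k < n.*2) F k = \sum_(k < n) (F k.*2 + F k.*2.+1).
Proof.
elim: n => [|n IH]; first by rewrite !big_ord0.
by rewrite doubleS !big_ord_recr/= IH addrA.
Qed.

(** Halving a cell changes the sum only by [f] at the midpoint minus [f] at the left end, times the
    increment over the right half. *)
Lemma Jn_refine f L n (N : nat) x : 0 <= x -> lip f L 0 N%:R ->
  nm P (Jn f n.+1 N x - Jn f n N x) <= (N%:R * L) * rate ^+ n.
Proof.
move=> x0 [L0 hf]; pose m k := Num.min x (grid n.+1 k).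
have m0 k : 0 <= m k by rewrite min_ge0 ?grid_ge0.
have -> : Jn f n.+1 N x - Jn f n N x = \sum_(k < N * 2 ^ n)
   (f (grid n.+1 k.*2.+1) - f (grid n.+1 k.*2)) *: (B (m k.*2.+2) - B (m k.*2.+1)).
  rewrite /Jn expnS mulnCA mul2n (sum_pairs (fun k => f (grid n.+1 k) *:
    (B (Num.min x (grid n.+1 k.+1)) - B (Num.min x (grid n.+1 k))))) -sumrB.
  apply: eq_bigr => k _; rewrite -[grid n k.+1]grid_double -[grid n k]grid_double doubleS.
  rewrite -!/(m _) scalerBl -addrA addrC -addrA; congr (_ + _).
  by rewrite -!scalerN -scalerDr !opprB addrC addrA subrK.
apply: le_trans (nm_sum _ _) _.
  by move=> k; apply/L2Z/(incr_L2 B_fBM).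
(* There are [N 2^n] cells; each costs the Lipschitz bound for half a cell times the norm of the
   increment over it. *)
apply: le_trans (_ : \sum_(k < N * 2 ^ n) (L * (2 ^+ n.+1)^-1) * rate ^+ n.+1 <= _).
  apply: ler_sum => k _; rewrite nmZ; last exact: (incr_L2 B_fBM).
  apply: ler_pM => //; first exact: nm_ge0.
  - have gN (j : nat) : (j <= (N * 2 ^ n).*2)%N -> 0 <= grid n.+1 j <= N%:R.
      by rewrite grid_ge0/= -(grid_top n.+1) expnS mulnCA mul2n; exact: grid_le.
    apply: le_trans (hf _ _ _ _) _.
    + by apply: gN; rewrite ltn_double.
    + by apply: gN; rewrite leq_double ltnW.
    + by rewrite gridS ger0_norm// invr_ge0 exprn_ge0.
  - rewrite (incr_nm H0 B_fBM)// -rateX ge0_ler_powR ?(ltW H0) ?nnegrE ?invr_ge0 ?exprn_ge0//.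
    apply: le_trans (min_dist _ _ _) _.
    by rewrite gridS ger0_norm// invr_ge0 exprn_ge0.
rewrite sumr_const card_ord -[X in X <= _]mulr_natl natrM natrX !exprS invfM.
have r1 := rate_lt1; have r0 := rate_ge0.
have -> : N%:R * 2 ^+ n * (L * (2^-1 * (2 ^+ n)^-1) * (rate * rate ^+ n)) =
  N%:R * L * rate ^+ n * (2^-1 * rate).
  by field; rewrite expf_neq0.
apply: ler_piMr; first by rewrite !mulr_ge0// exprn_ge0.
lra.
Qed.

Definition loclip (f : R -> R) := forall M, exists L, lip f L (- M) M.

Lemma loclip_ab f a b : loclip f -> exists L, lip f L a b.
Proof.
move=> hf; have [L hL] := hf (`|a| + `|b|); exists L; apply: lipS hL.
  by rewrite lerNl -normrN (le_trans (ler_norm (- a)))// lerDl.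
by rewrite (le_trans (ler_norm b))// lerDr.
Qed.

(** The geometric rate of [Jn_refine] gives the limit on one grid that covers [x]; [Jn_indep]
    extends the bound to every other such grid. *)
Lemma J_lim f x : loclip f -> 0 <= x -> exists2 Y, inB P B Y &
  exists2 C, 0 <= C & forall n (N : nat), x <= N%:R -> nm P (Jn f n N x - Y) <= C * rate ^+ n.
Proof.
move=> hf x0; pose N := (Num.truncn x).+1; have xN : x <= N%:R by rewrite ltW// truncnS_gt.
have [L hL] := loclip_ab 0 N%:R hf; have r1 : 0 < 1 - rate by rewrite subr_gt0 rate_lt1.
have LJ n : L2 P (Jn f n N x) := inB_L2 (Jn_inB f n N x0).
have [Y hY hn] := L2_complete LJ rate_ge0 rate_lt1 (fun n => Jn_refine n x0 hL).
have C0 : 0 <= N%:R * L / (1 - rate) by rewrite divr_ge0 ?mulr_ge0 ?(ltW r1)//; case: hL.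
have hn' n (N' : nat) : x <= N'%:R -> nm P (Jn f n N' x - Y) <= (N%:R * L / (1 - rate)) * rate ^+ n.
  move=> xN'; have -> : Jn f n N' x = Jn f n N x.
    by case: (leqP N N') => h; [exact: Jn_indep|rewrite (Jn_indep _ _ _ (ltnW h))].
  by apply: le_trans (hn n) _; rewrite mulrAC.
exists Y; last by exists (N%:R * L / (1 - rate)).
apply: (inB_lim B_fBM) => // e e0; pose C := N%:R * L / (1 - rate).
have : (C * rate ^+ n) @[n --> \oo] --> (C * 0 : R).
  apply: cvgMl_tmp; apply: cvg_expr; rewrite ger0_norm; [exact: rate_lt1|exact: rate_ge0].
rewrite mulr0 => /cvgrPdist_le /(_ _ e0)[n _ /(_ n (leqnn _))].
rewrite sub0r normrN ger0_norm; last by rewrite mulr_ge0// exprn_ge0// rate_ge0.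
move=> ne; exists (Jn f n N x); first exact: Jn_inB.
by rewrite nmBC//; apply: le_trans (hn' n N xN) ne.
Qed.

(** Abel summation over the cells that meet [[a, b]]. The grid step appears because the cell
    containing [a] may be tagged below [a]; the bound stays finite under refinement and so passes to
    the limit. *)
Lemma Jn_sewing f L n (N : nat) a b : 0 <= a -> a <= b -> b <= N%:R -> (0 < N)%N ->
  lip f L (a - 1) b ->
  nm P (Jn f n N b - Jn f n N a - f a *: (B b - B a)) <=
  2 * L * (b - a + (2 ^+ n)^-1) * (b - a) `^ H.
Proof.
move=> a0 ab bN N0 [L0 hf]; have b0 := le_trans a0 ab.
have en0 : 0 < (2 ^+ n)^-1 :> R by rewrite invr_gt0 exprn_gt0.
have en1 : (2 ^+ n)^-1 <= 1 :> R by rewrite invf_le1 ?exprn_gt0// exprn_ege1// ler1n.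
set e := (2 ^+ n)^-1 in en0 en1 *.
(* [c k] agrees with the grid point on every cell that contributes, stays where [f] is Lipschitz,
   and is monotone in [k], so that its variation telescopes. *)
pose c k := Num.max (a - e) (Num.min b (grid n k)).
pose G k := f (c k) - f a.
pose bk k := B (Num.min b (grid n k)) - B (Num.min a (grid n k)).
have bk0 : bk 0%N = 0.
  by rewrite /bk /grid mul0r !min_r// subrr.
have cr k : a - 1 <= c k <= b.
  rewrite /c le_max ge_max ge_min lexx/= andbT; apply/andP; split; last lra.
  by rewrite (_ : a - 1 <= a - e)//; lra.
have [K hK] : exists K, (N * 2 ^ n)%N = K.+1.
  by exists (N * 2 ^ n).-1; rewrite prednK// muln_gt0 N0 expn_gt0.
have gtop : grid n K.+1 = N%:R by rewrite -hK grid_top.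
have -> : Jn f n N b - Jn f n N a - f a *: (B b - B a) =
   \sum_(k < K.+1) G k *: (bk k.+1 - bk k).
  have -> : B b - B a = \sum_(k < K.+1) (bk k.+1 - bk k).
    rewrite -(big_mkord xpredT (fun k => bk k.+1 - bk k)) telescope_sumr// bk0 subr0 /bk gtop.
    by rewrite !min_l// (le_trans ab).
  rewrite scaler_sumr /Jn hK -!sumrB; apply: eq_bigr => k _.
  rewrite -scalerBr.
  have -> : B (Num.min b (grid n k.+1)) - B (Num.min b (grid n k)) -
     (B (Num.min a (grid n k.+1)) - B (Num.min a (grid n k))) = bk k.+1 - bk k.
    by rewrite /bk !opprB addrACA [RHS]addrACA; congr (_ + _); rewrite addrC.
  rewrite -scalerBl /G; have gk := gridS n k; rewrite -/e in gk.
  case: (lerP b (grid n k)) => h1.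
    have h2 := le_trans h1 (grid_le n (leqnSn k)).
    have -> : bk k.+1 = bk k by rewrite /bk !min_l// (le_trans ab).
    by rewrite subrr !scaler0.
  case: (lerP (grid n k.+1) a) => h2.
    have h3 := le_trans (grid_le n (leqnSn k)) h2.
    rewrite /bk !min_r ?subrr ?scaler0 ?(le_trans _ ab)//.
  congr ((f _ - _) *: _); rewrite /c min_r ?(ltW h1)// max_r//; lra.
apply: le_trans (@abel_bound G bk K ((b - a) `^ H) (L * (b - a + e)) (L * (b - a + e)) bk0 _ _ _ _) _.
- by move=> k; apply: (incr_L2 B_fBM); rewrite min_ge0 ?grid_ge0.
- move=> k; rewrite (incr_nm H0 B_fBM) ?min_ge0 ?grid_ge0//.
  rewrite ge0_ler_powR ?nnegrE ?(ltW H0) ?subr_ge0//.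
  rewrite -(minC (grid n k)) -(minC (grid n k) a); apply: le_trans (min_dist _ _ _) _.
  by rewrite ger0_norm// subr_ge0.
- apply: le_trans (hf _ _ (cr K) _) _; first by rewrite ab andbT; lra.
  rewrite ler_wpM2l//; rewrite ler_norml; have /andP[_ cK] := cr K.
  have : a - e <= c K by rewrite /c le_max lexx.
  by move=> ?; apply/andP; split; lra.
- apply: le_trans (_ : \sum_(k < K) L * (c k.+1 - c k) <= _).
    apply: ler_sum => k _; rewrite /G opprB addrA subrK.
    apply: le_trans (hf _ _ (cr _) (cr _)) _.
    rewrite ger0_norm// subr_ge0 /c ge_max le_max lexx/= le_max; apply/orP; right.
    by rewrite le_min ge_min lexx/= ge_min grid_le ?leqnSn// orbT.
  rewrite -mulr_sumr -(big_mkord xpredT (fun k => c k.+1 - c k)) telescope_sumr//.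
  rewrite ler_wpM2l//; have /andP[_ cK] := cr K.
  have : a - e <= c 0%N by rewrite /c le_max lexx.
  lra.
rewrite ler_wpM2r ?powR_ge0//; lra.
Qed.

End sewing.

Lemma le_of_cvg0 {R : realType} (x c : R) (u : nat -> R) :
  u n @[n --> \oo] --> (0 : R) -> (forall n, x <= c + u n) -> x <= c.
Proof.
move=> u0 h; apply/ler_addgt0Pr => e e0.
have /cvgrPdist_le /(_ _ e0)[n _ /(_ n (leqnn _))] := u0.
rewrite sub0r normrN => un; apply: le_trans (h n) _; rewrite lerD2l.
exact: le_trans (ler_norm _) un.
Qed.

(** * Sewn processes as stochastic integrals: existence and uniqueness *)

Section stochastic_integral.
Context {R : realType} {d : measure_display} {Omega : measurableType d}.
Variables (P : probability Omega R) (H : R) (B : R -> Omega -> R).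
Hypotheses (H0 : 0 < H) (H1 : H < 1) (B_fBM : fBM P H B).

Lemma rate_cvg0 (C : R) : (C * rate H ^+ n) @[n --> \oo] --> (0 : R).
Proof.
rewrite -[X in _ --> X](mulr0 C); apply: cvgMl_tmp; apply: cvg_expr.
by rewrite ger0_norm; [exact: rate_lt1|exact: rate_ge0].
Qed.

(* [J] is an indefinite integral of [f] against [B], characterised by its local
   expansion; [a - 1] leaves room for the dyadic point below [a]. *)
Definition sews (f : R -> R) (J : R -> Omega -> R) :=
  [/\ forall x, 0 <= x -> inB P B (J x), nm P (J 0) = 0 &
   forall L a b, 0 <= a -> a <= b -> lip f L (a - 1) b ->
   nm P (J b - J a - f a *: (B b - B a)) <= 2 * L * (b - a) * (b - a) `^ H].

(** A dyadic limit is chosen for each upper end; in the bound of [Jn_sewing] the term in [2^-n]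
    vanishes. *)
Lemma sewing f : loclip f -> exists J, sews f J.
Proof.
move=> hf.
have /choice[J hJ] : forall x : R, exists Y, 0 <= x -> inB P B Y /\
  exists2 C, 0 <= C & forall n (N : nat), x <= N%:R -> nm P (Jn B f n N x - Y) <= C * rate H ^+ n.
  move=> x; have [x0|x0] := leP 0 x; last by exists 0.
  by have [Y hY hC] := J_lim H0 B_fBM hf x0; exists Y.
exists J; split.
- by move=> x /hJ[].
- have [h0 [C C0 hC]] := hJ 0 (lexx 0).
  apply/eqP; rewrite eq_le nm_ge0 andbT; apply: (le_of_cvg0 (rate_cvg0 C)) => n.
  rewrite add0r; have := hC n 0%N (lexx _); rewrite /Jn mul0n big_ord0 sub0r nmN//.
  by case: h0.
- move=> L a b a0 ab hL; have b0 := le_trans a0 ab.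
  have [ha [Ca Ca0 hCa]] := hJ a a0; have [hb [Cb Cb0 hCb]] := hJ b b0.
  pose N := (Num.truncn b).+1; have bN : b <= N%:R by rewrite ltW// truncnS_gt.
  have aN := le_trans ab bN.
  have LL0 : 0 <= L by case: hL.
  have LX := incr_L2 B_fBM b0 a0.
  apply: (@le_of_cvg0 _ _ _ (fun n => (Ca + Cb + 2 * L * (b - a) `^ H) * rate H ^+ n)) => [|n].
    exact: rate_cvg0.
  have := Jn_sewing H0 B_fBM n a0 ab bN (ltn0Sn _) hL.
  set U := Jn B f n N b; set V := Jn B f n N a; set D := f a *: _ => h.
  have LU : L2 P U := inB_L2 (Jn_inB B_fBM f n N b0).
  have LV : L2 P V := inB_L2 (Jn_inB B_fBM f n N a0).
  have LD : L2 P D by exact: L2Z.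
  have La := inB_L2 ha; have Lb := inB_L2 hb.
  have -> : J b - J a - D = (U - V - D) + ((V - J a) - (U - J b)).
    by apply/funext => w; rewrite !fctE; ring.
  apply: le_trans (nmD _ _) _; [exact: L2B (L2B LU LV) LD|exact: L2B (L2B LV La) (L2B LU Lb)|].
  have h2 := nmB (L2B LV La) (L2B LU Lb).
  have h3 := hCa n N aN; have h4 := hCb n N bN.
  (* As [H <= 1], the grid step is at most [rate H ^+ n], so all the errors vanish at one rate. *)
  have h5 : (2 ^+ n)^-1 <= rate H ^+ n.
    rewrite -rateX -[X in X <= _]powRr1 ?invr_ge0 ?exprn_ge0//.
    apply: ger_powR; last exact: ltW.
    by rewrite invr_gt0 exprn_gt0//= invf_le1 ?exprn_gt0// exprn_ege1// ler1n.
  have h6 : 2 * L * (b - a) `^ H * (2 ^+ n)^-1 <= 2 * L * (b - a) `^ H * rate H ^+ n.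
    by rewrite ler_wpM2l// mulr_ge0 ?powR_ge0// mulr_ge0.
  rewrite -/U -/V in h3 h4; move: h h2 h3 h4 h6; rewrite !mulrDr !mulrDl; lra.
Qed.

Definition tagged (s tau : nat -> R) n r := forall k, (k < n)%N ->
  [/\ s k <= tau k, tau k <= s k.+1 & s k.+1 - s k <= r].

Definition rsum (f : R -> R) n (s tau : nat -> R) : Omega -> R :=
  \sum_(k < n) f (tau k) *: (B (s k.+1) - B (s k)).

Lemma rsumE f n s tau : riemann_sum B f n s tau = rsum f n s tau.
Proof. by apply/funext => w; rewrite /riemann_sum /rsum fct_sumE. Qed.

Lemma tagged_mono s tau n r : tagged s tau n r -> forall k l, (k <= l)%N -> (l <= n)%N -> s k <= s l.
Proof.
move=> h k l; elim: l => [|l IH]; first by rewrite leqn0 => /eqP->.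
rewrite leq_eqVlt => /orP[/eqP->//|]; rewrite ltnS => kl ln.
have [h1 h2 _] := h l ln; exact: le_trans (IH kl (ltnW ln)) (le_trans h1 h2).
Qed.

(** Telescoping [J] leaves one error per cell: [L r^H] times its length for moving the tag to the
    left end, and twice as much for the local expansion, whence the 3. *)
Lemma rsum_close f J L a b n s tau r : sews f J -> 0 <= a -> a <= b -> 0 <= r ->
  lip f L (a - 1) b -> s 0%N = a -> s n = b -> tagged s tau n r ->
  nm P (rsum f n s tau - (J b - J a)) <= 3 * L * r `^ H * (b - a).
Proof.
move=> [hJ _ hsew] a0 ab r0 hL s0 sn ht; have [L0 hf] := hL.
have mono := tagged_mono ht.
have sr k : (k <= n)%N -> a <= s k <= b.
  by move=> kn; rewrite -s0 -sn !mono.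
have sp k : (k <= n)%N -> 0 <= s k by move=> /sr /andP[h _]; exact: le_trans a0 h.
have -> : rsum f n s tau - (J b - J a) = \sum_(k < n)
   (f (tau k) *: (B (s k.+1) - B (s k)) - (J (s k.+1) - J (s k))).
  rewrite sumrB; congr (_ - _).
  by rewrite -(big_mkord xpredT (fun k => J (s k.+1) - J (s k))) telescope_sumr// s0 sn.
have LX (k : 'I_n) : L2 P (B (s k.+1) - B (s k)).
  by apply: (incr_L2 B_fBM); apply: sp => //; exact: ltnW.
have LJ (k : 'I_n) : L2 P (J (s k.+1) - J (s k)).
  by apply: L2B; apply/inB_L2/hJ; apply: sp => //; exact: ltnW.
apply: le_trans (nm_sum _ _) _.
  by move=> k; apply: L2B => //; exact: L2Z.
apply: le_trans (_ : \sum_(k < n) (3 * L * r `^ H) * (s k.+1 - s k) <= _); last first.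
  rewrite -mulr_sumr -(big_mkord xpredT (fun k => s k.+1 - s k)) telescope_sumr//.
  by rewrite s0 sn.
apply: ler_sum => k _; have kn := ltn_ord k.
have [t1 t2 t3] := ht k kn; have h1 := sr k (ltnW kn); have h2 := sr k.+1 kn.
have p1 := sp k (ltnW kn); have p2 := sp k.+1 kn; have s12 := le_trans t1 t2.
set D := B (s k.+1) - B (s k) in LX *.
have -> : f (tau k) *: D - (J (s k.+1) - J (s k)) =
  (f (tau k) - f (s k)) *: D - (J (s k.+1) - J (s k) - f (s k) *: D).
  by apply/funext => w; rewrite !fctE /GRing.scale/=; ring.
apply: le_trans (nmB _ _) _.
- exact/L2Z/LX.
- by apply: L2B; [exact: LJ|exact/L2Z/LX].
have nD : nm P D <= r `^ H.
  rewrite (incr_nm H0 B_fBM)// ge0_ler_powR ?nnegrE ?(ltW H0)//.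
  by rewrite ger0_norm// subr_ge0.
have hk : lip f L (s k - 1) (s k.+1).
  by apply: lipS hL; [case/andP: h1 => ? _; rewrite lerD2r|case/andP: h2].
have n2 := hsew L _ _ p1 s12 hk.
have h0 : 0 <= s k.+1 - s k by rewrite subr_ge0.
have n3 : 2 * L * (s k.+1 - s k) * (s k.+1 - s k) `^ H <= 2 * L * (s k.+1 - s k) * r `^ H.
  rewrite ler_wpM2l ?mulr_ge0// ge0_ler_powR ?nnegrE ?(ltW H0)//.
have n1 : nm P ((f (tau k) - f (s k)) *: D) <= L * (s k.+1 - s k) * r `^ H.
  rewrite nmZ; last exact: LX.
  apply: ler_pM => //; first exact: nm_ge0.
  apply: le_trans (hf _ _ _ _) _.
  - case/andP: h1 => ? _; case/andP: h2 => _ ?; apply/andP; split; lra.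
  - case/andP: h1 => ? ?; apply/andP; split; lra.
  - by rewrite ler_wpM2l// ger0_norm ?subr_ge0// lerD2r.
have -> : 3 * L * r `^ H * (s k.+1 - s k) =
  L * (s k.+1 - s k) * r `^ H + 2 * L * (s k.+1 - s k) * r `^ H by ring.
apply: lerD => //; exact: le_trans n2 n3.
Qed.

Lemma mesh_exists (K e : R) : 0 <= K -> 0 < e -> exists2 r, 0 < r & K * r `^ H <= e.
Proof.
move=> K0 e0; have K1 : 0 < K + 1 by rewrite ltr_wpDl.
have q0 : 0 < e / (K + 1) by rewrite divr_gt0.
exists ((e / (K + 1)) `^ H^-1); first exact: powR_gt0.
rewrite -powRrM mulVf ?gt_eqF// powRr1 ?(ltW q0)// mulrA ler_pdivrMr// mulrC ler_wpM2l ?(ltW e0)//.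
by rewrite lerDl.
Qed.

Lemma sews_stoch f J t : loclip f -> sews f J -> 0 <= t -> stoch_integral P B t f (J t).
Proof.
move=> hf hJ t0; have [hB J0 _] := hJ.
have LJ x : 0 <= x -> L2 P (J x) by move=> /hB /inB_L2.
split; first exact: L2_measurable (LJ t t0).
move=> e e0; have [L hL] := loclip_ab (0 - 1) t hf.
have L0 : 0 <= L by case: hL.
have K0 : 0 <= 3 * L * t by rewrite !mulr_ge0.
have s0 : 0 < Num.sqrt e by rewrite sqrtr_gt0.
have [r r0 hr] := mesh_exists K0 s0; exists r => // n s tau hs0 hst ht.
have ht' : tagged s tau n r by move=> k /ht[h1 h2 /ltW h3]; split.
have sp k : (k <= n)%N -> 0 <= s k by move=> kn; rewrite -hs0 (tagged_mono ht').
have LS : L2 P (rsum f n s tau).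
  by apply: L2_sum => k _; apply/L2Z/(incr_L2 B_fBM); apply: sp => //; exact: ltnW.
have := rsum_close hJ (lexx 0) t0 (ltW r0) hL hs0 hst ht'; rewrite subr0 => h.
have h2 : nm P (rsum f n s tau - J t) <= Num.sqrt e.
  have -> : rsum f n s tau - J t = (rsum f n s tau - (J t - J 0)) - J 0.
    by apply/funext => w; rewrite !fctE; ring.
  apply: le_trans (nmB _ _) _; [|exact: LJ|].
    by apply: L2B => //; apply: L2B; exact: LJ.
  by rewrite J0 addr0; apply: le_trans h _; rewrite mulrAC.
rewrite (_ : (fun w => _) = (fun w => (rsum f n s tau - J t) w ^+ 2)); last first.
  by apply/funext => w; rewrite rsumE.
apply: sqr_of_L2; first by apply: L2B => //; exact: LJ.
by rewrite -sqr_nm -(sqr_sqrtr (ltW e0)) ler_sqr ?nnegrE ?nm_ge0 ?sqrtr_ge0.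
Qed.

Lemma rsum_L2 f n s tau r : tagged s tau n r -> 0 <= s 0%N -> L2 P (rsum f n s tau).
Proof.
move=> ht s0; have sp k : (k <= n)%N -> 0 <= s k by move=> kn; apply: le_trans s0 (tagged_mono ht _ _).
by apply: L2_sum => k _; apply/L2Z/(incr_L2 B_fBM); apply: sp => //; exact: ltnW.
Qed.

Definition ugrid (a b : R) n k := a + (b - a) * k%:R / n.+1%:R.

Lemma ugrid0 a b n : ugrid a b n 0 = a.
Proof. by rewrite /ugrid mulr0 mul0r addr0. Qed.

Lemma ugrid_top a b n : ugrid a b n n.+1 = b.
Proof. by rewrite /ugrid mulfK ?pnatr_eq0// addrC subrK. Qed.

Lemma ugridS a b n k : ugrid a b n k.+1 - ugrid a b n k = (b - a) / n.+1%:R.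
Proof. by rewrite /ugrid opprD addrACA subrr add0r -mulrBl -mulrBr -natrB// subSnn mulr1. Qed.

Lemma ugrid_tagged a b n : a <= b -> tagged (ugrid a b n) (ugrid a b n) n.+1 ((b - a) / n.+1%:R).
Proof.
move=> ab k _; split; rewrite ?ugridS// -subr_ge0 ugridS divr_ge0// subr_ge0//.
Qed.

Lemma tagged_le s tau n r r' : r <= r' -> tagged s tau n r -> tagged s tau n r'.
Proof. by move=> rr h k /h[h1 h2 h3]; split => //; exact: le_trans rr. Qed.

(** Both variables are limits of Riemann sums, so one partition fine enough for each brings them
    within any [e] of each other. *)
Lemma stoch_uniq f J t I : loclip f -> sews f J -> 0 <= t -> stoch_integral P B t f I ->
  L2 P I /\ {ae P, forall w, I w = J t w}.
Proof.
move=> hf hJ t0 [mI hI]; have [mJ hJ'] := sews_stoch hf hJ t0; have [hB _ _] := hJ.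
have part (r : R) : 0 < r -> exists n, forall k, (k < n.+1)%N ->
    [/\ ugrid 0 t n k <= ugrid 0 t n k, ugrid 0 t n k <= ugrid 0 t n k.+1
      & ugrid 0 t n k.+1 - ugrid 0 t n k < r].
  move=> r0; exists (Num.truncn (t / r)) => k kn.
  have [h1 h2 _] := @ugrid_tagged 0 t (Num.truncn (t / r)) t0 k kn; split => //.
  rewrite ugridS subr0 ltr_pdivrMr// mulrC -ltr_pdivrMr//; exact: truncnS_gt.
have key (e : R) : 0 < e -> exists S, [/\ L2 P S, L2 P (S - I), nm P (S - I) <= e & nm P (S - J t) <= e].
  move=> e0; have ee : 0 < e ^+ 2 by rewrite exprn_gt0.
  have [r r0 hr] := hI _ ee; have [r' r'0 hr'] := hJ' _ ee.
  have m0 : 0 < Num.min r r' by rewrite lt_min r0.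
  have [n hn] := part _ m0; set s := ugrid 0 t n in hn.
  have hn1 : tagged s s n.+1 r.
    by move=> k /hn[h1 h2]; rewrite lt_min => /andP[/ltW h3 _].
  have LS := rsum_L2 f hn1; rewrite /s ugrid0 -/s in LS; have {}LS := LS (lexx 0).
  have b2 : ('E_P[(fun w => (riemann_sum B f n.+1 s s w - I w) ^+ 2)%R] <= (e ^+ 2)%:E)%E.
    apply: hr; [exact: ugrid0|exact: ugrid_top|].
    by move=> k /hn[h1 h2]; rewrite lt_min => /andP[h3 _].
  have b1 : ('E_P[(fun w => (riemann_sum B f n.+1 s s w - J t w) ^+ 2)%R] <= (e ^+ 2)%:E)%E.
    apply: hr'; [exact: ugrid0|exact: ugrid_top|].
    by move=> k /hn[h1 h2]; rewrite lt_min => /andP[_ h3].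
  rewrite rsumE in b1 b2.
  have m1 : measurable_fun setT (rsum f n.+1 s s - I).
    by apply: measurable_funB => //; exact: L2_measurable LS.
  have m2 : measurable_fun setT (rsum f n.+1 s s - J t).
    by apply: measurable_funB => //; exact: L2_measurable LS.
  have [c1 d1] := L2_of_sqr m1 b2; have [c2 d2] := L2_of_sqr m2 b1.
  exists (rsum f n.+1 s s); split => //; apply: nm_le => //; exact: ltW.
have LI : L2 P I.
  have [S [h1 h2 _ _]] := key 1 ltr01.
  by have := L2B h1 h2; rewrite opprB addrC subrK.
have LJ := inB_L2 (hB t t0).
split => //; apply: (ae_eq_of_nm LI LJ) => e e0.
have [S [h1 h2 h3 h4]] := key (e / 2) (divr_gt0 e0 (ltr0Sn _ 1)).
apply: le_trans (nm_dist LI h1 LJ) _; rewrite nmBC//; lra.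
Qed.

End stochastic_integral.

(** * Lower bounds for combinations of sines and cosines *)

Section trigonometric_bounds.
Context {R : realType}.

Lemma cos_ge_half (x : R) : `|x| <= 1 -> 2^-1 <= cos x.
Proof.
move=> x1; have := one_sub_cos_le x.
have : x ^+ 2 <= 1 by rewrite -real_normK ?num_real// -[leRHS](expr1n _ 2) lerXn2r ?nnegrE.
lra.
Qed.

Lemma sin_ge_half (x : R) : 0 <= x <= 1 -> x / 2 <= sin x.
Proof.
move=> /andP[x0 x1].
have : (x / 2 - sin x) <= (0 / 2 - sin 0).
  apply: (@nincr_of_derive R (fun y => y / 2 - sin y) (fun y => 2^-1 - cos y)) => // [y|y y0 yx].
    apply: (is_derive_cong (is_deriveB (is_derive_lin 2^-1 y) (is_derive_sin y))) => // t.
    by rewrite !fctE mulrC.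
  rewrite subr_le0 cos_ge_half// ger0_norm//; exact: le_trans yx x1.
rewrite sin0; lra.
Qed.

Lemma trig_incr_ge (a w m h z : R) : 0 <= a -> 0 <= m -> `|(w - z) * m| <= 1 ->
  0 <= z * h <= 1 ->
  z * h / 2 <= expR (a * m) * cos (w * m) * trig_incr (m + h) (m - h) sin z -
    expR (a * m) * sin (w * m) * trig_incr (m + h) (m - h) cos z.
Proof.
move=> a0 m0 wz zh; rewrite /trig_incr !mulrDl !mulNr !(mulrC m) !(mulrC h) sinD sinB cosD cosB.
have c1 := cos_ge_half wz; have s1 := sin_ge_half zh.
have -> : expR (a * m) * cos (w * m) * (sin (z * m) * cos (z * h) + cos (z * m) * sin (z * h) -
     (sin (z * m) * cos (z * h) - cos (z * m) * sin (z * h))) -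
   expR (a * m) * sin (w * m) * (cos (z * m) * cos (z * h) - sin (z * m) * sin (z * h) -
     (cos (z * m) * cos (z * h) + sin (z * m) * sin (z * h))) =
   expR (a * m) * (2 * sin (z * h)) * cos ((w - z) * m).
  by rewrite mulrBl cosB; ring.
have e1 : 1 <= expR (a * m) by rewrite -expR0 ler_expR mulr_ge0.
have zh0 : 0 <= z * h by case/andP: zh.
have h2 : z * h <= expR (a * m) * (2 * sin (z * h)).
  rewrite -[leLHS]mul1r; apply: ler_pM => //; lra.
apply: ler_pM => //; exact: invr_ge0.
Qed.

End trigonometric_bounds.

(** * Growth of the variance along an unstable mode *)

Section growth.
Context {R : realType} {d : measure_display} {Omega : measurableType d}.
Variables (P : probability Omega R) (H : R) (B : R -> Omega -> R).
Hypotheses (H0 : 0 < H) (H1 : H < 1) (B_fBM : fBM P H B).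

Lemma stoch_nm t f I : 0 <= t -> stoch_integral P B t f I -> forall e, 0 < e ->
  exists2 r, 0 < r & forall n s tau, s 0%N = 0 -> s n = t ->
   (forall k, (k < n)%N -> [/\ s k <= tau k, tau k <= s k.+1 & s k.+1 - s k < r]) ->
   L2 P (rsum B f n s tau - I) /\ nm P (rsum B f n s tau - I) <= e.
Proof.
move=> t0 [mI hI] e e0; have ee : 0 < e ^+ 2 by rewrite exprn_gt0.
have [r r0 hr] := hI _ ee; exists r => // n s tau s0 st ht.
have ht' : tagged s tau n r by move=> k /ht[h1 h2 /ltW h3]; split.
have s00 : 0 <= s 0%N by rewrite s0.
have LS := rsum_L2 B_fBM f ht' s00.
have := hr n s tau s0 st ht; rewrite rsumE => b.
have [|c1 d1] := L2_of_sqr _ b.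
  by apply: measurable_funB => //; exact: L2_measurable LS.
by split => //; apply: nm_le => //; exact: ltW.
Qed.

Lemma rsum_inB f n s tau r : tagged s tau n r -> 0 <= s 0%N -> inB P B (rsum B f n s tau).
Proof.
move=> ht s0; have sp k : (k <= n)%N -> 0 <= s k by move=> kn; apply: le_trans s0 (tagged_mono ht _ _).
rewrite /rsum; apply: (inB_sum B_fBM) => k; apply: (inBZ B_fBM).
by apply: (inBB B_fBM); apply: (inB_B B_fBM); apply: sp => //; exact: ltnW.
Qed.

Lemma ugrid_fine (t r : R) : 0 <= t -> 0 < r -> exists n0, forall n, (n0 <= n)%N -> t / n.+1%:R < r.
Proof.
move=> t0 r0; exists (Num.truncn (t / r)) => n hn.
rewrite ltr_pdivrMr// mulrC -ltr_pdivrMr//; apply: lt_le_trans (truncnS_gt _) _.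
by rewrite ler_nat.
Qed.

Definition mid (s : nat -> R) k := (s k + s k.+1) / 2.

Lemma ugrid_mid t n r : 0 <= t -> t / n.+1%:R < r -> forall k, (k < n.+1)%N ->
  [/\ ugrid 0 t n k <= mid (ugrid 0 t n) k, mid (ugrid 0 t n) k <= ugrid 0 t n k.+1 &
   ugrid 0 t n k.+1 - ugrid 0 t n k < r].
Proof.
move=> t0 tr k kn; have h := ugridS 0 t n k; rewrite subr0 in h.
have h0 : 0 <= t / n.+1%:R by rewrite divr_ge0.
rewrite /mid; move: (t / n.+1%:R) h h0 tr => q h h0 tr; split; lra.
Qed.

Lemma stoch_inB t f I : 0 <= t -> stoch_integral P B t f I -> inB P B I.
Proof.
move=> t0 hI; have key e : 0 < e -> exists S, [/\ inB P B S, L2 P (S - I) & nm P (S - I) <= e].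
  move=> e0; have [r r0 hr] := stoch_nm t0 hI e0.
  have [n0 hn] := ugrid_fine t0 r0; have ht := ugrid_mid t0 (hn n0 (leqnn _)).
  have ht' : tagged (ugrid 0 t n0) (mid (ugrid 0 t n0)) n0.+1 r.
    by move=> k /ht[h1 h2 /ltW h3]; split.
  have [h1 h2] := hr n0.+1 _ _ (ugrid0 0 t n0) (ugrid_top 0 t n0) ht.
  exists (rsum B f n0.+1 (ugrid 0 t n0) (mid (ugrid 0 t n0))); split => //.
  by apply: rsum_inB ht' _; rewrite ugrid0.
have LI : L2 P I.
  have [S [h1 h2 _]] := key 1 ltr01.
  by have := L2B (inB_L2 h1) h2; rewrite opprB addrC subrK.
apply: (inB_lim B_fBM) => // e e0; have [S [h1 h2 h3]] := key e e0; exists S => //.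
by rewrite nmBC//; exact: (inB_L2 h1).
Qed.

(* With midpoint tags, the component of the two sums at frequency [z] combines to
   a sum of [cos ((w - z) * (t - m_k))], bounded below uniformly in [k] on the
   window [w + 1/(2t), w + 1/t]. *)
Lemma rsum_lower (a w t : R) n (s := ugrid 0 t n)
  (c := fun (f : R -> R) u => expR (a * (t - u)) * f (w * (t - u))) : 0 <= a -> 0 <= w -> 1 <= t -> (w + t^-1) * t <= n.+1%:R ->
  (2 * t)^-1 * (((w + (2 * t)^-1) * t / 4) ^+ 2 * wgt H (w + t^-1)) <=
  4 * psi H 1 * (nm P (rsum B (c cos) n.+1 s (mid s)) ^+ 2 + nm P (rsum B (c sin) n.+1 s (mid s)) ^+ 2).
Proof.
move=> a0 w0 t1 nt; have t0 : 0 < t := lt_le_trans ltr01 t1.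
have tn0 : t != 0 by rewrite gt_eqF.
pose x (k : 'I_n.+1) := t - s k; pose y (k : 'I_n.+1) := t - s k.+1.
pose m (k : 'I_n.+1) := t - mid s k.
have s_ge k : (k <= n.+1)%N -> 0 <= s k <= t.
  move=> kn; rewrite /s /ugrid add0r subr0 divr_ge0 ?mulr_ge0 ?(ltW t0)//=.
  by rewrite ler_pdivrMr// ler_wpM2l ?(ltW t0)// ler_nat.
have hrev f : nm P (rsum B (c f) n.+1 s (mid s)) =
   nm P (\sum_(k < n.+1) (expR (a * m k) * f (w * m k)) *: (B (x k) - B (y k))).
  (* After reflection about [t] the weight of a cell is evaluated at the midpoint of that same cell,
     the form that [trig_incr_ge] requires. *)
  have := @reversal _ _ _ P H B B_fBM _ (index_enum 'I_n.+1) (fun k => c f (mid s k))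
    (fun k => s k.+1) (fun k => s k) t; apply => k; apply: s_ge => //; exact: ltnW.
rewrite !hrev !sqr_nm.
have xy0 (k : 'I_n.+1) : 0 <= y k /\ y k <= x k.
  have /andP[h1 h2] := s_ge k.+1 (ltn_ord k); have h := ugridS 0 t n k.
  rewrite /x /y subr_ge0; split => //; rewrite lerD2l lerN2 -subr_ge0 h.
  by rewrite subr0 divr_ge0 ?(ltW t0).
have ti : t * t^-1 = 1 by rewrite mulfV.
have t2 : (2 * t)^-1 = t^-1 / 2 by rewrite invfM mulrC.
have ti0 : 0 < t^-1 by rewrite invr_gt0.
have -> : (2 * t)^-1 = (w + t^-1) - (w + (2 * t)^-1) by rewrite t2; lra.
rewrite (_ : w + (w + t^-1 - _) = w + (2 * t)^-1); last by rewrite t2; lra.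
apply: (spectral_lower H0 H1 B_fBM).
- by move=> k; have [h1 h2] := xy0 k; exact: le_trans h1 h2.
- by move=> k; have [h1 h2] := xy0 k.
- by rewrite ltr_wpDl// t2 divr_gt0.
- rewrite t2; lra.
- by rewrite divr_ge0// mulr_ge0 ?(ltW t0)// addr_ge0// t2 divr_ge0// ltW.
move=> z /andP[z1 z2]; pose h := t / n.+1%:R / 2.
have z0 : 0 <= z by apply: le_trans z1; rewrite addr_ge0// t2 divr_ge0// ltW.
have h0 : 0 <= h by rewrite /h !divr_ge0// ltW.
(* As [h] is half a cell, [n.+1] terms [z h / 2] add up to [z t / 4], whatever the number of
   cells. *)
apply: le_trans (_ : \sum_(k < n.+1) z * h / 2 <= _).
  rewrite sumr_const card_ord -[leRHS]mulr_natl /h.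
  have hf (N : R) : N != 0 -> N * (z * (t / N / 2) / 2) = z * t / 4 by move=> ?; field.
  rewrite hf ?pnatr_eq0//.
  by rewrite !ler_wpM2r// ltW.
apply: ler_sum => k _.
have hk := ugridS 0 t n k; rewrite subr0 -/s in hk.
have xk : x k = m k + h by rewrite /x /m /mid /h; move: (t / _) (s _) (s k) hk => q s1 s2 hk; lra.
have yk : y k = m k - h by rewrite /y /m /mid /h; move: (t / _) (s _) (s k) hk => q s1 s2 hk; lra.
have [y0 yx] := xy0 k; have /andP[sk0 _] := s_ge k (ltnW (ltn_ord k)).
have [m0 mt] : 0 <= m k /\ m k <= t.
  by move: y0 yx sk0; rewrite /m /mid /x /y; move: (s k.+1) (s k) => s1 s2 *; split; lra.
rewrite xk yk; apply: trig_incr_ge => //.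
- rewrite normrM (ger0_norm m0) distrC -ti (mulrC t); apply: ler_pM => //.
  by rewrite ler_norml; apply/andP; split; lra.
- rewrite mulr_ge0//= /h mulrA ler_pdivrMr// mul1r mulrA ler_pdivrMr//.
  apply: le_trans (ler_wpM2r (ltW t0) z2) _; apply: le_trans nt _.
  by rewrite -[leLHS]mul1r ler_wpM2r//; lra.
Qed.

Lemma pow_unbounded (c g K T : R) : 0 < c -> 0 < g -> exists t, [/\ T <= t, 1 <= t & K < c * t `^ g].
Proof.
move=> c0 g0; pose X := `|K| / c + 1 + `|T| `^ g; exists (X `^ g^-1).
have KK : 0 <= `|K| / c by rewrite divr_ge0// ltW.
have TT : 0 <= `|T| `^ g by exact: powR_ge0.
have X1 : 1 <= X by rewrite /X -addrA addrCA lerDl addr_ge0.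
have X0 : 0 <= X := le_trans ler01 X1.
have gi : 0 <= g^-1 by rewrite invr_ge0 ltW.
split.
- apply: le_trans (ler_norm T) _.
  rewrite -[leLHS](powRr1 (normr_ge0 T)) -(mulfV (lt0r_neq0 g0)) powRrM.
  by rewrite ge0_ler_powR// ?nnegrE// /X; lra.
- have <- : (1 : R) `^ g^-1 = 1 by rewrite powR1.
  by rewrite ge0_ler_powR// nnegrE.
- rewrite -powRrM mulVf ?gt_eqF// powRr1// /X.
  apply: le_lt_trans (ler_norm K) _; rewrite !mulrDr mulrC mulfVK ?gt_eqF//.
  by rewrite -addrA ltrDl mulr1 ltr_pwDl// mulr_ge0// ltW.
Qed.

(** The bound is of order [t (w + 1/t)^(1 - 2 H)]. For [2 H <= 1] the power is at least
    [t^(2 H - 1)], which gives [t^(2 H)]; for [2 H > 1] it is at least [(w + 1)^(1 - 2 H)], which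
    gives linear growth. *)
Lemma rate_lower (w : R) : 0 <= w -> exists c g, [/\ 0 < c, 0 < g & forall t, 1 <= t ->
  c * t `^ g <= (2 * t)^-1 * (((w + (2 * t)^-1) * t / 4) ^+ 2 * wgt H (w + t^-1))].
Proof.
move=> w0.
(* 128 is 2 times the square of 8, once [w + 1 / (2 t)] is bounded below by half of [w + 1 / t]. *)
have key t : 1 <= t -> t * (w + t^-1) `^ (1 - 2 * H) / 128 <=
    (2 * t)^-1 * (((w + (2 * t)^-1) * t / 4) ^+ 2 * wgt H (w + t^-1)).
  move=> t1; have t0 : 0 < t := lt_le_trans ltr01 t1.
  have t00 : t != 0 by rewrite gt_eqF.
  have ti0 : 0 < t^-1 by rewrite invr_gt0.
  have v0 : 0 < w + t^-1 by rewrite ltr_wpDl.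
  have -> : (w + t^-1) `^ (1 - 2 * H) = (w + t^-1) ^+ 2 * wgt H (w + t^-1).
    rewrite /wgt -powR_mulrn ?(ltW v0)// -powRD; last by rewrite (gt_eqF v0) implybT.
    by congr (_ `^ _); ring.
  have W0 : 0 <= wgt H (w + t^-1) by exact: powR_ge0.
  have -> : t * ((w + t^-1) ^+ 2 * wgt H (w + t^-1)) / 128 =
     (2 * t)^-1 * (((w + t^-1) / 2 * t / 4) ^+ 2 * wgt H (w + t^-1)) by field.
  have t2 : (2 * t)^-1 = t^-1 / 2 by rewrite invfM mulrC.
  rewrite ler_wpM2l ?invr_ge0 ?mulr_ge0 ?(ltW t0)// ler_wpM2r//.
  rewrite ler_sqr ?nnegrE ?mulr_ge0 ?invr_ge0 ?(ltW t0) ?(ltW v0)// ?addr_ge0 ?t2 ?mulr_ge0 ?invr_ge0 ?(ltW ti0) ?(ltW t0)//.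
  rewrite !ler_wpM2r ?(ltW t0)//; lra.
have [h|h] := leP (2 * H) 1.
  exists (128^-1), (2 * H); split; rewrite ?mulr_gt0 ?invr_gt0// => t t1; apply: le_trans (key t t1).
  have t0 : 0 < t := lt_le_trans ltr01 t1.
  rewrite mulrC ler_wpM2r ?invr_ge0//.
  have -> : t `^ (2 * H) = t * t^-1 `^ (1 - 2 * H).
    rewrite -[t^-1](powR_inv1 (ltW t0)) -powRrM -{2}(powRr1 (ltW t0)) -powRD; last by rewrite (gt_eqF t0) implybT.
    by congr (_ `^ _); ring.
  have ti : 0 <= t^-1 by rewrite invr_ge0 ltW.
  rewrite ler_wpM2l ?(ltW t0)//; apply: ge0_ler_powR; rewrite ?nnegrE//.
  - by rewrite subr_ge0.
  - exact: addr_ge0.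
  - by rewrite lerDr.
have w1 : 0 < w + 1 by rewrite ltr_wpDl.
exists ((w + 1) `^ (1 - 2 * H) / 128), 1; split; rewrite ?divr_gt0 ?powR_gt0// => t t1.
have t0 : 0 < t := lt_le_trans ltr01 t1.
apply: le_trans (key t t1); rewrite powRr1 ?(ltW t0)// mulrC mulrA ler_wpM2r ?invr_ge0//.
rewrite ler_wpM2l ?(ltW t0)//.
have v0 : 0 < w + t^-1 by rewrite ltr_wpDl// invr_gt0.
rewrite -[1 - 2 * H]opprB !powRN lef_pV2 ?posrE ?powR_gt0//.
rewrite ge0_ler_powR ?nnegrE ?(ltW v0) ?(ltW w1)//; first lra.
by rewrite lerD2l invf_le1.
Qed.

Lemma stoch_lin t n (c : 'I_n -> R) (f : 'I_n -> R -> R) (I : 'I_n -> Omega -> R) : 0 <= t ->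
  (forall i, stoch_integral P B t (f i) (I i)) ->
  forall e, 0 < e -> exists2 r, 0 < r & forall m s tau, s 0%N = 0 -> s m = t ->
   (forall k, (k < m)%N -> [/\ s k <= tau k, tau k <= s k.+1 & s k.+1 - s k < r]) ->
   nm P (rsum B (fun u => \sum_i c i * f i u) m s tau - \sum_i c i *: I i) <= e.
Proof.
move=> t0 hI e e0; pose K := 1 + \sum_i `|c i|.
have K0 : 0 < K by rewrite /K ltr_pwDl// sumr_ge0.
have /choice[r hr] : forall i, exists r, 0 < r /\ forall m s tau, s 0%N = 0 -> s m = t ->
   (forall k, (k < m)%N -> [/\ s k <= tau k, tau k <= s k.+1 & s k.+1 - s k < r]) ->
   L2 P (rsum B (f i) m s tau - I i) /\ nm P (rsum B (f i) m s tau - I i) <= e / K.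
  by move=> i; have [r r0 h] := stoch_nm t0 (hI i) (divr_gt0 e0 K0); exists r.
exists (\big[Num.min/1]_i r i).
  by apply: lt_bigmin => // i _; exact: (hr i).1.
move=> m s tau s0 st ht.
have hi i : L2 P (rsum B (f i) m s tau - I i) /\ nm P (rsum B (f i) m s tau - I i) <= e / K.
  apply: (hr i).2 => // k /ht[h1 h2 h3]; split => //; apply: lt_le_trans h3 _; exact: bigmin_le_cond.
have -> : rsum B (fun u => \sum_i c i * f i u) m s tau - \sum_i c i *: I i =
   \sum_i c i *: (rsum B (f i) m s tau - I i).
  under [RHS]eq_bigr do rewrite scalerBr; rewrite sumrB; congr (_ - _).
  rewrite /rsum; under [RHS]eq_bigr do rewrite scaler_sumr.
  rewrite exchange_big/=; apply: eq_bigr => k _.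
  by rewrite scaler_suml; apply: eq_bigr => i _; rewrite scalerA.
apply: le_trans (nm_sum _ _) _; first by move=> i; apply: L2Z; exact: (hi i).1.
apply: le_trans (_ : \sum_i `|c i| * (e / K) <= _).
  by apply: ler_sum => i _; rewrite nmZ; [rewrite ler_wpM2l//; exact: (hi i).2|exact: (hi i).1].
rewrite -mulr_suml mulrA ler_pdivrMr// mulrC ler_wpM2l ?(ltW e0)// /K lerDr//.
Qed.

(** The integrals are close to the Riemann sums of every fine partition, in particular of one to
    which [rsum_lower] applies; the terms [+ 1] absorb the distance. *)
Lemma nm_growth (a w t c g : R) n (x y : 'I_n -> R) (f : 'I_n -> R -> R) (I : 'I_n -> Omega -> R) :
  0 <= a -> 0 <= w -> 1 <= t ->
  c * t `^ g <= (2 * t)^-1 * (((w + (2 * t)^-1) * t / 4) ^+ 2 * wgt H (w + t^-1)) ->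
  (forall i, stoch_integral P B t (f i) (I i)) ->
  (forall u, \sum_i x i * f i u = expR (a * (t - u)) * cos (w * (t - u))) ->
  (forall u, \sum_i y i * f i u = expR (a * (t - u)) * sin (w * (t - u))) ->
  c * t `^ g <= 4 * psi H 1 * ((nm P (\sum_i x i *: I i) + 1) ^+ 2 + (nm P (\sum_i y i *: I i) + 1) ^+ 2).
Proof.
move=> a0 w0 t1 hc hI hx hy; apply: le_trans hc _.
have t0 : 0 <= t := le_trans ler01 t1.
have [r r0 hr] := stoch_lin x t0 hI ltr01; have [r' r'0 hr'] := stoch_lin y t0 hI ltr01.
have m0 : 0 < Num.min r r' by rewrite lt_min r0.
have [n0 hn] := ugrid_fine t0 m0.
pose N := maxn n0 (Num.truncn ((w + t^-1) * t)).+1.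
have hN := hn N (leq_maxl _ _).
have nt : (w + t^-1) * t <= N.+1%:R.
  apply: ltW (lt_le_trans (truncnS_gt _) _); rewrite ler_nat.
  exact: leq_trans (leq_maxr _ _) (leqnSn _).
apply: le_trans (rsum_lower a0 w0 t1 nt) _.
have p0 : 0 <= 4 * psi H 1.
  by rewrite mulr_ge0// Rintegral_ge0// => v _; rewrite mulr_ge0 ?one_sub_cos_ge0 ?powR_ge0.
rewrite ler_wpM2l//.
have LI i : L2 P (I i) := inB_L2 (stoch_inB t0 (hI i)).
have ht := ugrid_mid t0 hN.
have ht' : tagged (ugrid 0 t N) (mid (ugrid 0 t N)) N.+1 (Num.min r r').
  by move=> k /ht[h1 h2 /ltW h3].
have s0 : 0 <= ugrid 0 t N 0%N by rewrite ugrid0.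
have bound (z : 'I_n -> R) (F : R -> R) : (forall u, \sum_i z i * f i u = F u) ->
    nm P (rsum B (fun u => \sum_i z i * f i u) N.+1 (ugrid 0 t N) (mid (ugrid 0 t N)) - \sum_i z i *: I i) <= 1 ->
    nm P (rsum B F N.+1 (ugrid 0 t N) (mid (ugrid 0 t N))) ^+ 2 <= (nm P (\sum_i z i *: I i) + 1) ^+ 2.
  move=> zF; have -> : (fun u => \sum_i z i * f i u) = F by apply/funext.
  move=> h; have LR := rsum_L2 B_fBM F ht' s0.
  have LZ : L2 P (\sum_i z i *: I i) by apply: L2_sum => i _; exact: L2Z.
  rewrite ler_sqr ?nnegrE ?nm_ge0 ?addr_ge0 ?nm_ge0//.
  have := nm_sub LR LZ; have := ler_norm (nm P (rsum B F N.+1 (ugrid 0 t N) (mid (ugrid 0 t N))) - nm P (\sum_i z i *: I i)); lra.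
apply: lerD; apply: bound => //.
- apply: hr; [exact: ugrid0|exact: ugrid_top|] => k /ht[h1 h2]; rewrite lt_min => /andP[h3 _] //.
- apply: hr'; [exact: ugrid0|exact: ugrid_top|] => k /ht[h1 h2]; rewrite lt_min => /andP[_ h3] //.
Qed.

End growth.

(** * Measurability of continuous and linear functionals of matrices *)

Section borel_matrices.
Context {R : realType}.

Lemma borel_cont_measurable m n (f : 'M[R]_(m, n) -> R) : continuous f ->
  measurable_fun setT (f : borel_mx R m n -> R).
Proof.
move=> /continuousP cf.
apply: (measurability _ (RGenOInfty.measurableE R)).
move=> _ [_ [x ->] <-]; rewrite setTI; apply: sub_sigma_algebra.
by apply: cf; rewrite set_itvoy; exact: open_gt.
Qed.

Lemma continuous_mx_lin m n (v : 'rV[R]_m) (j : 'I_n) :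
  continuous (fun x : 'M[R]_(m, n) => (v *m x) 0 j).
Proof.
have -> : (fun x : 'M[R]_(m, n) => (v *m x) 0 j) = (fun x => \sum_i v 0 i * x i j).
  by apply/funext => x; rewrite mxE.
apply: continuous_big => [|i _ x]; first exact: add_continuous.
exact: (@continuous_comp _ _ _ (fun M : 'M[R]_(m, n) => M i j) (fun y => v 0 i * y) x
  (@coord_continuous R m n i j x) (@mulrl_continuous R (v 0 i) (x i j))).
Qed.

Lemma measurable_mx_lin (d : measure_display) (T : measurableType d) m n (v : 'rV[R]_m) (j : 'I_n)
  (X : T -> 'M[R]_(m, n)) : (forall i, measurable_fun setT (fun w => X w i j)) ->
  measurable_fun setT (fun w => (v *m X w) 0 j).
Proof.
move=> mX; have -> : (fun w => (v *m X w) 0 j) = (fun w => \sum_i v 0 i * X w i j).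
  by apply/funext => w; rewrite mxE.
by apply: measurable_sum => i; exact: measurable_funM.
Qed.

End borel_matrices.

(** * Tightness tested by bumps *)

Section tightness.
Context {R : realType} {d : measure_display} {Omega : measurableType d}.
Variables (P : probability Omega R).

(** A continuous cut-off: 1 on [[-M, M]] and 0 outside [[-(M + 1), M + 1]]. *)
Definition bump (M x : R) : R := clamp (M + 1 - `|x|).

Lemma bump01 M x : 0 <= bump M x <= 1. Proof. exact: clamp01. Qed.

Lemma blip_bump M : blip (bump M).
Proof.
split; first by exists 1 => x; have /andP[h1 h2] := bump01 M x; rewrite ger0_norm.
exists 1 => x y; apply: le_trans (clamp_lip _ _) _.
rewrite mul1r (_ : M + 1 - `|x| - (M + 1 - `|y|) = `|y| - `|x|); last by ring.
by rewrite distrC; exact: ler_dist_dist.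
Qed.

Lemma bump_le_indic M x : bump M x <= (\1_(`[- (M + 1), M + 1]%classic : set R) x : R).
Proof.
rewrite indicE mem_setE in_itv/=; have /andP[b0 b1] := bump01 M x.
rewrite -ler_norml; case: (leP `|x| (M + 1)) => h; first exact: b1.
by rewrite /bump clamp_le0// subr_le0 ltW.
Qed.

(** The bumps converge to 1 as [n] grows, so their expectations do; 1/2 is the mass that
    [bump_small] asks for. *)
Lemma bump_tight (d' : measure_display) (T : measurableType d') (Q : probability T R) (f : T -> R) :
  measurable_fun setT f -> exists n : nat, 2^-1 < \int[Q]_w bump n%:R (f w).
Proof.
move=> mf; have : \int[Q]_w bump n%:R (f w) @[n --> \oo] --> \int[Q]_w cst 1 w.
  apply: (@bounded_cvg _ _ _ _ (fun n w => bump n%:R (f w)) (cst 1) 1) => //.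
  - by move=> n; exact: (blip_measurable (blip_bump n%:R) mf).
  - by move=> n w; have /andP[h1 h2] := bump01 n%:R (f w); rewrite ger0_norm.
  - apply: aeW => w; apply: cvg_near_cst; near=> n.
    apply: clamp_ge1; rewrite addrAC lerDr subr_ge0; near: n.
    exact: nbhs_infty_ger.
have -> : \int[Q]_w cst 1 w = 1 :> R by rewrite Rintegral_cst//= probability_setT mulr1.
move=> /cvgrPdist_lt /(_ 2^-1) [|n _ /(_ n (leqnn _)) h].
  by rewrite invr_gt0.
exists n; have := ler_norm (1 - \int[Q]_w bump n%:R (f w)); lra.
Unshelve. all: by end_near. Qed.

(** The small-ball estimate in reverse: more than half of the mass lies in an interval of length
    [2 (M + 1) / s]. The centre [D], where an uncontrolled drift sits, does not enter the bound. *)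
Lemma bump_small (M D s : R) (U : Omega -> R) : 0 <= M -> 0 < s -> L2 P U -> gaussian_rv P U ->
  \int[P]_w U w = 0 -> 2^-1 < \int[P]_w bump M (D + s * U w) -> nm P U <= 4 * (M + 1) / s.
Proof.
move=> M0 s0 LU gU EU h; have [U0|U0] := leP (nm P U) 0.
  by apply: le_trans U0 _; rewrite divr_ge0 ?mulr_ge0 ?addr_ge0 ?(ltW s0).
have mU := L2_measurable LU.
pose a := (- (M + 1) - D) / s; pose b := (M + 1 - D) / s.
have ab : a <= b by rewrite /a /b ler_wpM2r ?invr_ge0 ?(ltW s0)//; lra.
have mA : measurable (U @^-1` `[a, b]) by rewrite -[X in measurable X]setTI; exact: mU.
have h2 : \int[P]_w bump M (D + s * U w) <= fine (P (U @^-1` `[a, b])).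
  have -> : fine (P (U @^-1` `[a, b])) = \int[P]_w (\1_(U @^-1` `[a, b]) w : R).
    by rewrite /Rintegral; congr fine; rewrite integral_indic ?setIT.
  apply: le_Rintegral => //.
  - apply: (blip_int P (X := fun w => D + s * U w) (blip_bump M)).
    by apply: measurable_funD => //; apply: measurable_funM.
  - apply: (@bounded_int _ _ _ P (\1_(U @^-1` `[a, b])) 1) => [|w]; first exact: measurable_indic.
    by rewrite indicE; case: (_ \in _); rewrite ?normr1 ?normr0.
  - move=> w _; apply: le_trans (bump_le_indic _ _) _.
    rewrite !indicE; case: (boolP (_ \in `[_, M + 1]%classic)) => //=; rewrite ?ler0n//.
    rewrite inE/= in_itv/= => /andP[h1 h2]; rewrite mem_set//= in_itv/= /a /b.
    by rewrite ler_pdivrMr// ler_pdivlMr// (mulrC (U w)); apply/andP; split; lra.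
have := gaussian_small_ball LU gU EU U0 ab.
have -> : b - a = 2 * (M + 1) / s by rewrite /a /b -mulrBl; congr (_ / _); ring.
move=> h3; have {h2 h3}h := lt_le_trans h (le_trans h2 h3).
by move: h; rewrite ltr_pdivlMr// => h; lra.
Qed.

End tightness.

(** * Asymptotic stationarity forces stability *)

Section necessity.
Context {R : realType} {d : measure_display} {Omega : measurableType d}.
Variables (P : probability Omega R) (H : R) (B : R -> Omega -> R).
Hypotheses (H0 : 0 < H) (H1 : H < 1) (B_fBM : fBM P H B).
Variables (p : nat) (alpha : nat -> R) (sigma : R).
Hypothesis sigma_gt0 : 0 < sigma.
Local Notation A := (companion p.+1 alpha).
Local Notation delta := (@delta_vec R p.+1).

(** Conjugating the eigenvector when its frequency is negative gives [0 <= w]. The two real rows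
    then satisfy the system of [rotation_ode], whose initial value [(1, 0)] is the normalisation in
    [left_eigenvector]. *)
Lemma growing_modes (z : R[i]) : eigenvalue (map_mx (real_complex R) A) z -> 0 <= complex.Re z ->
  exists a w (vr vi : 'rV[R]_p.+1), [/\ 0 <= a, 0 <= w &
   forall s, (vr *m (E A s *m delta)) 0 0 = expR (a * s) * cos (w * s) /\
             (vi *m (E A s *m delta)) 0 0 = expR (a * s) * sin (w * s)].
Proof.
move=> /left_eigenvector[vr [vi [hr hi dr di]]] a0.
have [w [ui [w0 hr' hi' di']]] : exists w ui, [/\ 0 <= w, vr *m A = complex.Re z *: vr - w *: ui,
    ui *m A = w *: vr + complex.Re z *: ui & (ui *m delta) 0 0 = 0].
  have [w0|w0] := leP 0 (complex.Im z); first by exists (complex.Im z), vi.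
  exists (- complex.Im z), (- vi); split.
  - by rewrite oppr_ge0 ltW.
  - by rewrite scalerN scaleNr opprK.
  - by rewrite mulNmx hi opprD scaleNr scalerN.
  - by rewrite mulNmx mxE di oppr0.
exists (complex.Re z), w, vr, ui; split => // s; move: (complex.Re z) hr' hi' => a hr' hi'.
have der (v u : 'rV[R]_p.+1) (t : R) : v *m A = u ->
    is_derive t (1 : R) (fun s => (v *m (E A s *m delta)) 0 0) ((u *m (E A t *m delta)) 0 0).
  move=> <-; have := is_dmx_mul (is_dmx_lE A v t) (is_dmx_cst delta t) 0 0.
  rewrite mulmx0 addr0 => h; apply: (is_derive_cong h) => [y|]; by rewrite !mulmxA.
apply: (@rotation_ode R (fun s => (vr *m (E A s *m delta)) 0 0) (fun s => (ui *m (E A s *m delta)) 0 0)).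
- move=> t; apply: (is_derive_cong (der vr _ t hr')) => //.
  by rewrite mulmxBl -!scalemxAl [LHS]mxE [X in X + _ = _]mxE [X in _ + X = _]mxE; congr (_ - _); rewrite [LHS]mxE.
- move=> t; apply: (is_derive_cong (der ui _ t hi')) => //.
  by rewrite mulmxDl -!scalemxAl [LHS]mxE [X in X + _ = _]mxE [X in _ + X = _]mxE.
- by rewrite E0 mul1mx.
- by rewrite E0 mul1mx.
Qed.

Variables (x0 : 'cV[R]_p.+1) (X : R -> Omega -> 'cV[R]_p.+1).
Hypothesis X_sol : sde_solution P A (alpha 0%N) sigma B (fun=> x0) X.
Hypothesis X_stat : asymptotically_stationary P X.

(** Tightness of one-time marginals. The weak limit gives some bump of the functional [v] an
    expectation above 1/2, so the law of [X t] does too for large [t], and [bump_small] then bounds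
    the noise. *)
Lemma asym_bounded (v : 'rV[R]_p.+1) : exists K T, forall t, 0 <= t -> T <= t ->
  forall I : Omega -> 'cV[R]_p.+1,
  (forall i, stoch_integral P B t (fun u => (E A (t - u) *m delta) i 0) (fun w => I w i 0)) ->
  {ae P, forall w, X t w = E A t *m x0 + alpha 0%N *: integral_cV `[0, t]
     (fun u => E A (t - u) *m delta) + sigma *: I w} ->
  nm P (\sum_i v 0 i *: (fun w => I w i 0)) <= K.
Proof.
have [mu hmu] := X_stat (k := 1) (h := fun=> 0) (fun=> lexx 0).
pose f (x : 'M[R]_(p.+1, 1)) := (v *m x) 0 0.
have cf : continuous f by exact: continuous_mx_lin.
have [n hn] := bump_tight mu (borel_cont_measurable cf).
pose g x := bump n%:R (f x).
have cg : continuous g.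
  move=> x; apply: (@continuous_comp _ _ _ f (bump n%:R)); first exact: cf.
  exact: (blip_continuous (blip_bump n%:R)).
have gb : exists M : R, forall x, `|g x| <= M.
  by exists 1 => x; have /andP[h1 h2] := bump01 n%:R (f x); rewrite ger0_norm.
have ig : mu.-integrable setT (EFin \o (g : borel_mx R p.+1 1 -> R)).
  exact: (blip_int mu (blip_bump n%:R) (borel_cont_measurable cf)).
have := hmu g cg gb.
have -> : (\int[mu]_x (g x)%:E)%E = (\int[mu]_x (g x))%:E.
  by rewrite /Rintegral fineK//; exact: (integrable_fin_num measurableT ig).
move=> hlim.
have : \forall t \near +oo%R, (2^-1%:E < 'E_P[(fun w => g (shifted X (fun _ : 'I_1 => 0) t w))%R])%E.
  apply: (hlim [set x : \bar R | 2^-1%:E < x]%E); apply: open_nbhs_nbhs; split; first exact: open_ereal_gt_ereal.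
  by rewrite /= lte_fin.
move=> [T [_ hT]]; exists (4 * (n%:R + 1) / sigma), (T + 1) => t t0 tT I hI hX.
have Tt : T < t by apply: lt_le_trans tT; rewrite ltrDl.
pose U := \sum_i v 0 i *: (fun w => I w i 0).
have UB : inB P B U.
  by apply: (inB_sum B_fBM) => i; apply: (inBZ B_fBM); exact: (stoch_inB B_fBM t0 (hI i)).
pose m := E A t *m x0 + alpha 0%N *: integral_cV `[0, t] (fun u => E A (t - u) *m delta).
apply: (@bump_small _ _ _ P n%:R ((v *m m) 0 0)) => //.
- exact: inB_L2 UB.
- exact: (inB_gaussian B_fBM UB).
- exact: (inB_mean B_fBM UB).
have mU := L2_measurable (inB_L2 UB).
have := hT t Tt; rewrite unlock /= => {}hT.
have eqX w : shifted X (fun _ : 'I_1 => 0) t w = X t w.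
  by apply/matrixP => i j; rewrite mxE addr0 ord1.
have mX : measurable_fun setT (fun w => f (X t w)).
  by apply: measurable_mx_lin; have [] := X_sol t0.
have mR : measurable_fun setT (fun w => (v *m m) 0 0 + sigma * U w).
  by apply: measurable_funD => //; exact: measurable_funM.
have e : (\int[P]_w (g (shifted X (fun _ : 'I_1 => 0) t w))%:E =
   \int[P]_w (bump n%:R ((v *m m) 0 0 + sigma * U w))%:E)%E.
  apply: ae_eq_integral => //.
  - apply/measurable_EFinP; under eq_fun do rewrite eqX.
    exact: (blip_measurable (blip_bump n%:R) mX).
  - by apply/measurable_EFinP; exact: (blip_measurable (blip_bump n%:R) mR).
  - move: hX; apply: filterS => w hw _; rewrite eqX /g /f hw -/m; congr (_%:E); congr (bump _ _).
    rewrite mulmxDr mxE; congr (_ + _); rewrite -scalemxAr mxE; congr (_ * _).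
    by rewrite /U fct_sumE mxE.
move: hT; rewrite e -lte_fin /Rintegral fineK//.
exact: (integrable_fin_num measurableT (blip_int P (blip_bump n%:R) mR)).
Qed.

Lemma stationary_stable : eigenvalues_Re_lt0 A.
Proof.
move=> z zE; rewrite ltNge; apply/negP => z0.
have [a [w [vr [vi [a0 w0 hv]]]]] := growing_modes zE z0.
have [K [T hK]] := asym_bounded vr; have [K' [T' hK']] := asym_bounded vi.
have [c [g [c0 g0 hc]]] := rate_lower H0 w0.
(* A time beyond both thresholds at which the growth exceeds everything that [K] and [K'] allow. *)
have [t [tT t1 hgt]] := pow_unbounded (4 * psi H 1 * ((`|K| + 1) ^+ 2 + (`|K'| + 1) ^+ 2)) (Num.max T T') c0 g0.
have t0 := le_trans ler01 t1.
move: tT; rewrite ge_max => /andP[tT tT'].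
have [_ [I [hI hX]]] := X_sol t0.
have b1 := hK t t0 tT I hI hX; have b2 := hK' t t0 tT' I hI hX.
have := nm_growth H0 H1 B_fBM (x := fun i => vr 0 i) (y := fun i => vi 0 i) a0 w0 t1 (hc t t1) hI.
have hx u : \sum_i vr 0 i * (E A (t - u) *m delta) i 0 = expR (a * (t - u)) * cos (w * (t - u)).
  by rewrite -(hv (t - u)).1 mxE.
have hy u : \sum_i vi 0 i * (E A (t - u) *m delta) i 0 = expR (a * (t - u)) * sin (w * (t - u)).
  by rewrite -(hv (t - u)).2 mxE.
move=> /(_ hx hy); apply/negP; rewrite -ltNge; apply: le_lt_trans hgt.
have p0 : 0 <= 4 * psi H 1.
  by rewrite mulr_ge0// Rintegral_ge0// => y _; rewrite mulr_ge0 ?one_sub_cos_ge0 ?powR_ge0.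
rewrite ler_wpM2l//; apply: lerD; rewrite ler_sqr ?nnegrE ?addr_ge0 ?nm_ge0// lerD2r.
- exact: le_trans b1 (ler_norm _).
- exact: le_trans b2 (ler_norm _).
Qed.

End necessity.

(** * Borel measurability of matrices with measurable entries *)

Section borel_vectors.
Context {R : realType} {d : measure_display} {T : measurableType d}.

(** An open set is a countable union of boxes with rational centres and radii [1 / (n + 1)], and the
    preimage of a box is described by finitely many entries. *)
Lemma measurable_preimage_open m n (X : T -> 'M[R]_(m, n)) :
  (forall i j, measurable_fun setT (fun w => X w i j)) ->
  measurable_fun setT (X : T -> borel_mx R m n).
Proof.
move=> mX; apply: (@measurability _ _ T (borel_mx R m n) setT X (@open 'M[R]_(m, n))) => //.
move=> _ [U oU <-]; rewrite setTI.
pose box (a : 'M[rat]_(m, n) * nat) : set 'M[R]_(m, n) :=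
  [set x | forall i j, `|ratr (a.1 i j) - x i j| < a.2.+1%:R^-1].
have -> : X @^-1` U = \bigcup_(a in [set a | box a `<=` U]) X @^-1` box a.
  apply/seteqP; split => [w Uw|w [a aU wa]]; last exact: aU.
  have [e /= e0 he] : exists2 e : R, 0 < e & ball (X w) e `<=` U.
    by apply/nbhs_ballP; apply: open_nbhs_nbhs; split.
  (* The radius is below [e / 2]: the centre is within one radius of [X w], and the box within
     another. *)
  pose k := Num.truncn (2 / e).
  have ke : k.+1%:R^-1 < e / 2 :> R.
    rewrite invf_plt ?posrE ?divr_gt0// invf_div; exact: truncnS_gt.
  have k0 : 0 < k.+1%:R^-1 :> R by rewrite invr_gt0.
  have /choice[q hq] : forall ij : 'I_m * 'I_n, exists q : rat,
      ratr q \in `](X w ij.1 ij.2 - k.+1%:R^-1), (X w ij.1 ij.2 + k.+1%:R^-1)[.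
    by move=> ij; apply: rat_in_itvoo; rewrite ltrBlDr -addrA ltrDl addr_gt0.
  exists (\matrix_(i, j) q (i, j), k).
    move=> y hy; apply: he; split => // i j; have := hy i j; rewrite /= mxE.
    have := hq (i, j); rewrite in_itv/= => /andP[h1 h2] h3.
    rewrite /ball/= ltr_norml; move: h3; rewrite ltr_norml => /andP[h4 h5].
    move: (k.+1%:R^-1) (ratr _) (X w i j) (y i j) ke h1 h2 h4 h5 => a b c c' ke h1 h2 h4 h5.
    by apply/andP; split; lra.
  move=> i j; rewrite /= mxE; have := hq (i, j); rewrite in_itv/= => /andP[h1 h2].
  rewrite ltr_norml; move: (k.+1%:R^-1) (ratr _) (X w i j) h1 h2 => a b c h1 h2.
  by apply/andP; split; lra.
rewrite bigcup_mkcond; apply: countable_bigcupT_measurable => [|a]; first exact: countableP.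
case: ifPn => // _.
have -> : X @^-1` box a = \bigcap_(ij in [set: 'I_m * 'I_n])
    (fun w => X w ij.1 ij.2) @^-1` [set x | `|ratr (a.1 ij.1 ij.2) - x| < a.2.+1%:R^-1].
  apply/seteqP; split => w h; first by move=> ij _; exact: h.
  by move=> i j; exact: (h (i, j)).
apply: fin_bigcap_measurable => // ij _; rewrite -[X in measurable X]setTI.
apply: mX => //; apply: open_measurable; rewrite (_ : [set _ | _] = ball (ratr (a.1 ij.1 ij.2) : R) a.2.+1%:R^-1)//.
exact: ball_open.
Qed.

End borel_vectors.

(** * Bernstein approximation at a point of continuity *)

Section bernstein.
Context {R : realType}.

(* Expectation of [h] at [k] plus the number of successes in [n] independent
   trials of success probability [u]; [n]-fold recursion avoids binomials. *)
Fixpoint bern (u : R) n (h : nat -> R) (k : nat) : R :=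
  if n is n'.+1 then u * bern u n' h k.+1 + (1 - u) * bern u n' h k else h k.

Lemma bern_le u n h h' k : 0 <= u <= 1 -> (forall j, h j <= h' j) -> bern u n h k <= bern u n h' k.
Proof.
move=> /andP[u0 u1] hh; elim: n k => [|n IH] k //=.
by apply: lerD; rewrite ler_wpM2l// subr_ge0.
Qed.

(** Mean and variance of the binomial law, in the form of its action on quadratic test functions. *)
Lemma bern_quad u n (a b c x : R) k : bern u n (fun j => a + b * (c * j%:R - x) ^+ 2) k =
  a + b * ((c * (k%:R + n%:R * u) - x) ^+ 2 + c ^+ 2 * n%:R * u * (1 - u)).
Proof.
elim: n k => [|n IH] k /=; first by ring.
by rewrite !IH -[n.+1]addn1 -[k.+1]addn1 !natrD; ring.
Qed.

Lemma bern_bound u n h M k : 0 <= u <= 1 -> (forall j, `|h j| <= M) -> `|bern u n h k| <= M.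
Proof.
move=> /andP[u0 u1] hM; elim: n k => [|n IH] k //=.
have u1' : 0 <= 1 - u by rewrite subr_ge0.
apply: le_trans (ler_normD _ _) _; rewrite !normrM (ger0_norm u0) (ger0_norm u1').
apply: le_trans (lerD (ler_wpM2l u0 (IH _)) (ler_wpM2l u1' (IH _))) _.
by rewrite -mulrDl addrC subrK mul1r.
Qed.

(** Chebyshev's argument at one point: continuity at [u] and the bound [M] squeeze [h] between two
    parabolas centred at [u], whose expectations are within [e / 2 + K / n] of [h u]. *)
Lemma bern_cvg (u : R) (h : R -> R) (M : R) : 0 <= u <= 1 -> {for u, continuous h} ->
  (forall s, `|h s| <= M) -> bern u n (fun j => h (n%:R^-1 * j%:R)) 0 @[n --> \oo] --> h u.
Proof.
move=> u01 ch hM; have /andP[u0 u1] := u01; apply/cvgrPdist_le => e e0.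
have M0 : 0 <= M := le_trans (normr_ge0 _) (hM 0).
have /cvgrPdist_le/(_ _ (divr_gt0 e0 (ltr0Sn _ 1)))/nbhs_ballP[r /= r0 hr] := ch.
pose K := 2 * M / r ^+ 2; have K0 : 0 <= K.
  by rewrite /K divr_ge0 ?sqr_ge0// mulr_ge0.
have quad s : `|h s - h u| <= e / 2 + K * (s - u) ^+ 2.
  have [sr|sr] := ltP `|u - s| r.
    rewrite distrC; apply: le_trans (hr s sr) _.
    by rewrite lerDl mulr_ge0 ?sqr_ge0.
  apply: le_trans (_ : 2 * M <= _).
    by apply: le_trans (ler_normB _ _) _; have := hM s; have := hM u; lra.
  have : r ^+ 2 <= (s - u) ^+ 2.
    by rewrite -[leRHS]real_normK ?num_real// distrC ler_sqr ?nnegrE ?(ltW r0).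
  move=> /(ler_wpM2l K0); rewrite {1}/K divfK ?expf_neq0 ?gt_eqF//; lra.
have var n : (0 < n)%N -> `|h u - bern u n (fun j => h (n%:R^-1 * j%:R)) 0| <= e / 2 + K * n%:R^-1.
  move=> n0; have nn0 : n%:R != 0 :> R by rewrite pnatr_eq0 -lt0n.
  have ub (b : R) (a : R) : a + b * ((n%:R^-1 * (0%:R + n%:R * u) - u) ^+ 2 + n%:R^-1 ^+ 2 * n%:R * u * (1 - u)) =
     a + b * (n%:R^-1 * (u * (1 - u))).
    by field.
  have uu : K * (n%:R^-1 * (u * (1 - u))) <= K * n%:R^-1.
    rewrite ler_wpM2l// ler_piMr ?invr_ge0//; nra.
  have lo : bern u n (fun j => (h u - e / 2) + (- K) * (n%:R^-1 * j%:R - u) ^+ 2) 0 <=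
      bern u n (fun j => h (n%:R^-1 * j%:R)) 0.
    apply: bern_le => // j; have := quad (n%:R^-1 * j%:R); rewrite ler_norml => /andP[h1 h2]; lra.
  have hi : bern u n (fun j => h (n%:R^-1 * j%:R)) 0 <=
      bern u n (fun j => (h u + e / 2) + K * (n%:R^-1 * j%:R - u) ^+ 2) 0.
    apply: bern_le => // j; have := quad (n%:R^-1 * j%:R); rewrite ler_norml => /andP[h1 h2]; lra.
  move: lo hi; rewrite !bern_quad !ub ler_norml => lo hi; apply/andP; split; lra.
near=> n; have n0 : (0 < n)%N by near: n; exists 1%N.
apply: le_trans (var n n0) _.
have : K * n%:R^-1 <= e / 2.
  rewrite ler_pdivrMr ?ltr0n// mulrC -ler_pdivrMr ?divr_gt0//.
  near: n; exact: nbhs_infty_ger.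
lra.
Unshelve. all: by end_near. Qed.

End bernstein.

(** * Entrywise convergence of matrices; sine as a bounded substitute for the identity *)

Section matrix_topology.
Context {R : realType}.

Lemma mx_cvg (T : Type) (F : set_system T) (FF : Filter F) p k (f : T -> 'M[R]_(p, k)) (l : 'M[R]_(p, k)) :
  (forall i j, f x i j @[x --> F] --> l i j) -> f x @[x --> F] --> l.
Proof.
move=> h; apply/cvg_ballP => e e0.
have hf (ij : 'I_p * 'I_k) : \forall x \near F, ball (l ij.1 ij.2) e (f x ij.1 ij.2).
  by have /cvg_ballP := h ij.1 ij.2; exact.
have := @filter_forall T _ (fun ij x => ball (l ij.1 ij.2) e (f x ij.1 ij.2)) F FF hf.
apply: filterS => x hx.
by split => // i j; exact: (hx (i, j)).
Qed.

Lemma mx_continuous (T : topologicalType) p k (f : T -> 'M[R]_(p, k)) :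
  (forall i j, continuous (fun x => f x i j)) -> continuous f.
Proof. by move=> h x; apply: mx_cvg => i j; exact: h. Qed.

Lemma sin_near_id (y : R) : `|sin y - y| <= `|y| ^+ 3.
Proof.
have pos (z : R) : 0 <= z -> `|sin z - z| <= z ^+ 3.
  move=> z0; have := @mvt_le R (fun x => sin x - x) (fun x => cos x - 1) 0 z (z ^+ 2 / 2) z0.
  rewrite sin0 !subr0 => h; apply: le_trans (h _ _) _.
  - move=> x x0 xz; rewrite distrC ger0_norm ?one_sub_cos_ge0//.
    apply: le_trans (one_sub_cos_le x) _; rewrite ler_wpM2r ?invr_ge0//.
    by rewrite ler_sqr ?nnegrE.
  - have -> : z ^+ 2 / 2 * z = z ^+ 3 / 2 by ring.
    have := exprn_ge0 3 z0; lra.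
have [y0|y0] := leP 0 y; first by rewrite (ger0_norm y0) pos.
have n0 : 0 <= - y by rewrite oppr_ge0 ltW.
by have := pos _ n0; rewrite sinN -opprD normrN -normrN (ltr0_norm y0) normrN.
Qed.

(** A bounded trigonometric stand-in for the coordinate [x]; the error is at most [|x|^3] over the
    square of [n.+1]. *)
Lemma cvg_scaled_sin (x : R) : n.+1%:R * sin (x / n.+1%:R) @[n --> \oo] --> x.
Proof.
apply/cvgrPdist_le => e e0; near=> n.
have N0 : 0 < n.+1%:R :> R by rewrite ltr0n.
have N1 : 1 <= n.+1%:R :> R by rewrite ler1n.
have -> : x - n.+1%:R * sin (x / n.+1%:R) = n.+1%:R * (x / n.+1%:R - sin (x / n.+1%:R)).
  by rewrite mulrBr mulrCA mulfV ?gt_eqF// mulr1.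
rewrite normrM (ger0_norm (ltW N0)) distrC.
apply: le_trans (ler_wpM2l (ltW N0) (sin_near_id _)) _.
rewrite normrM exprMn normfV (ger0_norm (ltW N0)).
have -> : n.+1%:R * (`|x| ^+ 3 * n.+1%:R^-1 ^+ 3) = `|x| ^+ 3 / n.+1%:R / n.+1%:R.
  by move: (n.+1%:R) N0 => N N0; field; rewrite gt_eqF.
apply: le_trans (_ : `|x| ^+ 3 / n.+1%:R <= _).
  by rewrite ler_pdivrMr// ler_peMr// divr_ge0 ?exprn_ge0// ltW.
rewrite ler_pdivrMr// mulrC -ler_pdivrMr//; apply: le_trans (_ : n%:R <= _); last by rewrite ler_nat.
near: n; exact: nbhs_infty_ger.
Unshelve. all: by end_near. Qed.

End matrix_topology.

(** * Equality in law from equality of characteristic functions *)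

Section cramer_wold.
Context {R : realType} {d : measure_display} {Omega : measurableType d}.
Variables (P : probability Omega R) (p k : nat) (xi zeta : Omega -> 'M[R]_(p, k)).
Implicit Types (F g : 'M[R]_(p, k) -> R) (c : 'I_p * 'I_k -> R) (a : 'I_p * 'I_k).

Definition mxdot c (x : 'M[R]_(p, k)) : R := \sum_a c a * x a.1 a.2.

Hypotheses (mxi : forall i j, measurable_fun setT (fun w => xi w i j))
  (mzeta : forall i j, measurable_fun setT (fun w => zeta w i j)).
Hypothesis same_trig : forall c phi,
  \int[P]_w cos (mxdot c (xi w) + phi) = \int[P]_w cos (mxdot c (zeta w) + phi).

Lemma mxdot_measurable (X : Omega -> 'M[R]_(p, k)) c : (forall i j, measurable_fun setT (fun w => X w i j)) ->
  measurable_fun setT (fun w => mxdot c (X w)).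
Proof. by move=> mX; apply: measurable_sum => a; apply: measurable_funM. Qed.

Lemma cos_measurable (f : Omega -> R) : measurable_fun setT f -> measurable_fun setT (fun w => cos (f w)).
Proof.
by move=> mf; apply: measurableT_comp mf; apply: continuous_measurable_fun; exact: continuous_cos.
Qed.

Lemma mcos_measurable (X : Omega -> 'M[R]_(p, k)) c phi : (forall i j, measurable_fun setT (fun w => X w i j)) ->
  measurable_fun setT (fun w => cos (mxdot c (X w) + phi)).
Proof.
by move=> mX; apply: cos_measurable; apply: measurable_funD => //; exact: mxdot_measurable.
Qed.

(** The waves in the test condition make the class stable under multiplication by a cosine, as a
    product of cosines is a half sum of cosines. Bounded pointwise limits then lead from
    trigonometric functions to all bounded continuous ones. *)
Definition trig_class F := [/\ exists M : R, forall x, `|F x| <= M,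
  measurable_fun setT (fun w => F (xi w)), measurable_fun setT (fun w => F (zeta w)) &
  forall c phi, \int[P]_w (F (xi w) * cos (mxdot c (xi w) + phi)) =
                \int[P]_w (F (zeta w) * cos (mxdot c (zeta w) + phi))].

Lemma trig_int F (X : Omega -> 'M[R]_(p, k)) c phi : (exists M : R, forall x, `|F x| <= M) ->
  (forall i j, measurable_fun setT (fun w => X w i j)) -> measurable_fun setT (fun w => F (X w)) ->
  P.-integrable setT (EFin \o (fun w => F (X w) * cos (mxdot c (X w) + phi))).
Proof.
move=> [M hM] mX mF; apply: (@bounded_int _ _ _ P _ (M)) => [|w].
  by apply: measurable_funM => //; exact: mcos_measurable.
rewrite normrM -[leRHS]mulr1; apply: ler_pM => //; exact: cos_max.
Qed.

Lemma trig_cst b : trig_class (fun=> b).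
Proof.
split => //; first by exists `|b|.
move=> c phi.
have i (X : Omega -> 'M[R]_(p, k)) : (forall i j, measurable_fun setT (fun w => X w i j)) ->
   P.-integrable setT (EFin \o (fun w => cos (mxdot c (X w) + phi))).
  move=> mX; apply: (@bounded_int _ _ _ P _ (1)) => [|w]; first exact: mcos_measurable.
  exact: cos_max.
by rewrite !RintegralZl ?same_trig//; exact: i.
Qed.

Lemma trigD F g : trig_class F -> trig_class g -> trig_class (fun x => F x + g x).
Proof.
move=> [[M hM] m1 m2 e] [[M' hM'] m1' m2' e']; split.
- by exists (M + M') => x; apply: le_trans (ler_normD _ _) _; apply: lerD.
- exact: measurable_funD.
- exact: measurable_funD.
- move=> c phi.
  have hd (X : Omega -> 'M[R]_(p, k)) : (forall i j, measurable_fun setT (fun w => X w i j)) ->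
      measurable_fun setT (fun w => F (X w)) -> measurable_fun setT (fun w => g (X w)) ->
      \int[P]_w ((F (X w) + g (X w)) * cos (mxdot c (X w) + phi)) =
      \int[P]_w (F (X w) * cos (mxdot c (X w) + phi)) + \int[P]_w (g (X w) * cos (mxdot c (X w) + phi)).
    move=> mX mF mg; rewrite -RintegralD//; [|by apply: trig_int => //; exists M|by apply: trig_int => //; exists M'].
    by apply: eq_Rintegral => w _; rewrite mulrDl.
  by rewrite !hd// e e'.
Qed.

Lemma trigZ b F : trig_class F -> trig_class (fun x => b * F x).
Proof.
move=> [[M hM] m1 m2 e]; split.
- by exists (`|b| * M) => x; rewrite normrM ler_wpM2l.
- exact: measurable_funM.
- exact: measurable_funM.
- move=> c phi.
  have hd (X : Omega -> 'M[R]_(p, k)) : (forall i j, measurable_fun setT (fun w => X w i j)) ->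
      measurable_fun setT (fun w => F (X w)) ->
      \int[P]_w (b * F (X w) * cos (mxdot c (X w) + phi)) =
      b * \int[P]_w (F (X w) * cos (mxdot c (X w) + phi)).
    move=> mX mF; rewrite -RintegralZl//; last by apply: trig_int => //; exists M.
    by apply: eq_Rintegral => w _; rewrite mulrA.
  by rewrite !hd// e.
Qed.

Lemma cos_cos (x y : R) : cos x * cos y = (cos (x + y) + cos (x - y)) / 2.
Proof. by rewrite cosD cosB; field. Qed.

Lemma trig_cos F c0 phi0 : trig_class F -> trig_class (fun x => F x * cos (mxdot c0 x + phi0)).
Proof.
move=> [[M hM] m1 m2 e]; split.
- by exists M => x; rewrite normrM -[leRHS]mulr1; apply: ler_pM => //; exact: cos_max.
- by apply: measurable_funM => //; exact: mcos_measurable.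
- by apply: measurable_funM => //; exact: mcos_measurable.
- move=> c phi.
  have hd (X : Omega -> 'M[R]_(p, k)) : (forall i j, measurable_fun setT (fun w => X w i j)) ->
      measurable_fun setT (fun w => F (X w)) ->
      \int[P]_w (F (X w) * cos (mxdot c0 (X w) + phi0) * cos (mxdot c (X w) + phi)) =
      2^-1 * \int[P]_w (F (X w) * cos (mxdot (fun a => c0 a + c a) (X w) + (phi0 + phi))) +
      2^-1 * \int[P]_w (F (X w) * cos (mxdot (fun a => c0 a - c a) (X w) + (phi0 - phi))).
    move=> mX mF; have hb : exists M : R, forall x, `|F x| <= M by exists M.
    have i1 := trig_int (fun a => c0 a + c a) (phi0 + phi) hb mX mF.
    have i2 := trig_int (fun a => c0 a - c a) (phi0 - phi) hb mX mF.
    have half (f : Omega -> R) : P.-integrable setT (EFin \o f) ->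
      2^-1 * \int[P]_w f w = \int[P]_w (2^-1 * f w) by move=> i; rewrite RintegralZl.
    have ihalf (f : Omega -> R) : P.-integrable setT (EFin \o f) ->
        P.-integrable setT (EFin \o (fun w => 2^-1 * f w)).
      by move=> i; exact: eq_integrable (integrableZl measurableT 2^-1 i).
    rewrite (half _ i1) (half _ i2).
    rewrite -(RintegralD measurableT (ihalf _ i1) (ihalf _ i2)).
    apply: eq_Rintegral => w _; rewrite -mulrA cos_cos.
    have -> : mxdot c0 (X w) + phi0 + (mxdot c (X w) + phi) =
        mxdot (fun a => c0 a + c a) (X w) + (phi0 + phi).
      by rewrite addrACA /mxdot -big_split; congr (_ + _); apply: eq_bigr => a _; rewrite mulrDl.
    have -> : mxdot c0 (X w) + phi0 - (mxdot c (X w) + phi) =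
        mxdot (fun a => c0 a - c a) (X w) + (phi0 - phi).
      by rewrite opprD addrACA /mxdot -sumrB; congr (_ + _); apply: eq_bigr => a _; rewrite mulrBl.
    by ring.
  by rewrite !hd// !e.
Qed.

Lemma trig_lim (Fn : nat -> 'M[R]_(p, k) -> R) F M : (forall n, trig_class (Fn n)) ->
  (forall n x, `|Fn n x| <= M) -> (forall x, Fn n x @[n --> \oo] --> F x) -> trig_class F.
Proof.
move=> hF hM hl.
have FM x : `|F x| <= M.
  have hc : `|Fn n x| @[n --> \oo] --> `|F x| by apply: cvg_norm; exact: hl.
  rewrite -(cvg_lim _ hc)//; apply: limr_le; first by apply/cvg_ex; exists `|F x|.
  by near=> n; exact: hM.
have mF (X : Omega -> 'M[R]_(p, k)) : (forall n, measurable_fun setT (fun w => Fn n (X w))) -> measurable_fun setT (fun w => F (X w)).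
  by move=> mX; apply: (@measurable_fun_cvg _ _ _ setT (fun n w => Fn n (X w)) (fun w => F (X w)) mX) => w _; exact: hl.
have m1 : measurable_fun setT (fun w => F (xi w)) by apply: mF => n; have [] := hF n.
have m2 : measurable_fun setT (fun w => F (zeta w)) by apply: mF => n; have [] := hF n.
split => //; first by exists M.
move=> c phi.
have hc (X : Omega -> 'M[R]_(p, k)) : (forall i j, measurable_fun setT (fun w => X w i j)) ->
    (forall n, measurable_fun setT (fun w => Fn n (X w))) -> measurable_fun setT (fun w => F (X w)) ->
    \int[P]_w (Fn n (X w) * cos (mxdot c (X w) + phi)) @[n --> \oo] -->
    \int[P]_w (F (X w) * cos (mxdot c (X w) + phi)).
  move=> mX mn mFX; apply: (bounded_cvg (M := M)).
  - by move=> n; apply: measurable_funM => //; exact: mcos_measurable.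
  - by apply: measurable_funM => //; exact: mcos_measurable.
  - by move=> n w; rewrite normrM -[leRHS]mulr1; apply: ler_pM => //; exact: cos_max.
  - by apply: aeW => w; apply: cvgMr_tmp; exact: hl.
have h1 := hc xi mxi (fun n => let: And4 _ m _ _ := hF n in m) m1.
have h2 := hc zeta mzeta (fun n => let: And4 _ _ m _ := hF n in m) m2.
have e n : \int[P]_w (Fn n (xi w) * cos (mxdot c (xi w) + phi)) =
    \int[P]_w (Fn n (zeta w) * cos (mxdot c (zeta w) + phi)) by have [_ _ _ ->] := hF n.
by move: h1; rewrite (funext e) => h1; exact: (cvg_unique _ h1 h2).
Unshelve. all: by end_near. Qed.

(** A trigonometric function of one entry with values in [[0, 1]], the interval on which Bernstein
    polynomials operate. *)
Definition usin (L : R) a (x : 'M[R]_(p, k)) : R := (1 + sin (x a.1 a.2 / L)) / 2.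

Lemma usin01 L a x : 0 <= usin L a x <= 1.
Proof.
rewrite /usin; have := sin_le1 (x a.1 a.2 / L); have := sin_geN1 (x a.1 a.2 / L).
by move=> h1 h2; apply/andP; split; lra.
Qed.

Lemma usin_cos L a x : usin L a x =
  2^-1 + 2^-1 * cos (mxdot (fun b => (b == a)%:R / L) x + - (pi / 2)).
Proof.
rewrite /usin cosBpihalf /mxdot (bigD1 a)//= eqxx mul1r big1 ?addr0.
  by rewrite (mulrC L^-1); field.
by move=> b /negbTE ->; rewrite !mul0r.
Qed.

Lemma trig_ext F g : F =1 g -> trig_class F -> trig_class g.
Proof. by move=> /funext ->. Qed.

Lemma trig_usin L a F : trig_class F -> trig_class (fun x => usin L a x * F x).
Proof.
move=> hF; apply: trig_ext (trigD (trigZ 2^-1 hF)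
  (trigZ 2^-1 (trig_cos (fun b => (b == a)%:R / L) (- (pi / 2)) hF))) => x.
by rewrite usin_cos; ring.
Qed.

Lemma trig_bern L a (G : nat -> 'M[R]_(p, k) -> R) n j : (forall i, trig_class (G i)) ->
  trig_class (fun x => bern (usin L a x) n (fun i => G i x) j).
Proof.
move=> hG; elim: n j => [|n IH] j //=.
apply: trigD; first exact: trig_usin.
apply: trig_ext (trigD (IH j) (trigZ (-1) (trig_usin L a (IH j)))) => x; ring.
Qed.

Definition upd a (v : R) (x : 'M[R]_(p, k)) : 'M[R]_(p, k) :=
  \matrix_(i, j) if (i, j) == a then v else x i j.

Lemma upd_continuousl a x : continuous (fun v => upd a v x).
Proof.
apply: mx_continuous => i j; under eq_fun do rewrite mxE.
by case: eqP => _ v; [exact: cvg_id|exact: cvg_cst].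
Qed.

Lemma upd_continuousr a v : continuous (upd a v).
Proof.
apply: mx_continuous => i j; under eq_fun do rewrite mxE.
by case: eqP => _; [exact: cst_continuous|exact: coord_continuous].
Qed.

(** Zeroing the entries outside [s] permits an induction on the set of entries that a test function
    sees. *)
Fixpoint mask_mx (s : seq ('I_p * 'I_k)) (x : 'M[R]_(p, k)) :=
  if s is a :: s' then upd a (x a.1 a.2) (mask_mx s' x) else 0.

Lemma mask_mxE s x i j : mask_mx s x i j = if (i, j) \in s then x i j else 0.
Proof.
elim: s => [|a s IH] /=; first by rewrite mxE.
by rewrite mxE inE; case: eqP => [<-|].
Qed.

(** Each entry is freed by two limits: [x_a] is the limit of [L sin (x_a / L)], and a function of
    the latter is the limit of its Bernstein polynomials in [usin]. Their coefficients involve the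
    other entries only and lie in the class by induction. *)
Lemma trig_mask s g : continuous g -> (exists M : R, forall x, `|g x| <= M) ->
  trig_class (fun x => g (mask_mx s x)).
Proof.
elim: s g => [|a s IH] g cg [M hM] /=; first exact: trig_cst.
apply: (@trig_lim (fun n x => g (upd a (n.+1%:R * sin (x a.1 a.2 / n.+1%:R)) (mask_mx s x))) _ M) => //; last first.
  move=> x; apply: (@continuous_cvg _ _ _ _ _ _ (fun v => g (upd a v (mask_mx s x)))).
    by apply: (@continuous_comp _ _ _ (fun v => upd a v (mask_mx s x)) g); [exact: upd_continuousl|exact: cg].
  exact: cvg_scaled_sin.
move=> n; set L : R := n.+1%:R.
(* [L (2 v - 1)] recovers [L sin (x_a / L)] from [v = usin L a x], so [h x] at that point is the
   function to approximate. *)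
pose h x (v : R) := g (upd a (L * (2 * v - 1)) (mask_mx s x)).
apply: (@trig_lim (fun m x => bern (usin L a x) m (fun j => h x (m%:R^-1 * j%:R)) 0) _ M).
- move=> m; apply: trig_bern => j.
  apply: (IH (fun y => g (upd a (L * (2 * (m%:R^-1 * j%:R) - 1)) y))); last by exists M => y; exact: hM.
  by move=> y; apply: (@continuous_comp _ _ _ (upd a _) g); [exact: upd_continuousr|exact: cg].
- by move=> m x; apply: bern_bound => [|j]; [exact: usin01|exact: hM].
- move=> x; have -> : g (upd a (L * sin (x a.1 a.2 / L)) (mask_mx s x)) = h x (usin L a x).
    by rewrite /h /usin; congr (g (upd _ (_ * _) _)); field.
  apply: (bern_cvg (M := M)); [exact: usin01| |by move=> v; exact: hM].
  apply: (@continuous_comp R R R (fun v : R => L * (2 * v - 1)) (fun v => g (upd a v (mask_mx s x)))).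
    by apply: cvgMl_tmp; apply: cvgB; [apply: cvgMl_tmp; exact: cvg_id|exact: cvg_cst].
  by apply: (@continuous_comp _ _ _ (fun v => upd a v (mask_mx s x)) g); [exact: upd_continuousl|exact: cg].
Qed.

Lemma cramer_wold g : continuous g -> (exists M : R, forall x, `|g x| <= M) ->
  \int[P]_w g (xi w) = \int[P]_w g (zeta w).
Proof.
move=> cg hg; have [_ _ _ /(_ (fun=> 0) 0)] := trig_mask (enum [set: 'I_p * 'I_k]%SET) cg hg.
have e x : mask_mx (enum [set: 'I_p * 'I_k]%SET) x = x.
  by apply/matrixP => i j; rewrite mask_mxE mem_enum inE.
have c x : cos (mxdot (fun=> 0) x + 0) = 1.
  by rewrite addr0 /mxdot big1 ?cos0// => a _; rewrite mul0r.
by under eq_Rintegral do rewrite e c mulr1; under [RHS]eq_Rintegral do rewrite e c mulr1.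
Qed.

End cramer_wold.

(** * Time reversal of integrals and their convergence at infinity *)

Section time_reversal.
Context {R : realType} {d : measure_display} {Omega : measurableType d}.
Variables (P : probability Omega R) (H : R) (B : R -> Omega -> R).
Hypotheses (H0 : 0 < H) (H1 : H < 1) (B_fBM : fBM P H B).

Lemma stoch_integral_lin t n (c : 'I_n -> R) (f : 'I_n -> R -> R) (I : 'I_n -> Omega -> R) : 0 <= t ->
  (forall i, stoch_integral P B t (f i) (I i)) ->
  stoch_integral P B t (fun u => \sum_i c i * f i u) (\sum_i c i *: I i).
Proof.
move=> t0 hI.
have LI : L2 P (\sum_i c i *: I i).
  by apply: L2_sum => i _; apply: L2Z; exact: inB_L2 (stoch_inB B_fBM t0 (hI i)).
split; first exact: L2_measurable LI.
move=> e e0; have s0 : 0 < Num.sqrt e by rewrite sqrtr_gt0.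
have [r r0 hr] := stoch_lin B_fBM c t0 hI s0; exists r => // m s tau hs ht htag.
have htag' : tagged s tau m r by move=> k /htag[h1 h2 /ltW h3].
have hs0 : 0 <= s 0%N by rewrite hs.
have LS := rsum_L2 B_fBM (fun u => \sum_i c i * f i u) htag' hs0.
rewrite (_ : (fun w => _) = (fun w => (rsum B (fun u => \sum_i c i * f i u) m s tau - \sum_i c i *: I i) w ^+ 2)); last first.
  by apply/funext => w; rewrite rsumE.
apply: sqr_of_L2; first exact: L2B.
by rewrite -sqr_nm -(sqr_sqrtr (ltW e0)) ler_sqr ?nnegrE ?nm_ge0 ?sqrtr_ge0//; exact: hr.
Qed.

Lemma loclip_shift f s : loclip f -> loclip (fun v : R => f (v - s)).
Proof.
move=> hf M; have [L [L0 hL]] := loclip_ab (- M - s) (M - s) hf.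
exists L; split => // x y /andP[x1 x2] /andP[y1 y2].
have -> : x - y = (x - s) - (y - s) by ring.
by apply: hL; rewrite !lerD2r; apply/andP.
Qed.

Lemma ugrid_rev (l T : R) n k : (k <= n.+1)%N ->
  T - ugrid 0 l n k = ugrid (T - l) T n (n.+1 - k).
Proof.
move=> kn; rewrite /ugrid add0r subr0 natrB//.
have nn : n.+1%:R != 0 :> R by rewrite pnatr_eq0.
by move: (n.+1%:R) nn => N nn; field.
Qed.

(** Reflection carries midpoint tags to midpoint tags and reverses the order of the cells. *)
Lemma rsum_rev f (l T : R) n :
  \sum_(k < n.+1) f (l - mid (ugrid 0 l n) k) *: (B (T - ugrid 0 l n k) - B (T - ugrid 0 l n k.+1)) =
  rsum B (fun v => f (v - (T - l))) n.+1 (ugrid (T - l) T n) (mid (ugrid (T - l) T n)).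
Proof.
rewrite /rsum (reindex_inj rev_ord_inj)/=; apply: eq_bigr => k _.
have kn := ltn_ord k.
have e1 : T - ugrid 0 l n (n.+1 - k.+1) = ugrid (T - l) T n k.+1.
  by rewrite ugrid_rev ?leq_subr// subKn.
have e2 : T - ugrid 0 l n (n.+1 - k.+1).+1 = ugrid (T - l) T n k.
  by rewrite -subSn// subSS ugrid_rev ?leq_subr// subKn// ltnW.
rewrite e1 e2; congr (f _ *: _); rewrite /mid -e1 -e2.
by move: (ugrid _ _ _ _) (ugrid _ _ _ _.+1) => a b; field.
Qed.

(** All integrals are reflected about one point [T], so joint covariances survive although the upper
    ends [T - s b] differ. On the right the integrand is free of [T], and only the upper end moves
    with [T], which allows a limit. *)
Lemma reversed_nm (K : finType) (c : K -> R) (s : K -> R) (T : R) (f : K -> R -> R)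
  (F : K -> Omega -> R) (G : K -> R -> Omega -> R) :
  (forall b, 0 <= s b <= T) -> (forall b, loclip (f b)) ->
  (forall b, stoch_integral P B (T - s b) (fun u => f b (T - s b - u)) (F b)) ->
  (forall b, sews P H B (fun v => f b (v - s b)) (G b)) ->
  nm P (\sum_b c b *: F b) = nm P (\sum_b c b *: (G b T - G b (s b))).
Proof.
move=> hs hf hF hG.
have l0 b : 0 <= T - s b by rewrite subr_ge0; case/andP: (hs b).
have sb0 b : 0 <= s b by case/andP: (hs b).
have sbT b : s b <= T by case/andP: (hs b).
have Ts b : T - (T - s b) = s b by rewrite subKr.
have LF b : L2 P (F b) by exact: inB_L2 (stoch_inB B_fBM (l0 b) (hF b)).
have LG b : L2 P (G b T - G b (s b)).
  have [hB _ _] := hG b; apply: L2B; apply: inB_L2; apply: hB => //; exact: le_trans (sbT b).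
pose U n b := rsum B (fun u => f b (T - s b - u)) n.+1 (ugrid 0 (T - s b) n) (mid (ugrid 0 (T - s b) n)).
pose V n b := rsum B (fun v => f b (v - s b)) n.+1 (ugrid (s b) T n) (mid (ugrid (s b) T n)).
have tU n b : tagged (ugrid 0 (T - s b) n) (mid (ugrid 0 (T - s b) n)) n.+1 ((T - s b - 0) / n.+1%:R).
  move=> k kn; have [h1 h2 h3] := @ugrid_tagged _ 0 (T - s b) n (l0 b) k kn.
  rewrite /mid; split => //; move: (ugrid _ _ _ _) (ugrid _ _ _ _.+1) h1 h2 h3 => x y h1 h2 h3; lra.
have LU n b : L2 P (U n b) by apply: (rsum_L2 B_fBM _ (tU n b)); rewrite ugrid0.
have tV n b : tagged (ugrid (s b) T n) (mid (ugrid (s b) T n)) n.+1 ((T - s b) / n.+1%:R).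
  move=> k kn; have [h1 h2 h3] := @ugrid_tagged _ (s b) T n (sbT b) k kn.
  rewrite /mid; split => //; move: (ugrid _ _ _ _) (ugrid _ _ _ _.+1) h1 h2 h3 => x y h1 h2 h3; lra.
have LV n b : L2 P (V n b) by apply: (rsum_L2 B_fBM _ (tV n b)); rewrite ugrid0.
have UV n : nm P (\sum_b c b *: U n b) = nm P (\sum_b c b *: V n b).
  have flat (W : K -> 'I_n.+1 -> Omega -> R) (x : K -> 'I_n.+1 -> R) :
      \sum_b c b *: (\sum_k x b k *: W b k) = \sum_(a : K * 'I_n.+1) (c a.1 * x a.1 a.2) *: W a.1 a.2.
    rewrite -(pair_bigA _ (fun b k => (c b * x b k) *: W b k))/=; apply: eq_bigr => b _.
    by rewrite scaler_sumr; apply: eq_bigr => k _; rewrite scalerA.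
  have -> : \sum_b c b *: V n b = \sum_b c b *: (\sum_(k < n.+1)
     f b (T - s b - mid (ugrid 0 (T - s b) n) k) *:
       (B (T - ugrid 0 (T - s b) n k) - B (T - ugrid 0 (T - s b) n k.+1))).
    by apply: eq_bigr => b _; congr (_ *: _); rewrite rsum_rev Ts.
  rewrite /U /rsum !flat.
  have rng b k : (k <= n.+1)%N -> 0 <= ugrid 0 (T - s b) n k <= T.
    move=> kn; rewrite /ugrid add0r subr0 divr_ge0 ?mulr_ge0 ?l0//=.
    apply: le_trans (_ : T - s b <= _); last by rewrite gerBl sb0.
    by rewrite ler_pdivrMr// ler_wpM2l ?l0// ler_nat.
  have := @reversal _ _ _ P H B B_fBM _ (index_enum (K * 'I_n.+1)%type)
    (fun a => c a.1 * f a.1 (T - s a.1 - mid (ugrid 0 (T - s a.1) n) a.2))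
    (fun a => ugrid 0 (T - s a.1) n a.2.+1) (fun a => ugrid 0 (T - s a.1) n a.2) T.
  by apply => a; apply: rng => //; exact: ltnW.
pose C := 1 + \sum_b `|c b|; have C0 : 0 < C by rewrite /C ltr_pwDl// sumr_ge0.
have Cb b : `|c b| <= C.
  by rewrite /C (bigD1 b)//= addrCA lerDl addr_ge0// sumr_ge0.
have closeS (W W' : K -> Omega -> R) e : (forall b, L2 P (W b)) -> (forall b, L2 P (W' b)) ->
    (forall b, nm P (W b - W' b) <= e) ->
    `|nm P (\sum_b c b *: W b) - nm P (\sum_b c b *: W' b)| <= (\sum_b `|c b|) * e.
  move=> LW LW' h; apply: le_trans (nm_sub _ _) _; try by apply: L2_sum => b _; exact: L2Z.
  rewrite -sumrB; under eq_bigr do rewrite -scalerBr.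
  apply: le_trans (nm_sum _ _) _; first by move=> b; exact/L2Z/L2B.
  by rewrite mulr_suml; apply: ler_sum => b _; rewrite nmZ ?ler_wpM2l//; exact: L2B.
apply/eqP; rewrite -subr_eq0 -normr_le0; apply/ler_addgt0Pr => e e0; rewrite add0r.
pose eta := e / (2 * C); have eta0 : 0 < eta by rewrite divr_gt0// mulr_gt0.
have /choice[r hr] : forall b, exists r, 0 < r /\
    (forall n, (T - s b) / n.+1%:R < r -> nm P (U n b - F b) <= eta /\
      nm P (V n b - (G b T - G b (s b))) <= eta).
  move=> b; have [r1 r10 h1] := stoch_nm B_fBM (l0 b) (hF b) eta0.
  have [L hL] := loclip_ab (s b - 1) T (loclip_shift (s b) (hf b)).
  have L0 : 0 <= L by case: hL.
  have K0 : 0 <= 3 * L * (T - s b) by rewrite !mulr_ge0// l0.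
  have [r2 r20 h2] := mesh_exists H0 K0 eta0.
  exists (Num.min r1 r2); split; first by rewrite lt_min r10.
  move=> n; rewrite lt_min => /andP[n1 n2]; split.
    have [_ ] := h1 n.+1 (ugrid 0 (T - s b) n) (mid (ugrid 0 (T - s b) n)) (ugrid0 _ _ _) (ugrid_top _ _ _)
      (ugrid_mid (l0 b) n1); exact.
  apply: le_trans (rsum_close H0 B_fBM (hG b) (sb0 b) (sbT b) (ltW r20) hL (ugrid0 _ _ _) (ugrid_top _ _ _) _) _.
    exact: tagged_le (ltW n2) (tV n b).
  by rewrite mulrAC.
have [n hn] : exists n, forall b, (T - s b) / n.+1%:R < r b.
  have /choice[n0 hn0] : forall b, exists n0, forall n, (n0 <= n)%N -> (T - s b) / n.+1%:R < r b.
    by move=> b; apply: ugrid_fine; [exact: l0|exact: (hr b).1].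
  by exists (\max_b n0 b)%N => b; apply: hn0; exact: leq_bigmax.
have h1 := closeS (U n) F eta (LU n) LF (fun b => ((hr b).2 n (hn b)).1).
have h2 := closeS (V n) (fun b => G b T - G b (s b)) eta (LV n) LG (fun b => ((hr b).2 n (hn b)).2).
have h3 : (\sum_b `|c b|) * eta <= e / 2.
  apply: le_trans (_ : C * eta <= _); first by rewrite ler_wpM2r ?(ltW eta0)// /C lerDr.
  have Cn := lt0r_neq0 C0; have <- : C * eta = e / 2 by rewrite /eta; move: (C) Cn => C' Cn; field.
  exact: lexx.
move: h1 h2; rewrite UV => h1 h2.
move: (nm P (\sum_b c b *: V n b)) (nm P (\sum_b c b *: F b)) (nm P (\sum_b c b *: (G b T - G b (s b)))) h1 h2 => x y z h1 h2.
move: h1 h2; rewrite !ler_norml => /andP[h11 h12] /andP[h21 h22]; apply/andP; split; lra.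
Qed.

(** The Lipschitz constant decays along with the function, as the local expansion requires on remote
    intervals. *)
Definition declip (f : R -> R) := exists C c, [/\ 0 <= C, 0 < c,
  forall s, 0 <= s -> `|f s| <= C * expR (- c * s) &
  forall a b, 0 <= a -> lip f (C * expR (- c * a)) a b].

(** Over a step from [a] of length at most 1 the expansion error is at most [2 C expR (- c (a - 1))]
    and the leading term at most [C expR (- c a)], hence [K]. Integer times form a geometric series,
    and any other time is one step away. *)
Lemma sews_infty f J : sews P H B f J -> declip f -> exists Y C c, [/\ inB P B Y, 0 <= C, 0 < c &
  forall t, 1 <= t -> nm P (J t - Y) <= C * expR (- c * t)].
Proof.
move=> [hJ _ hsew] [C [c [C0 c0 hf hlip]]].
have LJ t : 0 <= t -> L2 P (J t) by move=> /hJ /inB_L2.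
have ec : 1 <= expR c by rewrite -expR0 ler_expR ltW.
pose K := 3 * C * expR c; have K0 : 0 <= K by rewrite /K !mulr_ge0// expR_ge0.
have step a b : 1 <= a -> a <= b -> b <= a + 1 -> nm P (J b - J a) <= K * expR (- c * a).
  move=> a1 ab ba; have a0 : 0 <= a by lra.
  have b0 : 0 <= b by lra.
  have am : 0 <= a - 1 by lra.
  have LX := incr_L2 B_fBM b0 a0.
  have h := hsew _ a b a0 ab (hlip (a - 1) b am).
  have -> : J b - J a = (J b - J a - f a *: (B b - B a)) + f a *: (B b - B a) by rewrite subrK.
  apply: le_trans (nmD _ (L2Z _ LX)) _; first by apply: L2B; [apply: L2B; exact: LJ|exact: L2Z].
  have ba1 : (b - a) `^ H <= 1.
    have <- : (1 : R) `^ H = 1 by rewrite powR1.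
    by apply: ge0_ler_powR; rewrite ?nnegrE ?(ltW H0)//; lra.
  have n1 : nm P (f a *: (B b - B a)) <= C * expR (- c * a).
    rewrite nmZ// -[leRHS]mulr1; apply: ler_pM => //; [exact: nm_ge0|exact: hf|].
    by rewrite (incr_nm H0 B_fBM)// ger0_norm ?subr_ge0.
  have ea : expR (- c * (a - 1)) = expR c * expR (- c * a).
    by rewrite -expRD; congr expR; ring.
  have n2 : 2 * (C * expR (- c * (a - 1))) * (b - a) * (b - a) `^ H <= 2 * (C * expR (- c * (a - 1))).
    rewrite -mulrA; apply: ler_piMr; first by rewrite !mulr_ge0// expR_ge0.
    by rewrite -[leRHS]mulr1; apply: ler_pM => //; [lra|exact: powR_ge0|lra].
  apply: le_trans (lerD (le_trans h n2) n1) _; rewrite ea /K.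
  have : C * expR (- c * a) <= C * expR (- c * a) * expR c.
    by rewrite ler_peMr// mulr_ge0// expR_ge0.
  lra.
pose rho := expR (- c); have r0 : 0 <= rho by exact: expR_ge0.
have r1 : rho < 1 by rewrite /rho -expR0 ltr_expR oppr_lt0.
have rn n : expR (- c * n%:R) = rho ^+ n by rewrite -expRM_natr.
have LJn n : L2 P (J n.+1%:R) by exact: LJ.
have hstep n : nm P (J n.+2%:R - J n.+1%:R) <= K * rho ^+ n.
  apply: le_trans (step n.+1%:R n.+2%:R _ _ _) _; rewrite ?ler1n ?ler_nat//.
    by rewrite -(natr1 n.+1).
  rewrite ler_wpM2l// rn exprS ler_piMl ?exprn_ge0// ltW//.
have [Y LY hY] := L2_complete LJn r0 r1 hstep.
have d0 : 0 < 1 - rho by rewrite subr_gt0.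
have bound t : 1 <= t -> nm P (J t - Y) <= (K + K / (1 - rho)) * expR (2 * c) * expR (- c * t).
  move=> t1; have t0 : 0 <= t by lra.
  pose n := (Num.truncn t).-1.
  have nt : n.+1 = Num.truncn t.
    rewrite /n prednK//; rewrite -ltnS -(@ltr_nat R); apply: le_lt_trans t1 _; exact: truncnS_gt.
  have h1 : n.+1%:R <= t by rewrite nt truncn_le.
  have h2 : t < n.+1%:R + 1 by rewrite natr1 nt truncnS_gt.
  have b1 := step n.+1%:R t (ler1n _ _) h1 (ltW h2).
  apply: le_trans (nm_dist (LJ t t0) (LJn n) LY) _.
  apply: le_trans (lerD b1 (hY n)) _.
  have e1 : expR (- c * n.+1%:R) <= expR (2 * c) * expR (- c * t).
    rewrite -expRD ler_expR; have : c * t <= c * (n.+1%:R + 1) by rewrite ler_wpM2l ?(ltW c0) ?(ltW h2).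
    lra.
  have e2 : rho ^+ n <= expR (2 * c) * expR (- c * t).
    rewrite -rn -expRD ler_expR; have : c * t <= c * (n.+1%:R + 1) by rewrite ler_wpM2l ?(ltW c0) ?(ltW h2).
    by rewrite -(natr1 n); lra.
  rewrite -[leRHS]mulrA mulrDl; apply: lerD; first by rewrite ler_wpM2l.
  by rewrite mulrAC ler_wpM2l// divr_ge0// ltW.
exists Y, ((K + K / (1 - rho)) * expR (2 * c)), c; split => //; last first.
  by rewrite mulr_ge0 ?expR_ge0// addr_ge0// divr_ge0// ltW.
apply: (inB_lim B_fBM) => // e e0; pose D := (K + K / (1 - rho)) * expR (2 * c).
have : (D * rho ^+ n) @[n --> \oo] --> (D * 0 : R).
  by apply: cvgMl_tmp; apply: cvg_expr; rewrite ger0_norm.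
rewrite mulr0 => /cvgrPdist_le /(_ _ e0)[n _ /(_ n.+1 (leqnSn _))].
rewrite sub0r normrN => hn; exists (J n.+1%:R); first exact: hJ.
rewrite nmBC//; apply: le_trans (bound n.+1%:R (ler1n _ _)) _.
by rewrite rn; apply: le_trans (ler_norm _) hn.
Qed.

End time_reversal.

(** * Regularity and decay of the entries of the exponential *)

Section state_functions.
Context {R : realType} (p : nat) (A : 'M[R]_p).

Lemma mxE_der m n (M : 'M[R]_(m, p)) (N : 'M[R]_(p, n)) i j (x : R) :
  is_derive x (1 : R) (fun v => (M *m E A v *m N) i j) ((M *m A *m E A x *m N) i j).
Proof.
by have := is_dmx_mul (is_dmx_lE A M x) (is_dmx_cst N x) i j; rewrite mulmx0 addr0.
Qed.

Lemma loclip_of_derive (f g : R -> R) : (forall x : R, is_derive x (1 : R) f (g x)) -> continuous g -> loclip f.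
Proof.
move=> df cg M; have [M0|M0] := ltP M 0.
  exists 0; split => // x y /andP[x1 x2]; have := le_trans x1 x2; lra.
have MM : - M <= M by lra.
have [|c cM hc] := @EVT_max R (fun x => `|g x|) (- M) M MM.
  by apply: continuous_subspaceT => x; apply: (@continuous_comp _ _ _ g Num.norm); [exact: cg|exact: norm_continuous].
exists `|g c|; split => // x y /andP[x1 x2] /andP[y1 y2].
have gb z : - M <= z -> z <= M -> `|g z| <= `|g c| by move=> z1 z2; apply: hc; rewrite in_itv/= z1.
have [xy|yx] := leP x y.
  rewrite distrC (distrC x) (ger0_norm (_ : 0 <= y - x)) ?subr_ge0//.
  apply: mvt_le xy df _ => z z1 z2; apply: gb; lra.
rewrite (ger0_norm (_ : 0 <= x - y)) ?subr_ge0 ?(ltW yx)//.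
apply: mvt_le (ltW yx) df _ => z z1 z2; apply: gb; lra.
Qed.

Lemma mxE_cont m n (M : 'M[R]_(m, p)) (N : 'M[R]_(p, n)) i j :
  continuous (fun v => (M *m E A v *m N) i j).
Proof. by move=> x; apply: cont_of_derive; move=> y; exact: mxE_der. Qed.

Lemma mxE_loclip m n (M : 'M[R]_(m, p)) (N : 'M[R]_(p, n)) i j :
  loclip (fun v => (M *m E A v *m N) i j).
Proof. by apply: loclip_of_derive (mxE_der M N i j) _; exact: mxE_cont. Qed.

Lemma loclip_opp (f : R -> R) : loclip f -> loclip (fun u => f (- u)).
Proof.
move=> hf M; have [L [L0 hL]] := hf M; exists L; split => // x y /andP[x1 x2] /andP[y1 y2].
have -> : `|x - y| = `|- x - - y| by rewrite -normrN; congr Num.norm; ring.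
apply: hL; apply/andP; split; lra.
Qed.

Lemma loclip_cst (c : R) : loclip (fun=> c).
Proof. by move=> M; exists 0; split => // x y _ _; rewrite subrr normr0 mul0r. Qed.

Lemma declip_of_decays (f g : R -> R) : (forall x : R, is_derive x (1 : R) f (g x)) ->
  decays f -> decays g -> declip f.
Proof.
move=> df hf hg; have [C [c [C0 c0 h]]] := decays_common hf hg.
exists C, c; split => // [s s0|a b a0]; first by have [] := h s s0.
split; first by rewrite mulr_ge0// expR_ge0.
have gb z : a <= z -> `|g z| <= C * expR (- c * a).
  move=> az; have [_] := h z (le_trans a0 az); move/le_trans; apply.
  by rewrite ler_wpM2l// ler_expR !mulNr lerN2 ler_wpM2l// ltW.
move=> x y /andP[x1 x2] /andP[y1 y2]; have [xy|yx] := leP x y.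
  rewrite distrC (distrC x) (ger0_norm (_ : 0 <= y - x)) ?subr_ge0//.
  apply: mvt_le xy df _ => z z1 z2; apply: gb; lra.
rewrite (ger0_norm (_ : 0 <= x - y)) ?subr_ge0 ?(ltW yx)//.
apply: mvt_le (ltW yx) df _ => z z1 z2; apply: gb; lra.
Qed.

Hypothesis A_stable : eigenvalues_Re_lt0 A.

Lemma mxE_decays m n (M : 'M[R]_(m, p)) (N : 'M[R]_(p, n)) i j :
  decays (fun v => (M *m E A v *m N) i j).
Proof.
have -> : (fun v => (M *m E A v *m N) i j) = (fun v => \sum_k \sum_l (M i l * N k j) * E A v l k).
  apply/funext => v; rewrite mxE; apply: eq_bigr => k _; rewrite mxE mulr_suml.
  by apply: eq_bigr => l _; rewrite mulrAC.
by apply: decays_sum => k; apply: decays_sum => l; apply: decaysZ; exact: E_decays.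
Qed.

Lemma mxE_declip m n (M : 'M[R]_(m, p)) (N : 'M[R]_(p, n)) i j :
  declip (fun v => (M *m E A v *m N) i j).
Proof. by apply: declip_of_decays (mxE_der M N i j) _ _; exact: mxE_decays. Qed.

Lemma decays_seq (f : R -> R) (u : nat -> R) : decays f -> (forall n, n.+1%:R <= u n) ->
  f (u n) @[n --> \oo] --> (0 : R).
Proof.
move=> [C [c [C0 c0 h]]] hu.
have rn n : expR (- c * n%:R) = expR (- c) ^+ n by rewrite -expRM_natr.
have : (C * expR (- c) ^+ n) @[n --> \oo] --> (C * 0 : R).
  by apply: cvgMl_tmp; apply: cvg_expr; rewrite ger0_norm ?expR_ge0// -expR0 ltr_expR oppr_lt0.
rewrite mulr0 => hC; apply/cvgrPdist_le => e e0.
move/cvgrPdist_le: hC => /(_ _ e0); apply: filterS => n.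
rewrite !sub0r !normrN => hn; have un : n%:R <= u n by apply: le_trans (hu n); rewrite ler_nat.
apply: le_trans (h _ (le_trans (ler0n _ _) un)) _; apply: le_trans (le_trans (ler_norm _) hn).
by rewrite ler_wpM2l// -rn ler_expR !mulNr lerN2 ler_wpM2l// ltW.
Qed.

End state_functions.

(** * Weak convergence of [m t + sigma *: xi t] through a reversed copy [zeta t] of the noise *)

Section weak_limit.
Context {R : realType} {d : measure_display} {Omega : measurableType d}.
Variables (P : probability Omega R) (H : R) (B : R -> Omega -> R).
Hypotheses (H0 : 0 < H) (H1 : H < 1) (B_fBM : fBM P H B).

(** A failure at infinity yields a sequence with one bad point beyond each integer. Dominated
    convergence is available along sequences. *)
Lemma cvg_pinfty_seq (F : R -> R) (l : R) :
  (forall u : nat -> R, (forall n, n.+1%:R <= u n) -> F (u n) @[n --> \oo] --> l) ->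
  F t @[t --> +oo%R] --> l.
Proof.
move=> h; apply/cvgrPdist_le => e e0; apply: contrapT => nh.
have /choice[u hu] : forall n : nat, exists t : R, n.+1%:R <= t /\ ~ (`|l - F t| <= e).
  move=> n; apply: contrapT => hn; apply: nh; exists n.+1%:R; split; first exact: num_real.
  move=> t nt; apply: contrapT => ht; apply: hn; exists t; split => //; exact: ltW.
have /cvgrPdist_le/(_ _ e0)[n _ /(_ n (leqnn _))] := h u (fun n => (hu n).1).
exact: (hu n).2.
Qed.

Lemma borel_int p k (g : 'M[R]_(p, k) -> R) (X : Omega -> 'M[R]_(p, k)) : continuous g ->
  (forall i j, measurable_fun setT (fun w => X w i j)) -> measurable_fun setT (fun w => g (X w)).
Proof.
move=> cg mX; exact: (measurableT_comp (borel_cont_measurable cg) (measurable_preimage_open mX)).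
Qed.

Variables (p k : nat) (m : R -> 'M[R]_(p, k)) (minf : 'M[R]_(p, k)) (sigma : R)
  (xi zeta Z : R -> Omega -> 'M[R]_(p, k)) (zinf : Omega -> 'M[R]_(p, k)).
Hypothesis m_cvg : forall u : nat -> R, (forall n, n.+1%:R <= u n) ->
  forall i j, m (u n) i j @[n --> \oo] --> minf i j.
Hypothesis xi_inB : forall t i j, 0 <= t -> inB P B (fun w => xi t w i j).
Hypothesis zeta_inB : forall t i j, 0 <= t -> inB P B (fun w => zeta t w i j).
Hypothesis zinf_inB : forall i j, inB P B (fun w => zinf w i j).
Hypothesis same_nm : forall t (c : 'I_p * 'I_k -> R), 0 <= t ->
  nm P (\sum_a c a *: (fun w => xi t w a.1 a.2)) = nm P (\sum_a c a *: (fun w => zeta t w a.1 a.2)).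
Hypothesis zeta_cvg : forall i j, exists C c, [/\ 0 <= C, 0 < c & forall t, 1 <= t ->
  nm P ((fun w => zeta t w i j) - (fun w => zinf w i j)) <= C * expR (- c * t)].
Hypothesis mZ : forall t i j, 0 <= t -> measurable_fun setT (fun w => Z t w i j).
Hypothesis ZE : forall t, 0 <= t -> {ae P, forall w, Z t w = m t + sigma *: xi t w}.

Let inBm X : inB P B X -> measurable_fun setT X. Proof. by move=> /inB_L2/L2_measurable. Qed.

Let affine_measurable (M : 'M[R]_(p, k)) (X : Omega -> 'M[R]_(p, k)) :
  (forall i j, measurable_fun setT (fun w => X w i j)) ->
  forall i j, measurable_fun setT (fun w => (M + sigma *: X w) i j).
Proof.
move=> mX i j; under eq_fun do rewrite !mxE.
by apply: measurable_funD => //; exact: measurable_funM.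
Qed.

(** Linear functionals of [xi t] and [zeta t] are centred Gaussian with equal variances, so the
    characteristic functions agree and [cramer_wold] applies. *)
Lemma weak_transfer g t : continuous g -> (exists M, forall x, `|g x| <= M) -> 0 <= t ->
  ('E_P[(fun w => g (Z t w))%R] = (\int[P]_w g (m t + sigma *: zeta t w))%R%:E)%E.
Proof.
move=> cg [M gM] t0.
have mxi i j := inBm (xi_inB i j t0); have mzeta i j := inBm (zeta_inB i j t0).
have cg' : continuous (fun x : 'M[R]_(p, k) => g (m t + sigma *: x)).
  move=> x; apply: (@continuous_comp _ _ _ (fun x : 'M[R]_(p, k) => m t + sigma *: x) g); last exact: cg.
  move: x; apply: mx_continuous => i j; under eq_fun do rewrite !mxE.
  move=> x; apply: (@continuous_comp _ _ _ (fun x : 'M[R]_(p, k) => x i j) (fun y => m t i j + sigma * y)).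
    exact: coord_continuous.
  by apply: cvgD; [exact: cvg_cst|apply: cvgMl_tmp; exact: cvg_id].
have <- : \int[P]_w g (m t + sigma *: xi t w) = \int[P]_w g (m t + sigma *: zeta t w).
  apply: (cramer_wold mxi mzeta _ cg'); last by exists M.
  move=> c phi.
  have e (x : Omega -> 'M[R]_(p, k)) w : mxdot c (x w) + phi = (\sum_a c a *: (fun w => x w a.1 a.2)) w + phi.
    by rewrite fct_sumE.
  under eq_Rintegral do rewrite e; under [RHS]eq_Rintegral do rewrite e.
  have lin (x : Omega -> 'M[R]_(p, k)) : (forall i j, inB P B (fun w => x w i j)) ->
      inB P B (\sum_a c a *: (fun w => x w a.1 a.2)).
    by move=> hx; apply: (inB_sum B_fBM) => a; apply: (inBZ B_fBM).
  apply: (@inB_same_int _ _ _ P H B B_fBM (fun y => cos (y + phi)) 1).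
  - by apply: lin => i j; exact: xi_inB.
  - by apply: lin => i j; exact: zeta_inB.
  - exact: same_nm.
  - apply: continuous_measurable_fun => x; apply: (@continuous_comp _ _ _ (fun y => y + phi) cos).
      by apply: cvgD; [exact: cvg_id|exact: cvg_cst].
    exact: continuous_cos.
  - by move=> x; exact: cos_max.
have mX := affine_measurable (m t) mxi.
have mgX := borel_int cg mX; have mgZ := borel_int cg (fun i j => mZ i j t0).
have ig : P.-integrable setT (EFin \o (fun w => g (m t + sigma *: xi t w))).
  by apply: (@bounded_int _ _ _ P _ M).
rewrite unlock /Rintegral fineK; last exact: (integrable_fin_num measurableT ig).
apply: ae_eq_integral => //.
- exact/measurable_EFinP.
- exact/measurable_EFinP.
- by have := ZE t0; apply: filterS => w -> _.
Qed.

Lemma weak_cvg g : continuous g -> (exists M, forall x, `|g x| <= M) ->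
  \int[P]_w g (m t + sigma *: zeta t w) @[t --> +oo%R] --> \int[P]_w g (minf + sigma *: zinf w).
Proof.
move=> cg [M gM]; apply: cvg_pinfty_seq => u hu.
have u0 n : 0 <= u n := le_trans (ler0n _ _) (hu n).
have u1 n : 1 <= u n by apply: le_trans (hu n); rewrite ler1n.
apply: (@bounded_cvg _ _ _ P (fun n w => g (m (u n) + sigma *: zeta (u n) w)) _ M) => //.
- by move=> n; apply: borel_int => //; apply: affine_measurable => i j; exact/inBm/zeta_inB.
- by apply: borel_int => //; apply: affine_measurable => i j; exact/inBm.
have hae (a : 'I_p * 'I_k) : {ae P, forall w, zeta (u n) w a.1 a.2 @[n --> \oo] --> zinf w a.1 a.2}.
  have [C [c [C0 c0 hC]]] := zeta_cvg a.1 a.2.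
  have rn n : expR (- c * n%:R) = expR (- c) ^+ n by rewrite -expRM_natr.
  apply: (@nm_cvg_ae _ _ _ P (fun n w => zeta (u n) w a.1 a.2) (fun w => zinf w a.1 a.2) C (expR (- c))).
  - by move=> n; exact: inB_L2 (zeta_inB _ _ (u0 n)).
  - exact: inB_L2 (zinf_inB _ _).
  - exact: expR_ge0.
  - by rewrite -expR0 ltr_expR oppr_lt0.
  - move=> n; apply: le_trans (hC _ (u1 n)) _; rewrite ler_wpM2l// -rn ler_expR !mulNr lerN2.
    by rewrite ler_wpM2l ?(ltW c0)// (le_trans _ (hu n))// ler_nat.
have hall : {ae P, forall w, forall a, zeta (u n) w a.1 a.2 @[n --> \oo] --> zinf w a.1 a.2}.
  exact: filter_forall.
apply: filterS hall => w hw; apply: (@continuous_cvg _ _ _ _ _ _ g); first exact: cg.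
apply: mx_cvg => i j; under eq_fun do rewrite !mxE; rewrite !mxE.
by apply: cvgD; [exact: m_cvg|apply: cvgMl_tmp; exact: (hw (i, j))].
Qed.

Lemma weak_limit : exists mu : probability (borel_mx R p k) R,
  forall g : 'M[R]_(p, k) -> R, continuous g -> (exists M : R, forall x, `|g x| <= M) ->
  ('E_P[(fun w => g (Z t w))%R] @[t --> +oo%R] --> \int[mu]_x (g x)%:E)%E.
Proof.
pose W w := minf + sigma *: zinf w.
have mW : forall i j, measurable_fun setT (fun w => W w i j) by apply: affine_measurable => i j; exact/inBm.
have mWb : measurable_fun setT (W : Omega -> borel_mx R p k) := measurable_preimage_open mW.
pose X : {mfun Omega >-> borel_mx R p k} := mfun_Sub (mem_set mWb).
exists (distribution P X) => g cg gb; have [M gM] := gb.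
have ig : P.-integrable setT (EFin \o (fun w => g (W w))).
  by apply: (@bounded_int _ _ _ P _ M) => //; exact: borel_int.
rewrite integral_distribution; last 2 first.
- by apply/measurable_EFinP; exact: borel_cont_measurable.
- exact: ig.
have -> : (\int[P]_x ((fun x => (g x)%:E) \o X) x)%E = (\int[P]_w g (W w))%:E.
  by rewrite /Rintegral fineK//; exact: (integrable_fin_num measurableT ig).
have hw := weak_cvg cg gb.
apply/fine_cvgP; split.
  near=> t; have t0 : 0 <= t by near: t; exact: nbhs_pinfty_ge.
  by rewrite weak_transfer.
apply: cvg_trans hw; apply: near_eq_cvg; near=> t.
have t0 : 0 <= t by near: t; exact: nbhs_pinfty_ge.
by rewrite /= weak_transfer.
Unshelve. all: by end_near. Qed.

End weak_limit.

Lemma affine_mxE {R : pzRingType} m n (M N : 'M[R]_(m, n)) c i j :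
  (M + c *: N) i j = M i j + c * N i j.
Proof. by rewrite mxE [X in _ + X]mxE. Qed.

(** * Stability gives an asymptotically stationary solution *)

Section sufficiency.
Context {R : realType} {d : measure_display} {Omega : measurableType d}.
Variables (P : probability Omega R) (H : R) (B : R -> Omega -> R).
Hypotheses (H0 : 0 < H) (H1 : H < 1) (B_fBM : fBM P H B).
Variables (p : nat) (alpha : nat -> R) (sigma : R).
Hypothesis alpha1_neq0 : alpha 1%N != 0.
Local Notation A := (companion p.+1 alpha).
Local Notation delta := (@delta_vec R p.+1).
Local Notation e1 := (@first_vec R p).

(** Since [A e_1 = alpha_1 delta], the vector [E A (t - u) e_1] divided by [- alpha_1] is an
    antiderivative of the integrand. *)
Lemma drift_integral t : 0 <= t -> integral_cV `[0, t] (fun u => E A (t - u) *m delta) =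
  (alpha 1%N)^-1 *: (E A t *m e1 - e1).
Proof.
move=> t0; apply/matrixP => i j; rewrite ord1 mxE {j}.
pose F (u : R) := - (alpha 1%N)^-1 * (E A (t - u) *m e1) i 0.
have dF (x : R) : is_derive x (1 : R) F ((E A (t - x) *m delta) i 0).
  have h1 := is_dmx_mul (is_dmx_E A (t - x)) (is_dmx_cst e1 (t - x)).
  have h2 : is_derive x (1 : R) (fun u => t - u) (-1).
    have h := is_deriveB (is_derive_cst t x (1 : R)) (is_derive_lin 1 x).
    apply: (is_derive_cong h) => [y|]; last by rewrite sub0r.
    by rewrite !fctE mul1r.
  have h3 := @is_dmx_comp R _ _ (fun v => E A v *m e1) (fun u => t - u) x _ _ h1 h2 i 0.
  apply: (is_derive_cong (is_deriveZ (- (alpha 1%N)^-1) h3)) => //.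
  rewrite mulmx0 addr0 E_comm -mulmxA companion_first -scalemxAr.
  by rewrite /GRing.scale/= !mxE mulrA mulrN1 opprK mulrA mulVf// mul1r.
rewrite (FTC t0 dF); last first.
  have -> : (fun u => (E A (t - u) *m delta) i 0) = (fun v => (E A t *m E A v *m delta) i 0) \o -%R.
    by apply/funext => u; rewrite /= -ED.
  move=> x; apply: continuous_comp; first exact: opp_continuous.
  exact: mxE_cont.
rewrite /F (subrr t) (subr0 t) (E0 A) (mul1mx e1).
rewrite [RHS]mxE [X in _ = _ * X]mxE [X in _ = _ * (_ + X)]mxE.
by move: ((E A t *m e1) i 0) (e1 i 0) => x y; ring.
Qed.

Lemma kernel_loclip t i : loclip (fun u => (E A (t - u) *m delta) i 0).
Proof.
have -> : (fun u => (E A (t - u) *m delta) i 0) = (fun u => (E A t *m E A (- u) *m delta) i 0).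
  by apply/funext => u; rewrite -ED.
exact: (loclip_opp (mxE_loclip A (E A t) delta i 0)).
Qed.

(** The integrand depends on the upper end, so each [t] has its own sewn process, evaluated at
    [t]. *)
Lemma state_integral : exists I : R -> Omega -> 'cV[R]_p.+1, forall t i, 0 <= t ->
  stoch_integral P B t (fun u => (E A (t - u) *m delta) i 0) (fun w => I t w i 0).
Proof.
have /choice[J hJ] : forall t : R, exists J : 'I_p.+1 -> R -> Omega -> R, forall i,
    sews P H B (fun u => (E A (t - u) *m delta) i 0) (J i).
  move=> t; have /choice[J hJ] : forall i, exists J, sews P H B (fun u => (E A (t - u) *m delta) i 0) J.
    by move=> i; exact: (sewing H0 H1 B_fBM (kernel_loclip t i)).
  by exists J.
exists (fun t w => \col_i J t i t w) => t i t0.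
have -> : (fun w => (\col_i J t i t w) i 0) = J t i t by apply/funext => w; rewrite mxE.
exact: (sews_stoch H0 B_fBM (kernel_loclip t i) (hJ t i) t0).
Qed.

Hypothesis A_stable : eigenvalues_Re_lt0 A.

Lemma stable_mean_cvg (x0 : 'cV[R]_p.+1) (u : nat -> R) i : (forall n, n.+1%:R <= u n) ->
  (E A (u n) *m x0 + alpha 0%N *: integral_cV `[0, u n] (fun v => E A (u n - v) *m delta)) i 0 @[n --> \oo]
  --> (- (alpha 0%N / alpha 1%N)) * e1 i 0.
Proof.
move=> hu; have u0 n : 0 <= u n := le_trans (ler0n _ _) (hu n).
have -> : (fun n => (E A (u n) *m x0 + alpha 0%N *: integral_cV `[0, u n] (fun v => E A (u n - v) *m delta)) i 0) =
  (fun n => (1%:M *m E A (u n) *m x0) i 0 + (alpha 0%N / alpha 1%N) * (1%:M *m E A (u n) *m e1) i 0 -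
    (alpha 0%N / alpha 1%N) * e1 i 0).
  apply/funext => n; rewrite drift_integral// mxE !mul1mx -addrA; congr (_ + _).
  by rewrite scalerA mxE mxE [X in _ + X]mxE mulrBr.
rewrite -[X in _ --> X]add0r -mulNr; apply: cvgD; last by rewrite mulNr; exact: cvg_cst.
rewrite -[X in _ --> X](addr0 0); apply: cvgD.
  exact: (decays_seq (mxE_decays A_stable 1%:M x0 i 0) hu).
rewrite -[X in _ --> X](mulr0 (alpha 0%N / alpha 1%N)); apply: cvgMl_tmp.
exact: (decays_seq (mxE_decays A_stable 1%:M e1 i 0) hu).
Qed.

Lemma shifted_kernel_declip s i : declip (fun v => (E A (v - s) *m delta) i 0).
Proof.
have -> : (fun v => (E A (v - s) *m delta) i 0) = (fun v => (E A (- s) *m E A v *m delta) i 0).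
  by apply/funext => v; rewrite -ED addrC.
exact: mxE_declip.
Qed.

Lemma fwd_kernel_loclip i : loclip (fun v => (E A v *m delta) i 0).
Proof.
have -> : (fun v => (E A v *m delta) i 0) = (fun v => (1%:M *m E A v *m delta) i 0).
  by apply/funext => v; rewrite mul1mx.
exact: mxE_loclip.
Qed.

(** Reflection about [t + Hm] fixes the lower ends [s] of the integrals and sends their common upper
    end to infinity, where [sews_infty] provides the limits [Y]. *)
Lemma stable_solution (x0 : 'cV[R]_p.+1) : exists X : R -> Omega -> 'cV[R]_p.+1,
  sde_solution P A (alpha 0%N) sigma B (fun=> x0) X /\ asymptotically_stationary P X.
Proof.
have [I hI] := state_integral.
have [m1 m1E] : exists m1 : R -> 'cV[R]_p.+1, forall t,
    m1 t = E A t *m x0 + alpha 0%N *: integral_cV `[0, t] (fun u => E A (t - u) *m delta).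
  by exists (fun t => E A t *m x0 + alpha 0%N *: integral_cV `[0, t] (fun u => E A (t - u) *m delta)).
pose X t w := m1 t + sigma *: I t w.
have XE t w i : X t w i 0 = m1 t i 0 + sigma * I t w i 0.
  by rewrite /X; move: (m1 t) (I t w) => M N; rewrite !mxE.
have mI t i : 0 <= t -> measurable_fun setT (fun w => I t w i 0) by move=> /(hI t i)[].
have mX t i : 0 <= t -> measurable_fun setT (fun w => X t w i 0).
  move=> t0; under eq_fun do rewrite XE.
  by apply: measurable_funD => //; apply: measurable_funM => //; exact: mI.
exists X; split.
  move=> t t0; split; first by move=> i; exact: mX.
  by exists (I t); split; [move=> i; exact: hI|apply: aeW => w; rewrite /X m1E].
(* [Hm] majorises every [h j], so that the lower ends [Hm - h j] are admissible times. *)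
move=> k h h0; pose Hm := \sum_j h j.
have hHm j : 0 <= Hm - h j by rewrite /Hm (bigD1 j)//= addrAC subrr add0r sumr_ge0.
have Hm0 : 0 <= Hm by rewrite sumr_ge0.
pose f (a : 'I_p.+1 * 'I_k) v := (E A v *m delta) a.1 0.
pose s (a : 'I_p.+1 * 'I_k) := Hm - h a.2.
have lf a : loclip (f a) by exact: fwd_kernel_loclip.
have /choice[G hG] : forall a, exists J, sews P H B (fun v => f a (v - s a)) J.
  by move=> a; apply: (sewing H0 H1 B_fBM); exact: loclip_shift.
have /choice[Y hY] : forall a, exists Y, exists C c, [/\ inB P B Y, 0 <= C, 0 < c &
    forall t, 1 <= t -> nm P (G a t - Y) <= C * expR (- c * t)].
  move=> a; apply: (sews_infty H0 B_fBM (hG a)); exact: shifted_kernel_declip.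
have GB a t : 0 <= t -> inB P B (G a t) by have [hB _ _] := hG a; exact: hB.
apply: (@weak_limit _ _ _ P H B B_fBM p.+1 k (fun t => \matrix_(i, j) m1 (t + h j) i 0)
  (\matrix_(i, j) ((- (alpha 0%N / alpha 1%N)) * e1 i 0)) sigma
  (fun t w => \matrix_(i, j) I (t + h j) w i 0)
  (fun t w => \matrix_(i, j) (G (i, j) (t + Hm) w - G (i, j) (s (i, j)) w))
  (shifted X h)
  (fun w => \matrix_(i, j) (Y (i, j) w - G (i, j) (s (i, j)) w))).
- move=> u hu i j; under eq_fun do rewrite mxE m1E; rewrite mxE.
  have hu' n : n.+1%:R <= u n + h j by rewrite (le_trans (hu n))// lerDl.
  exact: (@stable_mean_cvg x0 (fun n => u n + h j) i hu').
- move=> t i j t0; under eq_fun do rewrite mxE.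
  by apply: (stoch_inB B_fBM _ (hI _ i _)); exact: addr_ge0.
- move=> t i j t0; under eq_fun do rewrite mxE.
  by apply: (inBB B_fBM); apply: GB; [exact: addr_ge0|exact: hHm].
- move=> i j; under eq_fun do rewrite mxE.
  by apply: (inBB B_fBM); [have [C [c []]] := hY (i, j)|apply: GB; exact: hHm].
- move=> t c t0.
  have -> : (\sum_a c a *: (fun w => (\matrix_(i, j) I (t + h j) w i 0) a.1 a.2)) =
      \sum_a c a *: (fun w => I (t + h a.2) w a.1 0).
    by apply: eq_bigr => a _; congr (_ *: _); apply/funext => w; rewrite mxE.
  have -> : (\sum_a c a *: (fun w => (\matrix_(i, j) (G (i, j) (t + Hm) w - G (i, j) (s (i, j)) w)) a.1 a.2)) =
      \sum_a c a *: (G a (t + Hm) - G a (s a)).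
    by apply: eq_bigr => -[i j] _; congr (_ *: _); apply/funext => w; rewrite mxE.
  have Ts (a : 'I_p.+1 * 'I_k) : t + Hm - s a = t + h a.2 by rewrite /s; ring.
  have hs a : 0 <= s a <= t + Hm by rewrite hHm/= -subr_ge0 Ts addr_ge0.
  have hF a : stoch_integral P B (t + Hm - s a) (fun u => f a (t + Hm - s a - u)) (fun w => I (t + h a.2) w a.1 0).
    by rewrite Ts; apply: hI; exact: addr_ge0.
  exact: (reversed_nm H0 B_fBM c hs lf hF hG).
- move=> i j; have [C [c [hB C0 c0 hC]]] := hY (i, j); exists C, c; split => // t t1.
  have t1' : 1 <= t + Hm by rewrite (le_trans t1)// lerDl.
  rewrite (_ : (fun w => _) - _ = G (i, j) (t + Hm) - Y (i, j)); last first.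
    by apply/funext => w; rewrite !fctE !mxE; ring.
  apply: le_trans (hC _ t1') _; rewrite ler_wpM2l// ler_expR !mulNr lerN2 ler_wpM2l ?(ltW c0)//.
  by rewrite lerDl.
- move=> t i j t0; rewrite /shifted; under eq_fun do rewrite mxE.
  by apply: mX; exact: addr_ge0.
- move=> t t0; apply: aeW => w; apply/matrixP => i j; rewrite mxE XE.
  by rewrite affine_mxE [X in _ = X + _]mxE [X in _ = _ + _ * X]mxE.
Qed.

End sufficiency.

(** * Affine functionals of a stationary process and their limits *)

Section stationary_functionals.
Context {R : realType} {d : measure_display} {Omega : measurableType d}.
Variables (P : probability Omega R) (p : nat) (X : R -> Omega -> 'cV[R]_p).
Hypothesis X_meas : forall t i, 0 <= t -> measurable_fun setT (fun w => X t w i 0).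
Hypothesis X_stat : strictly_stationary P X.
Implicit Types (l : seq ('rV[R]_p * R)).

Definition statlin l (T : R) (w : Omega) : R := \sum_(x <- l) (x.1 *m X (T + x.2) w) 0 0.

Definition spos l := all (fun x : 'rV[R]_p * R => 0 <= x.2) l.

Lemma statlin_measurable l T : spos l -> 0 <= T -> measurable_fun setT (statlin l T).
Proof.
move=> + T0; elim: l => [_|x l IH /= /andP[x0 lp]].
  by have -> : statlin [::] T = cst 0 by apply/funext => w; rewrite /statlin big_nil.
have -> : statlin (x :: l) T = (fun w => (x.1 *m X (T + x.2) w) 0 0) + statlin l T.
  by apply/funext => w; rewrite /statlin big_cons.
apply: measurable_funD; last exact: IH.
by apply: measurable_mx_lin => i; apply: X_meas; rewrite addr_ge0.
Qed.

Lemma statlin_law l T : spos l -> 0 <= T -> forall E : set R, measurable E ->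
  P (statlin l T @^-1` E) = P (statlin l 0 @^-1` E).
Proof.
move=> lp T0 E mE; pose k := size l; pose x0 : 'rV[R]_p * R := (0, 0).
pose h (j : 'I_k) := (nth x0 l j).2.
have h0 j : 0 <= h j by move/allP: lp; apply; exact: mem_nth.
pose f (M : 'M[R]_(p, k)) : R := \sum_(j < k) ((nth x0 l j).1 *m M) 0 j.
have fE t w : statlin l t w = f (shifted X h t w).
  rewrite /statlin /f (big_nth x0) big_mkord; apply: eq_bigr => j _.
  by rewrite !mxE; apply: eq_bigr => i _; rewrite mxE.
have cf : continuous f.
  by apply: continuous_big => [|j _]; [exact: add_continuous|exact: continuous_mx_lin].
have mf : measurable ((f : borel_mx R p k -> R) @^-1` E).
  by rewrite -[X in measurable X]setTI; exact: (borel_cont_measurable cf).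
have := X_stat h0 T0 mf; congr (_ = _); congr (P _); apply/funext => w; rewrite /preimage/= fE//.
Qed.

(* [U] at time [T] and [V] at time [0] are limits of the same affine functional
   of the stationary process. *)
Definition statpair (T : R) (U V : Omega -> R) := [/\ measurable_fun setT U, measurable_fun setT V &
  forall e, 0 < e -> exists l b, [/\ spos l,
    L2 P (U - (cst b + statlin l T)) /\ nm P (U - (cst b + statlin l T)) <= e &
    L2 P (V - (cst b + statlin l 0)) /\ nm P (V - (cst b + statlin l 0)) <= e]].

Lemma statlin_cat l l' T : statlin (l ++ l') T = statlin l T + statlin l' T.
Proof. by apply/funext => w; rewrite /statlin big_cat. Qed.

Lemma statlin_scale c l T : statlin [seq (c *: x.1, x.2) | x <- l] T = c *: statlin l T.
Proof.
apply/funext => w; transitivity (c * statlin l T w); last by [].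
rewrite /statlin big_map mulr_sumr; apply: eq_bigr => x _.
by rewrite -scalemxAl mxE.
Qed.

Lemma statpairD T U V U' V' : statpair T U V -> statpair T U' V' -> statpair T (U + U') (V + V').
Proof.
move=> [mU mV h] [mU' mV' h']; split; [exact: measurable_funD|exact: measurable_funD|move=> e e0].
have e2 : 0 < e / 2 by rewrite divr_gt0.
have [l [b [lp [LU nU] [LV nV]]]] := h _ e2; have [l' [b' [lp' [LU' nU'] [LV' nV']]]] := h' _ e2.
exists (l ++ l'), (b + b'); split.
- by rewrite /spos all_cat; apply/andP.
- have -> : U + U' - (cst (b + b') + statlin (l ++ l') T) =
     (U - (cst b + statlin l T)) + (U' - (cst b' + statlin l' T)).
    by rewrite statlin_cat; apply/funext => w; rewrite !fctE; ring.
  by split; [exact: (L2D LU LU')|apply: le_trans (nmD LU LU') _; rewrite (splitr e); exact: (lerD nU nU')].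
- have -> : V + V' - (cst (b + b') + statlin (l ++ l') 0) =
     (V - (cst b + statlin l 0)) + (V' - (cst b' + statlin l' 0)).
    by rewrite statlin_cat; apply/funext => w; rewrite !fctE; ring.
  by split; [exact: (L2D LV LV')|apply: le_trans (nmD LV LV') _; rewrite (splitr e); exact: (lerD nV nV')].
Qed.

Lemma statpairZ T U V c : statpair T U V -> statpair T (c *: U) (c *: V).
Proof.
move=> [mU mV h]; split; [exact: measurable_funM|exact: measurable_funM|move=> e e0].
have c0 : 0 < `|c| + 1 by rewrite ltr_wpDl.
have [l [b [lp [LU nU] [LV nV]]]] := h _ (divr_gt0 e0 c0).
have ce x : x <= e / (`|c| + 1) -> `|c| * x <= e.
  move=> hx; apply: le_trans (ler_wpM2l (normr_ge0 c) hx) _.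
  by rewrite mulrCA ler_piMr ?(ltW e0)// ler_pdivrMr// mul1r lerDl.
exists [seq (c *: x.1, x.2) | x <- l], (c * b); split.
- by rewrite /spos all_map.
- have -> : c *: U - (cst (c * b) + statlin [seq (c *: x.1, x.2) | x <- l] T) =
     c *: (U - (cst b + statlin l T)).
    by rewrite statlin_scale; apply/funext => w; rewrite !fctE /GRing.scale/=; ring.
  by split; [exact: (L2Z c LU)|rewrite (nmZ c LU); exact: (ce _ nU)].
- have -> : c *: V - (cst (c * b) + statlin [seq (c *: x.1, x.2) | x <- l] 0) =
     c *: (V - (cst b + statlin l 0)).
    by rewrite statlin_scale; apply/funext => w; rewrite !fctE /GRing.scale/=; ring.
  by split; [exact: (L2Z c LV)|rewrite (nmZ c LV); exact: (ce _ nV)].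
Qed.

Lemma statpair0 T : statpair T 0 0.
Proof.
split; [exact: measurable_cst|exact: measurable_cst|move=> e e0]; exists [::], 0.
have z t : (0 : Omega -> R) - (cst 0 + statlin [::] t) = 0.
  by apply/funext => w; rewrite !fctE /statlin big_nil; ring.
have h0 : L2 P (0 : Omega -> R) /\ nm P 0 <= e by split; [exact: L2_0|rewrite nm0 ltW].
by rewrite !z; split.
Qed.

Lemma statpair_sum (I : Type) (r : seq I) T (U V : I -> Omega -> R) :
  (forall i, statpair T (U i) (V i)) -> statpair T (\sum_(i <- r) U i) (\sum_(i <- r) V i).
Proof.
move=> h; elim: r => [|i r IH]; first by rewrite !big_nil; exact: statpair0.
by rewrite !big_cons; exact: statpairD.
Qed.

Lemma statpair_lim T (U V : Omega -> R) : measurable_fun setT U -> measurable_fun setT V ->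
  (forall e, 0 < e -> exists U' V', [/\ statpair T U' V', L2 P (U - U') /\ nm P (U - U') <= e &
     L2 P (V - V') /\ nm P (V - V') <= e]) -> statpair T U V.
Proof.
move=> mU mV h; split => // e e0; have e2 : 0 < e / 2 by rewrite divr_gt0.
have [U' [V' [[_ _ h'] [LU nU] [LV nV]]]] := h _ e2.
have [l [b [lp [LU' nU'] [LV' nV']]]] := h' _ e2; exists l, b; split => //.
- by rewrite -[X in L2 P X](subrKA U') -[X in nm P X](subrKA U'); split;
    [exact: L2D|apply: le_trans (nmD LU LU') _; rewrite (splitr e); exact: (lerD nU nU')].
- by rewrite -[X in L2 P X](subrKA V') -[X in nm P X](subrKA V'); split;
    [exact: L2D|apply: le_trans (nmD LV LV') _; rewrite (splitr e); exact: (lerD nV nV')].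
Qed.

Lemma statpair_affine T l b : spos l -> 0 <= T ->
  statpair T (cst b + statlin l T) (cst b + statlin l 0).
Proof.
move=> lp T0; split.
- by apply: measurable_funD; [exact: measurable_cst|exact: statlin_measurable].
- by apply: measurable_funD; [exact: measurable_cst|exact: statlin_measurable].
- by move=> e e0; exists l, b; split => //; rewrite subrr nm0 (ltW e0); split => //; exact: L2_0.
Qed.

(** The approximating functional has the same law at both times; replacing [U] and [V] by it costs
    [K] times the error twice, which explains [2 * K + 1]. *)
Lemma statpair_int T U V (g : R -> R) : 0 <= T -> statpair T U V -> blip g ->
  \int[P]_w g (U w) = \int[P]_w g (V w).
Proof.
move=> T0 [mU mV h] hg; apply/eqP; rewrite -subr_eq0 -normr_le0; apply/ler_addgt0Pr => e e0; rewrite add0r.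
have [K K0 hK] := blip_dist P hg; have K1 : 0 < 2 * K + 1 by rewrite ltr_wpDl ?mulr_ge0.
have [l [b [lp [LU nU] [LV nV]]]] := h _ (divr_gt0 e0 K1).
have mT := statlin_measurable lp T0; have m0 := statlin_measurable lp (lexx 0).
have mbT : measurable_fun setT (cst b + statlin l T) by apply: measurable_funD.
have mb0 : measurable_fun setT (cst b + statlin l 0) by apply: measurable_funD.
have e1 : \int[P]_w g ((cst b + statlin l T) w) = \int[P]_w g ((cst b + statlin l 0) w).
  apply: (@transfer_int _ _ _ P (statlin l T) (statlin l 0) (fun x => g (b + x))) => //.
  - exact: statlin_law.
  - apply: continuous_measurable_fun => x; apply: (@continuous_comp _ _ _ (fun x => b + x) g).
      by apply: cvgD; [exact: cvg_cst|exact: cvg_id].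
    exact: blip_continuous.
  - exact: (blip_int P hg mbT).
  - exact: (blip_int P hg mb0).
have h1 := hK _ _ LU mU mbT; have h2 := hK _ _ LV mV mb0; rewrite e1 in h1.
have h3 := ler_wpM2l K0 nU; have h4 := ler_wpM2l K0 nV.
have h5 : 2 * (K * (e / (2 * K + 1))) <= e.
  by rewrite mulrA mulrCA ler_piMr ?(ltW e0)// ler_pdivrMr// mul1r lerDl.
move: (\int[P]_w g (U w)) (\int[P]_w g (V w)) (\int[P]_w _) (nm _ _) (nm _ _) h1 h2 h3 h4 => x y z n1 n2 + + h3 h4.
rewrite !ler_norml => /andP[h11 h12] /andP[h21 h22]; clear -h11 h12 h21 h22 h3 h4 h5.
by apply/andP; split; lra.
Qed.

End stationary_functionals.

(** The algebra behind [state_incr]: the initial vector [a] cancels. *)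
Lemma affine_step {R : comPzRingType} n (M N : 'M[R]_n) (a e U V : 'cV[R]_n) (c s : R) :
  N *m M *m a - c *: e + s *: (N *m M *m V) - N *m (M *m a - c *: e + s *: (M *m U)) =
  s *: (N *m M *m (V - U)) + c *: (N *m e - e).
Proof.
rewrite mulmxDr mulmxBr -!scalemxAr !mulmxA mulmxBr !scalerBr.
move: (N *m M *m a) (c *: e) (s *: (N *m M *m V)) (s *: (N *m M *m U)) (c *: (N *m e)) => x y z t u.
by apply/matrixP => i j; rewrite !mxE; ring.
Qed.

(** * Increments of the noise recovered from the states *)

Section increments_from_states.
Context {R : realType} {d : measure_display} {Omega : measurableType d}.
Variables (P : probability Omega R) (H : R) (B : R -> Omega -> R).
Hypotheses (H0 : 0 < H) (H1 : H < 1) (B_fBM : fBM P H B).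
Variables (p : nat) (alpha : nat -> R) (sigma : R).
Hypothesis alpha1_neq0 : alpha 1%N != 0.
Hypothesis sigma_gt0 : 0 < sigma.
Local Notation A := (companion p.+1 alpha).
Local Notation delta := (@delta_vec R p.+1).
Local Notation e1 := (@first_vec R p).
Local Notation kk := (alpha 0%N / alpha 1%N).

Lemma stoch_unique t f I I' : 0 <= t -> stoch_integral P B t f I -> stoch_integral P B t f I' ->
  {ae P, forall w, I w = I' w}.
Proof.
move=> t0 hI hI'; have LI := inB_L2 (stoch_inB B_fBM t0 hI); have LI' := inB_L2 (stoch_inB B_fBM t0 hI').
apply: (ae_eq_of_nm LI LI') => e e0; have e2 : 0 < e / 2 by rewrite divr_gt0.
have [r r0 hr] := stoch_nm B_fBM t0 hI e2; have [r' r'0 hr'] := stoch_nm B_fBM t0 hI' e2.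
have m0 : 0 < Num.min r r' by rewrite lt_min r0.
have [n hn] := ugrid_fine t0 m0; have {}hn := hn n (leqnn _); move: hn; rewrite lt_min => /andP[n1 n2].
have [L1 h1] := hr n.+1 _ _ (ugrid0 0 t n) (ugrid_top 0 t n) (ugrid_mid t0 n1).
have [L2' h2] := hr' n.+1 _ _ (ugrid0 0 t n) (ugrid_top 0 t n) (ugrid_mid t0 n2).
set S := rsum _ _ _ _ _ in L1 h1 L2' h2.
have -> : I - I' = (S - I') - (S - I) by apply/funext => w; rewrite !fctE; ring.
by apply: le_trans (nmB L2' L1) _; rewrite (splitr e); exact: lerD.
Qed.

Lemma loclip_bdd f (a b : R) : loclip f -> exists2 K, 0 <= K & forall x, a <= x <= b -> `|f x| <= K.
Proof.
move=> hf; have [L [L0 hL]] := loclip_ab a b hf.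
exists (`|f a| + L * `|b - a|); first by rewrite addr_ge0// mulr_ge0.
move=> x /andP[x1 x2]; have ab := le_trans x1 x2.
have := hL x a; rewrite x1 x2 lexx ab => /(_ isT isT) h.
have -> : f x = (f x - f a) + f a by rewrite subrK.
apply: le_trans (ler_normD _ _) _; rewrite addrC lerD2l; apply: le_trans h _.
by rewrite ler_wpM2l// !ger0_norm ?subr_ge0// lerD2r.
Qed.

Lemma back_kernel_loclip i : loclip (fun u => (E A (- u) *m delta) i 0).
Proof.
have -> : (fun u => (E A (- u) *m delta) i 0) = (fun u => (1%:M *m E A (- u) *m delta) i 0).
  by apply/funext => u; rewrite mul1mx.
exact: (loclip_opp (mxE_loclip A 1%:M delta i 0)).
Qed.

Variable J : 'I_p.+1 -> R -> Omega -> R.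
Hypothesis J_sews : forall i, sews P H B (fun u => (E A (- u) *m delta) i 0) (J i).

Let J_inB i t : 0 <= t -> inB P B (J i t). Proof. by have [h _ _] := J_sews i; exact: h. Qed.

(** Factoring [E A (t - u)] as [E A t *m E A (- u)] gives integrals [J] whose integrand is the same
    for all [t], so states at different times are compared through increments of [J]. *)
Lemma integral_repr t (I : Omega -> 'cV[R]_p.+1) : 0 <= t ->
  (forall i, stoch_integral P B t (fun u => (E A (t - u) *m delta) i 0) (fun w => I w i 0)) ->
  {ae P, forall w, I w = E A t *m \col_i J i t w}.
Proof.
move=> t0 hI.
have h (i : 'I_p.+1) : {ae P, forall w, I w i 0 = (E A t *m \col_i J i t w) i 0}.
  have hJ l := sews_stoch H0 B_fBM (back_kernel_loclip l) (J_sews l) t0.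
  have h2 := stoch_integral_lin B_fBM (fun l => E A t i l) t0 hJ.
  have e : (fun u => \sum_l E A t i l * (E A (- u) *m delta) l 0) = (fun u => (E A (t - u) *m delta) i 0).
    by apply/funext => u; rewrite ED -mulmxA [RHS]mxE.
  rewrite e in h2; have := stoch_unique t0 (hI i) h2; apply: filterS => w ->.
  by rewrite fct_sumE mxE; apply: eq_bigr => l _; rewrite [X in _ = _ * X]mxE.
have hall : {ae P, forall w, forall i : 'I_p.+1, I w i 0 = (E A t *m \col_i J i t w) i 0}.
  exact: filter_forall.
by apply: filterS hall => w hw; apply/matrixP => i j; rewrite ord1.
Qed.

(* As [delta^T *m delta = 1], this recovers the increment [B (s + h) - B s] from
   the state process, up to an error of order [h `^ (1 + H)]. *)
Definition jincr (s h : R) : Omega -> R :=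
  \sum_i (delta^T *m E A (s + h)) 0 i *: (J i (s + h) - J i s).

Lemma delta_sqr : delta^T *m delta = 1%:M :> 'M[R]_1.
Proof.
apply/matrixP => i j; rewrite !ord1 !mxE eqxx (bigD1 ord_max)//= !mxE eqxx mulr1 big1 ?addr0//.
by move=> k km; rewrite !mxE eqSS; case: eqP => [kp|_]; rewrite ?mulr0//; case/eqP: km; exact: val_inj.
Qed.

Lemma jincr_L2 s h : 0 <= s -> 0 <= h -> L2 P (jincr s h).
Proof.
move=> s0 h0; apply: L2_sum => i _; apply: L2Z; apply: L2B; apply: inB_L2; apply: J_inB => //.
exact: addr_ge0.
Qed.

(** The weights [ka i s * f i s] add up to 1, being the entry of [delta^T E(s) E(-s) delta]. Each
    index costs [2 K L] for the local expansion of [J i] and [K L] for the change of [ka i] over the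
    step. *)
Lemma jincr_close T : 0 <= T -> exists2 C, 0 <= C & forall s h, 0 <= s -> 0 <= h -> s + h <= T ->
  nm P (jincr s h - (B (s + h) - B s)) <= C * h * h `^ H.
Proof.
move=> T0; pose ka i v : R := (delta^T *m E A v) 0 i.
pose f i u := (E A (- u) *m delta) i 0.
have lka i : loclip (ka i).
  have -> : ka i = (fun v => (delta^T *m E A v *m 1%:M) 0 i) by apply/funext => v; rewrite mulmx1.
  exact: mxE_loclip.
have /choice[K hK] : forall i, exists K, 0 <= K /\ forall x, -1 <= x <= T -> `|ka i x| <= K /\ `|f i x| <= K.
  move=> i; have [K1 K10 h1] := loclip_bdd (-1) T (lka i).
  have [K2 K20 h2] := loclip_bdd (-1) T (back_kernel_loclip i).
  exists (K1 + K2); split; first exact: addr_ge0.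
  move=> x hx; split; [apply: le_trans (h1 x hx) _; by rewrite lerDl|apply: le_trans (h2 x hx) _; by rewrite lerDr].
have /choice[L hL] : forall i, exists L, lip (ka i) L (-1) T /\ lip (f i) L (-1) T.
  move=> i; have [L1 [L10 h1]] := loclip_ab (-1) T (lka i).
  have [L2' [L20 h2]] := loclip_ab (-1) T (back_kernel_loclip i).
  exists (L1 + L2'); split; split; rewrite ?addr_ge0// => x y hx hy.
    by apply: le_trans (h1 x y hx hy) _; rewrite ler_wpM2r// lerDl.
  by apply: le_trans (h2 x y hx hy) _; rewrite ler_wpM2r// lerDr.
have L0 i : 0 <= L i by have [[]] := hL i.
have K0 i : 0 <= K i by have [] := hK i.
exists (\sum_i 3 * K i * L i).
  by apply: sumr_ge0 => i _; rewrite !mulr_ge0.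
move=> s h s0 h0 shT; have sh0 := addr_ge0 s0 h0; have ssh : s <= s + h by rewrite lerDl.
have LX := incr_L2 B_fBM sh0 s0.
have LJ i : L2 P (J i (s + h) - J i s) by apply: L2B; apply: inB_L2; exact: J_inB.
pose D := B (s + h) - B s.
have one : \sum_i ka i s * f i s = 1.
  have : (delta^T *m E A s) *m (E A (- s) *m delta) = 1%:M.
    by rewrite mulmxA -(mulmxA _ (E A s)) -ED subrr E0 mulmx1 delta_sqr.
  by move/matrixP => /(_ 0 0); rewrite !mxE eqxx.
have -> : jincr s h - D = \sum_i (ka i (s + h) *: (J i (s + h) - J i s - f i s *: D) +
    ((ka i (s + h) - ka i s) * f i s) *: D).
  have e : \sum_i (ka i s * f i s) *: D = D by rewrite -scaler_suml one scale1r.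
  rewrite -{1}e /jincr -sumrB; apply: eq_bigr => i _; rewrite -/(ka i (s + h)).
  by rewrite mulrBl scalerBl [in RHS]scalerBr scalerA addrA subrK.
have LT i : L2 P (ka i (s + h) *: (J i (s + h) - J i s - f i s *: D)).
  by apply: L2Z; apply: L2B => //; exact: L2Z.
apply: le_trans (nm_sum _ _) _; first by move=> i; apply: L2D => //; exact: L2Z.
rewrite !mulr_suml; apply: ler_sum => i _.
apply: le_trans (nmD (LT i) (L2Z _ LX)) _.
have [_ kf] := hK i; have [lk lf] := hL i; have [_ _ hsew] := J_sews i.
have rs : -1 <= s <= T by apply/andP; split; lra.
have rsh : -1 <= s + h <= T by apply/andP; split; lra.
have a1 := (kf _ rsh).1; have a2 := (kf _ rs).2.
have b1 : nm P (J i (s + h) - J i s - f i s *: D) <= 2 * L i * h * h `^ H.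
  have := hsew (L i) s (s + h) s0 ssh; rewrite (addrAC s h) subrr add0r; apply.
  by apply: lipS lf => //; lra.
have b2 : `|ka i (s + h) - ka i s| <= L i * h.
  apply: le_trans (lk.2 _ _ rsh rs) _.
  have -> : s + h - s = h by rewrite addrAC subrr add0r.
  by rewrite (ger0_norm h0).
have b3 : nm P D = h `^ H by rewrite /D (incr_nm H0 B_fBM)// (addrAC s h) subrr add0r ger0_norm.
have p0 : 0 <= h `^ H by exact: powR_ge0.
have -> : 3 * K i * L i * h * h `^ H = K i * (2 * L i * h * h `^ H) + (L i * h * K i) * h `^ H by ring.
apply: lerD.
  by rewrite nmZ; [apply: ler_pM => //; exact: nm_ge0|apply: L2B => //; exact: L2Z].
rewrite nmZ// b3 ler_wpM2r// normrM; exact: ler_pM.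
Qed.

Variable X : R -> Omega -> 'cV[R]_p.+1.
Hypothesis X_sol : sde_solution P A (alpha 0%N) sigma B (X 0) X.

Lemma state_repr t : 0 <= t -> {ae P, forall w,
  X t w = E A t *m (X 0 w + kk *: e1) - kk *: e1 + sigma *: (E A t *m \col_i J i t w)}.
Proof.
move=> t0; have [_ [I [hI hX]]] := X_sol t0; have hJ := integral_repr t0 hI.
apply: filterS2 hX hJ => w hX hIw; rewrite hX hIw -[expmx (t *: A)]/(E A t); congr (_ + _).
have -> : integral_cV `[0, t] (fun u => expmx ((t - u) *: A) *m delta) =
  (alpha 1%N)^-1 *: (E A t *m e1 - e1) by rewrite -drift_integral.
by rewrite scalerA mulmxDr -scalemxAr scalerBr addrA.
Qed.

Definition incr_const (h : R) : R := kk * (delta^T *m (E A h *m e1 - e1)) 0 0.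

(** Subtracting [E A h *m X s] removes the initial condition, about which nothing is known, and
    leaves the noise of [[s, s + h]] and a constant. *)
Lemma state_incr s h : 0 <= s -> 0 <= h -> {ae P, forall w,
  (delta^T *m (X (s + h) w - E A h *m X s w)) 0 0 = sigma * jincr s h w + incr_const h}.
Proof.
move=> s0 h0; have r1 := state_repr s0; have r2 := state_repr (addr_ge0 s0 h0).
apply: filterS2 r1 r2 => w -> ->.
set a := X 0 w + _; set U := \col_i J i s w; set V := \col_i J i (s + h) w.
have -> : E A (s + h) *m a - kk *: e1 + sigma *: (E A (s + h) *m V) -
  E A h *m (E A s *m a - kk *: e1 + sigma *: (E A s *m U)) =
  sigma *: (E A (s + h) *m (V - U)) + kk *: (E A h *m e1 - e1).
  by rewrite (addrC s) ED; exact: affine_step.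
rewrite mulmxDr -!scalemxAr [LHS]mxE [X in X + _ = _]mxE [X in _ + X = _]mxE; congr (_ * _ + _).
rewrite mulmxA mxE /jincr fct_sumE; apply: eq_bigr => i _.
by have -> : (V - U) i 0 = J i (s + h) w - J i s w by rewrite !mxE.
Qed.

Hypothesis X_stat : strictly_stationary P X.

Let X_meas t i : 0 <= t -> measurable_fun setT (fun w => X t w i 0).
Proof. by move=> t0; have [] := X_sol t0. Qed.

Definition incr_list (u h : R) : seq ('rV[R]_p.+1 * R) :=
  [:: (sigma^-1 *: delta^T, u + h); (- (sigma^-1 *: (delta^T *m E A h)), u)].

Lemma incr_listE T u h : 0 <= T -> 0 <= u -> 0 <= h -> {ae P, forall w,
  jincr (T + u) h w = (cst (- (sigma^-1 * incr_const h)) + statlin X (incr_list u h) T) w}.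
Proof.
move=> T0 u0 h0; have := state_incr (addr_ge0 T0 u0) h0; apply: filterS => w hw.
have s0 : sigma != 0 by rewrite gt_eqF.
have e : statlin X (incr_list u h) T w = sigma^-1 * (delta^T *m (X (T + u + h) w - E A h *m X (T + u) w)) 0 0.
  rewrite /statlin /incr_list big_cons big_seq1 /= addrA mulNmx -!scalemxAl mulmxBr mulmxA.
  move: (delta^T *m X _ w) (delta^T *m E A h *m X _ w) => x y; rewrite !mxE; ring.
by rewrite fctE e hw /cst; field.
Qed.

(** Cells of length [h] cost [C h^(1 + H)] each, so [C t h^H] in total, which vanishes with the
    mesh. The approximating functional is the same at times [T] and 0. *)
Lemma statpair_B T t : 0 <= T -> 0 <= t -> statpair P X T (B (T + t) - B T) (B t - B 0).
Proof.
move=> T0 t0; have Tt := addr_ge0 T0 t0.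
apply: statpair_lim.
- exact: L2_measurable (incr_L2 B_fBM Tt T0).
- exact: L2_measurable (incr_L2 B_fBM t0 (lexx 0)).
move=> e e0; have [C C0 hC] := jincr_close Tt.
have [r r0 hr] := mesh_exists H0 (mulr_ge0 C0 t0) e0.
have [n hn] := ugrid_fine t0 r0; have {}hn := hn n (leqnn _).
pose h := t / n.+1%:R; have h0 : 0 <= h by rewrite divr_ge0.
pose u k := ugrid 0 t n k.
have uS k : u k.+1 = u k + h by have := ugridS 0 t n k; rewrite subr0 -/h => /eqP; rewrite subr_eq addrC => /eqP.
have u0 k : 0 <= u k by rewrite /u /ugrid add0r subr0 divr_ge0 ?mulr_ge0.
have ut k : (k <= n.+1)%N -> u k <= t.
  by move=> kn; rewrite /u /ugrid add0r subr0 ler_pdivrMr// ler_wpM2l// ler_nat.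
have tel S : 0 <= S -> B (S + t) - B S = \sum_(k < n.+1) (B (S + u k + h) - B (S + u k)).
  move=> S0; under eq_bigr do rewrite -addrA -uS.
  rewrite -(big_mkord xpredT (fun k => B (S + u k.+1) - B (S + u k))) telescope_sumr//.
  by rewrite /u ugrid0 ugrid_top addr0.
pose W S k := cst (- (sigma^-1 * incr_const h)) + statlin X (incr_list (u k) h) S.
have close S : 0 <= S -> S <= T -> L2 P (B (S + t) - B S - \sum_(k < n.+1) W S k) /\
    nm P (B (S + t) - B S - \sum_(k < n.+1) W S k) <= e.
  move=> S0 ST.
  have spu k : spos (incr_list (u k) h) by rewrite /spos /= u0 addr_ge0.
  have mW k : measurable_fun setT (W S k).
    by apply: measurable_funD; [exact: measurable_cst|exact: (statlin_measurable X_meas)].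
  have LB (k : 'I_n.+1) : L2 P (B (S + u k + h) - B (S + u k)).
    by apply: (incr_L2 B_fBM); [exact: addr_ge0 (addr_ge0 S0 (u0 k)) h0|exact: addr_ge0].
  have ae1 (k : 'I_n.+1) : {ae P, forall w, (B (S + u k + h) - B (S + u k) - jincr (S + u k) h) w =
       (B (S + u k + h) - B (S + u k) - W S k) w}.
    have := incr_listE S0 (u0 k) h0; apply: filterS => w hw.
    by transitivity ((B (S + u k + h) - B (S + u k)) w - jincr (S + u k) h w); last rewrite hw.
  have Lj (k : 'I_n.+1) : L2 P (B (S + u k + h) - B (S + u k) - jincr (S + u k) h).
    by apply: L2B => //; apply: jincr_L2 => //; exact: addr_ge0.
  have LW (k : 'I_n.+1) : L2 P (B (S + u k + h) - B (S + u k) - W S k).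
    by apply: L2_ae (ae1 k) (Lj k); apply: measurable_funB => //; exact: L2_measurable (LB k).
  rewrite (tel S S0) -sumrB; split; first by apply: L2_sum => k _; exact: LW.
  apply: le_trans (nm_sum _ _) _ => //.
  apply: le_trans (_ : \sum_(k < n.+1) C * h * h `^ H <= _).
    apply: ler_sum => k _; rewrite -(nm_ae (Lj k) (LW k) (ae1 k)).
    have Su := addr_ge0 S0 (u0 k).
    rewrite nmBC//; last by apply: jincr_L2.
    apply: hC => //; rewrite -addrA -uS; apply: lerD => //; exact: ut.
  rewrite sumr_const card_ord -[leLHS]mulr_natl.
  have -> : n.+1%:R * (C * h * h `^ H) = C * t * h `^ H.
    have nn : n.+1%:R != 0 :> R by rewrite pnatr_eq0.
    by rewrite /h; move: (n.+1%:R) (powR _ _) nn => N q nn; field.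
  apply: le_trans hr; rewrite ler_wpM2l ?mulr_ge0// ge0_ler_powR ?nnegrE ?(ltW H0) ?(ltW r0)//.
  exact: ltW.
exists (\sum_(k < n.+1) W T k), (\sum_(k < n.+1) W 0 k); split.
- apply: statpair_sum => k; apply: statpair_affine => //; by rewrite /spos /= u0 addr_ge0.
- exact: close.
- by have := close 0 (lexx 0) T0; rewrite add0r.
Qed.

Lemma statpair_X T (v : 'rV[R]_p.+1) : 0 <= T ->
  statpair P X T (fun w => (v *m X T w) 0 0) (fun w => (v *m X 0 w) 0 0).
Proof.
move=> T0.
have e t : cst 0 + statlin X [:: (v, 0)] t = (fun w => (v *m X t w) 0 0).
  by apply/funext => w; rewrite fctE /statlin big_seq1 /= addr0 add0r.
by have := @statpair_affine _ _ _ P _ X X_meas T [:: (v, 0)] 0; rewrite !e /spos /= lexx => /(_ isT T0).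
Qed.

End increments_from_states.

(** * Joint law of the state and of later increments under stationarity *)

Section limit_law.
Context {R : realType} {d : measure_display} {Omega : measurableType d}.
Variables (P : probability Omega R) (H : R) (B : R -> Omega -> R).
Hypotheses (H0 : 0 < H) (H1 : H < 1) (B_fBM : fBM P H B).
Variables (p : nat) (alpha : nat -> R) (sigma : R).
Hypothesis alpha1_neq0 : alpha 1%N != 0.
Hypothesis sigma_gt0 : 0 < sigma.
Local Notation A := (companion p.+1 alpha).
Local Notation delta := (@delta_vec R p.+1).
Local Notation e1 := (@first_vec R p).
Local Notation kk := (alpha 0%N / alpha 1%N).
Hypothesis A_stable : eigenvalues_Re_lt0 A.
Variable J : 'I_p.+1 -> R -> Omega -> R.
Hypothesis J_sews : forall i, sews P H B (fun u => (E A (- u) *m delta) i 0) (J i).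

Definition state_int (i : 'I_p.+1) (T : R) : Omega -> R := \sum_l E A T i l *: J l T.

Lemma state_int_stoch i T : 0 <= T ->
  stoch_integral P B T (fun u => (E A (T - u) *m delta) i 0) (state_int i T).
Proof.
move=> T0; have hJ l := sews_stoch H0 B_fBM (back_kernel_loclip alpha l) (J_sews l) T0.
have h2 := stoch_integral_lin B_fBM (fun l => E A T i l) T0 hJ.
have e : (fun u => \sum_l E A T i l * (E A (- u) *m delta) l 0) = (fun u => (E A (T - u) *m delta) i 0).
  by apply/funext => u; rewrite ED -mulmxA [RHS]mxE.
by rewrite e in h2.
Qed.

Lemma state_int_inB i T : 0 <= T -> inB P B (state_int i T).
Proof. by move=> T0; exact: (stoch_inB B_fBM T0 (state_int_stoch i T0)). Qed.

(** Increments of [B] are integrals of 1, so that [reversed_nm] handles them together with the noise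
    of the state. *)
Lemma sews_cst1 : sews P H B (fun=> 1) (fun t => B t - B 0).
Proof.
split.
- by move=> t t0; apply: (inBB B_fBM); exact: (inB_B B_fBM).
- by rewrite subrr nm0.
- move=> L a b a0 ab [L0 _]; have -> : B b - B 0 - (B a - B 0) - 1 *: (B b - B a) = 0.
    have -> : B b - B 0 - (B a - B 0) = B b - B a by rewrite opprB addrA subrK.
    by rewrite scale1r subrr.
  by rewrite nm0 !mulr_ge0 ?powR_ge0// subr_ge0.
Qed.

Variables (v : 'rV[R]_p.+1) (n : nat) (c tau : 'I_n -> R).
Hypothesis tau0 : forall k, 0 <= tau k.

(** The part of [stat_obs] that does not come from the initial condition or the drift; [c] and [tau]
    test the joint law with increments after [T]. *)
Definition stat_noise T : Omega -> R :=
  sigma *: (\sum_i v 0 i *: state_int i T) + \sum_k c k *: (B (T + tau k) - B T).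

Lemma stat_noise_inB T : 0 <= T -> inB P B (stat_noise T).
Proof.
move=> T0; apply: (inBD B_fBM).
  apply: (inBZ B_fBM); apply: (inB_sum B_fBM) => i; apply: (inBZ B_fBM); exact: state_int_inB.
apply: (inB_sum B_fBM) => k; apply: (inBZ B_fBM); apply: (inBB B_fBM); apply: (inB_B B_fBM) => //.
exact: addr_ge0.
Qed.

(** Reflection about [T + Tm]: the increments after [T] become the fixed variable [tail], and the
    noise of the state becomes integrals from [Tm] to an upper end that goes to infinity. *)
Lemma stat_noise_limit : exists2 Y, inB P B Y & forall e, 0 < e -> exists2 T0, 0 <= T0 &
  forall T, T0 <= T -> exists G, [/\ inB P B G, nm P (stat_noise T) = nm P G & nm P (G - Y) <= e].
Proof.
pose Tm := \sum_k tau k; have Tm0 : 0 <= Tm by exact: sumr_ge0.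
have Tmk k : 0 <= Tm - tau k by rewrite /Tm (bigD1 k)//= addrAC subrr add0r sumr_ge0.
have /choice[G hG] : forall i, exists J, sews P H B (fun v => (E A (v - Tm) *m delta) i 0) J.
  by move=> i; apply: (sewing H0 H1 B_fBM); exact: (loclip_shift Tm (fwd_kernel_loclip alpha i)).
have /choice[Y hY] : forall i, exists Y, inB P B Y /\ forall e, 0 < e -> exists2 T0, 0 <= T0 &
    forall t, T0 <= t -> nm P (G i (t + Tm) - Y) <= e.
  move=> i; have [Y [C [c' [hYB C0 c0 hY]]]] :=
    sews_infty H0 B_fBM (hG i) (shifted_kernel_declip A_stable Tm i).
  exists Y; split => // e e0; have C1 : 0 < C + 1 by rewrite ltr_wpDl.
  (* Beyond this time the exponential bound is below [e], already by [x <= expR x]; the 1 meets the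
     range of validity of [sews_infty]. *)
  exists (1 + (C + 1) / (e * c')).
    by rewrite addr_ge0// divr_ge0 ?(ltW C1)// mulr_ge0// ltW.
  move=> t ht; have q0 : 0 <= (C + 1) / (e * c') by rewrite divr_ge0 ?(ltW C1)// mulr_ge0// ltW.
  have t1 : 1 <= t + Tm by lra.
  apply: le_trans (hY _ t1) _; rewrite mulNr expRN.
  have h1 : (C + 1) / e <= c' * (t + Tm).
    have ne := lt0r_neq0 e0; have nc := lt0r_neq0 c0.
    have <- : c' * ((C + 1) / (e * c')) = (C + 1) / e by field; rewrite ?ne ?nc.
    rewrite ler_wpM2l ?(ltW c0)//; lra.
  have h2 : c' * (t + Tm) <= expR (c' * (t + Tm)).
    by apply: le_trans (expR_ge1Dx _); rewrite lerDr.
  rewrite ler_pdivrMr ?expR_gt0//; have := ler_wpM2l (ltW e0) (le_trans h1 h2).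
  rewrite mulrCA mulfV ?gt_eqF// mulr1; lra.
have GB i t : 0 <= t -> inB P B (G i t) by have [h _ _] := hG i; exact: h.
have YB i : inB P B (Y i) by have [] := hY i.
pose tail := \sum_k c k *: (B Tm - B (Tm - tau k)).
have tailB : inB P B tail.
  apply: (inB_sum B_fBM) => k; apply: (inBZ B_fBM); apply: (inBB B_fBM); apply: (inB_B B_fBM) => //.
pose rev (Z : 'I_p.+1 -> Omega -> R) := sigma *: (\sum_i v 0 i *: (Z i - G i Tm)) + tail.
have revB Z : (forall i, inB P B (Z i)) -> inB P B (rev Z).
  move=> hZ; apply: (inBD B_fBM) => //; apply: (inBZ B_fBM); apply: (inB_sum B_fBM) => i.
  by apply: (inBZ B_fBM); apply: (inBB B_fBM) => //; exact: GB.
exists (rev Y); first exact: revB.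
move=> e e0; pose S := \sum_i `|sigma * v 0 i|.
have S1 : 0 < S + 1 by rewrite ltr_wpDl// sumr_ge0.
have /choice[T0 hT0] : forall i, exists T0, 0 <= T0 /\ forall t, T0 <= t -> nm P (G i (t + Tm) - Y i) <= e / (S + 1).
  by move=> i; have [_ /(_ _ (divr_gt0 e0 S1))[T0 h1 h2]] := hY i; exists T0.
exists (\sum_i T0 i); first by apply: sumr_ge0 => i _; have [] := hT0 i.
move=> T hT; have T0' : 0 <= T.
  by apply: le_trans hT; apply: sumr_ge0 => i _; have [] := hT0 i.
have TTm := addr_ge0 T0' Tm0.
exists (rev (fun i => G i (T + Tm))); split; first by apply: revB => i; exact: GB.
  (* Three families under one index: the integrals of the state and, for each increment, its two
     ends, as integrals of 1 from 0 with opposite signs. *)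
  pose K := ('I_p.+1 + ('I_n + 'I_n))%type.
  pose cf (b : K) : R := match b with inl i => sigma * v 0 i | inr (inl k) => c k | inr (inr k) => - c k end.
  pose s (b : K) : R := match b with inl i => Tm | inr (inl k) => Tm - tau k | inr (inr k) => Tm end.
  pose f (b : K) : R -> R := match b with inl i => fun u => (E A u *m delta) i 0 | inr _ => fun=> 1 end.
  pose F (b : K) : Omega -> R := match b with inl i => state_int i T
    | inr (inl k) => B (T + tau k) - B 0 | inr (inr k) => B T - B 0 end.
  pose GG (b : K) : R -> Omega -> R := match b with inl i => G i | inr _ => fun t => B t - B 0 end.
  have hs b : 0 <= s b <= T + Tm.
    case: b => [i|[k|k]] /=; rewrite ?Tm0 ?Tmk ?lerDr//=.
    by apply: le_trans (_ : Tm <= _); [rewrite gerBl|rewrite lerDr].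
  have lf b : loclip (f b).
    by case: b => [i|b]; [exact: fwd_kernel_loclip|exact: loclip_cst].
  have hF b : stoch_integral P B (T + Tm - s b) (fun u => f b (T + Tm - s b - u)) (F b).
    case: b => [i|[k|k]] /=.
    + by rewrite addrK; exact: state_int_stoch.
    + have -> : T + Tm - (Tm - tau k) = T + tau k by ring.
      by apply: (sews_stoch H0 B_fBM (loclip_cst 1) sews_cst1); exact: addr_ge0.
    + by rewrite addrK; exact: (sews_stoch H0 B_fBM (loclip_cst 1) sews_cst1).
  have hGG b : sews P H B (fun u => f b (u - s b)) (GG b).
    by case: b => [i|[k|k]] /=; [exact: hG|exact: sews_cst1|exact: sews_cst1].
  have := reversed_nm H0 B_fBM cf hs lf hF hGG.
  have -> : \sum_b cf b *: F b = stat_noise T.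
    rewrite big_sumType/= big_sumType/= -big_split/= /stat_noise; congr (_ + _).
      by rewrite scaler_sumr; apply: eq_bigr => i _; rewrite scalerA.
    apply: eq_bigr => k _; rewrite scaleNr -scalerBr; congr (_ *: _).
    by rewrite opprB addrA subrK.
  move=> ->; congr (nm P _).
  rewrite big_sumType/= big_sumType/= -big_split/= /rev; congr (_ + _).
    by rewrite scaler_sumr; apply: eq_bigr => i _; rewrite scalerA.
  apply: eq_bigr => k _; rewrite scaleNr -scalerBr; congr (_ *: _).
  by apply/funext => w; rewrite !fctE; ring.
have -> : rev (fun i => G i (T + Tm)) - rev Y = \sum_i (sigma * v 0 i) *: (G i (T + Tm) - Y i).
  rewrite /rev opprD addrACA subrr addr0 -scalerBr -sumrB scaler_sumr; apply: eq_bigr => i _.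
  by rewrite -scalerBr scalerA; congr (_ *: _); apply/funext => w; rewrite !fctE; ring.
have LD i : L2 P (G i (T + Tm) - Y i) by apply: L2B; apply: inB_L2 => //; exact: GB.
apply: le_trans (nm_sum _ _) _; first by move=> i; exact: L2Z.
apply: le_trans (_ : \sum_i `|sigma * v 0 i| * (e / (S + 1)) <= _).
  apply: ler_sum => i _; rewrite nmZ// ler_wpM2l//; apply: (hT0 i).2; apply: le_trans hT.
  by rewrite (bigD1 i)//= lerDl sumr_ge0// => j _; have [] := hT0 j.
rewrite -mulr_suml -/S mulrA ler_pdivrMr// mulrC ler_wpM2l ?(ltW e0)// lerDl//.
Qed.

Variable X : R -> Omega -> 'cV[R]_p.+1.
Hypothesis X_sol : sde_solution P A (alpha 0%N) sigma B (X 0) X.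
Hypothesis X_stat : strictly_stationary P X.

Let X_meas t i : 0 <= t -> measurable_fun setT (fun w => X t w i 0).
Proof. by move=> t0; have [] := X_sol t0. Qed.

Definition stat_obs T : Omega -> R :=
  (fun w => (v *m X T w) 0 0) + \sum_k c k *: (B (T + tau k) - B T).

Lemma stat_obs_measurable T : 0 <= T -> measurable_fun setT (stat_obs T).
Proof.
move=> T0; apply: measurable_funD.
  by apply: measurable_mx_lin => i; exact: X_meas.
apply: L2_measurable; apply: L2_sum => k _; apply: L2Z; apply: (incr_L2 B_fBM) => //.
exact: addr_ge0.
Qed.

Lemma stat_obs_int T (g : R -> R) : 0 <= T -> blip g ->
  \int[P]_w g (stat_obs T w) = \int[P]_w g (stat_obs 0 w).
Proof.
move=> T0 hg; apply: (statpair_int X_meas X_stat T0 _ hg).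
apply: statpairD; first exact: (statpair_X X_sol v T0).
apply: statpair_sum => k; apply: statpairZ; rewrite add0r.
exact: (statpair_B H0 B_fBM alpha1_neq0 sigma_gt0 J_sews X_sol).
Qed.

Lemma stat_obs_repr T : 0 <= T -> {ae P, forall w, stat_obs T w =
  - kk * (v *m e1) 0 0 + (v *m E A T *m (X 0 w + kk *: e1)) 0 0 + stat_noise T w}.
Proof.
move=> T0; have := state_repr H0 B_fBM alpha1_neq0 J_sews X_sol T0; apply: filterS => w hw.
rewrite /stat_obs /stat_noise.
transitivity ((v *m X T w) 0 0 + (\sum_k c k *: (B (T + tau k) - B T)) w); first by [].
transitivity (- kk * (v *m e1) 0 0 + (v *m E A T *m (X 0 w + kk *: e1)) 0 0 +
  (sigma * (\sum_i v 0 i *: state_int i T) w + (\sum_k c k *: (B (T + tau k) - B T)) w)); last by [].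
rewrite addrA; congr (_ + _); rewrite hw mulmxDr mulmxBr -!scalemxAr mulmxA.
have -> : (\sum_i v 0 i *: state_int i T) w = (v *m (E A T *m \col_i J i T w)) 0 0.
  rewrite fct_sumE [RHS]mxE; apply: eq_bigr => i _; congr (_ * _).
  by rewrite /state_int fct_sumE [RHS]mxE; apply: eq_bigr => l _; rewrite [X in _ = _ * X]mxE.
move: (v *m E A T *m _) (v *m e1) (v *m (E A T *m _)) => x y z; rewrite !mxE; ring.
Qed.

(** By stationarity the expectation at time 0 equals the one at every [u j]. There the initial
    condition enters through [r j], which tends to 0 pointwise; bounded convergence removes it
    although [X 0] has no known moment, and Gaussian noise remains. *)
Lemma stat_obs_limit : exists2 Y, inB P B Y &
  (forall g, blip g -> \int[P]_w g (stat_obs 0 w) = \int[P]_w g (- kk * (v *m e1) 0 0 + Y w)) /\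
  (forall e, 0 < e -> exists2 T0, 0 <= T0 & forall T, T0 <= T -> `|nm P (stat_noise T) - nm P Y| <= e).
Proof.
have [Y YB hY] := stat_noise_limit; exists Y => //; split; last first.
  move=> e e0; have [T0 T00 hT] := hY e e0; exists T0 => // T TT.
  have [G [GB -> hG]] := hT T TT; apply: le_trans (nm_sub (inB_L2 GB) (inB_L2 YB)) hG.
move=> g hg; set m := - kk * (v *m e1) 0 0.
have [[M gM] [K gK]] := hg.
have [K' K'0 hK'] := blip_dist P hg.
pose u (j : nat) : R := j.+1%:R; have u0 j : 0 <= u j by exact: ler0n.
pose r j w := (v *m E A (u j) *m (X 0 w + kk *: e1)) 0 0.
have mX0 : forall i, measurable_fun setT (fun w => (X 0 w + kk *: e1) i 0).
  move=> i; under eq_fun do rewrite mxE.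
  by apply: measurable_funD; [exact: X_meas|exact: measurable_cst].
have mr j : measurable_fun setT (r j) by exact: measurable_mx_lin.
have NB j := stat_noise_inB (u0 j); have mN j := L2_measurable (inB_L2 (NB j)).
have mrN j : measurable_fun setT (fun w => m + r j w + stat_noise (u j) w).
  by apply: measurable_funD => //; exact: measurable_funD.
have mmN j : measurable_fun setT (fun w => m + stat_noise (u j) w) by exact: measurable_funD.
pose hn j w := g (m + r j w + stat_noise (u j) w) - g (m + stat_noise (u j) w).
have lim0 : \int[P]_w hn j w @[j --> \oo] --> \int[P]_w cst 0 w.
  apply: (@bounded_cvg _ _ _ P hn (cst 0) (2 * M)) => //.
  - move=> k; apply: measurable_funB; [exact: (blip_measurable hg (mrN k))|exact: (blip_measurable hg (mmN k))].
  - move=> k w; rewrite /hn; apply: le_trans (ler_normB _ _) _.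
    have := gM (m + r k w + stat_noise (u k) w); have := gM (m + stat_noise (u k) w); lra.
  - apply: aeW => w.
    have hr : r k w @[k --> \oo] --> (0 : R).
      exact: (decays_seq (mxE_decays A_stable v (X 0 w + kk *: e1) 0 0) (fun k => lexx _)).
    have hK : K * `|r k w| @[k --> \oo] --> (0 : R).
      by rewrite -[X in _ --> X](mulr0 K) -(normr0 R); apply: cvgMl_tmp; exact: cvg_norm hr.
    apply/cvgrPdist_le => e e0; move/cvgrPdist_le: hK => /(_ _ e0); apply: filterS => k.
    rewrite /cst !sub0r !normrN => hk; apply: le_trans (gK _ _) (le_trans _ hk).
    have -> : m + r k w + stat_noise (u k) w - (m + stat_noise (u k) w) = r k w by ring.
    exact: ler_norm.
have e0 k : \int[P]_w g (stat_obs 0 w) = \int[P]_w hn k w + \int[P]_w g (m + stat_noise (u k) w).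
  rewrite -(stat_obs_int (u0 k) hg) /hn RintegralB//; last 2 first.
  - exact: (blip_int P hg (mrN k)).
  - exact: (blip_int P hg (mmN k)).
  rewrite subrK /Rintegral; congr fine; apply: ae_eq_integral => //.
  - by apply/measurable_EFinP; exact: (blip_measurable hg (stat_obs_measurable (u0 k))).
  - by apply/measurable_EFinP; exact: (blip_measurable hg (mrN k)).
  - by have := stat_obs_repr (u0 k); apply: filterS => w -> _.
have lim1 : \int[P]_w g (m + stat_noise (u k) w) @[k --> \oo] --> \int[P]_w g (m + Y w).
  apply/cvgrPdist_le => e e0'; have K1 : 0 < K' + 1 by rewrite ltr_wpDl.
  have [T0 T00 hT] := hY _ (divr_gt0 e0' K1); near=> k.
  have uk : T0 <= u k.
    apply: le_trans (_ : k%:R <= _); last by rewrite /u ler_nat.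
    by near: k; exact: nbhs_infty_ger.
  have [G [GB nG hG]] := hT _ uk.
  have -> : \int[P]_w g (m + stat_noise (u k) w) = \int[P]_w g (m + G w).
    apply: (@inB_same_int _ _ _ P H B B_fBM (fun x => g (m + x)) M) => //.
    apply: continuous_measurable_fun => x; apply: (@continuous_comp _ _ _ (fun x => m + x) g).
      by apply: cvgD; [exact: cvg_cst|exact: cvg_id].
    exact: blip_continuous.
  have LG := inB_L2 GB; have LY := inB_L2 YB.
  have eD : (fun w => m + Y w) - (fun w => m + G w) = Y - G.
    by apply/funext => w; rewrite !fctE; ring.
  have LD : L2 P ((fun w => m + Y w) - (fun w => m + G w)) by rewrite eD; exact: L2B.
  have mY : measurable_fun setT (fun w => m + Y w).
    by apply: measurable_funD => //; exact: L2_measurable LY.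
  have mG : measurable_fun setT (fun w => m + G w).
    by apply: measurable_funD => //; exact: L2_measurable LG.
  apply: le_trans (hK' _ _ LD mY mG) _; rewrite eD nmBC//.
  apply: le_trans (ler_wpM2l K'0 hG) _.
  by rewrite mulrCA ler_piMr ?(ltW e0')// ler_pdivrMr// mul1r lerDl.
rewrite Rintegral_cst// mul0r in lim0.
have h : \int[P]_w hn k w + \int[P]_w g (m + stat_noise (u k) w) @[k --> \oo] --> 0 + \int[P]_w g (m + Y w).
  exact: cvgD lim0 lim1.
rewrite add0r in h.
have h2 : (fun _ : nat => \int[P]_w g (stat_obs 0 w)) k @[k --> \oo] --> \int[P]_w g (m + Y w).
  apply/cvgrPdist_le => e e0'; move/cvgrPdist_le: h => /(_ _ e0'); apply: filterS => k.
  by rewrite (e0 k).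
have h3 : (fun _ : nat => \int[P]_w g (stat_obs 0 w)) k @[k --> \oo] --> \int[P]_w g (stat_obs 0 w).
  exact: cvg_cst.
exact: (cvg_unique _ h3 h2).
Unshelve. all: by end_near. Qed.

End limit_law.

(** * Translation of Lebesgue measure and of normal laws *)

Section translation.
Context {R : realType}.
Local Notation mu := (@lebesgue_measure R).
Local Notation mR := (measurableTypeR R).

Lemma translate_measurable (m : R) : measurable_fun setT (fun x : mR => (m + x) : mR).
Proof. by apply: measurable_funD. Qed.

Definition translate (m : R) : {mfun mR >-> mR} := mfun_Sub (mem_set (translate_measurable m)).

Lemma translate_itv (m : R) (a b : R) : (fun x => m + x) @^-1` `]a, b] = `](a - m), (b - m)]%classic.
Proof.
apply/seteqP; split => x /=; rewrite !in_itv/= => /andP[h1 h2]; apply/andP; split; lra.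
Qed.

(** The translated measure gives half-open intervals their length, which characterises Lebesgue
    measure. *)
Lemma lebesgue_translate (m : R) (V : set mR) : measurable V -> mu V = mu ((fun x => m + x) @^-1` V).
Proof.
pose nu := pushforward mu (translate m).
have := @lebesgue_measure_unique R (pushforward mu (translate m)).
move=> h mV; rewrite (h (translate_measurable m) _ V mV)// => _ [[a b] _ <-] /=.
have -> : pushforward mu (translate m) `]a, b] = mu `](a - m), (b - m)].
  by rewrite /pushforward -translate_itv.
by rewrite !lebesgue_measure_itv/= !lte_fin ltrD2r -!EFinB (_ : b - m - (a - m) = b - a)//; ring.
Qed.

Lemma normal_translate (m s : R) (V : set mR) : measurable V -> s != 0 ->
  normal_prob 0 s ((fun x => m + x) @^-1` V) = normal_prob m s V.
Proof.
move=> mV s0; rewrite /normal_prob.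
have mt : measurable_fun setT (fun x : mR => (m + x) : mR) := translate_measurable m.
have mp : measurable_fun V (EFin \o normal_pdf m s).
  by apply: measurable_funTS; apply/measurable_EFinP; exact: measurable_normal_pdf.
have := @ge0_integral_pushforward _ _ mR mR R (translate m) mt mu V (EFin \o normal_pdf m s) mV mp.
move=> /(_ (fun y _ => _)) h.
have e : (\int[pushforward mu (translate m)]_(y in V) (normal_pdf m s y)%:E =
    \int[mu]_(y in V) (normal_pdf m s y)%:E)%E.
  apply: eq_measure_integral => A mA AV /=.
  by rewrite /pushforward (lebesgue_translate m mA).
have h0 : forall y : mR, (0 <= (EFin \o normal_pdf m s) y)%E by move=> y; rewrite /= lee_fin normal_pdf_ge0.
rewrite -e (h h0).
apply: eq_integral => x _ /=; congr EFin.
by rewrite !normal_pdfE// (normal_fun_center m)/= (addrC m) addrK.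
Qed.

End translation.

(** * Variables with the law of a shifted element of the Gaussian space *)

Section gaussian_shift.
Context {R : realType} {d : measure_display} {Omega : measurableType d}.
Variables (P : probability Omega R) (H : R) (B : R -> Omega -> R).
Hypothesis B_fBM : fBM P H B.

Lemma same_law_gaussian (X Y : Omega -> R) : measurable_fun setT X ->
  (forall E : set R, measurable E -> P (X @^-1` E) = P (Y @^-1` E)) ->
  gaussian_rv P Y -> gaussian_rv P X.
Proof.
move=> mX XY [mY [m [s [s0 h]]]]; split => //; exists m, s; split => // E mE.
by rewrite XY// h.
Qed.

(** Integrals of nonnegative functions are transported before integrability is known, so the
    finiteness passes from [Y] to [X]. *)
Lemma same_law_L2 (X Y : Omega -> R) : measurable_fun setT X ->
  (forall E : set R, measurable E -> P (X @^-1` E) = P (Y @^-1` E)) ->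
  L2 P Y -> L2 P X.
Proof.
move=> mX XY [mY iY]; split => //.
have mX1 : measurable_fun setT (X : Omega -> measurableTypeR R) by exact: mX.
have mY1 : measurable_fun setT (Y : Omega -> measurableTypeR R) by exact: mY.
pose X' : {mfun Omega >-> measurableTypeR R} := HB.pack (X : Omega -> measurableTypeR R) (isMeasurableFun.Build _ _ _ _ _ mX1).
pose Y' : {mfun Omega >-> measurableTypeR R} := HB.pack (Y : Omega -> measurableTypeR R) (isMeasurableFun.Build _ _ _ _ _ mY1).
pose f := (fun x : measurableTypeR R => (x ^+ 2)%:E).
have mf : measurable_fun setT f by apply/measurable_EFinP; apply: measurable_funX.
have f0 x : (0 <= f x)%E by rewrite lee_fin sqr_ge0.
have e : (\int[P]_w f (X w) = \int[P]_w f (Y w))%E.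
  have h1 := @ge0_integral_pushforward _ _ _ _ R X' mX P setT f measurableT mf (fun y _ => f0 y).
  have h2 := @ge0_integral_pushforward _ _ _ _ R Y' mY P setT f measurableT mf (fun y _ => f0 y).
  rewrite preimage_setT in h1 h2; rewrite -h1 -h2.
  by apply: eq_measure_integral => V mV _; rewrite /pushforward/=; exact: XY.
have mX2 : measurable_fun setT (EFin \o (fun w => X w ^+ 2)) by apply/measurable_EFinP; exact: measurable_funX.
apply/integrableP; split => //.
move/integrableP: iY => [_]; rewrite (_ : (\int[P]_x `|_| = \int[P]_w f (Y w))%E); last first.
  by apply: eq_integral => w _ /=; rewrite ger0_norm ?sqr_ge0.
rewrite -e; congr (_ < _)%E; apply: eq_integral => w _ /=.
by rewrite ger0_norm ?sqr_ge0.
Qed.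

Lemma inB_shift_gaussian m Y : inB P B Y -> gaussian_rv P (fun w => m + Y w).
Proof.
move=> YB; have mY := L2_measurable (inB_L2 YB); split; first exact: measurable_funD.
exists m, (nm P Y); split; [exact: nm_ge0|move=> E mE].
have e : (fun w => m + Y w) @^-1` E = Y @^-1` ((fun x => m + x) @^-1` E) by [].
have mE' : measurable ((fun x => m + x) @^-1` E).
  by rewrite -[X in measurable X]setTI; exact: translate_measurable.
rewrite e (inB_law B_fBM YB mE'); case: eqP => [_|/eqP s0]; last exact: normal_translate.
by rewrite !diracE /preimage; congr ((_ _)%:R%:E); apply/idP/idP; rewrite !inE/= addr0.
Qed.

(** All four conclusions depend on the law alone. Square integrability of the stationary state is
    obtained here, not assumed. *)
Lemma shift_law m (Y Z : Omega -> R) : inB P B Y -> measurable_fun setT Z ->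
  (forall g, blip g -> \int[P]_w g (Z w) = \int[P]_w g (m + Y w)) ->
  [/\ gaussian_rv P Z, L2 P Z, \int[P]_w Z w = m & nm P (Z - cst m) = nm P Y].
Proof.
move=> YB mZ hZ; have LY := inB_L2 YB; have mY := L2_measurable LY.
have mmY : measurable_fun setT (fun w => m + Y w) by exact: measurable_funD.
have law := law_eq mZ mmY hZ.
have LmY : L2 P (fun w => m + Y w) := L2D (L2_cst P m) LY.
have LZ := same_law_L2 mZ law LmY.
have LZm : L2 P (Z - cst m) by apply: L2B => //; exact: L2_cst.
split => //.
- exact: same_law_gaussian law (inB_shift_gaussian m YB).
- transitivity (\int[P]_w (m + Y w)).
    by apply: (@transfer_int _ _ _ P Z (fun w => m + Y w) id) => //; exact: L2_int.
  rewrite RintegralD//; [|exact: (L2_int (L2_cst P m))|exact: L2_int].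
  by rewrite (inB_mean B_fBM YB) addr0 Rintegral_cst// [X in fine X]probability_setT mulr1.
- rewrite /nm /ip; congr Num.sqrt.
  have := @transfer_int _ _ _ P Z (fun w => m + Y w) (fun x => (x - m) * (x - m)) mZ mmY law.
  move=> h; rewrite [LHS]h => //; last 3 first.
  + by apply: measurable_funM; apply: measurable_funB.
  + exact: (L2_mul LZm LZm).
  + by have := L2_mul LY LY; congr (P.-integrable setT); apply/funext => w /=; rewrite addrAC subrr add0r.
  + by congr Rintegral; apply/funext => w; rewrite addrAC subrr add0r.
Qed.

End gaussian_shift.

(** * A fundamental theorem for functions sewn against an integrator *)

Section sewn_integral.
Context {R : realType}.
Local Notation mu := (@lebesgue_measure R).

(** Evaluating [phi] at the later point lets one hypothesis serve both signs of the increment; the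
    error divided by [|y - x|] is [C |y - x|^H], which vanishes. *)
Lemma derive_of_sewn (H : R) (M phi G : R -> R) (x g C r0 : R) : 0 < H -> 0 <= C -> 0 < r0 ->
  is_derive x (1 : R) G g -> {for x, continuous phi} ->
  (forall y : R, `|y - x| <= r0 ->
     `|M y - M x - phi (Num.max x y) * (G y - G x)| <= C * `|y - x| * `|y - x| `^ H) ->
  is_derive x (1 : R) M (phi x * g).
Proof.
move=> H0 C0 r00 [dG eG] cphi hM.
pose q (h : R) := h^-1 *: ((G \o shift x) (h *: (1 : R)) - G x).
pose m (h : R) := h^-1 *: ((M \o shift x) (h *: (1 : R)) - M x).
pose f (h : R) := phi (Num.max x (h + x)).
have cq : q h @[h --> 0^'] --> g by rewrite -eG; exact: dG.
have cf : f h @[h --> 0^'] --> phi x.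
  have c2 : {for (0 : R), continuous f}.
    apply: (@continuous_comp _ _ _ (fun h : R => Num.max x (h + x)) phi).
      apply: continuous_max; first exact: cst_continuous.
      by apply: cvgD; [exact: cvg_id|exact: cvg_cst].
    by rewrite add0r maxxx.
  have f0 : f 0 = phi x by rewrite /f add0r maxxx.
  have h : f h @[h --> 0] --> f 0 by exact: c2.
  by rewrite -f0; apply: cvg_within_filter h.
have cfq : f h * q h @[h --> 0^'] --> phi x * g by exact: cvgM.
have cr : (m h - f h * q h) @[h --> 0^'] --> (0 : R).
  apply/cvgr0Pnorm_le => e e0; have [r r_gt0 hr] := mesh_exists H0 C0 e0.
  near=> h.
  have h0 : h != 0 by near: h; exact: nbhs_dnbhs_neq.
  have hr1 : `|h| <= r by near: h; exact: dnbhs0_le.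
  have hr2 : `|h| <= r0 by near: h; exact: dnbhs0_le.
  have := hM (h + x); rewrite addrK => /(_ hr2) h1.
  have -> : m h - f h * q h = h^-1 * (M (h + x) - M x - f h * (G (h + x) - G x)).
    by rewrite /m /q /= /GRing.scale/= mulr1; ring.
  have hh : 0 < `|h| by rewrite normr_gt0.
  rewrite normrM normfV mulrC ler_pdivrMr//; apply: le_trans h1 _.
  rewrite -mulrA mulrCA mulrC ler_pM2r//; apply: le_trans hr.
  by rewrite ler_wpM2l// ge0_ler_powR// ?nnegrE ?(ltW H0)// ltW.
have cm : m h @[h --> 0^'] --> phi x * g.
  have -> : m = (fun h => (m h - f h * q h) + f h * q h) by apply/funext => h; rewrite subrK.
  by rewrite -[X in _ --> X]add0r; exact: cvgD.
by apply: DeriveDef; [exact: cvgP cm|exact: cvg_lim cm].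
Unshelve. all: by end_near. Qed.

(** The integrator may fail to be differentiable at 0, as happens to [half_cov] for small [H], so
    the interval starts at [e > 0]. *)
Lemma sewn_FTC (H : R) (M phi G g : R -> R) (C T e : R) : 0 < H -> 0 <= C ->
  continuous phi -> (forall x : R, 0 < x -> is_derive x (1 : R) G (g x)) ->
  (forall x : R, 0 < x -> {for x, continuous g}) ->
  (forall x y, 0 <= x -> x <= y -> y <= T ->
     `|M y - M x - phi y * (G y - G x)| <= C * (y - x) * (y - x) `^ H) ->
  0 < e -> e <= T ->
  (\int[mu]_(x in `[e, T]) (phi x * g x)%:E = (M T - M e)%:E)%E.
Proof.
move=> H0 C0 cphi dG cg hM e0 eT.
(* [N] and [psi] continue [M] and [phi] beyond [T] with the same expansion, so that a two-sided
   derivative exists at [T] too. *)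
pose N (y : R) := if y <= T then M y else M T + phi T * (G y - G T).
pose psi (y : R) := phi (Num.min y T).
have cpsi : continuous psi.
  move=> x; apply: (@continuous_comp _ _ _ (fun y : R => Num.min y T) phi); last exact: cphi.
  by apply: continuous_min; [exact: cvg_id|exact: cst_continuous].
have T0 : 0 < T := lt_le_trans e0 eT.
have hN x y : 0 <= x -> x <= y -> `|N y - N x - psi y * (G y - G x)| <= C * (y - x) * (y - x) `^ H.
  move=> x0 xy; rewrite /N /psi; have [yT|Ty] := leP y T.
    by rewrite (le_trans xy yT); exact: hM.
  have [xT|Tx] := leP x T.
    have -> : M T + phi T * (G y - G T) - M x - phi T * (G y - G x) =
      M T - M x - phi T * (G T - G x) by ring.
    apply: le_trans (hM _ _ x0 xT (lexx _)) _.
    have h1 : T - x <= y - x by rewrite lerD2r ltW.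
    apply: ler_pM; rewrite ?mulr_ge0 ?powR_ge0 ?subr_ge0// ?ler_wpM2l//.
    by rewrite ge0_ler_powR// ?nnegrE ?subr_ge0// ltW.
  rewrite (_ : _ - _ = 0); last by ring.
  by rewrite normr0 !mulr_ge0 ?powR_ge0// subr_ge0.
have dN (x : R) : 0 < x -> is_derive x (1 : R) N (psi x * g x).
  move=> x0; apply: (@derive_of_sewn H N psi G x (g x) C x) => //; [exact: dG|exact: cpsi|move=> y yx].
  have y0 : 0 <= y.
    by move: yx; rewrite ler_norml => /andP[+ _]; rewrite lerBrDr addrC subrr.
  have [xy|yx'] := leP x y.
    by rewrite (ger0_norm (_ : 0 <= y - x)) ?subr_ge0//; apply: hN => //; exact: ltW.
  rewrite [`|y - x|]distrC (ger0_norm (_ : 0 <= x - y)) ?subr_ge0 ?(ltW yx')//.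
  have -> : N y - N x - psi x * (G y - G x) = - (N x - N y - psi x * (G x - G y)) by ring.
  by rewrite normrN; apply: hN => //; exact: ltW.
have := @FTC_pos R N (fun x => psi x * g x) e T e0 eT dN.
have -> : N T - N e = M T - M e by rewrite /N lexx eT.
move=> <-; last by move=> x x0; apply: cvgM; [exact: cpsi|exact: cg].
apply: eq_integral => x; rewrite inE/= in_itv/= => /andP[_ xT].
by rewrite /psi min_l.
Qed.

End sewn_integral.

(** * The kernel of the covariance formula and its integrability *)

Section memory_kernel.
Context {R : realType}.
Local Notation mu := (@lebesgue_measure R).
Local Notation D := (`]0%R, +oo[%classic : set R).

Lemma integrable_split01 (f : R -> R) : mu.-integrable `]0%R, 1%R] (EFin \o f) ->
  mu.-integrable `]1%R, +oo[ (EFin \o f) -> mu.-integrable D (EFin \o f).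
Proof.
have -> : D = `]0%R, 1%R] `|` `]1%R, +oo[.
  apply/seteqP; split => y /=; rewrite !in_itv/= !andbT.
    by move=> y0; case: (leP y 1) => h; [left; rewrite y0|right].
  by case => [/andP[]//|]; exact: lt_trans.
move=> /integrableP[m1 i1] /integrableP[m2 i2]; apply/integrableP.
have m12 : measurable_fun (`]0%R, 1%R] `|` `]1%R, +oo[ : set R) (EFin \o f).
  by apply/measurable_funU.
split => //; rewrite ge0_integral_setU//=; last 2 first.
- by apply/measurable_EFinP; apply: measurableT_comp => //; exact/measurable_EFinP.
- by apply/disj_setPLR => y /=; rewrite !in_itv/= andbT => /andP[_ h] /lt_geF; rewrite h.
exact: lte_add_pinfty.
Qed.

Definition memory (H t u : R) : R := (u + t) `^ (2 * H - 1) - u `^ (2 * H - 1).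

Variable H : R.
Hypotheses (H0 : 0 < H) (H1 : H < 1).

Let H2 : 2 * H - 1 <= 1.
Proof. by rewrite lerBlDr -mulr2n -[leRHS]mulr1 ler_pM2l// ltW. Qed.

(* [half_cov t u - half_cov t 0] is the covariance of the increments of [B] over
   [T - u, T] and [T, T + t]. *)
Definition half_cov (t u : R) : R := ((u + t) `^ (2 * H) - u `^ (2 * H)) / 2.

Lemma is_derive_half_cov (t : R) (x : R) : 0 <= t -> 0 < x ->
  is_derive x (1 : R) (half_cov t) (H * memory H t x).
Proof.
move=> t0 x0; have a0 : 0 < 2 * H by rewrite mulr_gt0.
have xt : 0 < x + t by rewrite ltr_wpDr.
have d1 : is_derive x (1 : R) (fun u => (u + t) `^ (2 * H)) (2 * H * (x + t) `^ (2 * H - 1)).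
  have ds : is_derive x (1 : R) (fun u : R => u + t) 1.
    by apply: (is_derive_cong (is_deriveD (is_derive_id x 1) (is_derive_cst t x 1))) => //; rewrite addr0.
  have := @is_derive1_comp R (fun y => y `^ (2 * H)) (fun u => u + t) x _ _ (is_derive1_powR (2 * H) xt) ds.
  by move=> h; apply: (is_derive_cong h) => //; rewrite mulr1.
have d2 := is_derive1_powR (2 * H) x0.
apply: (is_derive_cong (is_deriveZ 2^-1 (is_deriveB d1 d2))).
  by move=> y; exact: mulrC.
by rewrite /memory /GRing.scale/=; field.
Qed.

Lemma memory_continuous (t : R) (x : R) : 0 <= t -> 0 < x -> {for x, continuous (memory H t)}.
Proof.
move=> t0 x0; apply: cvgB; last exact: powR_continuous.
apply: (@continuous_comp _ _ _ (fun u : R => u + t) (fun y => y `^ (2 * H - 1))).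
  by apply: cvgD; [exact: cvg_id|exact: cvg_cst].
by apply: powR_continuous; rewrite ltr_wpDr.
Qed.

(** For [2 H <= 1] the power is nonincreasing and the shifted term is the smaller one; for [2 H > 1]
    the exponent is at most 1 and the shifted term is at most [1 + u + t]. One bound covers both
    regimes. *)
Lemma memory_le (t : R) (u : R) : 0 <= t -> 0 < u ->
  `|memory H t u| <= u `^ (2 * H - 1) + (1 + u + t).
Proof.
move=> t0 u0; have ut : 0 < u + t by rewrite ltr_wpDr.
rewrite /memory; have p1 := powR_ge0 u (2 * H - 1); have p2 := powR_ge0 (u + t) (2 * H - 1).
have h : (u + t) `^ (2 * H - 1) <= u `^ (2 * H - 1) + (1 + u + t).
  have [a1|a1] := leP (2 * H) 1.
    apply: (@le_trans _ _ (u `^ (2 * H - 1))); last by rewrite lerDl; lra.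
    rewrite -(opprB 1) !powRN lef_pV2 ?posrE ?powR_gt0//.
    by apply: ge0_ler_powR; rewrite ?nnegrE ?subr_ge0 ?(ltW u0) ?(ltW ut)// lerDl.
  apply: (@le_trans _ _ (1 + u + t)); last by rewrite lerDr.
  apply: (@le_trans _ _ ((1 + u + t) `^ (2 * H - 1))).
    by apply: ge0_ler_powR; rewrite ?nnegrE; lra.
  apply: le_trans (_ : _ <= (1 + u + t) `^ 1) _; last by rewrite powRr1//; lra.
  have u1 : 1 <= 1 + u + t by lra.
  exact: ler_powR.
move: ((u + t) `^ _) (u `^ _) p1 p2 h => x y *; rewrite ler_norml; apply/andP; split; lra.
Qed.

Lemma measurable_memory t : measurable_fun setT (memory H t).
Proof.
apply: measurable_funB; last exact: measurable_powR.
have -> : (fun u => (u + t) `^ (2 * H - 1)) = (fun y => y `^ (2 * H - 1)) \o (fun u => u + t) by [].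
by apply: measurableT_comp; [exact: measurable_powR|exact: measurable_funD].
Qed.

(** Near 0 the possible singularity [u^(2 H - 1)] is integrable because [0 < H]; beyond 1 the kernel
    grows at most linearly and the decay of [phi] prevails. *)
Lemma memory_integrable (t : R) (phi : R -> R) : 0 <= t -> continuous phi -> decays phi ->
  mu.-integrable D (EFin \o (fun u => phi u * memory H t u)).
Proof.
move=> t0 cphi [C [c [C0 c0 hphi]]].
have mf : measurable_fun setT (fun u => phi u * memory H t u).
  by apply: measurable_funM; [exact: continuous_measurable_fun|exact: measurable_memory].
have mfE A : measurable_fun A (EFin \o (fun u => phi u * memory H t u)).
  by apply: measurable_funTS; exact/measurable_EFinP.
have mle u : 0 < u -> `|phi u * memory H t u| <= C * expR (- c * u) * (u `^ (2 * H - 1) + (1 + u + t)).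
  by move=> u0; rewrite normrM ler_pM//; [apply: hphi; exact: ltW|exact: memory_le].
apply: integrable_split01.
- apply: (@le_integrable _ _ _ mu _ _ _ (EFin \o (fun u => C * u `^ (2 * H - 1) + C * (2 + t)))) => //; first exact: mfE.
    move=> u /=; rewrite in_itv/= => /andP[u0 u1]; rewrite lee_fin.
    rewrite [leRHS]ger0_norm; last by rewrite addr_ge0// mulr_ge0 ?powR_ge0//; lra.
    apply: le_trans (mle u u0) _; rewrite -mulrDr -mulrA ler_wpM2l//.
    apply: (@le_trans _ _ (1 * (u `^ (2 * H - 1) + (1 + u + t)))).
      rewrite ler_wpM2r ?addr_ge0 ?powR_ge0//; [by rewrite ltW|].
      by rewrite -[leRHS]expR0 ler_expR mulNr oppr_le0 mulr_ge0 ?ltW.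
    rewrite mul1r lerD2l; lra.
  have i1 : mu.-integrable `]0%R, 1%R] (EFin \o (fun u => u `^ (2 * H - 1))).
    apply/integrableP; split; first by apply: measurable_funTS; apply/measurable_EFinP; exact: measurable_powR.
    under eq_integral do rewrite /= ger0_norm ?powR_ge0//.
    by rewrite int_powR0 ?ltry// mulr_gt0.
  have i2 : mu.-integrable `]0%R, 1%R] (EFin \o (cst (C * (2 + t)))).
    apply/integrableP; split; first by apply: measurable_funTS; exact/measurable_EFinP.
    under eq_integral do rewrite /= .
    by rewrite integral_cst//= lebesgue_measure_itv/= lte_fin ltr01 -EFinB -EFinM ltry.
  have m01 : measurable (`]0%R, 1%R] : set (measurableTypeR R)) by exact: measurable_itv.
  have := integrableD m01 (integrableZl m01 C i1) i2.
  by congr (mu.-integrable _ _); apply/funext => u.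
(* Cubing [c u / 3 <= expR (c u / 3)] bounds [expR (- c u)] by [(3 / c)^3 u^-3]; against the linear
   growth [(3 + t) u] this leaves [u^-2]. *)
- pose K := C * (3 / c) ^+ 3 * (3 + t).
  have K0 : 0 <= K.
    by apply: mulr_ge0; [apply: mulr_ge0 => //; apply: exprn_ge0; rewrite divr_ge0// ltW|exact: addr_ge0].
  have bound (u : R) : 1 < u -> `|phi u * memory H t u| <= K * u `^ (- 1 - 1).
    move=> u1; have u0 : 0 < u := lt_trans ltr01 u1.
    apply: le_trans (mle u u0) _.
    have h1 : u `^ (2 * H - 1) + (1 + u + t) <= (3 + t) * u.
      have : u `^ (2 * H - 1) <= u `^ 1 by apply: ler_powR => //; exact: ltW.
      rewrite powRr1 ?(ltW u0)// => h.
      have tu : t <= t * u by rewrite ler_peMr// ltW.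
      have -> : (3 + t) * u = u + ((u + u) + t * u) by ring.
      exact: lerD h (lerD (lerD (ltW u1) (lexx u)) tu).
    have h2 : expR (- c * u) <= (3 / c) ^+ 3 * (u ^+ 3)^-1.
      rewrite mulNr expRN -[leRHS]invrK invfM invrK -exprVn invf_div.
      have cu : 0 < c / 3 * u by rewrite mulr_gt0 ?divr_gt0.
      rewrite -exprMn lef_pV2 ?posrE ?expR_gt0 ?exprn_gt0//.
      have -> : c * u = c / 3 * u * 3%:R by field.
      rewrite expRM_natr lerXn2r ?nnegrE ?(ltW cu) ?expR_ge0//.
      by apply: le_trans (expR_ge1Dx _); rewrite lerDr.
    have -> : u `^ (- 1 - 1) = (u ^+ 2)^-1.
      by rewrite -opprD powRN -powR_mulrn ?(ltW u0)//.
    have -> : K * (u ^+ 2)^-1 = C * ((3 / c) ^+ 3 * (u ^+ 3)^-1) * ((3 + t) * u).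
      by rewrite /K; have := lt0r_neq0 u0; have := lt0r_neq0 c0 => *; field; apply/andP.
    apply: ler_pM => //; rewrite ?mulr_ge0 ?expR_ge0 ?ler_wpM2l//.
    by rewrite addr_ge0 ?powR_ge0//; lra.
  apply: (@le_integrable _ _ _ mu _ _ _ (EFin \o (fun u => K * u `^ (- 1 - 1)))) => //; first exact: mfE.
    move=> u /=; rewrite in_itv/= andbT => u1; rewrite lee_fin.
    by rewrite [leRHS]ger0_norm; [exact: bound|rewrite mulr_ge0// powR_ge0].
  have i1 : mu.-integrable `]1%R, +oo[ (EFin \o (fun u => u `^ (- 1 - 1))).
    apply: (@integrableS _ _ _ mu `[1%R, +oo[) => //.
      by move=> y /=; rewrite !in_itv/= !andbT; exact: ltW.
    apply/integrableP; split; first by apply: measurable_funTS; apply/measurable_EFinP; exact: measurable_powR.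
    under eq_integral do rewrite /= ger0_norm ?powR_ge0//.
    by rewrite int_powR_inf ?ltry.
  have m1 : measurable (`]1%R, +oo[ : set (measurableTypeR R)) by exact: measurable_itv.
  have := integrableZl m1 K i1.
  by congr (mu.-integrable _ _); apply/funext => u.
Qed.

Lemma cvg_exhaust (f : R -> R) : mu.-integrable D (EFin \o f) ->
  (\int[mu]_(u in `[(n.+1%:R)^-1%R, n.+1%:R%R]) (f u)%:E @[n --> \oo] --> \int[mu]_(u in D) (f u)%:E)%E.
Proof.
move=> fi; pose S n : set R := `[(n.+1%:R)^-1, n.+1%:R]%classic.
have SD n : S n `<=` D.
  by move=> u; rewrite /S /= !in_itv/= andbT => /andP[h _]; apply: lt_le_trans h; rewrite invr_gt0.
have mS n : measurable (S n) by exact: measurable_itv.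
have [_ mfD] : True /\ measurable_fun D (EFin \o f) by split => //; exact: measurable_int fi.
have eS n : (\int[mu]_(u in S n) (f u)%:E = \int[mu]_(u in D) ((EFin \o f) \_ (S n)) u)%E.
  by rewrite -integral_mkcondr; congr integral; apply/esym/setIidPr; exact: SD.
have -> : (fun n => (\int[mu]_(u in `[(n.+1%:R)^-1%R, n.+1%:R%R]) (f u)%:E)%E) =
   (fun n => \int[mu]_(u in D) ((EFin \o f) \_ (S n)) u)%E by apply/funext => n; exact: eS.
have mD : measurable D by exact: measurable_itv.
have := @dominated_convergence _ _ _ mu D mD (fun n => (EFin \o f) \_ (S n)) (EFin \o f)
  (fun u => `|(f u)%:E|%E).
case => //.
- move=> n; apply/(measurable_restrict _ (mS n) mD); apply: (measurable_funS mD _ mfD); exact: subIsetl.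
- apply: aeW => u; rewrite /= in_itv/= andbT => u0.
  apply: cvg_near_cst; near=> n; rewrite patchE ifT//; rewrite inE /S/= in_itv/=; apply/andP; split.
    rewrite -[leRHS]invrK lef_pV2 ?posrE ?invr_gt0//; apply: (@le_trans _ _ n%:R); last by rewrite ler_nat.
    by near: n; exact: nbhs_infty_ger.
  apply: (@le_trans _ _ n%:R); last by rewrite ler_nat.
  by near: n; exact: nbhs_infty_ger.
- exact: integrable_abse.
- apply: aeW => u n _; rewrite patchE; case: ifPn => // _; rewrite abse0; exact: abse_ge0.
Unshelve. all: by end_near. Qed.

End memory_kernel.

(** * Covariance of an integral with a later increment *)

Section covariance_limit.
Context {R : realType} {d : measure_display} {Omega : measurableType d}.
Variables (P : probability Omega R) (H : R) (B : R -> Omega -> R).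
Hypotheses (H0 : 0 < H) (H1 : H < 1) (B_fBM : fBM P H B).
Local Notation mu := (@lebesgue_measure R).

Lemma half_cov_ip (t T x y : R) : 0 <= t -> 0 <= x -> x <= y -> y <= T ->
  ip P (B (T - x) - B (T - y)) (B (T + t) - B T) = half_cov H t y - half_cov H t x.
Proof.
move=> t0 x0 xy yT; have y0 := le_trans x0 xy; have T0 := le_trans y0 yT.
have Tx : 0 <= T - x by rewrite subr_ge0 (le_trans xy).
have Ty : 0 <= T - y by rewrite subr_ge0.
have Tt : 0 <= T + t by exact: addr_ge0.
rewrite (incr_ip B_fBM)// /half_cov /rho.
have -> : T - x - T = - x by ring.
have -> : T - y - (T + t) = - (y + t) by ring.
have -> : T - x - (T + t) = - (x + t) by ring.
have -> : T - y - T = - y by ring.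
by rewrite !normrN !ger0_norm ?addr_ge0//; field.
Qed.

(** By Cauchy-Schwarz, the covariance of the integral over [[T - v, T]] with the later increment
    inherits, in [v], the local expansion of the integral with integrator [half_cov]; [sewn_FTC]
    evaluates it on [[e, T]]. Over [[0, e]] the leading term contributes [C] and the expansion error
    [2 L]. *)
Lemma integral_increment_ip (phi : R -> R) (t T e C L : R) (I : Omega -> R) :
  loclip phi -> continuous phi -> 0 <= t -> 0 < e -> e <= T -> e <= 1 ->
  `|phi e| <= C -> lip phi L 0 2 ->
  stoch_integral P B T (fun u => phi (T - u)) I ->
  exists2 r, (\int[mu]_(u in `[e, T]) (phi u * (H * memory H t u))%:E = r%:E)%E &
    `|ip P I (B (T + t) - B T) - r| <= (C + 2 * L) * t `^ H * e `^ H.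
Proof.
move=> lphi cphi t0 e0 eT e1 phiC hL hI.
have T0 : 0 <= T := le_trans (ltW e0) eT; have Tt : 0 <= T + t by exact: addr_ge0.
pose Z := B (T + t) - B T; pose f u := phi (T - u).
have LZ : L2 P Z by exact: (incr_L2 B_fBM).
have nZ : nm P Z = t `^ H by rewrite (incr_nm H0 B_fBM)// addrAC subrr add0r ger0_norm.
have lf : loclip f.
  have -> : f = (fun u => (fun v => phi (- v)) (u - T)) by apply/funext => u; rewrite opprB.
  exact: (loclip_shift T (loclip_opp lphi)).
have [J hJ] := sewing H0 H1 B_fBM lf.
have LJ x : 0 <= x -> L2 P (J x) by have [h _ _] := hJ; move=> /h /inB_L2.
have [LI eI] := stoch_uniq H0 B_fBM lf hJ T0 hI.
have sew L' x y : 0 <= x -> x <= y -> y <= T -> lip phi L' x (y + 1) ->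
    nm P (J (T - x) - J (T - y) - phi y *: (B (T - x) - B (T - y))) <= 2 * L' * (y - x) * (y - x) `^ H.
  move=> x0 xy yT [L'0 hL']; have [_ _ h] := hJ.
  have Ty : 0 <= T - y by rewrite subr_ge0.
  have yx : T - y <= T - x by rewrite lerD2l lerN2.
  have := h L' (T - y) (T - x) Ty yx; have -> : T - x - (T - y) = y - x by ring.
  have -> : f (T - y) = phi y by rewrite /f; congr phi; ring.
  apply; split => // u v /andP[u1 u2] /andP[v1 v2]; rewrite /f.
  have -> : `|u - v| = `|T - u - (T - v)| by rewrite -normrN; congr Num.norm; ring.
  by apply: hL'; apply/andP; split; lra.
pose M v := ip P (J T - J (T - v)) Z.
have sewM L' x y : 0 <= x -> x <= y -> y <= T -> lip phi L' x (y + 1) ->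
    `|M y - M x - phi y * (half_cov H t y - half_cov H t x)| <= 2 * L' * t `^ H * (y - x) * (y - x) `^ H.
  move=> x0 xy yT hL'; have y0 := le_trans x0 xy.
  have Tx : 0 <= T - x by rewrite subr_ge0 (le_trans xy).
  have Ty : 0 <= T - y by rewrite subr_ge0.
  have LB : L2 P (B (T - x) - B (T - y)) by exact: (incr_L2 B_fBM).
  have LJxy : L2 P (J (T - x) - J (T - y)) by apply: L2B; exact: LJ.
  have LS : L2 P (J (T - x) - J (T - y) - phi y *: (B (T - x) - B (T - y))) by apply: L2B => //; exact: L2Z.
  have -> : M y - M x - phi y * (half_cov H t y - half_cov H t x) =
      ip P (J (T - x) - J (T - y) - phi y *: (B (T - x) - B (T - y))) Z.
    rewrite (ipBl LJxy (L2Z _ LB) LZ) (ipZl _ LB LZ) (half_cov_ip t0 x0 xy yT); congr (_ - _).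
    rewrite /M -(ipBl _ _ LZ); [|apply: L2B; exact: LJ|apply: L2B; exact: LJ].
    by congr (ip P _ Z); apply/funext => w; rewrite !fctE; ring.
  apply: le_trans (cauchy_schwarz LS LZ) _; rewrite nZ.
  have := ler_wpM2r (powR_ge0 t H) (sew L' x y x0 xy yT hL').
  congr (_ <= _); ring.
have [L' hL'] := loclip_ab 0 (T + 1) lphi; have [L'0 _] := hL'.
exists (M T - M e).
  apply: (@sewn_FTC R H M phi (half_cov H t) _ (2 * L' * t `^ H) T e H0) => //.
  - by rewrite !mulr_ge0 ?powR_ge0.
  - by move=> x x0; exact: is_derive_half_cov.
  - by move=> x x0; apply: cvgM; [exact: cvg_cst|exact: memory_continuous].
  - move=> x y x0 xy yT; apply: sewM => //; apply: lipS hL' => //; by rewrite lerD2r.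
have J0 : nm P (J 0) = 0 by have [] := hJ.
have MT : ip P I Z = M T.
  have L0 := LJ 0 (lexx _).
  rewrite (ip_ae LI (LJ T T0) LZ eI) /M subrr (ipBl (LJ T T0) L0 LZ).
  have e00 : {ae P, forall w, J 0 w = (0 : Omega -> R) w} by exact: nm_eq0.
  by rewrite (ip_ae L0 (L2_0 P) LZ e00) ip0l subr0.
rewrite -/Z MT opprB addrC subrK.
have M0 : M 0 = 0 by rewrite /M subr0 subrr ip0l.
have := sewM L 0 e (lexx _) (ltW e0) eT; rewrite M0 !subr0 => h.
have hL2 : lip phi L 0 (e + 1) by apply: lipS hL => //; lra.
have {h} h := h hL2.
have hG : `|half_cov H t e - half_cov H t 0| <= e `^ H * t `^ H.
  rewrite -(half_cov_ip t0 (lexx _) (ltW e0) eT) -/Z.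
  have Te : 0 <= T - e by rewrite subr_ge0.
  have T0' : 0 <= T - 0 by rewrite subr0.
  apply: le_trans (cauchy_schwarz (incr_L2 B_fBM T0' Te) LZ) _; rewrite nZ (incr_nm H0 B_fBM)//.
  have -> : T - 0 - (T - e) = e by ring.
  by rewrite ger0_norm// ltW.
have L0 : 0 <= L by case: hL.
have -> : M e = (M e - phi e * (half_cov H t e - half_cov H t 0)) + phi e * (half_cov H t e - half_cov H t 0).
  by rewrite subrK.
apply: le_trans (ler_normD _ _) _.
have -> : (C + 2 * L) * t `^ H * e `^ H = 2 * L * t `^ H * e `^ H + C * (e `^ H * t `^ H) by ring.
apply: lerD; last by rewrite normrM ler_pM.
apply: le_trans h _; rewrite ler_wpM2r ?powR_ge0// ler_piMr// !mulr_ge0 ?powR_ge0//.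
Qed.

(** The cut-off [1 / (n + 1)] and the horizon [n + 1] move together; the remainder is of order
    [(n + 1)^(- H)]. *)
Lemma integral_increment_limit (phi : R -> R) (t : R) (I : R -> Omega -> R) :
  loclip phi -> continuous phi -> decays phi -> 0 <= t ->
  (forall T, 0 <= T -> stoch_integral P B T (fun u => phi (T - u)) (I T)) ->
  ip P (I n.+1%:R) (B (n.+1%:R + t) - B n.+1%:R) @[n --> \oo] -->
    H * \int[mu]_(u in `[0, +oo[) (phi u * memory H t u).
Proof.
move=> lphi cphi dphi t0 hI; have [L hL] := loclip_ab 0 2 lphi.
have [C [c [C0 c0 hC]]] := dphi.
have mi := memory_integrable H0 H1 t0 cphi dphi.
have mi' : mu.-integrable `]0, +oo[ (EFin \o (fun u => phi u * (H * memory H t u))).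
  have m0 : measurable (`]0%R, +oo[ : set (measurableTypeR R)) by exact: measurable_itv.
  have := integrableZl m0 H mi; congr (mu.-integrable _ _); apply/funext => u /=.
  by rewrite -EFinM; congr EFin; ring.
have -> : H * \int[mu]_(u in `[0, +oo[) (phi u * memory H t u) =
    \int[mu]_(u in `]0, +oo[) (phi u * (H * memory H t u)).
  rewrite -(Rintegral_itv_obnd_cbnd mi) -RintegralZl//.
  by apply: eq_Rintegral => u _; ring.
have := cvg_exhaust mi'; set l := (\int[mu]_(u in _) _)%E => hl.
have lf : l \is a fin_num by exact: integrable_fin_num.
have Tn n : (0 : R) <= n.+1%:R by exact: ler0n.
have en n : (0 : R) < n.+1%:R^-1 by rewrite invr_gt0.
have en1 n : (n.+1%:R^-1 : R) <= 1 by rewrite invf_le1// ler1n.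
have enT n : (n.+1%:R^-1 : R) <= n.+1%:R by apply: le_trans (en1 n) _; rewrite ler1n.
have phiC n : `|phi n.+1%:R^-1| <= C.
  apply: le_trans (hC _ (ltW (en n))) _; rewrite ler_piMr// -expR0 ler_expR mulNr oppr_le0.
  by rewrite mulr_ge0// ltW.
have /choice[r hr] : forall n, exists r : R,
    (\int[mu]_(u in `[n.+1%:R^-1%R, n.+1%:R%R]) (phi u * (H * memory H t u))%:E = r%:E)%E /\
    `|ip P (I n.+1%:R) (B (n.+1%:R + t) - B n.+1%:R) - r| <= (C + 2 * L) * t `^ H * (n.+1%:R^-1) `^ H.
  move=> n; have [r h1 h2] := integral_increment_ip lphi cphi t0 (en n) (enT n) (en1 n) (phiC n) hL (hI _ (Tn n)).
  by exists r.
have cr : r n @[n --> \oo] --> fine l.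
  have h : ((r n)%:E @[n --> \oo] --> (fine l)%:E)%E.
    rewrite fineK//; apply: cvg_trans hl; apply: near_eq_cvg; apply: nearW => n.
    by have [-> _] := hr n.
  exact: fine_cvg h.
have K0 : 0 <= (C + 2 * L) * t `^ H.
  by have [L0 _] := hL; rewrite mulr_ge0 ?powR_ge0// addr_ge0// mulr_ge0.
have c0' : ip P (I n.+1%:R) (B (n.+1%:R + t) - B n.+1%:R) - r n @[n --> \oo] --> (0 : R).
  apply/cvgr0Pnorm_le => e e0; have [r0 r00 hr0] := mesh_exists H0 K0 e0.
  near=> n; apply: le_trans (hr n).2 _; apply: le_trans hr0; rewrite ler_wpM2l//.
  apply: ge0_ler_powR; rewrite ?nnegrE ?(ltW H0) ?(ltW r00) ?(ltW (en n))// ltW//.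
  by near: n; exact: (near_infty_natSinv_lt (PosNum r00)).
have -> : (fun n : nat => ip P (I n.+1%:R) (B (n.+1%:R + t) - B n.+1%:R)) =
   (fun n => (ip P (I n.+1%:R) (B (n.+1%:R + t) - B n.+1%:R) - r n) + r n).
  by apply/funext => n; rewrite subrK.
by rewrite -[X in _ --> X]add0r; exact: cvgD.
Unshelve. all: by end_near. Qed.

End covariance_limit.

(** * Mean, joint normality and covariance of the stationary process *)

Section stationary_moments.
Context {R : realType} {d : measure_display} {Omega : measurableType d}.
Variables (P : probability Omega R) (H : R) (B : R -> Omega -> R).
Hypotheses (H0 : 0 < H) (H1 : H < 1) (B_fBM : fBM P H B).
Variables (p : nat) (alpha : nat -> R) (sigma : R).
Hypothesis alpha1_neq0 : alpha 1%N != 0.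
Hypothesis sigma_gt0 : 0 < sigma.
Local Notation A := (companion p.+1 alpha).
Local Notation delta := (@delta_vec R p.+1).
Local Notation e1 := (@first_vec R p).
Local Notation kk := (alpha 0%N / alpha 1%N).
Hypothesis A_stable : eigenvalues_Re_lt0 A.
Variable J : 'I_p.+1 -> R -> Omega -> R.
Hypothesis J_sews : forall i, sews P H B (fun u => (E A (- u) *m delta) i 0) (J i).
Variable X : R -> Omega -> 'cV[R]_p.+1.
Hypothesis X_sol : sde_solution P A (alpha 0%N) sigma B (X 0) X.
Hypothesis X_stat : strictly_stationary P X.
Local Notation mu := (@lebesgue_measure R).

Lemma ip_polar U V : L2 P U -> L2 P V -> 4 * ip P U V = nm P (U + V) ^+ 2 - nm P (U - V) ^+ 2.
Proof.
move=> LU LV; have LD := L2D LU LV; have LB := L2B LU LV.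
rewrite !sqr_nm (ipDl LU LV LD) (ipDr LU LV LU) (ipDr LU LV LV) (ipBl LU LV LB).
by rewrite (ipBr LU LV LU) (ipBr LU LV LV) (ipC _ V U); ring.
Qed.

(** [Z] is any measurable version of the observable. The number [s] is its standard deviation at
    every time and also the limit of the norms of the noise, so second moments at time 0 are
    computed from large times. *)
Lemma stat_obs_law (v : 'rV[R]_p.+1) n (c tau : 'I_n -> R) : (forall k, 0 <= tau k) ->
  exists2 s : R,
   (forall Z T, 0 <= T -> measurable_fun setT Z -> {ae P, forall w, Z w = stat_obs B v c tau X T w} ->
     [/\ gaussian_rv P Z, L2 P Z, \int[P]_w Z w = - kk * (v *m e1) 0 0 &
         nm P (Z - cst (- kk * (v *m e1) 0 0)) = s]) &
   nm P (stat_noise B alpha sigma J v c tau n.+1%:R) @[n --> \oo] --> s.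
Proof.
move=> tau0.
have [Y YB [hY nY]] := stat_obs_limit H0 H1 B_fBM alpha1_neq0 sigma_gt0 A_stable J_sews v c tau0 X_sol X_stat.
exists (nm P Y).
  move=> Z T T0 mZ eZ; apply: (shift_law B_fBM YB mZ) => g hg.
  have mO := stat_obs_measurable B_fBM v c tau0 X_sol T0.
  rewrite -(hY g hg) -(stat_obs_int H0 B_fBM alpha1_neq0 sigma_gt0 J_sews v c tau0 X_sol X_stat T0 hg).
  rewrite /Rintegral; congr fine; apply: ae_eq_integral => //.
  - by apply/measurable_EFinP; exact: (blip_measurable hg mZ).
  - by apply/measurable_EFinP; exact: (blip_measurable hg mO).
  - by apply: filterS eZ => w hw _; rewrite hw.
apply/cvgrPdist_le => e e0; have [T0 T00 hT] := nY e e0; near=> k.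
rewrite distrC; apply: hT; apply: (@le_trans _ _ k%:R); last by rewrite ler_nat.
by near: k; exact: nbhs_infty_ger.
Unshelve. all: by end_near. Qed.

Definition obs (v : 'rV[R]_p.+1) (t : R) (w : Omega) : R := (v *m X t w) 0 0.

Lemma obs_measurable v t : 0 <= t -> measurable_fun setT (obs v t).
Proof. by move=> t0; apply: measurable_mx_lin => i; have [] := X_sol t0. Qed.

Lemma obs_moments v t : 0 <= t -> L2 P (obs v t) /\ \int[P]_w obs v t w = - kk * (v *m e1) 0 0.
Proof.
move=> t0; have [s hs _] := @stat_obs_law v 0 (fun=> 0) (fun=> 0) (fun=> lexx _).
have [] // := hs (obs v t) t t0 (obs_measurable v t0).
by apply: aeW => w; rewrite /stat_obs fctE big_ord0 addr0.
Qed.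

Lemma B0_ae : {ae P, forall w, B 0 w = 0}.
Proof. by have [_ + _ _] := B_fBM. Qed.

Lemma obs_gaussian v n (c tau : 'I_n -> R) : (forall k, 0 <= tau k) ->
  gaussian_rv P (fun w => obs v 0 w + \sum_k c k * B (tau k) w).
Proof.
move=> tau0; have [s hs _] := @stat_obs_law v n c tau tau0.
have [] // := hs (fun w => obs v 0 w + \sum_k c k * B (tau k) w) 0 (lexx _).
  apply: measurable_funD; first exact: obs_measurable.
  have -> : (fun w => \sum_k c k * B (tau k) w) = \sum_k c k *: B (tau k).
    by apply/funext => w; rewrite fct_sumE.
  by apply: L2_measurable; apply: L2_sum => k _; apply: L2Z; exact: (fBM_L2 B_fBM).
apply: filterS B0_ae => w hw.
transitivity (obs v 0 w + (\sum_k c k *: (B (0 + tau k) - B 0)) w); last by [].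
congr (_ + _); by rewrite fct_sumE; apply: eq_bigr => k _; rewrite add0r !fctE hw subr0.
Qed.

(** Polarization: the observables with coefficients 1 and -1 on the increment have variances that
    are limits of variances of the noise, so the covariance is a limit of covariances within the
    noise, given by [integral_increment_limit]. *)
Lemma obs_cov v t : 0 <= t ->
  ip P (obs v 0 - cst (- kk * (v *m e1) 0 0)) (B t) =
  sigma * \sum_i v 0 i * (H * \int[mu]_(u in `[0, +oo[) ((E A u *m delta) i 0 * memory H t u)).
Proof.
move=> t0; set m := - kk * _; have t0' := fun _ : 'I_1 => t0.
have [LY _] := obs_moments v (lexx (0 : R)); have Lm := L2_cst P m.
have LYm : L2 P (obs v 0 - cst m) := L2B LY Lm.
have Lt : L2 P (B t) := fBM_L2 B_fBM t0.
pose N T : Omega -> R := sigma *: (\sum_i v 0 i *: state_int alpha J i T).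
pose D T := B (T + t) - B T.
have LS i T : 0 <= T -> L2 P (state_int alpha J i T).
  by move=> T0; exact: (inB_L2 (state_int_inB H0 B_fBM J_sews i T0)).
have LN T : 0 <= T -> L2 P (N T).
  by move=> T0; apply: L2Z; apply: L2_sum => i _; apply: L2Z; exact: LS.
have LD T : 0 <= T -> L2 P (D T).
  by move=> T0; apply: (incr_L2 B_fBM) => //; exact: addr_ge0.
have noiseE a T : stat_noise B alpha sigma J v (fun _ : 'I_1 => a) (fun=> t) T = N T + a *: D T.
  by rewrite /stat_noise big_ord1.
have obsE a : {ae P, forall w, (obs v 0 + a *: B t) w = stat_obs B v (fun _ : 'I_1 => a) (fun=> t) X 0 w}.
  apply: filterS B0_ae => w hw; rewrite /stat_obs big_ord1 add0r.
  by rewrite !fctE hw subr0.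
have moba a : measurable_fun setT (obs v 0 + a *: B t) by exact: (L2_measurable (L2D LY (L2Z a Lt))).
have lim a : nm P (N n.+1%:R + a *: D n.+1%:R) ^+ 2 @[n --> \oo] --> nm P (obs v 0 - cst m + a *: B t) ^+ 2.
  have [s hs cs] := @stat_obs_law v 1 (fun=> a) (fun=> t) t0'.
  have [_ _ _ e] := hs _ 0 (lexx _) (moba a) (obsE a).
  have -> : obs v 0 - cst m + a *: B t = obs v 0 + a *: B t - cst m by rewrite addrAC.
  rewrite e expr2; under eq_fun do rewrite expr2 -noiseE.
  exact: cvgM.
have l1 : 4 * ip P (N n.+1%:R) (D n.+1%:R) @[n --> \oo] --> 4 * ip P (obs v 0 - cst m) (B t).
  have h := cvgB (lim 1) (lim (-1)); rewrite !(scale1r, scaleN1r) in h.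
  rewrite (ip_polar LYm Lt).
  have e n : 4 * ip P (N n.+1%:R) (D n.+1%:R) =
      nm P (N n.+1%:R + 1 *: D n.+1%:R) ^+ 2 - nm P (N n.+1%:R + -1 *: D n.+1%:R) ^+ 2.
    by rewrite (ip_polar (LN _ (ler0n _ _)) (LD _ (ler0n _ _))) scale1r scaleN1r.
  under eq_fun do rewrite e.
  exact: h.
have l2 : 4 * ip P (N n.+1%:R) (D n.+1%:R) @[n --> \oo] -->
    4 * (sigma * \sum_i v 0 i * (H * \int[mu]_(u in `[0, +oo[) ((E A u *m delta) i 0 * memory H t u))).
  have e n : ip P (N n.+1%:R) (D n.+1%:R) =
      sigma * \sum_i v 0 i * ip P (state_int alpha J i n.+1%:R) (D n.+1%:R).
    have n0 : (0 : R) <= n.+1%:R by exact: ler0n.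
    have Li i : L2 P (v 0 i *: state_int alpha J i n.+1%:R) by apply: L2Z; exact: LS.
    rewrite /N (ipZl _ (L2_sum _ (fun i _ => Li i)) (LD _ n0)) (ip_suml _ Li (LD _ n0)).
    by congr (_ * _); apply: eq_bigr => i _; rewrite (ipZl _ (LS i _ n0) (LD _ n0)).
  under eq_fun do rewrite e.
  apply: cvgMl_tmp; apply: cvgMl_tmp; apply: cvg_big => [|i _]; first by move=> x; exact: add_continuous.
  apply: cvgMl_tmp.
  have em : (fun u => (E A u *m delta) i 0) = (fun u => (1%:M *m E A u *m delta) i 0).
    by apply/funext => u; rewrite mul1mx.
  apply: (@integral_increment_limit _ _ _ P H B H0 H1 B_fBM (fun u => (E A u *m delta) i 0) t (state_int alpha J i)) => //.
  - by rewrite em; exact: mxE_loclip.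
  - by rewrite em => x; exact: mxE_cont.
  - by rewrite em; exact: mxE_decays.
  - by move=> T T0; exact: (state_int_stoch H0 B_fBM J_sews i T0).
have e4 : 4 * ip P (obs v 0 - cst m) (B t) =
    4 * (sigma * \sum_i v 0 i * (H * \int[mu]_(u in `[0, +oo[) ((E A u *m delta) i 0 * memory H t u))).
  exact: cvg_unique l1 l2.
by apply: (mulfI _ e4); rewrite pnatr_eq0.
Qed.

End stationary_moments.

Lemma beta_first {R : realType} p q (beta : nat -> R) : ((beta_vec p.+1 q beta)^T *m first_vec p) 0 0 = 1.
Proof.
rewrite mxE (bigD1 ord0)//= !mxE eqxx mulr1 big1 ?addr0// => i i0.
by rewrite !mxE -val_eqE/= in i0 *; rewrite (negPf i0) mulr0.
Qed.

Theorem theorem1 (R : realType) (d : measure_display) (Omega : measurableType d)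
    (P : probability Omega R) (H : R) (p q : nat) (alpha beta : nat -> R)
    (sigma : R) (B : R -> Omega -> R)
    (H_gt0 : 0 < H) (H_lt1 : H < 1) (p_ge1 : (1 <= p)%N) (q_lt_p : (q < p)%N)
    (alpha1_neq0 : alpha 1%N != 0)
    (betaq_neq0 : (1 <= q)%N -> beta q != 0)
    (sigma_gt0 : 0 < sigma)
    (B_fBM : fBM P H B) :
  (forall x0 : 'cV[R]_p,
     (exists X : R -> Omega -> 'cV[R]_p,
        sde_solution P (companion p alpha) (alpha 0%N) sigma B (fun=> x0) X /\
        asymptotically_stationary P X)
     <-> eigenvalues_Re_lt0 (companion p alpha)) /\
  (eigenvalues_Re_lt0 (companion p alpha) ->
   forall X : R -> Omega -> 'cV[R]_p,
     sde_solution P (companion p alpha) (alpha 0%N) sigma B (X 0) X ->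
     strictly_stationary P X ->
     [/\ jointly_gaussian P
           [set o : option R | if o is Some t then 0 <= t else True]
           (fun o => if o is Some t then B t else carfima q beta X 0),
         forall t : R, 0 <= t ->
           covariance P (carfima q beta X 0) (B t) =
             (H * sigma *
               ((beta_vec p q beta)^T *m
                 integral_cV `[0, +oo[ (fun u =>
                   ((u + t) `^ (2 * H - 1) - u `^ (2 * H - 1)) *:
                     (expmx (u *: companion p alpha) *m delta_vec p))) 0 0)%:E
       & forall t : R, 0 <= t ->
           ('E_P[carfima q beta X t] = (- (alpha 0%N / alpha 1%N))%:E)%E]).
Proof.
case: p p_ge1 q_lt_p => [//|p] _ _; split.
  move=> x0; split; first by move=> [X [X_sol X_stat]]; exact: (stationary_stable H_gt0 H_lt1 B_fBM sigma_gt0 X_sol X_stat).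
  by move=> A_stable; exact: (stable_solution H_gt0 H_lt1 B_fBM).
move=> A_stable X X_sol X_stat.
have /choice[J J_sews] : forall i : 'I_p.+1, exists J, sews P H B
    (fun u => (E (companion p.+1 alpha) (- u) *m delta_vec p.+1) i 0) J.
  by move=> i; apply: (sewing H_gt0 H_lt1 B_fBM); exact: back_kernel_loclip.
pose b := (beta_vec p.+1 q beta)^T.
have b1 : (b *m first_vec p) 0 0 = 1 by exact: beta_first.
have moments v t := obs_moments H_gt0 H_lt1 B_fBM alpha1_neq0 sigma_gt0 A_stable J_sews X_sol X_stat v (t := t).
have mean t : 0 <= t -> ('E_P[carfima q beta X t] = (- (alpha 0%N / alpha 1%N))%:E)%E.
  move=> t0; have [L e] := moments b t t0; rewrite b1 mulr1 in e.
  rewrite unlock -e /Rintegral fineK//; exact: (integrable_fin_num _ (L2_int L)).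
split => //.
(* The indices may select the observation at time 0 several times: [s] collects these coefficients,
   and their places among the times are filled by time 0 with coefficient 0. *)
- move=> n i c hi; pose s := \sum_(k < n | i k == None) c k.
  pose c' k := if i k is Some _ then c k else 0.
  pose tau k := if i k is Some t then t else 0.
  have tau0 k : 0 <= tau k by have := hi k; rewrite /tau; case: (i k).
  have := obs_gaussian H_gt0 H_lt1 B_fBM alpha1_neq0 sigma_gt0 A_stable J_sews X_sol X_stat (s *: b) c' tau0.
  congr (gaussian_rv P _); apply/funext => w; rewrite /obs -scalemxAl mxE -/(carfima q beta X 0 w).
  rewrite /s mulr_suml big_mkcond -big_split/=; apply: eq_bigr => k _; rewrite /c' /tau.
  by case: (i k) => [t|] /=; rewrite ?add0r ?mul0r ?addr0.
- move=> t t0; have [LY eY] := moments b 0 (lexx _); rewrite b1 mulr1 in eY.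
  have Lt := fBM_L2 B_fBM t0; have [_ _ B_mean _] := B_fBM.
  have := obs_cov H_gt0 H_lt1 B_fBM alpha1_neq0 sigma_gt0 A_stable J_sews X_sol X_stat b t0.
  rewrite b1 mulr1 => e.
  rewrite covariance.unlock (mean 0 (lexx _)) B_mean//= expectation.unlock.
  have LYm : L2 P (obs X b 0 - cst (- (alpha 0%N / alpha 1%N))) by apply: L2B => //; exact: L2_cst.
  transitivity (ip P (obs X b 0 - cst (- (alpha 0%N / alpha 1%N))) (B t))%:E.
    rewrite -(ip_fct LYm Lt); apply: eq_integral => w _; congr EFin.
    by rewrite !fctE/= subr0.
  rewrite e; congr EFin; rewrite mxE !mulr_sumr; apply: eq_bigr => j _.
  pose F u := memory H t u *: (E (companion p.+1 alpha) u *m delta_vec p.+1).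
  have FE : integral_cV `[0, +oo[ F j 0 =
      \int[lebesgue_measure]_(u in `[0, +oo[) ((E (companion p.+1 alpha) u *m delta_vec p.+1) j 0 * memory H t u).
    by rewrite mxE; apply: eq_Rintegral => u _; rewrite [LHS]mxE mulrC.
  transitivity (H * sigma * (b 0 j * integral_cV `[0, +oo[ F j 0)); last by [].
  by rewrite FE; ring.
Qed.
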